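(* Let $p_0,q,r\in(1,\infty]$, $\kappa\in[0,1]$ and $M\in[0,\infty]$ satisfy $q\ge p_0$, $r\ge q$, $M>\frac{n}{2p_0}$ and $M>\frac n2\big(\frac1{p_0}-\frac1r\big)+\frac1{p_0}-\kappa$. Let $S$ be a singular integral operator of type $(p_0,q,r,\kappa,M)$. Let $\beta>-1$ and $T\in(0,\infty]$. (i) Let $p\in[p_0,\infty)$. Then $S$ extends by density to a bounded operator $Z^{p,q}_\beta(T)\to Z^{p,r}_{\beta+\kappa}(T)$. (ii) There exists a bounded operator $\widetilde S\colon Z^{\infty,q}_\beta(T)\to Z^{\infty,r}_{\beta+\kappa}(T)$ such that: - $\widetilde S(f)=S(f)$ almost everywhere for all $f\in Z^{\infty,q}_\beta(T)\cap L^q_c(T)$; - for every $f\in Z^{\infty,q}_\beta(T)$ there is a sequence $f_m\in L^q_c$ such that, for every compact subset $E\subseteq(0,T]\times\mathbb{R}^n$, $f_m\to f$ in $L^q(E)$ as $m\to\infty$, $u_m:=S(f_m)\in L^r(E)$, $u_m$ converges in $L^r(E)$ as $m\to\infty$, and its limit coincides with $\widetilde S(f)$ almost everywhere on $E$. All operator norms are independent of $T$. In particular, the mapping property in (ii) remains true for the ${}_{\mathrm v}Z$-spaces, i.e. $\widetilde S$ maps ${}_{\mathrm v}Z^{\infty,q}_\beta(T)$ boundedly into ${}_{\mathrm v}Z^{\infty,r}_{\beta+\kappa}(T)$.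
   Context: Z-spaces: $\mathbb{R}^{1+n}_+=(0,\infty)\times\mathbb{R}^n$. For $p,q\in(1,\infty]$, $\beta\in\mathbb{R}$, $Z^{p,q}_\beta$ is the space of measurable $u$ on $\mathbb{R}^{1+n}_+$ with $$\|u\|_{Z^{p,q}_\beta}=\Big(\int_0^\infty\!\!\int_{\mathbb{R}^n}\Big(\frac{2}{t}\int_{t/2}^t\frac1{|B(x,\sqrt t)|}\int_{B(x,\sqrt t)}|s^{-\beta}u(s,y)|^q\,dy\,ds\Big)^{p/q}dx\,\frac{dt}{t}\Big)^{1/p}<\infty$$ (usual modifications if $p=\infty$ or $q=\infty$). For $T\in(0,\infty]$, $Z^{p,q}_\beta(T)$ consists of $u$ on $(0,T)\times\mathbb{R}^n$ whose extension by zero lies in $Z^{p,q}_\beta$, with the norm of the extension. ${}_{\mathrm v}Z^{\infty,q}_\beta(T)$ is the subspace of $u\in Z^{\infty,q}_\beta(T)$ such that for all $\varepsilon>0$ there is $\tau\in(0,T]$, $\tau<\infty$, with $\|u\|_{Z^{\infty,q}_\beta(\tau)}\le\varepsilon$. Weighted Lebesgue spaces: $L^p_\beta$ is the space of measurable $u$ on $\mathbb{R}^{1+n}_+$ such that $(t,x)\mapsto t^{-\beta}u(t,x)$ is in $L^p(\mathbb{R}^{1+n}_+,dx\,\frac{dt}{t})$, with the corresponding norm; $L^p:=L^p_0$. $L^q_c$ denotes functions in $L^q$ with compact support in $\mathbb{R}^{1+n}_+$; $L^q_c(T)$ denotes functions on $(0,T)\times\mathbb{R}^n$ whose zero extension is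 in $L^q_c$. Functions on $(0,T)\times\mathbb{R}^n$ are extended by zero before applying $S$. Spaces on $\mathbb{R}^n$ carry the index $x$, e.g. $L^p_x=L^p(\mathbb{R}^n)$. If $T=\infty$, $(0,T]$ is read as $(0,\infty)$. Parabolic annuli: $C_1(x,t)=B(x,\sqrt{4t})$, $C_j(x,t)=B(x,\sqrt{2^{j+1}t})\setminus B(x,\sqrt{2^jt})$ for $j\ge2$. For $f$ on $\mathbb{R}^{1+n}_+$, $\pi(f)=\pi_1(\operatorname{supp}f)\times\pi_2(\operatorname{supp}f)$, with $\pi_1,\pi_2$ the projections of $\mathbb{R}\times\mathbb{R}^n$ onto $\mathbb{R}$ and $\mathbb{R}^n$. SIO of type $(p_0,q,r,\kappa,M)$: let $p_0,q,r\in(1,\infty]$, $\kappa\in[0,1]$, $M\in[0,\infty]$ with $q\ge p_0$, $r\ge q$, $\kappa\ge\frac n2(\frac1q-\frac1r)$. A (linear) operator $S$ is a singular integral operator of this type with integral kernel $K(t,s)$ if: (a) $S$ is bounded $L^q\to L^r_{\kappa-\frac n2(\frac1q-\frac1r)}$; (b) for $0<s<t<\infty$, $K(t,s)\colon L^{p_0}_x\to L^r_x$ satisfies, for all $f\in L^{p_0}_x$, $x\in\mathbb{R}^n$, $j\ge1$, with a uniform constant, $$\|\mathbf 1_{B(x,\sqrt t)}K(t,s)(f\mathbf 1_{C_j(x,t)})\|_{L^r_x}\lesssim(t-s)^{-1+\kappa-\frac n2(\frac1{p_0}-\frac1r)}\Big(1+\frac{d^2}{t-s}\Big)^{-M}\|\mathbf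 1_{C_j(x,t)}f\|_{L^{p_0}_x},$$ where $d$ is the distance between $B(x,\sqrt t)$ and $C_j(x,t)$ (for $M=\infty$: for every finite exponent, with constant depending on it); (c) for $f\in L^q$ with compact support and a.e. $(t,x)\notin\pi(f)$, $S(f)(t,x)=\int_0^t(K(t,s)f(s))(x)\,ds$. *)

(* Defs.v *)
From HB Require Import structures.
From mathcomp Require Import all_boot all_order all_algebra.
From mathcomp Require Import complex.
From mathcomp Require Import all_classical all_reals all_analysis.
From mathcomp Require Import measurable_realfun ess_sup_inf.

Set Implicit Arguments.
Unset Strict Implicit.
Unset Printing Implicit Defensive.

Import Order.TTheory GRing.Theory Num.Theory.
Import numFieldNormedType.Exports.

Local Open Scope classical_set_scope.
Local Open Scope ring_scope.

(* The product sigma-algebra on R^n, generated by the coordinates. *)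
Definition measure_rV_display : measure_display.
Proof. exact: default_measure_display. Qed.

Section measurable_rV.
Context {R : realType} {n : nat}.

Let coor (i : 'I_n) (v : 'rV[R]_n) : R := v ord0 i.

Let rV_set0 : g_sigma_preimage coor set0.
Proof. exact: sigma_algebra0. Qed.

Let rV_setC A : g_sigma_preimage coor A -> g_sigma_preimage coor (~` A).
Proof. exact: sigma_algebraC. Qed.

Let rV_bigcup (F : _^nat) : (forall i, g_sigma_preimage coor (F i)) ->
  g_sigma_preimage coor (\bigcup_i (F i)).
Proof. exact: sigma_algebra_bigcup. Qed.

HB.instance Definition _ := @isMeasurable.Build measure_rV_display
  'rV[R]_n (g_sigma_preimage coor) rV_set0 rV_setC rV_bigcup.

Lemma measurable_coor (i : 'I_n) :
  measurable_fun [set: 'rV[R]_n] (fun v => v ord0 i).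
Proof.
move=> _ Y mY; rewrite setTI; apply: sub_sigma_algebra => /=.
rewrite -bigcup_seq/=; exists i => /=; first by rewrite mem_index_enum.
by exists Y => //; rewrite setTI.
Qed.

Lemma measurable_fun_rVP d (T : measurableType d) (f : T -> 'rV[R]_n) :
  measurable_fun [set: T] f <->
  forall i, measurable_fun [set: T] (fun x => f x ord0 i).
Proof.
split=> [mf i|mf].
  exact: (measurableT_comp (measurable_coor i) mf).
move=> _ A mA; rewrite setTI.
suff : preimage_set_system [set: T] f (g_sigma_preimage coor) `<=` measurable.
  by apply; exists A => //; rewrite setTI.
rewrite -g_sigma_preimage_comp.
apply: smallest_sub; first exact: sigma_algebra_measurable.
move=> B; rewrite -bigcup_seq => -[i _ [C mC <-]].
exact: (mf i).
Qed.

End measurable_rV.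


Section dt_over_t.
Context {R : realType}.
Local Open Scope ereal_scope.

(* The measure dt/t on (0,oo), seen as a measure on the whole line. *)
Definition dt_t (A : set R) : \bar R :=
  \int[lebesgue_measure]_(t in A `&` `]0%R, +oo[) (t^-1)%:E.

Let inv_ge0 (t : R) : `]0%R, +oo[%classic t -> 0 <= (t^-1)%:E.
Proof. by rewrite /= in_itv/= andbT lee_fin invr_ge0 => /ltW. Qed.

Let measurable_inv_pos (D : set R) : measurable D ->
  measurable_fun (D `&` `]0%R, +oo[) (EFin \o (fun t : R => t^-1)%R).
Proof.
move=> mD; apply/measurable_EFinP.
apply: (@measurable_funS _ _ _ _ (`]0%R, +oo[%classic : set R)) => //.
apply: open_continuous_measurable_fun.
  exact: interval_open.
by move=> x; rewrite inE/= in_itv/= andbT => x0; apply: inv_continuous; rewrite gt_eqF.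
Qed.

Let dt_t0 : dt_t set0 = 0.
Proof. by rewrite /dt_t set0I integral_set0. Qed.

Let dt_t_ge0 A : 0 <= dt_t A.
Proof. by apply: integral_ge0 => t [_ /inv_ge0]. Qed.

Let dt_t_sigma_additive : semi_sigma_additive dt_t.
Proof.
move=> /= A mA tA mUA; rewrite /dt_t setI_bigcupl.
have mB k : measurable (A k `&` `]0%R, +oo[) by exact: measurableI.
rewrite (@ge0_integral_bigcup _ (measurableTypeR R) R lebesgue_measure
  (fun k => A k `&` `]0%R, +oo[) (fun t : R => (t^-1)%:E) mB); first last.
- exact: trivIset_setIr tA.
- by move=> t [k _ [_ /inv_ge0]].
- by rewrite -setI_bigcupl; exact: measurable_inv_pos.
by apply: is_cvg_ereal_nneg_natsum_cond => k _ _; exact: dt_t_ge0.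
Qed.

HB.instance Definition _ := isMeasure.Build _ _ _ dt_t
  dt_t0 dt_t_ge0 dt_t_sigma_additive.

Let dt_t_sigma_finite : sigma_finite setT dt_t.
Proof.
pose J k : set R := `[(k.+1%:R^-1)%R, k.+1%:R]%classic.
exists (fun k => `]-oo, 0%R] `|` J k).
  apply/esym/seteqP; split=> // t _.
  have [t0|t0] := leP t 0%R; first by exists 0%N => //; left; rewrite /= in_itv.
  pose k := maxn (Num.truncn t) (Num.truncn t^-1)%R.
  exists k => //; right; rewrite /J /= in_itv/=; apply/andP; split.
    rewrite -[leRHS]invrK lef_pV2 ?posrE ?invr_gt0//.
    apply: (@le_trans _ _ (Num.truncn t^-1).+1%:R); first by apply/ltW/real_truncnS_gt/num_real.
    by rewrite ler_nat ltnS leq_maxr.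
  apply: (@le_trans _ _ (Num.truncn t).+1%:R); first by apply/ltW/real_truncnS_gt/num_real.
  by rewrite ler_nat ltnS leq_maxl.
move=> k; have mJ : measurable (J k) by exact: measurable_itv.
have Jk t : J k t -> (0 < t)%R /\ (t^-1 <= k.+1%:R)%R.
  rewrite /J /= in_itv/= => /andP[kt _].
  have t0 : (0 < t)%R by apply: lt_le_trans kt; rewrite invr_gt0.
  by split=> //; rewrite -[leRHS]invrK lef_pV2 ?posrE ?invr_gt0.
split; first by apply: measurableU => //; exact: measurable_itv.
rewrite /= /dt_t.
have -> : (`]-oo, 0%R] `|` J k) `&` `]0%R, +oo[ = J k.
  apply/seteqP; split=> t.
    move=> [] [/= t0|//]; rewrite in_itv/= andbT => t1.
    by move: t0; rewrite in_itv/= leNgt t1.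
  move=> Jt; split; first by right.
  by rewrite /= in_itv/= andbT; case: (Jk _ Jt).
apply: (@le_lt_trans _ _ (\int[lebesgue_measure]_(t in J k) (k.+1%:R)%:E)).
  apply: (@ge0_le_integral _ (measurableTypeR R) R lebesgue_measure _ mJ
    (fun t : R => (t^-1)%:E) (cst (k.+1%:R)%:E)).
  - by move=> t /Jk[t0 _]; rewrite lee_fin invr_ge0 ltW.
  - have mE : measurable (setT `&` `]0%R, +oo[ : set R) by exact: measurableI.
    apply: (measurable_funS mE _ (measurable_inv_pos measurableT)).
    by move=> t /Jk[t0 _]; split=> //; rewrite /= in_itv/= andbT.
  - exact: measurable_cst.
  - by move=> t /Jk[_ tk]; rewrite lee_fin.
rewrite (@integral_cst _ (measurableTypeR R) R lebesgue_measure _ mJ)/= lebesgue_measure_itv/=.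
by case: ifP => _; rewrite ?mule0 -?EFinD -?EFinM ltry.
Qed.

HB.instance Definition _ := Measure_isSigmaFinite.Build _ _ _ dt_t
  dt_t_sigma_finite.

End dt_over_t.

(* The library's sigma-finite instance on [m1 \x m2] is not found by inference
   unless both factors are subprobabilities. *)
Lemma sigma_finite_product d1 d2 (T1 : measurableType d1)
    (T2 : measurableType d2) (R : realType)
    (m1 : {sigma_finite_measure set T1 -> \bar R})
    (m2 : {sigma_finite_measure set T2 -> \bar R}) :
  sigma_finite setT (m1 \x m2)%E.
Proof.
have /sigma_finiteP[F [TF ndF Foo]] := sigma_finiteT m1.
have /sigma_finiteP[G [TG ndG Goo]] := sigma_finiteT m2.
exists (fun n => F n `*` G n).
  rewrite -setXTT TF TG predeqE => -[x y]; split.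
    move=> [/= [n _ Fnx] [k _ Gky]]; exists (maxn n k) => //; split.
    - by move: x Fnx; exact/subsetPset/ndF/leq_maxl.
    - by move: y Gky; exact/subsetPset/ndG/leq_maxr.
  by move=> [n _ []/= ? ?]; split; exists n.
move=> k; have [? ?] := Foo k; have [? ?] := Goo k.
split; first exact: measurableX.
by rewrite product_measure1E// lte_mul_pinfty// ge0_fin_numE.
Qed.

Section lebesgue_rV.
Context {R : realType}.
Local Open Scope ereal_scope.

Definition rV_cons n (z : R * 'rV[R]_n) : 'rV[R]_n.+1 :=
  row_mx (z.1)%:M z.2 : 'rV[R]_(1 + n).

Lemma rV_cons_measurable n : measurable_fun [set: R * 'rV[R]_n] (@rV_cons n).
Proof.
apply/measurable_fun_rVP => i; case: (splitP (i : 'I_(1 + n))) => j ij.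
  suff -> : (fun z : R * 'rV[R]_n => rV_cons z ord0 i) = fst by exact: measurable_fst.
  apply/funext => z; rewrite /rV_cons.
  have -> : i = lshift n j by apply/val_inj.
  by rewrite (@row_mxEl _ 1 1 n) mxE (ord1 j) eqxx mulr1n.
suff -> : (fun z : R * 'rV[R]_n => rV_cons z ord0 i) =
    (fun v : 'rV[R]_n => v ord0 j) \o snd.
  by apply: measurableT_comp => //; exact: measurable_coor.
apply/funext => z; rewrite /rV_cons.
have -> : i = rshift 1 j by apply/val_inj.
by rewrite (@row_mxEr _ 1 1 n).
Qed.

Definition rV_uncons n (v : 'rV[R]_n.+1) : R * 'rV[R]_n :=
  (v ord0 ord0, \row_i v ord0 (lift ord0 i)).

Lemma rV_consK n : cancel (@rV_cons n) (@rV_uncons n).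
Proof.
move=> [t v]; rewrite /rV_uncons /rV_cons /=; congr (_, _).
  have -> : ord0 = lshift n ord0 :> 'I_(1 + n) by apply/val_inj.
  by rewrite (@row_mxEl _ 1 1 n) mxE eqxx mulr1n.
apply/rowP => i; rewrite mxE.
have -> : lift ord0 i = rshift 1 i :> 'I_(1 + n) by apply/val_inj.
by rewrite (@row_mxEr _ 1 1 n).
Qed.

Lemma rV_uncons_measurable n : measurable_fun [set: 'rV[R]_n.+1] (@rV_uncons n).
Proof.
apply: measurable_fun_pair; first exact: measurable_coor.
apply/measurable_fun_rVP => i.
under eq_fun do rewrite mxE.
exact: measurable_coor.
Qed.

Section step.
Context {n : nat} (m : {sigma_finite_measure set 'rV[R]_n -> \bar R}).

Definition rV_step : set 'rV[R]_n.+1 -> \bar R :=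
  pushforward (@lebesgue_measure R \x m) (@rV_cons n).

Let rV_step0 : rV_step set0 = 0.
Proof. by rewrite /rV_step /pushforward preimage_set0 measure0. Qed.

Let rV_step_ge0 A : 0 <= rV_step A.
Proof. by apply: integral_ge0 => t _; exact: measure_ge0. Qed.

Let rV_step_sigma_additive : semi_sigma_additive rV_step.
Proof.
move=> F mF tF mUF; rewrite /rV_step /pushforward preimage_bigcup.
apply: measure_semi_sigma_additive.
- by move=> k; rewrite -[X in measurable X]setTI; exact: rV_cons_measurable.
- apply/trivIsetP => i j _ _ ij; rewrite -preimage_setI.
  by move/trivIsetP : tF => -> //; rewrite preimage_set0.
- by rewrite -preimage_bigcup -[X in measurable X]setTI; exact: rV_cons_measurable.
Qed.

HB.instance Definition _ := isMeasure.Build _ _ _ rV_step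
  rV_step0 rV_step_ge0 rV_step_sigma_additive.

Let rV_step_sigma_finite : sigma_finite setT rV_step.
Proof.
have [F FT mF] : sigma_finite setT (@lebesgue_measure R \x m).
  exact: sigma_finite_product.
exists (fun k => @rV_uncons n @^-1` F k).
  by rewrite -preimage_bigcup -FT preimage_setT.
move=> k; have [mFk Fk] := mF k; split.
  by rewrite -[X in measurable X]setTI; exact: rV_uncons_measurable.
rewrite /= /rV_step /pushforward -comp_preimage.
rewrite [X in X @^-1` _](_ : _ = id)//.
by apply/funext => z /=; rewrite rV_consK.
Qed.

HB.instance Definition _ := Measure_isSigmaFinite.Build _ _ _ rV_step
  rV_step_sigma_finite.

End step.

(* Lebesgue measure on R^n: a point mass on R^0, and the image of the product
   measure on R x R^n for R^(n+1). *)
Fixpoint leb (n : nat) : {sigma_finite_measure set 'rV[R]_n -> \bar R} :=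
  match n with
  | 0 => [the {sigma_finite_measure set 'rV[R]_0 -> \bar R} of @dirac _ 'rV[R]_0 0%R R]
  | n'.+1 => [the {sigma_finite_measure set 'rV[R]_n'.+1 -> \bar R}
                of rV_step (leb n')]
  end.

Lemma leb_box n (A : 'I_n -> set R) : (forall i, measurable (A i)) ->
  leb n [set v : 'rV[R]_n | forall i, A i (v ord0 i)] =
    \prod_(i < n) @lebesgue_measure R (A i).
Proof.
elim: n A => [|n IHn] A mA.
  rewrite big_ord0 /= diracE mem_set//.
  by case.
rewrite big_ord_recl /= /rV_step /pushforward.
have -> : @rV_cons n @^-1` [set v : 'rV[R]_n.+1 | forall i, A i (v ord0 i)] =
    A ord0 `*` [set v : 'rV[R]_n | forall i : 'I_n, A (lift ord0 i) (v ord0 i)].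
  apply/seteqP; split=> z /=.
    move=> Az; rewrite -[z]rV_consK; split=> /=; first exact: Az.
    by move=> i; rewrite mxE; exact: Az.
  rewrite -{1 2}[z]rV_consK => -[/= A0 AS] i.
  case: (unliftP ord0 i) => [j ->|->] //.
  by have := AS j; rewrite mxE.
have mB : measurable [set v : 'rV[R]_n | forall i : 'I_n, A (lift ord0 i) (v ord0 i)].
  rewrite (_ : [set v | _] = \bigcap_(i in [set: 'I_n])
      ((fun v : 'rV[R]_n => v ord0 i) @^-1` A (lift ord0 i))).
    apply: fin_bigcap_measurable => // i _.
    by rewrite -[X in measurable X]setTI; apply: measurable_coor => //; exact: mA.
  by apply/seteqP; split=> [v vA i _|v vA i]; [exact: vA|exact: (vA i I)].
rewrite (@product_measure1E _ _ (measurableTypeR R) _ R lebesgue_measure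
  (leb n) _ _ (mA ord0) mB).
by congr (_ * _); apply: (IHn (fun i => A (lift ord0 i))) => i; exact: mA.
Qed.

End lebesgue_rV.

(* Conventions.  Functions are complex-valued.  A function on the half-space
   (0,oo) x R^n is represented by a function on R x R^n and a function on the
   strip (0,T) x R^n by its extension by zero [zero_off (strip T) u]; values outside
   play no role, since all norms and almost-everywhere statements refer to the
   measure [dtdx], which does not charge t <= 0 and has the same null sets in
   t > 0 as Lebesgue measure.  Elements of function spaces are representatives:
   operators are required to respect almost-everywhere equality. *)

Local Notation cabs := Normc.normc.

(* [einv +oo = 0] *)
Definition einv {R : realType} (p : \bar R) : R := (fine p)^-1.

Definition zero_off {R : realType} {T : Type} (A : set T) (f : T -> R[i]) : T -> R[i] :=
  patch (fun=> 0) A f.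

Definition cmeasurable {R : realType} d {T : measurableType d} (f : T -> R[i]) :=
  measurable_fun [set: T] (fun x => complex.Re (f x)) /\
  measurable_fun [set: T] (fun x => complex.Im (f x)).

Definition cintegrable {R : realType} (D : set R) (f : R -> R[i]) :=
  (@lebesgue_measure R).-integrable D (EFin \o (fun s => complex.Re (f s))) /\
  (@lebesgue_measure R).-integrable D (EFin \o (fun s => complex.Im (f s))).

Definition cintegral {R : realType} (D : set R) (f : R -> R[i]) : R[i] :=
  Complex (\int[lebesgue_measure]_(s in D) complex.Re (f s))
          (\int[lebesgue_measure]_(s in D) complex.Im (f s)).

Section operators.
Context {R : realType} {d} {T : measurableType d}.
Variables (mu : {measure set T -> \bar R}) (D : set T).

(* Linear maps from V to W, whose elements are functions on D up to
   mu-null sets. *)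
Record linear_operator (V W : set (T -> R[i])) (A : (T -> R[i]) -> (T -> R[i])) :
    Prop := {
  linop_maps : forall f, V f -> W (A f);
  linop_ae : forall f g, V f -> V g ->
    {ae mu, forall z, D z -> f z = g z} ->
    {ae mu, forall z, D z -> A f z = A g z};
  linop_linear : forall (a : R[i]) f g, V f -> V g ->
    {ae mu, forall z, D z ->
      A (fun w => a * f w + g w) z = a * A f z + A g z}
}.

Definition bounded_operator (V : set (T -> R[i])) (NV : (T -> R[i]) -> \bar R)
    (W : set (T -> R[i])) (NW : (T -> R[i]) -> \bar R) (c : R)
    (A : (T -> R[i]) -> (T -> R[i])) : Prop :=
  linear_operator V W A /\ forall f, V f -> (NW (A f) <= c%:E * NV f)%E.

End operators.

Section spaces.
Context {R : realType} {n : nat}.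
Local Notation X := ('rV[R]_n).
Local Notation U := (R * 'rV[R]_n)%type.
Local Notation C := (R[i]).

Definition dtdx : {measure set U -> \bar R} :=
  [the {measure set U -> \bar R} of (@dt_t R \x @leb R n)%E].

(* The norm of the library on 'rV is the sup norm. *)
Definition edist (x y : X) : R := Num.sqrt (\sum_(i < n) (x ord0 i - y ord0 i) ^+ 2).

Definition eball (x : X) (rho : R) : set X := [set y | edist x y < rho].

Definition set_dist (A B : set X) : R :=
  inf [set rho | exists2 y, A y & exists2 z, B z & rho = edist y z].

Definition annulus (j : nat) (x : X) (t : R) : set X :=
  if j == 1%N then eball x (Num.sqrt (4 * t))
  else eball x (Num.sqrt (2 ^+ j.+1 * t)) `\` eball x (Num.sqrt (2 ^+ j * t)).

Definition strip (T : \bar R) : set U := [set z | 0 < z.1 /\ (z.1%:E < T)%E].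

Definition Lx_norm (p : \bar R) (f : X -> C) : \bar R :=
  'N[leb n]_p[(fun x => (cabs (f x))%:E)]%E.

Definition Lx (p : \bar R) : set (X -> C) :=
  [set f | cmeasurable f /\ (Lx_norm p f < +oo)%E].

Definition L_norm (p : \bar R) (beta : R) (u : U -> C) : \bar R :=
  'N[dtdx]_p[(fun z => (z.1 `^ (- beta) * cabs (u z))%:E)]%E.

Definition Lspace (p : \bar R) (beta : R) : set (U -> C) :=
  [set u | cmeasurable u /\ (L_norm p beta u < +oo)%E].

(* The essential support, relative to the half-space. *)
Definition ess_supp (f : U -> C) : set U :=
  [set z : U | 0 < z.1 /\
    forall V : set U, nbhs z V -> ~ {ae dtdx, forall w, V w -> f w = 0}].

Definition supp_box (f : U -> C) : set U :=
  (fst @` ess_supp f) `*` (snd @` ess_supp f).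

Definition Lspace_c (q : \bar R) : set (U -> C) :=
  [set f | Lspace q 0 f /\ compact (ess_supp f)].

Definition Lspace_c_strip (q : \bar R) (T : \bar R) : set (U -> C) :=
  [set f | Lspace_c q (zero_off (strip T) f)].

Definition Lspace_on (q : \bar R) (E : set U) : set (U -> C) :=
  [set f | Lspace q 0 (zero_off E f)].

Definition cvg_L_on (q : \bar R) (E : set U) (f_ : nat -> U -> C) (f : U -> C) :=
  [/\ forall m, Lspace_on q E (f_ m), Lspace_on q E f &
      (fun m => L_norm q 0 (zero_off E (fun z => f_ m z - f z))) @ \oo --> 0%E].

Definition whitney_mean (q : \bar R) (beta : R) (u : U -> C) (z : U) : \bar R :=
  let t := z.1 in
  let B := eball z.2 (Num.sqrt t) in
  let v := fun w : U => w.1 `^ (- beta) * cabs (u w) in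
  match q with
  | q'%:E => (((2 / t)%:E *
       \int[lebesgue_measure]_(s in `[(t / 2)%R, t])
         ((fine (leb n B))^-1%:E *
          \int[leb n]_(y in B) (v (s, y) `^ q')%:E)) `^ (q'^-1))%E
  | +oo%E => ess_sup dtdx (patch (fun=> 0%E) (`[t / 2, t] `*` B) (EFin \o v))
  | -oo%E => 0%E
  end.

Definition Z_norm (p q : \bar R) (beta : R) (u : U -> C) : \bar R :=
  'N[dtdx]_p[whitney_mean q beta u]%E.

Definition Z_norm_on (p q : \bar R) (beta : R) (T : \bar R) (u : U -> C) : \bar R :=
  Z_norm p q beta (zero_off (strip T) u).

Definition Zspace (p q : \bar R) (beta : R) (T : \bar R) : set (U -> C) :=
  [set u | cmeasurable (zero_off (strip T) u) /\ (Z_norm_on p q beta T u < +oo)%E].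

Definition vZspace (q : \bar R) (beta : R) (T : \bar R) : set (U -> C) :=
  [set u | Zspace +oo%E q beta T u /\
    forall eps : R, 0 < eps -> exists tau : R,
      [/\ 0 < tau, (tau%:E <= T)%E &
          (Z_norm_on +oo%E q beta tau%:E u <= eps%:E)%E]].

(* The bound of [SIO_offdiag] is uniform in t, s, x, j and f.  For M = +oo it is
   required with every finite exponent N in place of M, with a constant
   depending on N. *)
Definition off_diagonal_decay (p0 r : \bar R) (kappa : R) (N : R)
    (K : R -> R -> (X -> C) -> (X -> C)) : Prop :=
  exists c : R, forall (s t : R) (f : X -> C) (x : X) (j : nat),
    0 < s -> s < t -> Lx p0 f -> (1 <= j)%N ->
    let B := eball x (Num.sqrt t) in
    let A := annulus j x t in
    (Lx_norm r (zero_off B (K t s (zero_off A f))) <=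
     (c * (t - s) `^ (- 1 + kappa - n%:R / 2 * (einv p0 - einv r))
        * (1 + set_dist B A ^+ 2 / (t - s)) `^ (- N))%:E
     * Lx_norm p0 (zero_off A f))%E.

(* In [SIO_kernel], s |-> K(t,s)f(s) is a family of classes of functions of x;
   the integral is that of a version g which is measurable in (s,x). *)
Record is_SIO (p0 q r : \bar R) (kappa : R) (M : \bar R)
    (S : (U -> C) -> (U -> C)) (K : R -> R -> (X -> C) -> (X -> C)) : Prop := {
  SIO_exponents : [/\ (1 < p0)%E, (1 < q)%E, (1 < r)%E, (p0 <= q)%E & (q <= r)%E];
  SIO_kappa : 0 <= kappa <= 1;
  SIO_kappa_ge : n%:R / 2 * (einv q - einv r) <= kappa;
  SIO_M : (0 <= M)%E;
  SIO_bounded : exists c : R,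
    let gamma := kappa - n%:R / 2 * (einv q - einv r) in
    bounded_operator dtdx setT (Lspace q 0) (L_norm q 0) (Lspace r gamma) (L_norm r gamma)
      c S;
  SIO_kernel_linear : forall s t, 0 < s -> s < t ->
    linear_operator (leb n) setT (Lx p0) (Lx r) (K t s);
  SIO_offdiag : forall N : R, 0 <= N -> M = N%:E \/ M = +oo%E ->
    off_diagonal_decay p0 r kappa N K;
  SIO_kernel : forall f, Lspace_c q f ->
    {ae lebesgue_measure, forall t : R, 0 < t -> exists g : U -> C,
      [/\ cmeasurable g,
          {ae lebesgue_measure, forall s : R, 0 < s < t ->
            {ae leb n, forall x : X, ~ supp_box f (t, x) ->
              g (s, x) = K t s (fun y => f (s, y)) x}} &
          {ae leb n, forall x : X, ~ supp_box f (t, x) ->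
            cintegrable `]0, t[ (fun s => g (s, x)) /\
            S f (t, x) = cintegral `]0, t[ (fun s => g (s, x))}]}
}.

End spaces.

(* Main.v *)
From HB Require Import structures.
From mathcomp Require Import all_boot all_order all_algebra.
From mathcomp Require Import complex.
From mathcomp Require Import all_classical all_reals all_analysis.
From mathcomp Require Import measurable_realfun ess_sup_inf.
From mathcomp Require Import ring lra.
Require Import Defs.

Set Implicit Arguments.
Unset Strict Implicit.
Unset Printing Implicit Defensive.

Import Order.TTheory GRing.Theory Num.Theory.
Import numFieldNormedType.Exports.

Local Open Scope classical_set_scope.
Local Open Scope ring_scope.

(** Why the theorem holds.

    Write v = t^-beta |u|.  Up to constants, the mean that enters the norm of
    Z^{p,q}_beta at z = (t,x) is t^(-n/(2q)) times the L^q(dx dt/t) norm of v over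
    the Whitney region [t/2,t] x B(x,sqrt t) of z; this is [wmean q whitney_ind v z]
    ([whitney_mean_wmean]).  The Z-norm is the L^p norm of this function of z, so
    the theorem is about what S does to local means around one point.

    The estimate at a point ([whitney_estimate]).  Let f be in L^q with support in
    a compact box and fix z.  The part of f in the enlarged region
    (t/4,t] x B(x,4 sqrt t) is treated by the boundedness of S from L^q to a
    weighted L^r: the weight is the one for which this bound is invariant under
    parabolic scaling, so it turns the q-mean of f into the r-mean of S f
    ([loc_wmean]).  The rest of f is cut so that the kernel represents S f on the
    Whitney region of z.  There, for each earlier time s, the off-diagonal bound is
    summed over the annuli ([kernel_far]), and Minkowski's inequality and Hoelder's
    inequality in s ([far_at_time]) leave the L^p0 norm of v against a weight
    (s/t)^eta (1+|x-y|^2/t)^-N' on s <= t.  Any 0 < eta < beta+1 and 0 <= N' < M are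
    allowed: the Hoelder factor is integrable at s = 0 because eta < beta + 1, and
    at the singularity s = t' of the kernel because
    M > (n/2)(1/p0 - 1/r) + 1/p0 - kappa.

    The bound in L^p.  Both resulting means of v are dominated by
    (int k(z,w) F(w)^p dw)^(1/p), where F is the function of Whitney q-means of v
    and the kernel k decays like a power of s/t and of 1+|x-y|^2/t
    ([enlarged_mean_le], [far_mean_le]).  The integrals of k in either variable are
    bounded as soon as the second power exceeds n/2.  It can be taken to be N' p0,
    and M > n/(2 p0) leaves room for this; p >= p0 serves to pass from p0-means to
    p-means by Jensen's inequality.  Hence the bound in L^p for all p in
    [p0,oo] at once ([Lnorm_schur_mean]).

    The extension.  Since all inequalities on eta and N' are strict, both can be
    raised by some delta > 0, which gains a factor 2^(-l delta) on functions living
    off the l-th box of an exhaustion of the half-space ([SIO_tail_bound]).  So if F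
    is a function whose means are finite almost everywhere, the images under S of
    its truncations to the boxes have summable increments in L^r of each compact
    set ([SIO_increments]); they converge there almost everywhere and in L^r, and
    the limit [Sext F] inherits the pointwise estimate ([Sext_bound]).  The operator
    Sext does not depend on p or T and agrees with S on compactly supported
    functions ([Sext_eq]), and the truncations are the approximating sequence that
    is asked for when p = oo.  For p < oo truncations are dense by dominated
    convergence ([trunc_dense]).  Finally the means that bound Sext F at time t
    only involve times up to t, so Sext F on (0,tau) is determined by F on (0,tau)
    ([Sext_causal]); the bound on (0,tau) then preserves the vanishing condition
    that defines the vZ-spaces. *)

(** * Powers in the extended reals and L^p norms *)

Section ereal_power.
Context {R : realType}.
Local Open Scope ereal_scope.
Implicit Types p : \bar R.

Lemma le_poweR (x y : \bar R) (a : R) : (0 <= a)%R -> 0 <= x -> x <= y -> x `^ a <= y `^ a.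
Proof.
move=> a0 x0 xy; apply: gt0_ler_poweR => //; rewrite in_itv/= leey andbT//.
exact: le_trans xy.
Qed.

Lemma ler_powRl (x y a : R) : (0 <= a -> 0 <= x -> x <= y -> x `^ a <= y `^ a)%R.
Proof.
move=> a0 x0 xy; apply: ge0_ler_powR => //; rewrite nnegrE//.
exact: le_trans xy.
Qed.

Lemma einv_ge0 p : 0 < p -> (0 <= einv p)%R.
Proof. by rewrite /einv; case: p => [p||]//=; rewrite ?invr0// lte_fin invr_ge0 => /ltW. Qed.

Lemma einv_lt1 p : 1 < p -> (einv p < 1)%R.
Proof.
by rewrite /einv; case: p => [p||]//=; rewrite ?invr0// lte_fin => p1; rewrite invf_lt1// (lt_trans _ p1).
Qed.

Lemma poweRK (x : \bar R) (a : R) : (a != 0)%R -> 0 <= x -> (x `^ a) `^ a^-1 = x.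
Proof. by move=> a0 x0; rewrite -poweRrM divff// poweRe1. Qed.

Lemma poweRVK (x : \bar R) (a : R) : (a != 0)%R -> 0 <= x -> (x `^ a^-1) `^ a = x.
Proof. by move=> a0 x0; rewrite -poweRrM mulVf// poweRe1. Qed.

Lemma poweR_lee_inv (x y : \bar R) (a : R) : (0 < a)%R -> 0 <= x -> 0 <= y ->
  (x `^ a^-1 <= y) = (x <= y `^ a).
Proof.
move=> a0 x0 y0; apply/idP/idP => h.
  by rewrite -[x](@poweRVK _ a) ?gt_eqF//; apply: le_poweR => //; [exact: ltW|exact: poweR_ge0].
rewrite -[y](@poweRK _ a) ?gt_eqF//; apply: le_poweR => //.
by rewrite invr_ge0 ltW.
Qed.

Lemma measurable_fun_poweR d (T : measurableType d) (f : T -> \bar R) (a : R) D :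
  measurable_fun D f -> measurable_fun D (fun x => f x `^ a).
Proof. by move=> mf; apply: (measurableT_comp (measurable_poweR a) mf). Qed.

End ereal_power.

Section Lnorm_basic.
Context d {T : measurableType d} {R : realType}.
Variable mu : {measure set T -> \bar R}.
Local Open Scope ereal_scope.
Implicit Types (p : \bar R) (f g : T -> \bar R).
Local Notation "'N_ p [ f ]" := (Lnorm mu p f).

Lemma LnormE (a : R) f : 'N_a%:E[f] = (\int[mu]_x `|f x| `^ a) `^ a^-1.
Proof. by rewrite unlock. Qed.

(** Exponents range over (0,oo]: below, the case oo is an essential supremum
    and the other case an integral. *)
Lemma gt0_cases p : 0 < p -> p = +oo \/ exists2 a : R, (0 < a)%R & p = a%:E.
Proof. by case: p => [a| |]//; [rewrite lte_fin => a0; right; exists a|left]. Qed.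

(** On a space of measure zero the library norm of exponent oo is 0 rather
    than the essential supremum, so this characterization is split off once
    and for all. *)
Lemma Lnormy_le f c : 'N_+oo[f] <= c <-> 0 <= c /\ {ae mu, forall x, `|f x| <= c}.
Proof.
split=> [h|[c0 h]].
  split; first by apply: le_trans h; exact: Lnorm_ge0.
  move: h; rewrite unlock; case: ifPn => [m0|]; first by move/ess_supP.
  rewrite -leNgt => m0 _; exists setT; split => //.
  by apply/eqP; rewrite eq_le m0 measure_ge0.
rewrite unlock; case: ifPn => // _.
exact/ess_supP.
Qed.

Lemma Lnormy_ae f : {ae mu, forall x, `|f x| <= 'N_+oo[f]}.
Proof. by have [] := (Lnormy_le f 'N_+oo[f]).1 (lexx _). Qed.

Lemma Lnorm_le_integral (a : R) f c : (0 < a)%R -> 0 <= c ->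
  ('N_a%:E[f] <= c) = (\int[mu]_x `|f x| `^ a <= c `^ a).
Proof.
by move=> a0 c0; rewrite LnormE poweR_lee_inv//; apply: integral_ge0 => x _; exact: poweR_ge0.
Qed.

Lemma ae_le_Lnorm p f g : 0 < p -> measurable_fun setT f -> measurable_fun setT g ->
  {ae mu, forall x, `|f x| <= `|g x|} -> 'N_p[f] <= 'N_p[g].
Proof.
move=> /gt0_cases[->|[a a0 ->]] mf mg fg.
  apply/Lnormy_le; split; first exact: Lnorm_ge0.
  by apply: filterS2 fg (Lnormy_ae g) => x; exact: le_trans.
rewrite !LnormE; apply: le_poweR; first by rewrite invr_ge0 ltW.
  by apply: integral_ge0 => x _; exact: poweR_ge0.
apply: ae_ge0_le_integral => //.
- by move=> x _; exact: poweR_ge0.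
- by apply: measurable_fun_poweR; exact: measurableT_comp.
- by move=> x _; exact: poweR_ge0.
- by apply: measurable_fun_poweR; exact: measurableT_comp.
by apply: filterS fg => x fg _; apply: le_poweR => //; exact: ltW.
Qed.

Lemma le_Lnorm p f g : 0 < p -> measurable_fun setT f -> measurable_fun setT g ->
  (forall x, `|f x| <= `|g x|) -> 'N_p[f] <= 'N_p[g].
Proof. by move=> p0 mf mg fg; apply: ae_le_Lnorm => //; exact: aeW. Qed.

Lemma ae_eq_Lnorm p f g : 0 < p -> measurable_fun setT f -> measurable_fun setT g ->
  {ae mu, forall x, f x = g x} -> 'N_p[f] = 'N_p[g].
Proof.
move=> p0 mf mg fg; apply/eqP; rewrite eq_le; apply/andP; split;
  by apply: ae_le_Lnorm => //; apply: filterS fg => x ->.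
Qed.

Lemma LnormZ_ge0 p f (k : R) : 0 < p -> measurable_fun setT f -> (0 <= k)%R ->
  'N_p[(fun x => k%:E * f x)] = k%:E * 'N_p[f].
Proof.
move=> p0 mf; rewrite le_eqVlt => /predU1P[<-|k0].
  under eq_Lnorm do rewrite mul0e.
  by rewrite mul0e Lnorm0// gt_eqF.
move: p0 => /gt0_cases[->|[a a0 ->]].
  rewrite unlock; case: ifPn => [m0|_]; last by rewrite mule0.
  rewrite -ess_sup_pZl//; congr (ess_sup _ _); apply/funext => x/=.
  by rewrite abseM gee0_abs// lee_fin ltW.
have kE x : `|k%:E * f x| `^ a = k%:E `^ a * `|f x| `^ a.
  by rewrite abseM (@gee0_abs _ k%:E) ?poweRM ?lee_fin ?(ltW k0).
rewrite !LnormE; under eq_integral do rewrite kE.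
rewrite ge0_integralZl//.
- rewrite poweRM; [|exact: poweR_ge0|].
    by rewrite poweRK ?gt_eqF// lee_fin ltW.
  by apply: integral_ge0 => x _; exact: poweR_ge0.
- by apply: measurable_fun_poweR; exact: measurableT_comp.
- by move=> x _; exact: poweR_ge0.
- exact: poweR_ge0.
Qed.

Lemma Lnorm_lty_ae p f : 0 < p -> measurable_fun setT f -> 'N_p[f] < +oo ->
  {ae mu, forall x, `|f x| < +oo}.
Proof.
move=> /gt0_cases[->|[a a0 ->]] mf fy.
  by apply: filterS (Lnormy_ae f) => x /le_lt_trans; exact.
have : \int[mu]_x `|f x| `^ a < +oo.
  by rewrite -poweR_Lnorm ?gt_eqF//; exact: poweR_lty.
move=> foo.
have : mu.-integrable setT (fun x => `|f x| `^ a).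
  apply/integrableP; split.
    by apply: measurable_fun_poweR; exact: measurableT_comp.
  by under eq_integral do rewrite gee0_abs ?poweR_ge0//.
move/integrable_ae => /(_ measurableT); apply: filterS => x /(_ I).
rewrite ge0_fin_numE ?poweR_ge0// => h.
by apply: lty_poweRy h; rewrite gt_eqF.
Qed.

Lemma ge0_LnormD p f g : 1 <= p -> measurable_fun setT f -> measurable_fun setT g ->
  (forall x, 0 <= f x) -> (forall x, 0 <= g x) ->
  'N_p[(fun x => f x + g x)] <= 'N_p[f] + 'N_p[g].
Proof.
move=> p1 mf mg f0 g0; have p0 : 0 < p by exact: lt_le_trans p1.
have [fy|] := ltP 'N_p[f] +oo; last first.
  rewrite leye_eq => /eqP ->; rewrite addye ?leey//.
  by rewrite gt_eqF// (lt_le_trans _ (Lnorm_ge0 _ _ _)).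
have [gy|] := ltP 'N_p[g] +oo; last first.
  rewrite leye_eq => /eqP ->; rewrite addey ?leey//.
  by rewrite gt_eqF// (lt_le_trans _ (Lnorm_ge0 _ _ _)).
have fK : {ae mu, forall x, (fine (f x))%:E = f x}.
  apply: filterS (Lnorm_lty_ae p0 mf fy) => x.
  by rewrite gee0_abs// => ?; rewrite fineK// ge0_fin_numE.
have gK : {ae mu, forall x, (fine (g x))%:E = g x}.
  apply: filterS (Lnorm_lty_ae p0 mg gy) => x.
  by rewrite gee0_abs// => ?; rewrite fineK// ge0_fin_numE.
have mF : measurable_fun setT (fun x => fine (f x)) by exact: measurableT_comp.
have mG : measurable_fun setT (fun x => fine (g x)) by exact: measurableT_comp.
rewrite (@ae_eq_Lnorm p _ (EFin \o ((fun x => fine (f x)) \+ (fun x => fine (g x)))%R))//; first last.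
- by apply: filterS2 fK gK => x /= fx gx; rewrite EFinD fx gx.
- by apply/measurable_EFinP; exact: measurable_funD.
- exact: emeasurable_funD.
rewrite (le_trans (eminkowski _ _ _ _))//.
apply: leeD; apply: ae_le_Lnorm => //; try exact/measurable_EFinP.
  by apply: filterS fK => x /= <-.
by apply: filterS gK => x /= <-.
Qed.

Lemma measurable_fun_esum_seq (I : Type) (s : seq I) (P : pred I) (F : I -> T -> \bar R) :
  (forall i, measurable_fun setT (F i)) ->
  measurable_fun setT (fun x => \sum_(i <- s | P i) F i x).
Proof.
move=> mF; elim: s => [|i s ih]; first by under eq_fun do rewrite big_nil; exact: measurable_cst.
under eq_fun do rewrite big_cons.
by case: (P i) => //; exact: emeasurable_funD.
Qed.

Lemma ge0_Lnorm_sum (I : Type) (s : seq I) (P : pred I) p (F : I -> T -> \bar R) : 1 <= p ->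
  (forall i, measurable_fun setT (F i)) -> (forall i x, 0 <= F i x) ->
  'N_p[(fun x => \sum_(i <- s | P i) F i x)] <= \sum_(i <- s | P i) 'N_p[F i].
Proof.
move=> p1 mF F0; elim: s => [|i s ih].
  under eq_Lnorm do rewrite big_nil.
  by rewrite big_nil Lnorm0// gt_eqF// (lt_le_trans _ p1).
under eq_Lnorm do rewrite big_cons.
rewrite big_cons; case: ifPn => // Pi.
apply: (le_trans (ge0_LnormD _ _ _ _ _)) => //.
- exact: measurable_fun_esum_seq.
- by move=> x; exact: sume_ge0.
by rewrite leeD2l.
Qed.

(** Hoelder's inequality in the form used for the time integral: the second
    factor may be infinite and p may be oo, in which case the conjugate
    exponent (1 - einv p)^-1 is 1. *)
Lemma ehoelder p (th : T -> R) (Psi : T -> \bar R) (C : R) : 1 < p -> (0 < C)%R ->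
  measurable_fun setT th -> (forall x, 0 <= th x)%R ->
  measurable_fun setT Psi -> (forall x, 0 <= Psi x) ->
  \int[mu]_x (th x `^ (1 - einv p)^-1)%:E <= C%:E ->
  \int[mu]_x ((th x)%:E * Psi x) <= (C `^ (1 - einv p))%:E * 'N_p[Psi].
Proof.
move=> p1 C0 mth th0 mP P0 hC.
have p0 : 0 < p by exact: lt_trans p1.
have [Py|] := ltP 'N_p[Psi] +oo; last first.
  by rewrite leye_eq => /eqP ->; rewrite gt0_muley ?leey// lte_fin powR_gt0.
have mthE : measurable_fun setT (fun x => (th x)%:E) by exact/measurable_EFinP.
move: (p1) p0 => /(lt_trans (@lte01 _))/gt0_cases[py|[a a0 pa]] p0.
  move: hC; rewrite py /einv/= invr0 subr0 invr1 (powRr1 (ltW C0)) => hC.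
  apply: (@le_trans _ _ (\int[mu]_x ((th x)%:E * 'N_+oo[Psi]))).
    apply: ae_ge0_le_integral => //.
    - by move=> x _; rewrite mule_ge0 ?lee_fin.
    - exact: emeasurable_funM.
    - by move=> x _; rewrite mule_ge0 ?lee_fin ?Lnorm_ge0.
    - by apply: emeasurable_funM.
    apply: filterS (Lnormy_ae Psi) => x + _; rewrite gee0_abs// => h.
    by rewrite lee_wpmul2l ?lee_fin.
  under eq_integral do rewrite muleC.
  rewrite ge0_integralZl ?Lnorm_ge0//; last by move=> x _; rewrite lee_fin.
  rewrite muleC lee_wpmul2r ?Lnorm_ge0//.
  by move: hC; under eq_integral do rewrite powRr1//.
have PK : {ae mu, forall x, (fine (Psi x))%:E = Psi x}.
  apply: filterS (Lnorm_lty_ae p0 mP Py) => x.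
  by rewrite gee0_abs// => ?; rewrite fineK// ge0_fin_numE.
have mF : measurable_fun setT (fun x => fine (Psi x)) by exact: measurableT_comp.
have -> : \int[mu]_x ((th x)%:E * Psi x) = 'N_1[EFin \o (th \* (fun x => fine (Psi x)))%R].
  rewrite Lnorm1; apply: ge0_ae_eq_integral => //.
  - exact: emeasurable_funM.
  - by apply: measurableT_comp => //; apply/measurable_EFinP; exact: measurable_funM.
  - by move=> x _; rewrite mule_ge0 ?lee_fin.
  apply: filterS PK => x /= Px _; rewrite ger0_norm ?mulr_ge0 ?fine_ge0//.
  by rewrite EFinM Px.
have a1 : (1 < a)%R by rewrite pa lte_fin in p1.
rewrite pa in hC *.
set b := (1 - einv a%:E)%R in hC *.
have b0 : (0 < b)%R by rewrite /b subr_gt0 einv_lt1.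
have := hoelder mu mth mF (_ : 0 < b^-1)%R a0; rewrite !invr_gt0 invrK => /(_ b0).
rewrite /b /einv/= subrK => /(_ erefl) /le_trans; apply.
apply: lee_pmul => //; rewrite ?Lnorm_ge0//.
  rewrite LnormE invrK.
  have -> : \int[mu]_x `|(EFin \o th) x| `^ (1 - a^-1)^-1 = \int[mu]_x (th x `^ b^-1)%:E.
    by apply: eq_integral => x _ /=; rewrite ger0_norm.
  apply: (@le_poweR _ _ C%:E); [exact: ltW| |exact: hC].
  by apply: integral_ge0 => x _; rewrite lee_fin powR_ge0.
apply: ae_le_Lnorm => //.
- exact/measurable_EFinP.
- by apply: filterS PK => x /= <-.
Qed.

(** Jensen's inequality for a finite measure k dmu, obtained from Hoelder's
    inequality by writing k F as k^(1-1/P) times k^(1/P) F. *)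
Lemma jensen_integral (k : T -> R) (F : T -> \bar R) (C P : R) : (1 <= P)%R -> (0 < C)%R ->
  measurable_fun setT k -> (forall x, 0 <= k x)%R ->
  measurable_fun setT F -> (forall x, 0 <= F x) ->
  \int[mu]_x (k x)%:E <= C%:E ->
  (\int[mu]_x ((k x)%:E * F x)) `^ P <=
    (C `^ (P - 1))%:E * \int[mu]_x ((k x)%:E * F x `^ P).
Proof.
move=> P1 C0 mk k0 mF F0 kC.
have mkE : measurable_fun setT (fun x => (k x)%:E) by exact/measurable_EFinP.
move: P1; rewrite le_eqVlt => /predU1P[<-|P1].
  rewrite subrr powRr0 mul1e poweRe1; last by apply: integral_ge0 => x _; rewrite mule_ge0 ?lee_fin.
  by under [leRHS]eq_integral do rewrite poweRe1//.
have P0 : (0 < P)%R by exact: lt_trans P1.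
have b0 : (0 < 1 - P^-1)%R by rewrite subr_gt0 invf_lt1.
have := @ehoelder P%:E (fun x => k x `^ (1 - P^-1))%R
  (fun x => (k x `^ P^-1)%:E * F x) C.
rewrite lte_fin /einv/= => /(_ P1 C0).
have mk1 a : measurable_fun setT (fun x => k x `^ a)%R.
  exact: measurableT_comp (measurable_powR _) mk.
move=> /(_ (mk1 _)) h.
have {h} := h (fun x => powR_ge0 _ _).
have mPsi : measurable_fun setT (fun x => (k x `^ P^-1)%:E * F x).
  by apply: emeasurable_funM => //; exact/measurable_EFinP.
move=> /(_ mPsi) h.
have {h} := h (fun x => mule_ge0 (_ : 0 <= (k x `^ P^-1)%:E) (F0 x)).
have K0 x : 0 <= (k x `^ P^-1)%:E by rewrite lee_fin powR_ge0.
move=> /(_ K0).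
have e1 x : ((k x `^ (1 - P^-1)) `^ (1 - P^-1)^-1)%R = k x.
  by rewrite -powRrM divff ?gt_eqF// powRr1.
under eq_integral do rewrite e1.
move=> /(_ kC).
have e2 x : (k x `^ (1 - P^-1))%:E * ((k x `^ P^-1)%:E * F x) = (k x)%:E * F x.
  by rewrite muleA -EFinM -powRD ?subrK ?powRr1// oner_eq0.
under eq_integral do rewrite e2.
move=> h; apply: (le_trans (le_poweR (ltW P0) _ h)).
  by apply: integral_ge0 => x _; rewrite mule_ge0 ?lee_fin.
rewrite poweRM ?Lnorm_ge0 ?lee_fin ?powR_ge0// poweR_EFin -powRrM mulrBl mul1r mulVf ?gt_eqF//.
rewrite poweR_Lnorm ?gt_eqF// le_eqVlt; apply/orP; left; apply/eqP; congr (_ * _).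
apply: eq_integral => x _; rewrite gee0_abs ?mule_ge0// poweRM// poweR_EFin.
by rewrite -powRrM mulVf ?gt_eqF// powRr1.
Qed.

End Lnorm_basic.

(** * L^p norms on products *)

Section Lnorm_product.
Context d1 d2 (T1 : measurableType d1) (T2 : measurableType d2) (R : realType).
Variables (m1 : {sigma_finite_measure set T1 -> \bar R})
  (m2 : {sigma_finite_measure set T2 -> \bar R}).
Local Open Scope ereal_scope.

Lemma ae_prod (P : T1 * T2 -> Prop) : {ae m1 \x m2, forall z, P z} ->
  {ae m1, forall x, {ae m2, forall y, P (x, y)}}.
Proof.
move=> [N [mN N0 PN]].
have m2N : measurable_fun setT (m2 \o xsection N) by exact: measurable_fun_xsection.
have : \int[m1]_x `|(m2 \o xsection N) x| = 0.
  rewrite -[RHS]N0 /product_measure1; apply: eq_integral => x _.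
  by rewrite gee0_abs.
move/(ae_eq_integral_abs m1 measurableT m2N).
apply: filterS => x /(_ I)/= Nx; exists (xsection N x); split => //.
  exact: measurable_xsection.
by move=> y /= Pxy; rewrite /xsection/= inE; exact: PN.
Qed.

(** The converse of [ae_prod] needs the set of good points to be measurable,
    to know that its complement is null from its sections. *)
Lemma ae_prod_measurable (A : set (T1 * T2)) : measurable A ->
  {ae m1, forall x, {ae m2, forall y, A (x, y)}} -> {ae m1 \x m2, forall z, A z}.
Proof.
move=> mA h; exists (~` A); split => //; first exact: measurableC.
rewrite /product_measure1 (@ge0_ae_eq_integral _ _ _ _ _ _ (cst 0))//.
- exact: integral0.
- by apply: measurable_fun_xsection; exact: measurableC.
apply: filterS h => x [N [mN N0 AN]] _ /=.
apply/eqP; rewrite eq_le measure_ge0 andbT -N0 le_measure ?inE//.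
  by apply: measurable_xsection; exact: measurableC.
by move=> y; rewrite /xsection/= inE => nA; exact: AN.
Qed.

Lemma measurable_fun_pair1 d (T : measurableType d) (F : T1 * T2 -> T) x :
  measurable_fun setT F -> measurable_fun setT (fun y => F (x, y)).
Proof. by move=> mF; apply: (measurableT_comp mF); exact: pair1_measurable. Qed.

Lemma measurable_ereal_le d (T : measurableType d) (f g : T -> \bar R) :
  measurable_fun setT f -> measurable_fun setT g -> measurable [set x | f x <= g x].
Proof.
move=> mf mg; rewrite -[X in measurable X]setTI.
rewrite [X in measurable X](_ : _ = setT `&` (fun x => f x <= g x) @^-1` [set true]).
  exact: measurable_fun_lee.
by apply/seteqP; split => x /= [].
Qed.

Lemma measurable_fun_from_le d (T : measurableType d) (f : T -> \bar R) :
  (forall c : R, measurable [set x | f x <= c%:E]) -> measurable_fun setT f.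
Proof.
move=> h; apply: (measurability _ (ErealGenOInfty.measurableE R)) => //.
move=> _ [_ [c ->] <-]; rewrite setTI -[X in measurable X]setCK; apply: measurableC.
rewrite [X in measurable X](_ : _ = [set x | f x <= c%:E])//.
apply/seteqP; split => x /=; rewrite in_itv/= andbT; first by move=> /negP; rewrite -leNgt.
by move=> h1; apply/negP; rewrite -leNgt.
Qed.

(** For p = oo the norm of a slice is at most c exactly when the slice of the
    set where |F| > c is null, and the measure of slices is a measurable
    function. *)
Lemma measurable_Lnorm (F : T1 * T2 -> \bar R) p : 0 < p -> measurable_fun setT F ->
  measurable_fun setT (fun x => 'N[m2]_p[(fun y => F (x, y))]).
Proof.
move=> /gt0_cases[->|[a a0 ->]] mF; last first.
  under eq_fun do rewrite LnormE.
  apply: measurable_fun_poweR.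
  apply: (@measurable_fun_fubini_tonelli_F _ _ _ _ _ m2 (fun z => `|F z| `^ a)).
    by apply: measurable_fun_poweR; exact: measurableT_comp.
  by move=> z; exact: poweR_ge0.
apply: measurable_fun_from_le => c.
pose B := [set z | c%:E < `|F z|].
have mB : measurable B.
  rewrite -[B]setTI; apply: emeasurable_fun_o_infty => //.
  exact: measurableT_comp.
have [c0|c0] := ltP c 0%R.
  rewrite [X in measurable X](_ : _ = set0)//.
  apply/seteqP; split => x //=; apply/negP; rewrite -ltNge (lt_le_trans _ (Lnorm_ge0 _ _ _))//.
rewrite [X in measurable X](_ : _ = (m2 \o xsection B) @^-1` [set 0]); last first.
  apply/seteqP; split=> x /=.
    move/Lnormy_le => [_ [N [mN N0 FN]]].
    apply/eqP; rewrite eq_le measure_ge0 andbT -N0 le_measure ?inE//.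
      exact: measurable_xsection.
    by move=> y; rewrite /xsection/= inE /B/= => cF; apply: FN => /=; apply/negP; rewrite -ltNge.
  move=> Bx; apply/Lnormy_le; split; first by rewrite lee_fin.
  exists (xsection B x); split => //; first exact: measurable_xsection.
  by move=> y /= /negP; rewrite -ltNge /xsection/= inE.
rewrite -[X in measurable X]setTI; apply: measurable_fun_xsection => //.
Qed.

(** For finite p this is Fubini and Tonelli; for p = oo the measurability of
    the inner norm, [measurable_Lnorm], is what makes the nested null sets
    usable. *)
Lemma Lnorm_prod (F : T1 * T2 -> \bar R) p : 0 < p -> measurable_fun setT F ->
  'N[m1 \x m2]_p[F] = 'N[m1]_p[(fun x => 'N[m2]_p[(fun y => F (x, y))])].
Proof.
move=> p0 mF; have := measurable_Lnorm p0 mF.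
move: p0 => /gt0_cases[->|[a a0 ->]] mN; last first.
  rewrite !LnormE (@fubini_tonelli1 _ _ _ _ _ m1 m2 (fun z => `|F z| `^ a)).
  - congr (_ `^ _); apply: eq_integral => x _.
    by rewrite gee0_abs ?Lnorm_ge0// poweR_Lnorm ?gt_eqF.
  - by apply: measurable_fun_poweR; exact: measurableT_comp.
  - by move=> z; exact: poweR_ge0.
apply/eqP; rewrite eq_le; apply/andP; split.
  apply/Lnormy_le; split; first exact: Lnorm_ge0.
  apply: (@ae_prod_measurable [set z | `|F z| <= _]).
    by apply: measurable_ereal_le => //; exact: measurableT_comp.
  apply: filterS (Lnormy_ae m1 (fun x => 'N[m2]_+oo[(fun y => F (x, y))])) => x.
  rewrite gee0_abs ?Lnorm_ge0// => h.
  by apply: filterS (Lnormy_ae m2 (fun y => F (x, y))) => y /le_trans; exact.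
apply/Lnormy_le; split; first exact: Lnorm_ge0.
have := ae_prod (Lnormy_ae (m1 \x m2) F).
apply: filterS => x h; rewrite gee0_abs ?Lnorm_ge0//.
by apply/Lnormy_le; split => //; exact: Lnorm_ge0.
Qed.

Lemma ae_prod_swap (A : set (T1 * T2)) : measurable A ->
  {ae m1, forall x, {ae m2, forall y, A (x, y)}} ->
  {ae m2, forall y, {ae m1, forall x, A (x, y)}}.
Proof.
move=> mA /(ae_prod_measurable mA)[N [mN N0 AN]].
have m1N : measurable_fun setT (m1 \o ysection N) by exact: measurable_fun_ysection.
have : \int[m2]_y `|(m1 \o ysection N) y| = 0.
  rewrite -[RHS]N0; under eq_integral do rewrite gee0_abs//.
  transitivity (\int[m1 \x m2]_z (\1_N z)%:E); last by rewrite integral_indic// setIT.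
  by rewrite indic_fubini_tonelli1// indic_fubini_tonelli// indic_fubini_tonelli_GE.
move/(ae_eq_integral_abs m2 measurableT m1N).
apply: filterS => y /(_ I)/= Ny; exists (ysection N y); split => //.
  exact: measurable_ysection.
by move=> x /= nA; rewrite /ysection/= inE; exact: AN.
Qed.

(** Minkowski's integral inequality. For 1 < p < oo the proof is by duality:
    the function G to be estimated is replaced by bounded functions H below G
    with support of finite measure, G is tested against H^(p-1), and Hoelder's
    inequality is applied for each x. As the integral of H^p is finite, one
    can divide by its power. *)
Lemma minkowski_integral (F : T1 * T2 -> \bar R) p : 1 <= p -> measurable_fun setT F ->
  (forall z, 0 <= F z) ->
  'N[m2]_p[(fun y => \int[m1]_x F (x, y))] <= \int[m1]_x 'N[m2]_p[(fun y => F (x, y))].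
Proof.
move=> p1 mF F0; have p0 : 0 < p by exact: lt_le_trans p1.
have mG := measurable_fun_fubini_tonelli_G F mF F0 (m1 := m1).
have mN := measurable_Lnorm p0 mF.
rewrite /fubini_G in mG; set G := fun y => \int[m1]_x F (x, y) in mG *; set B := (leRHS).
have G0 y : 0 <= G y by exact: integral_ge0.
have B0 : 0 <= B by apply: integral_ge0 => x _; exact: Lnorm_ge0.
move: p0 p1 => /gt0_cases[py|[a a0 pa]] p1.
  rewrite py in mN B B0 *; apply/Lnormy_le; split => //.
  have h : {ae m1, forall x, {ae m2, forall y, F (x, y) <= 'N[m2]_+oo[(fun y => F (x, y))]}}.
    apply/aeW => x; apply: filterS (Lnormy_ae m2 (fun y => F (x, y))) => y.
    by rewrite gee0_abs.
  pose A := [set z : T1 * T2 | F z <= 'N[m2]_+oo[(fun y => F (z.1, y))]].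
  have mA : measurable A.
    by apply: measurable_ereal_le => //; exact: (measurableT_comp mN).
  apply: filterS (ae_prod_swap mA h) => y Ay; rewrite gee0_abs//.
  apply: ae_ge0_le_integral => //.
  - by apply: (measurableT_comp mF); exact: pair2_measurable.
  - by move=> x _; exact: Lnorm_ge0.
  - by apply: filterS Ay.
rewrite pa in mN B B0 p1 *.
rewrite lee_fin le_eqVlt in p1; case/predU1P: p1 => [a1|a1].
  rewrite /B -a1; under [leRHS]eq_integral do rewrite Lnorm1.
  rewrite Lnorm1; under eq_integral do rewrite gee0_abs//.
  under [leRHS]eq_integral do under eq_integral do rewrite gee0_abs//.
  by rewrite (fubini_tonelli F mF F0).
have [By|] := ltP B +oo; last by rewrite leye_eq => /eqP ->; rewrite leey.
have /sigma_finiteP[E [ET ndE Efin]] := sigma_finiteT m2.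
(* a truncation of G in height and in support, for which the integral of H^a
   is finite *)
pose H m y : R := (fine (mine (G y) m%:R%:E) * \1_(E m) y)%R.
have Gm0 m y : 0 <= mine (G y) m%:R%:E by rewrite le_min G0 lee_fin ler0n.
have Gmfin m y : mine (G y) m%:R%:E \is a fin_num.
  by rewrite ge0_fin_numE// gt_min ltry orbT.
have H0 m y : (0 <= H m y)%R by rewrite mulr_ge0// fine_ge0.
have mH m : measurable_fun setT (H m).
  apply: measurable_funM.
    by apply: measurableT_comp => //; exact: measurable_mine.
  by apply: measurable_indic; exact: (Efin m).1.
have HG m y : (H m y)%:E <= G y.
  rewrite /H EFinM fineK//.
  apply: (@le_trans _ _ (G y * 1)); last by rewrite mule1.
  apply: lee_pmul => //; rewrite ?lee_fin//; by rewrite ge_min lexx.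
have Hm m y : (H m y <= m%:R * \1_(E m) y)%R.
  rewrite /H ler_wpM2r// -lee_fin fineK// ge_min lexx orbT//.
pose I m := \int[m2]_y ((H m y) `^ a)%:E.
have mHa m b : measurable_fun setT (fun y => (H m y `^ b)%:E).
  by apply/measurable_EFinP; exact: (measurableT_comp (measurable_powR _) (mH m)).
have I0 m : 0 <= I m by apply: integral_ge0 => y _; rewrite lee_fin powR_ge0.
have Ify m : I m < +oo.
  apply: (@le_lt_trans _ _ (\int[m2]_y ((m%:R `^ a)%:E * (\1_(E m) y)%:E))).
    apply: ge0_le_integral => //.
    - by move=> y _; rewrite lee_fin powR_ge0.
    - apply: emeasurable_funM => //; apply/measurable_EFinP.
      by apply: measurable_indic; exact: (Efin m).1.
    move=> y _; rewrite -EFinM lee_fin.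
    have := Hm m y; rewrite indicE; case: (_ \in _) => /=.
      by rewrite !mulr1 => h; apply: ler_powRl => //; exact: ltW.
    rewrite !mulr0 => h; have -> : H m y = 0%R by apply/eqP; rewrite eq_le h H0.
    by rewrite powR0 ?gt_eqF.
  rewrite ge0_integralZl_EFin ?powR_ge0//; last first.
    by apply/measurable_EFinP; apply: measurable_indic; exact: (Efin m).1.
  rewrite integral_indic ?setIT//; last exact: (Efin m).1.
  by rewrite lte_mul_pinfty ?lee_fin ?powR_ge0//; exact: (Efin m).2.
have key m : I m <= B `^ a.
  have [->|Ine] := eqVneq (I m) 0; first exact: poweR_ge0.
  have Ifin : I m \is a fin_num by rewrite ge0_fin_numE.
  set C := fine (I m); have CI : C%:E = I m by rewrite /C fineK.
  have C0 : (0 < C)%R by rewrite -lte_fin CI lt0e Ine I0.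
  have e1 : I m <= \int[m2]_y ((H m y `^ (a - 1))%:E * G y).
    apply: ge0_le_integral => //.
    - by move=> y _; rewrite lee_fin powR_ge0.
    - exact: emeasurable_funM.
    move=> y _; rewrite -(mulr_powRB1 (H0 m y))// EFinM muleC.
    by rewrite lee_wpmul2l// lee_fin powR_ge0.
  have e2 : \int[m2]_y ((H m y `^ (a - 1))%:E * G y) =
      \int[m1]_x \int[m2]_y ((H m y `^ (a - 1))%:E * F (x, y)).
    have mHF : measurable_fun setT (fun z : T1 * T2 => (H m z.2 `^ (a - 1))%:E * F z).
      apply: emeasurable_funM => //.
      by apply: (@measurableT_comp _ _ _ _ _ _ (fun y => (H m y `^ (a - 1))%:E)).
    have HF0 z : 0 <= (H m z.2 `^ (a - 1))%:E * F z by rewrite mule_ge0// lee_fin powR_ge0.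
    rewrite (fubini_tonelli _ mHF HF0)//; apply: eq_integral => y _ /=.
    by rewrite ge0_integralZl_EFin ?powR_ge0//; apply: (measurableT_comp mF); exact: pair2_measurable.
  have e3 : I m <= (C `^ (1 - a^-1))%:E * B.
    rewrite (le_trans e1)// e2 -ge0_integralZl_EFin ?powR_ge0//; last first.
      by move=> x _; exact: Lnorm_ge0.
    apply: ge0_le_integral => //.
    - by move=> x _; apply: integral_ge0 => y _; rewrite mule_ge0// lee_fin powR_ge0.
    - apply: (@measurable_fun_fubini_tonelli_F _ _ _ _ _ m2 (fun z : T1 * T2 => (H m z.2 `^ (a - 1))%:E * F z)).
        apply: emeasurable_funM => //.
        by apply: (@measurableT_comp _ _ _ _ _ _ (fun y => (H m y `^ (a - 1))%:E)).
      by move=> z; rewrite mule_ge0// lee_fin powR_ge0.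
    - exact: measurable_funeM.
    move=> x _; apply: (@ehoelder _ _ _ m2 a%:E) => //.
    - exact: (measurableT_comp (measurable_powR _) (mH m)).
    - by move=> y; rewrite powR_ge0.
    - exact: measurable_fun_pair1.
    rewrite CI le_eqVlt; apply/orP; left; apply/eqP; apply: eq_integral => y _.
    rewrite -powRrM; congr ((_ `^ _)%:E); rewrite /einv/=.
    by field; rewrite subr_eq0 !gt_eqF.
  rewrite -poweR_lee_inv// -CI poweR_EFin.
  have : (C `^ (a^-1 - 1))%:E * I m <= B.
    apply: (@le_trans _ _ ((C `^ (a^-1 - 1))%:E * ((C `^ (1 - a^-1))%:E * B))).
      by rewrite lee_wpmul2l// lee_fin powR_ge0.
    rewrite muleA -EFinM -powRD; last by rewrite (gt_eqF C0)/= implybT.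
    have -> : (a^-1 - 1 + (1 - a^-1) = 0)%R by ring.
    by rewrite powRr0 mul1e.
  rewrite -CI -EFinM -{2}[C](powRr1 (ltW C0)) -powRD ?subrK//.
  by rewrite (gt_eqF C0)/= implybT.
rewrite Lnorm_le_integral//.
have -> : \int[m2]_y `|G y| `^ a = limn I.
  rewrite /I -monotone_convergence//.
  - apply: eq_integral => y _; apply/esym/cvg_lim => //; rewrite gee0_abs//.
    have [k _ Eky] : (\bigcup_k E k) y by rewrite -ET.
    have EE : \forall m \near \oo, \1_(E m) y = 1%R :> R.
      exists k => // m /= km; rewrite indicE mem_set//.
      by move: y Eky; exact/subsetPset/ndE.
    have [Gy|Gy] := ltP (G y) +oo.
      have Gfin : G y \is a fin_num by rewrite ge0_fin_numE.
      apply: cvg_near_cst; near=> m.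
      rewrite /H (near EE)// mulr1.
      have -> : mine (G y) m%:R%:E = G y.
        apply/min_idPl; rewrite -(fineK Gfin) lee_fin; near: m.
        exact: nbhs_infty_ger.
      by rewrite -poweR_EFin fineK.
    move: Gy; rewrite leye_eq => /eqP Gy; rewrite Gy eqy_poweR//.
    apply/cvgeyPge => A; near=> m.
    rewrite /H (near EE)// mulr1 Gy minye/= lee_fin.
    apply: (@le_trans _ _ m%:R); first by near: m; exact: nbhs_infty_ger.
    by apply: le1r_powR; [near: m; exact: nbhs_infty_ger|exact: ltW].
  - by move=> m y _; rewrite lee_fin powR_ge0.
  move=> y _ k m km; rewrite lee_fin; apply: ler_powRl => //; first exact: ltW.
  apply: ler_pM => //; first by rewrite fine_ge0.
    by rewrite fine_le// le_min ge_min lexx/= ge_min lee_fin ler_nat km orbT.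
  rewrite !indicE; case: (boolP (y \in E k)) => // /set_mem Ek.
  by rewrite mem_set//; move: y Ek; exact/subsetPset/ndE.
apply: lime_le; last by near=> m; exact: key.
apply: ereal_nondecreasing_is_cvgn => k m km; apply: ge0_le_integral => //.
  by move=> y _; rewrite lee_fin powR_ge0.
move=> y _; rewrite lee_fin; apply: ler_powRl => //; first exact: ltW.
apply: ler_pM => //; first by rewrite fine_ge0.
  by rewrite fine_le// le_min ge_min lexx/= ge_min lee_fin ler_nat km orbT.
rewrite !indicE; case: (boolP (y \in E k)) => // /set_mem Ek.
by rewrite mem_set//; move: y Ek; exact/subsetPset/ndE.
Unshelve. all: by end_near. Qed.

End Lnorm_product.

(** * Integration against a density *)

Section density.
Context d1 d2 (T1 : measurableType d1) (T2 : measurableType d2) (R : realType).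
Variables (mu : {measure set T1 -> \bar R}) (nu : {measure set T2 -> \bar R}).
Variables (phi : T1 -> T2) (w : T1 -> R).
Local Open Scope ereal_scope.
Hypotheses (mphi : measurable_fun setT phi).
Hypotheses (w0 : forall x, (0 <= w x)%R) (mw : measurable_fun setT w).
Hypothesis nuE : forall A, measurable A -> nu A = \int[mu]_x ((w x)%:E * (\1_A (phi x))%:E).

Import HBNNSimple.

(** Passes from measures of sets to integrals of nonnegative functions by
    approximation with simple functions; used below for dt/t. *)
Lemma integral_density (f : T2 -> \bar R) : measurable_fun setT f -> (forall x, 0 <= f x) ->
  \int[nu]_x f x = \int[mu]_x ((w x)%:E * f (phi x)).
Proof.
move=> mf f0; pose g := nnsfun_approx measurableT mf.
have mwE : measurable_fun setT (fun x => (w x)%:E) by exact/measurable_EFinP.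
have mcomp (h : T2 -> R) : measurable_fun setT h -> measurable_fun setT (fun x => (h (phi x))%:E).
  by move=> mh; apply/measurable_EFinP; exact: (measurableT_comp mh mphi).
have sfE (h : {nnsfun T2 >-> R}) : \int[nu]_x (h x)%:E = \int[mu]_x ((w x)%:E * (h (phi x))%:E).
  have hE x : (h x)%:E = \sum_(k \in range h) k%:E * (\1_(h @^-1` [set k]) x)%:E.
    by rewrite fsumEFin //= fimfunE.
  under [LHS]eq_integral do rewrite hE.
  rewrite ge0_integral_fsum //; last 2 first.
    - by move=> r; exact/measurable_EFinP/measurableT_comp.
    - by move=> r /= z _; exact: nnfun_muleindic_ge0.
  transitivity (\sum_(k \in range h)
      \int[mu]_x (k%:E * ((w x)%:E * (\1_(h @^-1` [set k]) (phi x))%:E))).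
    apply: eq_fsbigr => i; rewrite inE => -[z _ <-{i}].
    rewrite ge0_integralZl//; last 2 first.
      - exact/measurable_EFinP.
      - by rewrite lee_fin.
    rewrite integral_indic// setIT nuE// -ge0_integralZl//.
    - by apply: emeasurable_funM => //; exact: mcomp.
    - by move=> x _; rewrite mule_ge0 ?lee_fin.
    - by rewrite lee_fin.
  rewrite -ge0_integral_fsum//.
  - apply: eq_integral => x _; rewrite hE ge0_mule_fsumr; last first.
      by move=> r; exact: nnfun_muleindic_ge0.
    by apply: eq_fsbigr => r _; rewrite muleCA.
  - move=> r; apply: measurable_funeM; apply: emeasurable_funM => //.
    exact: mcomp.
  move=> r x _; rewrite muleCA mule_ge0 ?lee_fin//.
  exact: nnfun_muleindic_ge0.
transitivity (limn (fun n => \int[nu]_x (g n x)%:E)).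
  rewrite -monotone_convergence//.
  - by apply: eq_integral => x _; apply/esym/cvg_lim => //; exact: cvg_nnsfun_approx.
  - by move=> n; exact/measurable_EFinP.
  - by move=> n x _; rewrite lee_fin.
  - by move=> x _ a b ab; rewrite lee_fin; exact/lefP/nd_nnsfun_approx.
transitivity (limn (fun n => \int[mu]_x ((w x)%:E * (g n (phi x))%:E))).
  by congr (limn _); apply/funext => n; exact: sfE.
rewrite -monotone_convergence//.
- apply: eq_integral => x _; apply/cvg_lim => //; apply: cvgeZl => //.
  exact: cvg_nnsfun_approx.
- by move=> n; apply: emeasurable_funM => //; exact: mcomp.
- by move=> n x _; rewrite mule_ge0 ?lee_fin.
- by move=> x _ a b ab; rewrite lee_wpmul2l ?lee_fin//; exact/lefP/nd_nnsfun_approx.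
Qed.

End density.

(** * Dyadic layers *)

Section layers.
Context {R : realType}.
Local Notation h := (2^-1 : R).

Lemma half_itv01 : 0 < h < 1.
Proof. by rewrite invr_gt0 ltr0n/= invf_lt1// ltr1n. Qed.

Lemma dyadic_layer (x : R) : 0 < x <= 1 -> exists k, h ^+ k.+1 < x <= h ^+ k.
Proof.
move=> /andP[x0 x1]; have /andP[h0 h1] := half_itv01.
have ex : exists k, h ^+ k < x.
  have : \forall k \near \oo, h ^+ k < x.
    have : h ^+ k @[k --> \oo] --> (0 : R) by apply: cvg_expr; rewrite ger0_norm ?ltW.
    by move/cvgr_lt; apply.
  by move=> [k _ hk]; exists k; apply: hk => /=.
case: (ex_minnP ex) => -[|k] hk kmin; first by move: hk; rewrite expr0 ltNge x1.
exists k; rewrite hk/= leNgt; apply/negP => /kmin.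
by rewrite ltnn.
Qed.

Lemma powR_lt1 (x a : R) : 0 < x < 1 -> 0 < a -> x `^ a < 1.
Proof.
move=> /andP[x0 x1] a0; rewrite -[ltRHS](_ : (1 : R) `^ a = 1); last by rewrite powR1.
by apply: gt0_ltr_powR => //; rewrite nnegrE ltW.
Qed.

Lemma powR_exprn (x a : R) k : 0 <= x -> (x ^+ k) `^ a = (x `^ a) ^+ k.
Proof. by move=> x0; rewrite -(powR_mulrn k x0) -(powR_mulrn k (powR_ge0 x a)) powRAC. Qed.

Lemma powR_layer (x b : R) k : h ^+ k.+1 < x <= h ^+ k -> x `^ b <= 2 `^ `|b| * (h `^ b) ^+ k.
Proof.
move=> /andP[x1 x2]; have /andP[h0 h1] := half_itv01.
have x0 : 0 < x by apply: lt_trans x1; rewrite exprn_gt0.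
have [b0|b0] := leP 0 b.
  apply: (@le_trans _ _ ((h ^+ k) `^ b)).
    by apply: ge0_ler_powR; rewrite ?nnegrE ?exprn_ge0// ltW.
  rewrite (powR_exprn _ _ (ltW h0)) ler_peMl ?exprn_ge0 ?powR_ge0//.
  rewrite -[leLHS](powRr0 2); apply: ler_powR => //; rewrite ?ler1n//.
rewrite ltr0_norm// -[b]opprK powRN -powR_inv1 ?powR_ge0//.
rewrite -powRrM mulrN1 opprK.
have -> : x `^ b = (x^-1) `^ (- b).
  by rewrite -powR_inv1 ?ltW// -powRrM mulN1r opprK.
apply: (@le_trans _ _ ((2 * (2 ^+ k)) `^ (- b))).
  apply: ge0_ler_powR; rewrite ?nnegrE ?mulr_ge0 ?exprn_ge0 ?invr_ge0 ?ltW ?oppr_gt0//.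
  by rewrite -exprS -[ltRHS]invrK ltf_pV2 ?posrE ?invr_gt0 ?exprn_gt0// -exprVn.
rewrite powRM ?exprn_ge0// ler_wpM2l ?powR_ge0// (powR_exprn _ _ (ler0n _ 2)).
rewrite le_eqVlt; apply/orP; left; apply/eqP; congr (_ ^+ _).
by rewrite -powR_inv1// -powRrM mulN1r.
Qed.

Local Open Scope ereal_scope.

Lemma geometric_nneseries (c q : R) : (0 <= c)%R -> (0 <= q < 1)%R ->
  \sum_(k <oo) (c * q ^+ k)%:E <= (c / (1 - q))%:E.
Proof.
move=> c0 /andP[q0 q1].
have -> : \sum_(k <oo) (c * q ^+ k)%:E = (c * (1 - q)^-1)%:E.
  apply/cvg_lim => //; under eq_fun do rewrite sumEFin.
  apply: cvg_EFin; first exact: nearW.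
  by apply: cvg_geometric_series; rewrite ger0_norm.
by [].
Qed.

(** The integral of X^b is finite if the set where X is about 2^-k has measure
    of the order of 2^(-ka), with a + b > 0: sum a geometric series over
    dyadic layers. The model integrals in time and in space are instances,
    with X a ratio of times, a distance to the singularity, or the inverse of
    a spatial weight. *)
Lemma layer_integral (a b : R) : (0 < a + b)%R -> exists2 C : R, (0 < C)%R &
  forall d (T : measurableType d) (mu : {measure set T -> \bar R}) (D : set T)
      (X : T -> R) (m : R),
    measurable D -> measurable_fun setT X -> (forall x, D x -> (0 < X x <= 1)%R) -> (0 <= m)%R ->
    (forall k, let A := D `&` [set x | (h ^+ k.+1 < X x <= h ^+ k)%R] in
      measurable A -> mu A <= (m * (h `^ a) ^+ k)%:E) ->
    \int[mu]_(x in D) (X x `^ b)%:E <= (C * m)%:E.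
Proof.
move=> ab; exists (2 `^ `|b| / (1 - h `^ (a + b)))%R.
  by rewrite divr_gt0 ?powR_gt0// subr_gt0 powR_lt1// half_itv01.
move=> d T mu D X m mD mX DX m0 hm.
pose A k := D `&` [set x | (h ^+ k.+1 < X x <= h ^+ k)%R].
have mA k : measurable (A k).
  rewrite /A [X in _ `&` X](_ : _ = X @^-1` `](h ^+ k.+1)%R, (h ^+ k)%R]%classic); last first.
    by apply/seteqP; split => x /=; rewrite in_itv.
  by apply: measurableI => //; rewrite -[X in measurable X]setTI; exact: mX.
have DE : D = \bigcup_k A k.
  apply/seteqP; split=> [x Dx|x [k _ []]//].
  by have [k hk] := dyadic_layer (DX _ Dx); exists k.
have mXb : measurable_fun setT (fun x => (X x `^ b)%:E).
  by apply/measurable_EFinP; exact: (measurableT_comp (measurable_powR _) mX).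
rewrite [in leLHS]DE ge0_integral_bigcup//.
- apply: (@le_trans _ _ (\sum_(k <oo) (2 `^ `|b| * m * (h `^ (a + b)) ^+ k)%:E)).
    apply: lee_nneseries => k _; first by move=> _; apply: integral_ge0 => x _; rewrite lee_fin powR_ge0.
    apply: (@le_trans _ _ (\int[mu]_(x in A k) (cst (2 `^ `|b| * (h `^ b) ^+ k)%:E) x)).
      apply: ge0_le_integral => //.
      - by move=> x _; rewrite lee_fin powR_ge0.
      - exact: measurable_funTS.
      by move=> x [_ hx]; rewrite lee_fin; exact: powR_layer.
    rewrite integral_cst//; apply: (le_trans (lee_wpmul2l _ (hm k (mA k)))).
      by rewrite lee_fin mulr_ge0 ?exprn_ge0 ?powR_ge0.
    rewrite -EFinM lee_fin powRD; last by apply/implyP => _; rewrite gt_eqF// (andP half_itv01).1.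
    by rewrite exprMn le_eqVlt; apply/orP; left; apply/eqP; ring.
  rewrite (le_trans (geometric_nneseries _ _))//.
  - by rewrite mulr_ge0 ?powR_ge0.
  - by rewrite powR_ge0/= powR_lt1// half_itv01.
  by rewrite mulrAC.
- exact: measurable_funTS.
- by move=> x _; rewrite lee_fin powR_ge0.
- apply/trivIsetP => i j _ _; wlog ij : i j / (i < j)%N.
    move=> hw ne; have [ij|ji|ij] := ltngtP i j; first exact: hw.
      by rewrite setIC; apply: hw => //; rewrite eq_sym.
    by rewrite ij eqxx in ne.
  move=> _; rewrite -subset0 => x [[_ /andP[x1 _]] [_ /andP[_ x2]]].
  have := lt_le_trans x1 x2; rewrite ltNge => /negP; apply.
  apply: ler_wiXn2l => //; have /andP[h0 h1] := half_itv01; exact: ltW.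
Qed.

End layers.

(** * Series in L^p *)

Section counting_sigma_finite.
Context {R : realType}.
HB.instance Definition _ := Measure_isSigmaFinite.Build _ _ _ (@counting nat R)
  (sigma_finite_counting R).
End counting_sigma_finite.

Section Lnorm_series.
Context d (T : measurableType d) (R : realType).
Variable mu : {sigma_finite_measure set T -> \bar R}.
Local Open Scope ereal_scope.

(** Minkowski's integral inequality for the counting measure. *)
Lemma Lnorm_nneseries p (g : nat -> T -> \bar R) : 1 <= p ->
  (forall k, measurable_fun setT (g k)) -> (forall k x, 0 <= g k x) ->
  'N[mu]_p[(fun x => \sum_(k <oo) g k x)] <= \sum_(k <oo) 'N[mu]_p[g k].
Proof.
move=> p1 mg g0.
have mG : measurable_fun setT (fun z : nat * T => g z.1 z.2).
  move=> _ B mB; rewrite setTI.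
  rewrite [X in measurable X](_ : _ = \bigcup_k ([set k] `*` (g k @^-1` B))).
    apply: bigcup_measurable => k _; apply: measurableX => //.
    by rewrite -[X in measurable X]setTI; exact: mg.
  apply/seteqP; split => [[k x]/= Bg|[k x] [j _ [/= -> Bg]]//]; by exists k.
have := @minkowski_integral _ _ _ _ _ [the {sigma_finite_measure set nat -> \bar R} of @counting nat R] mu
  (fun z => g z.1 z.2) p p1 mG (fun z => g0 _ _).
rewrite /= ge0_integral_count; last by move=> k; exact: Lnorm_ge0.
by under eq_Lnorm do rewrite ge0_integral_count//.
Qed.

(** The Riesz-Fischer argument: the sum of the absolute increments has a
    finite norm, hence is finite almost everywhere, and the tails of that sum
    dominate the distance to the limit. The limit w is a parameter, so that
    any measurable version can be used. *)
Lemma cvg_of_summable_increments p (u : nat -> T -> R) (A : set T) : 1 <= p -> measurable A ->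
  (forall l, measurable_fun setT (u l)) ->
  \sum_(l <oo) 'N[mu]_p[(fun x => (`|u l.+1 x - u l x| * \1_A x)%:E)] < +oo ->
  {ae mu, forall x, A x -> cvgn (u ^~ x)} /\
  forall w : T -> R, measurable_fun setT w ->
    {ae mu, forall x, A x -> u ^~ x @ \oo --> w x} ->
    (fun l => 'N[mu]_p[(fun x => (`|w x - u l x| * \1_A x)%:E)]) @ \oo --> 0.
Proof.
move=> p1 mA mu_ sumfin; have p0 : 0 < p by exact: lt_le_trans p1.
pose g l x := (`|u l.+1 x - u l x| * \1_A x)%:E.
have mg l : measurable_fun setT (g l).
  apply/measurable_EFinP; apply: measurable_funM => //.
  by apply: measurableT_comp => //; exact: measurable_funB.
have g0 l x : 0 <= g l x by rewrite lee_fin mulr_ge0.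
have mS l : measurable_fun setT (fun x => \sum_(l <= k <oo) g k x).
  apply: (emeasurable_fun_cvg (fun n x => \sum_(l <= k < n) g k x)).
    by move=> n; exact: measurable_fun_esum_seq.
  by move=> x _; apply: is_cvg_nneseries => *; exact: g0.
have S0 l x : 0 <= \sum_(l <= k <oo) g k x by apply: nneseries_ge0 => *; exact: g0.
have tailN l : 'N[mu]_p[(fun x => \sum_(l <= k <oo) g k x)] <= \sum_(l <= k <oo) 'N[mu]_p[g k].
  rewrite -(nneseries_addn l)//.
  rewrite (_ : (fun x => _) = (fun x => \sum_(i <oo) g (i + l)%N x)).
    by apply: Lnorm_nneseries.
  by apply/funext => x; rewrite -(nneseries_addn l (fun i => g0 i x)).
by move=> i; exact: Lnorm_ge0.
have Sfin : {ae mu, forall x, \sum_(k <oo) g k x < +oo}.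
  have := Lnorm_lty_ae p0 (mS 0%N) (le_lt_trans (tailN 0%N) sumfin).
  by apply: filterS => x; rewrite gee0_abs.
split.
  apply: filterS Sfin => x Sx Ax.
  have : cvgn (series (fun k => `|u k.+1 x - u k x|)%R).
    apply: nnseries_is_cvg => //; apply: le_lt_trans Sx.
    by apply: lee_nneseries => // k _; rewrite /g indicE mem_set// mulr1.
  move=> /(@normed_cvg _ _ (fun k => u k.+1 x - u k x)%R).
  rewrite (telescopeK (u ^~ x)) => cu.
  have -> : u ^~ x = (fun n => u 0%N x + (u n x - u 0%N x))%R.
    by apply/funext => n; rewrite addrC subrK.
  exact: is_cvgD (is_cvg_cst _) cu.
move=> w mw wE.
have wtail l : {ae mu, forall x, (`|w x - u l x| * \1_A x)%:E <= \sum_(l <= k <oo) g k x}.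
  apply: filterS wE => x ux; rewrite indicE.
  case: (boolP (x \in A)) => [/set_mem Ax|_]; last by rewrite mulr0.
  rewrite mulr1; move: ux => /(_ Ax) ux.
  have : (`|u m x - u l x|%:E @[m --> \oo] --> `|w x - u l x|%:E).
    apply: cvg_EFin; first exact: nearW.
    by apply: cvg_norm; apply: cvgB => //; exact: cvg_cst.
  move=> /cvge_to_le; apply; near=> m.
  have lm : (l <= m)%N by near: m; exact: nbhs_infty_ge.
  apply: (@le_trans _ _ (\sum_(l <= k < m) g k x)); last by apply: nneseries_lim_ge => *; exact: g0.
  rewrite -(telescope_sumr (u ^~ x) lm)//.
  rewrite sumEFin lee_fin (le_trans (ler_norm_sum _ _ _))//.
  by apply: ler_sum => k _; rewrite indicE mem_set// mulr1.
apply: (@squeeze_cvge _ _ _ _ (cst 0) _ (fun l => \sum_(l <= k <oo) 'N[mu]_p[g k])).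
- near=> l; rewrite Lnorm_ge0/= (le_trans _ (tailN l))//.
  apply: ae_le_Lnorm => //.
    apply/measurable_EFinP; apply: measurable_funM => //.
    by apply: measurableT_comp => //; exact: measurable_funB.
  by apply: filterS (wtail l) => x; rewrite !gee0_abs// lee_fin mulr_ge0.
- exact: cvg_cst.
by apply: nneseries_tail_cvg => // k _; exact: Lnorm_ge0.
Unshelve. all: by end_near. Qed.

End Lnorm_series.

(** * Euclidean balls *)

Section euclidean_distance.
Context {R : realType} {n : nat}.
Local Notation X := ('rV[R]_n).
Implicit Types (x y : X).

Lemma edist_ge0 x y : 0 <= edist x y.
Proof. exact: sqrtr_ge0. Qed.

Lemma edistC x y : edist x y = edist y x.
Proof. by rewrite /edist; congr Num.sqrt; apply: eq_bigr => i _; rewrite -sqrrN opprB. Qed.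

Lemma edistxx x : edist x x = 0.
Proof. by rewrite /edist big1 ?sqrtr0// => i _; rewrite subrr expr0n. Qed.

Lemma cauchy_schwarz (I : finType) (a b : I -> R) :
  (\sum_i a i * b i) ^+ 2 <= (\sum_i a i ^+ 2) * (\sum_i b i ^+ 2).
Proof.
set A := \sum_i a i ^+ 2; set B := \sum_i b i ^+ 2; set D := \sum_i a i * b i.
have B0 : 0 <= B by apply: sumr_ge0 => i _; exact: sqr_ge0.
have [Bp|] := ltP 0 B; last first.
  move=> B0'; have BE : B = 0 by apply/eqP; rewrite eq_le B0' B0.
  have b0 i : b i = 0.
    have /eqP := BE; rewrite psumr_eq0; last by move=> j _; exact: sqr_ge0.
    by move=> /allP/(_ i (mem_index_enum _)); rewrite sqrf_eq0 => /eqP.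
  have -> : D = 0 by rewrite /D big1// => i _; rewrite b0 mulr0.
  by rewrite BE mulr0 expr0n.
have : 0 <= \sum_i (B * a i - D * b i) ^+ 2 by apply: sumr_ge0 => i _; exact: sqr_ge0.
have -> : \sum_i (B * a i - D * b i) ^+ 2 = B * (A * B - D ^+ 2).
  transitivity (\sum_i (B ^+ 2 * a i ^+ 2 + ((- (2 * B * D)) * (a i * b i) + D ^+ 2 * b i ^+ 2))).
    by apply: eq_bigr => i _; ring.
  rewrite !big_split/= -!mulr_sumr -/A -/B -/D; ring.
by rewrite pmulr_rge0// subr_ge0.
Qed.

Lemma edist_triangle x y (z : X) : edist x z <= edist x y + edist y z.
Proof.
pose a i := x ord0 i - y ord0 i; pose b i := y ord0 i - z ord0 i.
set A := \sum_i a i ^+ 2; set B := \sum_i b i ^+ 2; set D := \sum_i a i * b i.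
have A0 : 0 <= A by apply: sumr_ge0 => i _; exact: sqr_ge0.
have B0 : 0 <= B by apply: sumr_ge0 => i _; exact: sqr_ge0.
have -> : edist x z = Num.sqrt (A + 2 * D + B).
  rewrite /edist; congr Num.sqrt; rewrite /A /B /D mulr_sumr -!big_split/=.
  by apply: eq_bigr => i _; rewrite /a /b; ring.
rewrite -[leRHS]ger0_norm ?addr_ge0 ?edist_ge0// -sqrtr_sqr ler_wsqrtr//.
rewrite -[edist x y]/(Num.sqrt A) -[edist y z]/(Num.sqrt B).
have h : D <= Num.sqrt A * Num.sqrt B.
  rewrite -sqrtrM// (le_trans (ler_norm _))// -sqrtr_sqr ler_wsqrtr//.
  exact: cauchy_schwarz.
by rewrite sqrrD !sqr_sqrtr// -[_ *+ 2]mulr_natl; lra.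
Qed.

Lemma ler_coord_edist x y i : `|x ord0 i - y ord0 i| <= edist x y.
Proof.
rewrite -sqrtr_sqr ler_wsqrtr// (bigD1 i)//= lerDl.
by apply: sumr_ge0 => j _; exact: sqr_ge0.
Qed.

Lemma edist_le_sum x y : edist x y <= \sum_i `|x ord0 i - y ord0 i|.
Proof.
rewrite -[leRHS]ger0_norm ?sumr_ge0// -sqrtr_sqr ler_wsqrtr//.
suff : (\sum_i (x ord0 i - y ord0 i) ^+ 2 <= (\sum_i `|x ord0 i - y ord0 i|) ^+ 2) /\
  0 <= \sum_i `|x ord0 i - y ord0 i| by case.
apply: (big_ind2 (fun a b => a <= b ^+ 2 /\ 0 <= b)).
- by rewrite expr0n.
- move=> a b c d [ab b0] [cd d0]; split; last exact: addr_ge0.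
  rewrite sqrrD -addrA (le_trans (lerD ab cd))// lerD2l lerDr.
  by rewrite mulrn_wge0// mulr_ge0.
- by move=> i _; rewrite real_normK ?num_real.
Qed.

Lemma edist_scale x y (c : R) : edist (x + c *: y) x = `|c| * edist 0 y.
Proof.
rewrite /edist -sqrtr_sqr -sqrtrM ?sqr_ge0//; congr Num.sqrt.
rewrite mulr_sumr; apply: eq_bigr => i _; rewrite !mxE; ring.
Qed.

Lemma edist_scale2 x y (z : X) (c : R) : 0 < c -> edist (x + c *: y) z = c * edist y (c^-1 *: (z - x)).
Proof.
move=> c0; rewrite -{2}[c]gtr0_norm// -sqrtr_sqr /edist -sqrtrM ?sqr_ge0//; congr Num.sqrt.
rewrite mulr_sumr; apply: eq_bigr => i _; rewrite !mxE.
by field; rewrite gt_eqF.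
Qed.

Lemma measurable_edist d (T : measurableType d) (f g : T -> X) :
  measurable_fun setT f -> measurable_fun setT g ->
  measurable_fun setT (fun z => edist (f z) (g z)).
Proof.
move=> mf mg; rewrite /edist.
have s0 z : 0 <= \sum_(i < n) (f z ord0 i - g z ord0 i) ^+ 2.
  by apply: sumr_ge0 => i _; exact: sqr_ge0.
rewrite (_ : (fun z => _) = (fun z => (\sum_(i < n) (f z ord0 i - g z ord0 i) ^+ 2) `^ 2^-1)); last first.
  by apply/funext => z; rewrite powR12_sqrt.
apply: (measurableT_comp (measurable_powR _)).
apply: measurable_sum => i.
have mc (h : T -> X) : measurable_fun setT h -> measurable_fun setT (fun z => h z ord0 i).
  by move=> mh; exact: (measurableT_comp (measurable_coor i) mh).
by apply: measurable_funX; apply: measurable_funB; exact: mc.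
Qed.

Lemma measurable_eball x (rho : R) : measurable (eball x rho).
Proof.
rewrite -[X in measurable X]setTI.
rewrite (_ : eball x rho = (fun y => edist x y) @^-1` `]-oo, rho[%classic); last first.
  by apply/seteqP; split => y; rewrite /eball/= in_itv.
by apply: measurable_edist => //; exact: measurable_cst.
Qed.

Lemma leb_cube x (rho : R) : 0 < rho ->
  let Q := [set v : X | forall i, `]x ord0 i - rho, x ord0 i + rho[%classic (v ord0 i)] in
  measurable Q /\ leb n Q = ((2 * rho) ^+ n)%:E.
Proof.
move=> r0 Q; pose A i : set R := `]x ord0 i - rho, x ord0 i + rho[%classic; split.
  rewrite (_ : Q = \bigcap_(i in [set: 'I_n]) ((fun v : 'rV[R]_n => v ord0 i) @^-1` A i)).
    apply: fin_bigcap_measurable => // i _.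
    by rewrite -[X in measurable X]setTI; apply: measurable_coor => //; exact: measurable_itv.
  by apply/seteqP; split=> [v vA i _|v vA i]; [exact: vA|exact: (vA i I)].
rewrite (@leb_box _ _ A); last by move=> i; exact: measurable_itv.
transitivity (\prod_(i < n) (2 * rho)%:E)%E.
  apply: eq_bigr => i _; rewrite lebesgue_measure_itv/= lte_fin ltrD2l gtrN// -EFinB.
  by congr (_%:E); ring.
by rewrite prodEFin prodr_const card_ord.
Qed.

Lemma leb_eball_le x (rho : R) : 0 < rho -> (leb n (eball x rho) <= ((2 * rho) ^+ n)%:E)%E.
Proof.
move=> r0; have [mQ <-] := leb_cube x r0.
apply: le_measure; rewrite ?inE//; first exact: measurable_eball.
move=> y; rewrite /eball/= => xy i; rewrite in_itv/= -ltr_distlC.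
by apply: le_lt_trans xy; exact: ler_coord_edist.
Qed.

Lemma leb_eball_ge x (rho : R) : (0 < n)%N -> 0 < rho ->
  (((2 / n%:R * rho) ^+ n)%:E <= leb n (eball x rho))%E.
Proof.
move=> n0 r0; have n0' : 0 < n%:R :> R by rewrite ltr0n.
have rn : 0 < rho / n%:R by rewrite divr_gt0.
have [mQ E] := leb_cube x rn; rewrite mulrAC -mulrA -E.
apply: le_measure; rewrite ?inE//; first exact: measurable_eball.
move=> y /= xy; rewrite /eball/=; apply: le_lt_trans (edist_le_sum _ _) _.
apply: (@lt_le_trans _ _ (\sum_(i < n) (rho / n%:R))).
  apply: ltr_sum; first by rewrite -[n]card_ord in n0; move: n0 => /card_gt0P[i _]; apply/hasP; exists i.
  by move=> i _; have := xy i; rewrite in_itv/= -ltr_distlC.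
by rewrite sumr_const card_ord -[_ *+ n]mulr_natr mulfVK ?gt_eqF.
Qed.

(** By scaling and translation one finite net serves all balls; rounding the
    coordinates to a grid of step eps/n produces it. *)
Lemma eball_net (rho eps : R) : (0 < n)%N -> 0 < eps -> exists (ws : seq X) (C : R),
  [/\ 0 <= C, forall w, w \in ws -> edist 0 w <= C &
  forall (c : R) x y, 0 < c -> edist x y < rho * c ->
    exists2 w, w \in ws & edist (x + c *: w) y < eps * c].
Proof.
move=> n0 e0; have n0' : 0 < n%:R :> R by rewrite ltr0n.
(* the grid of step [delta] in the cube of side 2 rho, indexed by integer
   vectors *)
pose delta := eps / n%:R; have d0 : 0 < delta by rewrite divr_gt0.
pose N := (Num.truncn ((rho + rho) / delta)).+1.
pose wk (k : {ffun 'I_n -> 'I_N}) : X := \row_i (delta * (k i)%:R - rho).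
exists [seq wk k | k : {ffun 'I_n -> 'I_N}].
exists (\sum_(i < n) (delta * N%:R + `|rho|)); split.
- by apply: sumr_ge0 => i _; rewrite addr_ge0// mulr_ge0// ltW.
- move=> _ /mapP[k _ ->]; apply: le_trans (edist_le_sum _ _) _.
  apply: ler_sum => i _; rewrite !mxE sub0r normrN.
  apply: (le_trans (ler_normB _ _)); rewrite lerD2r ger0_norm; last by rewrite mulr_ge0// ltW.
  by rewrite ler_pM2l// ler_nat ltnW.
move=> c x y c0 xy.
pose v i := (y ord0 i - x ord0 i) / c.
have vr i : `|v i| < rho.
  rewrite /v normrM normfV (gtr0_norm c0) ltr_pdivrMr//.
  by apply: le_lt_trans xy; rewrite distrC; exact: ler_coord_edist.
have v0 i : 0 <= (v i + rho) / delta.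
  by rewrite divr_ge0 ?(ltW d0)//; have := vr i; rewrite ltr_norml => /andP[]; lra.
have kN i : (Num.truncn ((v i + rho) / delta) < N)%N.
  rewrite ltnS; apply: le_truncn; rewrite ler_pM2r ?invr_gt0// lerD2r.
  by apply/ltW/(le_lt_trans (ler_norm _)).
pose k : {ffun 'I_n -> 'I_N} := [ffun i => Ordinal (kN i)].
exists (wk k); first by apply/mapP; exists k => //; rewrite mem_enum.
rewrite edist_scale2// mulrC ltr_pM2r//; apply: le_lt_trans (edist_le_sum _ _) _.
apply: (@lt_le_trans _ _ (\sum_(i < n) delta)); last first.
  by rewrite sumr_const card_ord -[_ *+ n]mulr_natr mulfVK ?gt_eqF.
apply: ltr_sum; first by rewrite -[n]card_ord in n0; move: n0 => /card_gt0P[i _]; apply/hasP; exists i.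
move=> i _; rewrite !mxE ffunE/=.
have /andP[t1 t2] := truncn_itv (v0 i).
set m := Num.truncn _ in t1 t2 *.
have -> : delta * m%:R - rho - c^-1 * (y ord0 i - x ord0 i) = delta * (m%:R - (v i + rho) / delta).
  by rewrite /v; field; rewrite !gt_eqF.
rewrite normrM (gtr0_norm d0) -[ltRHS]mulr1 ltr_pM2l// ler0_norm ?subr_le0//.
by rewrite opprB ltrBlDl natr1.
Qed.

End euclidean_distance.

(** * The measure dt/t *)

Section dt_over_t_bounds.
Context {R : realType}.
Local Open Scope ereal_scope.
Local Notation lam := (@lebesgue_measure R).
Local Notation nu := (@dt_t R).

(** The density of dt/t with respect to Lebesgue measure on the whole line; in
    contrast to t^-1 it is nonnegative everywhere. *)
Definition inv_pos (s : R) : R := if (0 < s)%R then (s^-1)%R else 0%R.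

Lemma inv_pos_ge0 s : (0 <= inv_pos s)%R.
Proof. by rewrite /inv_pos; case: ifPn => // s0; rewrite invr_ge0 ltW. Qed.

Lemma measurable_inv_pos : measurable_fun setT inv_pos.
Proof.
rewrite (_ : inv_pos = fun s => if (0 < s)%R then s `^ (-1) else 0%R)%R; last first.
  apply/funext => s; rewrite /inv_pos; case: ifPn => // s0.
  by rewrite powR_inv1// ltW.
apply: measurable_fun_ifT => //.
exact: measurable_fun_ltr.
Qed.

Lemma dt_t_density (A : set R) : measurable A ->
  nu A = \int[lam]_s ((inv_pos s)%:E * (\1_A s)%:E).
Proof.
move=> mA; rewrite /dt_t integral_mkcond; apply: eq_integral => s _.
rewrite /patch indicE in_setI /inv_pos; case: (s \in A) => /=; last by rewrite mule0.
rewrite mule1; have -> : (s \in `]0%R, +oo[%classic) = (0 < s)%R.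
  by apply/idP/idP; rewrite inE/= in_itv/= andbT.
by case: ifPn.
Qed.

Lemma integral_dt_t (f : R -> \bar R) : measurable_fun setT f -> (forall s, 0 <= f s) ->
  \int[nu]_s f s = \int[lam]_s ((inv_pos s)%:E * f s).
Proof.
move=> mf f0.
by apply: (@integral_density _ _ (measurableTypeR R) R R lam nu idfun inv_pos) => //;
  [by move=> _ B mB; rewrite setTI; exact: mB|exact: inv_pos_ge0|exact: measurable_inv_pos|exact: dt_t_density].
Qed.

Lemma dt_t_le (A : set R) (a : R) : measurable A -> (0 < a)%R -> A `<=` `[a, +oo[%classic ->
  nu A <= (a^-1)%:E * lam A.
Proof.
move=> mA a0 Aa; rewrite dt_t_density//.
have -> : lam A = \int[lam]_s (\1_A s)%:E by rewrite integral_indic// setIT.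
rewrite -ge0_integralZl_EFin ?invr_ge0 ?(ltW a0)//; last exact/measurable_EFinP.
apply: ge0_le_integral => //.
- by move=> s _; rewrite -EFinM lee_fin mulr_ge0// inv_pos_ge0.
- by apply: emeasurable_funM; apply/measurable_EFinP => //; exact: measurable_inv_pos.
- by apply: measurable_funeM; exact/measurable_EFinP.
move=> s _; rewrite indicE; case: (boolP (s \in A)) => [/set_mem/Aa|]; last by rewrite !mule0.
rewrite /= in_itv/= andbT !mule1 lee_fin => as0.
have s0 : (0 < s)%R by exact: lt_le_trans as0.
by rewrite /inv_pos s0 lef_pV2.
Qed.

Lemma dt_t_itv_ge (a b : R) : (0 < a < b)%R -> ((b - a) / b)%:E <= nu `[a, b].
Proof.
move=> /andP[a0 ab]; have b0 : (0 < b)%R by exact: lt_trans ab.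
rewrite dt_t_density//.
apply: (@le_trans _ _ (\int[lam]_s ((b^-1)%:E * (\1_(`[a, b]%classic) s)%:E))).
  rewrite ge0_integralZl_EFin ?invr_ge0 ?(ltW b0)//; last exact/measurable_EFinP.
  have -> : \int[lam]_s (\1_(`[a, b]%classic) s)%:E = (b - a)%:E.
    rewrite integral_indic// setIT.
    by have := @lebesgue_measure_itv R `[a, b]; rewrite /= lte_fin ab.
  by rewrite -EFinM mulrC.
apply: ge0_le_integral => //.
- by move=> s _; rewrite -EFinM lee_fin mulr_ge0// invr_ge0 ltW.
- by apply: measurable_funeM; exact/measurable_EFinP.
- by apply: emeasurable_funM; apply/measurable_EFinP => //; exact: measurable_inv_pos.
move=> s _; rewrite indicE; case: (boolP (s \in _)) => [/set_mem|]; last by rewrite !mule0.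
rewrite /= in_itv/= => /andP[as0 sb]; rewrite !mule1 lee_fin.
have s0 : (0 < s)%R by exact: lt_le_trans as0.
by rewrite /inv_pos s0 lef_pV2.
Qed.

Lemma ae_lam_dt_t (P : R -> Prop) : {ae lam, forall s : R, (0 < s)%R -> P s} ->
  {ae nu, forall s, (0 < s)%R -> P s}.
Proof.
move=> [N [mN N0 PN]]; exists N; split => //.
rewrite dt_t_density// (@ge0_ae_eq_integral _ _ _ _ _ _ (cst 0))//.
- exact: integral0.
- by apply: emeasurable_funM; apply/measurable_EFinP => //; exact: measurable_inv_pos.
- by move=> s _; rewrite -EFinM lee_fin mulr_ge0// inv_pos_ge0.
exists N; split => // s /= h; apply: contrapT => Ns; apply: h => _.
by rewrite indicE memNset// mule0.
Qed.

Lemma ae_dt_t_gt0 : {ae nu, forall s, (0 < s)%R}.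
Proof.
exists `]-oo, 0%R]%classic; split => //.
  rewrite dt_t_density// (@eq_integral _ _ _ _ _ (cst 0)).
    exact: integral0.
  move=> s _; rewrite /inv_pos indicE; case: ifPn => s0; last by rewrite mul0e.
  by rewrite memNset ?mule0//= in_itv/= leNgt s0.
by move=> s /= /negP; rewrite -leNgt in_itv.
Qed.

End dt_over_t_bounds.

(** * The measure dx dt/t *)

Section dtdx_sigma_finite.
Context {R : realType} {n : nat}.

(** The measure dx dt/t under a name for which sigma-finiteness can be
    inferred. *)
Definition dtdx_sf : set (R * 'rV[R]_n) -> \bar R := dtdx.
HB.instance Definition _ := Measure.on dtdx_sf.

Let dtdx_sf_sigma_finite : sigma_finite setT dtdx_sf.
Proof. exact: sigma_finite_product. Qed.

HB.instance Definition _ := Measure_isSigmaFinite.Build _ _ _ dtdx_sf dtdx_sf_sigma_finite.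

End dtdx_sigma_finite.

Section dtdx_integrals.
Context {R : realType} {n : nat}.
Local Notation X := ('rV[R]_n).
Local Notation U := (R * 'rV[R]_n)%type.
Local Notation nu := (@dt_t R).
Local Notation lbg := (leb n : {sigma_finite_measure set X -> \bar R}).
Local Notation mu := (@dtdx R n).
Local Open Scope ereal_scope.

Lemma integral_dtdx (f : U -> \bar R) : measurable_fun setT f -> (forall z, 0 <= f z) ->
  \int[mu]_z f z = \int[nu]_s \int[lbg]_y f (s, y).
Proof. by move=> mf f0; rewrite -(@fubini_tonelli1 _ _ _ _ _ [the {sigma_finite_measure set R -> \bar R} of @dt_t R] lbg f mf f0). Qed.

Lemma Lnorm_dtdx (f : U -> \bar R) p : 0 < p -> measurable_fun setT f ->
  'N[mu]_p[f] = 'N[nu]_p[(fun s => 'N[lbg]_p[(fun y => f (s, y))])].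
Proof. by move=> p0 mf; exact: (@Lnorm_prod _ _ _ _ _ [the {sigma_finite_measure set R -> \bar R} of @dt_t R] lbg f p p0 mf). Qed.

Lemma dtdx_swap (f : U * U -> \bar R) : measurable_fun setT f -> (forall z, 0 <= f z) ->
  \int[mu]_z \int[mu]_w f (z, w) = \int[mu]_w \int[mu]_z f (z, w).
Proof.
move=> mf f0.
exact: (@fubini_tonelli _ _ _ _ _ [the {sigma_finite_measure set U -> \bar R} of dtdx_sf]
  [the {sigma_finite_measure set U -> \bar R} of dtdx_sf] f mf f0).
Qed.

Lemma measurable_Lnorm_dtdx (F : U * U -> \bar R) p : 0 < p -> measurable_fun setT F ->
  measurable_fun setT (fun z => 'N[mu]_p[(fun w => F (z, w))]).
Proof.
move=> p0 mF.
exact: (@measurable_Lnorm _ _ _ _ _ [the {sigma_finite_measure set U -> \bar R} of dtdx_sf] F p p0 mF).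
Qed.

Lemma measurable_integral_dtdx (F : U * U -> \bar R) : measurable_fun setT F -> (forall z, 0 <= F z) ->
  measurable_fun setT (fun z => \int[mu]_w F (z, w)).
Proof.
move=> mF F0.
exact: (@measurable_fun_fubini_tonelli_F _ _ _ _ _ [the {sigma_finite_measure set U -> \bar R} of dtdx_sf] F mF F0).
Qed.

Lemma dtdx_setX (A : set R) (B : set X) : measurable A -> measurable B ->
  mu (A `*` B) = nu A * leb n B.
Proof. by move=> mA mB; exact: product_measure1E. Qed.

Lemma ae_dtdx_gt0 : {ae mu, forall z, (0 < z.1)%R}.
Proof.
have [N [mN N0 PN]] := @ae_dt_t_gt0 R.
exists (N `*` setT); split; first exact: measurableX.
  by apply: etrans (dtdx_setX _ _) _ => //; rewrite N0 mul0e.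
by move=> [s y] /= h; split => //; exact: PN.
Qed.

End dtdx_integrals.

(** * Model integrals in time and in space *)

Section scale_integrals.
Context {R : realType}.
Local Open Scope ereal_scope.
Local Notation nu := (@dt_t R).
Local Notation lam := (@lebesgue_measure R).

Lemma lam_itv_co (a b : R) : (a <= b)%R -> lam `[a, b[ = (b - a)%:E.
Proof.
move=> ab; have := @lebesgue_measure_itv R `[a, b[; rewrite /= lte_fin => ->.
by case: ltgtP ab => // -> _; rewrite subrr.
Qed.

Lemma dt_t_itv_le (A : set R) (a b : R) : measurable A -> (0 < a <= b)%R ->
  A `<=` `[a, b]%classic -> nu A <= ((b - a) / a)%:E.
Proof.
move=> mA /andP[a0 ab] Aab.
apply: (le_trans (@dt_t_le R A a mA a0 _)).
  by move=> s /Aab /=; rewrite !in_itv/= => /andP[->].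
rewrite mulrC EFinM lee_wpmul2l ?lee_fin ?invr_ge0 ?(ltW a0)//.
apply: (@le_trans _ _ (lam `[a, b])).
  by apply: le_measure; rewrite ?inE.
have := @lebesgue_measure_itv R `[a, b]; rewrite /= lte_fin => ->.
by case: ltgtP ab => // -> _; rewrite subrr.
Qed.

(** Powers of s/t are integrable at s = 0 for ds/s, uniformly in t by scaling. *)
Lemma integral_scale_below (b : R) : (0 < b)%R -> exists2 C : R, (0 < C)%R &
  forall t, (0 < t)%R -> \int[nu]_(s in `]0%R, t]) ((s / t) `^ b)%:E <= C%:E.
Proof.
move=> b0; have [|C C0 hC] := @layer_integral R 0 b; first by rewrite add0r.
exists C => // t t0; rewrite -[C]mulr1.
apply: hC => //.
- exact: measurable_funM.
- by move=> s /=; rewrite in_itv/= => /andP[s0 st]; rewrite divr_gt0//= ler_pdivrMr// mul1r.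
move=> k A mA; rewrite powRr0 expr1n mulr1.
have hk : (0 < 2^-1 ^+ k.+1 * t :> R)%R by rewrite mulr_gt0// exprn_gt0// invr_gt0.
apply: (le_trans (@dt_t_itv_le _ (2^-1 ^+ k.+1 * t) (2^-1 ^+ k * t) mA _ _)).
- rewrite hk/= ler_pM2r// exprS ler_piMl ?exprn_ge0 ?invr_ge0//.
  by have /andP[_ /ltW] := @half_itv01 R.
- move=> s [_ /=]; rewrite in_itv/= ltr_pdivlMr// ler_pdivrMr// => /andP[/ltW -> ->].
  by [].
rewrite lee_fin le_eqVlt; apply/orP; left; apply/eqP.
by rewrite exprS; field; rewrite gt_eqF//= gt_eqF// exprn_gt0.
Qed.

Lemma integral_scale_above (b : R) : (0 < b)%R -> exists2 C : R, (0 < C)%R &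
  forall tau, (0 < tau)%R -> \int[nu]_(t in `[tau, +oo[) ((tau / t) `^ b)%:E <= C%:E.
Proof.
move=> b0; have [|C C0 hC] := @layer_integral R 0 b; first by rewrite add0r.
exists C => // tau tau0; rewrite -[C]mulr1.
have XE t : `[tau, +oo[%classic t -> (tau * inv_pos t = tau / t)%R.
  by rewrite /= in_itv/= andbT /inv_pos => /(lt_le_trans tau0) ->.
rewrite (_ : \int[nu]_(t in _) _ = \int[nu]_(t in `[tau, +oo[) ((tau * inv_pos t) `^ b)%:E); last first.
  by apply: eq_integral => t /set_mem/XE ->.
apply: hC => //.
- by apply: measurable_funM => //; exact: measurable_inv_pos.
- move=> t Dt; rewrite XE//; move: Dt; rewrite /= in_itv/= andbT => taut.
  have t0 : (0 < t)%R by exact: lt_le_trans taut.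
  by rewrite divr_gt0//= ler_pdivrMr// mul1r.
move=> k A mA; rewrite powRr0 expr1n mulr1.
have hk : (0 < 2 ^+ k * tau :> R)%R by rewrite mulr_gt0// exprn_gt0.
apply: (le_trans (@dt_t_itv_le _ (2 ^+ k * tau) (2 ^+ k.+1 * tau) mA _ _)).
- by rewrite hk/= ler_pM2r// exprS ler_peMl ?exprn_ge0// ler1n.
- move=> t [Dt /=]; rewrite XE//; move: Dt; rewrite /= !in_itv/= andbT => taut.
  have t0 : (0 < t)%R by exact: lt_le_trans taut.
  rewrite ltr_pdivlMr// ler_pdivrMr// !exprVn => /andP[h1 h2]; apply/andP; split.
    by rewrite -ler_pdivlMl ?exprn_gt0.
  by rewrite -ler_pdivrMl ?exprn_gt0// ltW.
rewrite lee_fin le_eqVlt; apply/orP; left; apply/eqP.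
by rewrite exprS; field; rewrite gt_eqF//= gt_eqF// exprn_gt0.
Qed.

(** On (t/4,t') the measure ds/s is comparable to ds/t, so only the local
    integrability of (t'-s)^b for b > -1 matters. *)
Lemma integral_singularity (b : R) : (-1 < b)%R -> exists2 C : R, (0 < C)%R &
  forall t t' : R, (0 < t)%R -> (t' <= t)%R ->
  \int[nu]_(s in `](t / 4)%R, t'[) (((t' - s) / t) `^ b)%:E <= C%:E.
Proof.
move=> b1; have [|C C0 hC] := @layer_integral R 1 b; first by rewrite addrC -ltrBlDr sub0r.
exists (C * 2)%R; first by rewrite mulr_gt0.
move=> t t' t0 t't.
apply: hC => //.
- by apply: measurable_funM => //; exact: measurable_funB.
- move=> s /=; rewrite in_itv/= => /andP[s0 st].
  rewrite divr_gt0 ?subr_gt0//= ler_pdivrMr// mul1r lerBlDr (le_trans t't)// lerDl.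
  by rewrite (le_trans _ (ltW s0))// divr_ge0// ltW.
move=> k A mA; rewrite powRr1 ?invr_ge0//.
have h0 : (0 < 2^-1 ^+ k :> R)%R by rewrite exprn_gt0// invr_gt0.
apply: (le_trans (@dt_t_le R A (t / 4) mA _ _)); first by rewrite divr_gt0.
  by move=> s [+ _]; rewrite /= !in_itv/= andbT => /andP[/ltW].
apply: (@le_trans _ _ (((t / 4)^-1)%:E * lam `[(t' - 2^-1 ^+ k * t)%R, (t' - 2^-1 ^+ k.+1 * t)%R[)).
  rewrite lee_wpmul2l// ?lee_fin ?invr_ge0 ?divr_ge0 ?(ltW t0)//.
  apply: le_measure; rewrite ?inE//.
  move=> s [_ /=]; rewrite in_itv/= ltr_pdivlMr// ler_pdivrMr// => /andP[h1 h2].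
  by apply/andP; split; lra.
rewrite lam_itv_co; last first.
  rewrite lerD2l lerN2 ler_pM2r// exprS ler_piMl ?exprn_ge0 ?invr_ge0//.
  by have /andP[_ /ltW] := @half_itv01 R.
rewrite -EFinM lee_fin le_eqVlt; apply/orP; left; apply/eqP.
by rewrite exprS; field; rewrite gt_eqF.
Qed.

End scale_integrals.

Section ball_volumes.
Context {R : realType} {n : nat}.
Local Notation X := ('rV[R]_n).
Local Open Scope ereal_scope.

Lemma sqrt_exprn (t : R) : (0 <= t)%R -> (Num.sqrt t ^+ n = t `^ (n%:R / 2))%R.
Proof. by move=> t0; rewrite -powR_mulrn ?sqrtr_ge0// -powR12_sqrt// -powRrM mulrC. Qed.

Lemma leb_eball_sqrt_le (x : X) (c t : R) : (0 < c)%R -> (0 < t)%R ->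
  leb n (eball x (c * Num.sqrt t)) <= ((2 * c) ^+ n * t `^ (n%:R / 2))%:E.
Proof.
move=> c0 t0; apply: (le_trans (leb_eball_le _ _)); first by rewrite mulr_gt0// sqrtr_gt0.
by rewrite mulrA exprMn sqrt_exprn// ltW.
Qed.

Lemma leb_eball_sqrt_ge (x : X) (c t : R) : (0 < n)%N -> (0 < c)%R -> (0 < t)%R ->
  ((2 / n%:R * c) ^+ n * t `^ (n%:R / 2))%:E <= leb n (eball x (c * Num.sqrt t)).
Proof.
move=> n0 c0 t0; apply: (le_trans _ (leb_eball_ge _ n0 _)); last by rewrite mulr_gt0// sqrtr_gt0.
by rewrite [in leRHS]mulrA [in leRHS]exprMn sqrt_exprn// ltW.
Qed.

(** Between 1 and 2 on B(x,sqrt t), then of the order of the squared distance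
    in units of sqrt t. *)
Definition pweight (x : X) (t : R) (y : X) : R := (1 + edist x y ^+ 2 / t)%R.

Lemma pweight_ge1 x t y : (0 < t)%R -> (1 <= pweight x t y)%R.
Proof. by move=> t0; rewrite lerDl divr_ge0 ?sqr_ge0// ltW. Qed.

Lemma pweight_gt0 x t y : (0 < t)%R -> (0 < pweight x t y)%R.
Proof. by move=> t0; apply: lt_le_trans (pweight_ge1 x y t0). Qed.

(** The layer on which the weight is about 2^k lies in a ball of radius
    2^(k/2) sqrt t, which explains the condition b > n/2. *)
Lemma integral_pweight (b : R) : (n%:R / 2 < b)%R -> exists2 C : R, (0 < C)%R &
  forall x t, (0 < t)%R -> \int[leb n]_y (pweight x t y `^ (- b))%:E <= (C * t `^ (n%:R / 2))%:E.
Proof.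
move=> nb; have [|C C0 hC] := @layer_integral R (- (n%:R / 2)) b; first by rewrite addrC subr_gt0.
exists (C * (2 ^+ n * 2 `^ (n%:R / 2)))%R; first by rewrite !mulr_gt0// powR_gt0.
move=> x t t0.
rewrite (_ : \int[_]_y _ = \int[leb n]_(y in setT) ((pweight x t y `^ (-1)) `^ b)%:E); last first.
  by apply: eq_integral => y _; rewrite -powRrM mulN1r.
rewrite -mulrA; apply: hC => //.
- apply: (measurableT_comp (measurable_powR _)).
  apply: measurable_funD => //; apply: measurable_funM => //; apply: measurable_funX.
  by apply: measurable_edist.
- move=> y _; rewrite powR_gt0 ?pweight_gt0//= powR_inv1; last exact/ltW/pweight_gt0.
  by rewrite invf_le1 ?pweight_gt0// pweight_ge1.
- by rewrite !mulr_ge0 ?powR_ge0.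
move=> k A mA.
apply: (@le_trans _ _ (leb n (eball x (1 * Num.sqrt (2 ^+ k.+1 * t))))).
  apply: le_measure; rewrite ?inE//; first exact: measurable_eball.
  move=> y [_ /= /andP[h1 _]]; rewrite /eball/= mul1r.
  rewrite -[ltLHS]ger0_norm ?edist_ge0// -sqrtr_sqr ltr_sqrt ?mulr_gt0 ?exprn_gt0//.
  move: h1; rewrite powR_inv1; last exact/ltW/pweight_gt0.
  rewrite exprVn ltf_pV2 ?posrE ?exprn_gt0 ?pweight_gt0// -ltr_pdivrMr//.
  by apply: le_lt_trans; rewrite lerDr.
apply: (le_trans (leb_eball_sqrt_le _ _ _)) => //; first by rewrite mulr_gt0// exprn_gt0.
rewrite lee_fin le_eqVlt; apply/orP; left; apply/eqP.
rewrite mulr1 exprSr -mulrA powRM ?mulr_ge0 ?exprn_ge0 ?(ltW t0)//.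
rewrite powRM ?(ltW t0)// (powR_exprn _ _ (ler0n _ 2)).
have -> : ((2^-1 : R) `^ (- (n%:R / 2)) = 2 `^ (n%:R / 2))%R.
  by rewrite -powR_inv1// -powRrM mulN1r opprK.
by ring.
Qed.

End ball_volumes.

(** * Compact sets and supports in the half-space *)

Section half_space_topology.
Context {R : realType} {n : nat}.
Local Notation X := ('rV[R]_n).
Local Notation U := (R * 'rV[R]_n)%type.

Lemma continuous_edist (x : X) : continuous (edist x).
Proof.
move=> y; rewrite /edist.
apply: (@continuous_comp _ _ _ (fun y : X => \sum_(i < n) (x ord0 i - y ord0 i) ^+ 2) Num.sqrt).
  elim: (index_enum _) => [|i s ih].
    rewrite (_ : (fun y : X => _) = cst 0); first exact: cst_continuous.
    by apply/funext => z; rewrite big_nil.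
  rewrite (_ : (fun y : X => _) = (fun y : X => (x ord0 i - y ord0 i) ^+ 2) \+
      (fun y : X => \sum_(j <- s) (x ord0 j - y ord0 j) ^+ 2)); last first.
    by apply/funext => z; rewrite big_cons.
  apply: continuousD => //.
  apply: (@continuous_comp _ _ _ (fun y : X => x ord0 i - y ord0 i) (fun a => a ^+ 2)).
    apply: continuousB; first exact: cst_continuous.
    exact: coord_continuous.
  exact: exprn_continuous.
exact: sqrt_continuous.
Qed.

Lemma open_tube (x : X) (a b rho : R) :
  open [set w : U | a < w.1 < b /\ edist x w.2 < rho].
Proof.
rewrite (_ : [set w | _] = ((fst : U -> R) @^-1` `]a, b[%classic) `&`
    ((edist x \o (snd : U -> X)) @^-1` `]-oo, rho[%classic)); last first.
  by apply/seteqP; split => w; rewrite /= !in_itv.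
apply: openI; apply: open_comp; try exact: interval_open.
  by move=> w _; exact: cvg_fst.
by move=> w _; apply: continuous_comp; [exact: cvg_snd|exact: continuous_edist].
Qed.

Lemma measurable_tube (x : X) (a b rho : R) :
  measurable [set w : U | a < w.1 < b /\ edist x w.2 < rho].
Proof.
rewrite (_ : [set w | _] = `]a, b[%classic `*` eball x rho).
  by apply: measurableX => //; exact: measurable_eball.
by apply/seteqP; split => -[s y]; rewrite /= in_itv.
Qed.

HB.instance Definition _ (T1 T2 : ptopologicalType) := Topological.on (T1 * T2)%type.

Lemma compact_subcover (I : choiceType) (E : set U) (D : set I) (F : I -> set U) :
  compact E -> (forall i, D i -> open (F i)) -> (forall z, E z -> exists2 i, D i & F i z) ->
  exists2 s : seq I, (forall i, i \in s -> D i) & forall z, E z -> exists2 i, i \in s & F i z.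
Proof.
move=> cE oF EF; rewrite (@compact_cover U) in cE.
have [|D' sD' ED'] := cE I D F oF; first by move=> z /EF[i Di Fi]; exists i.
exists (finmap.enum_fset D').
  by move=> i iD'; have := sD' i iD'; rewrite inE.
by move=> z /ED'[i /= iD' Fi]; exists i.
Qed.

Lemma nbhs_tube (z : U) (V : set U) : nbhs z V ->
  exists2 e : R, 0 < e & [set w : U | z.1 - e < w.1 < z.1 + e /\ edist z.2 w.2 < e] `<=` V.
Proof.
move=> /nbhs_ballP[e /= e0 zV]; exists e => // w [wz ew]; apply: zV; split => /=.
  by rewrite /ball/= ltr_distlC.
split => // i j; rewrite ord1 /ball/=; apply: le_lt_trans ew; exact: ler_coord_edist.
Qed.

(** A compact set is the intersection, over m, of unions of finitely many
    tubes of size 2^-m centred in it, and tubes are measurable for the product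
    sigma-algebra. *)
Lemma compact_measurable_half_space (E : set U) : compact E -> measurable E.
Proof.
move=> cE.
have clE : closed E by apply: compact_closed => //; exact: norm_hausdorff.
pose F (m : nat) (p : U) := [set w : U | p.1 - 2^-1 ^+ m < w.1 < p.1 + 2^-1 ^+ m /\ edist p.2 w.2 < 2^-1 ^+ m].
have Hm m : exists s : seq U, (forall i, i \in s -> E i) /\ forall z, E z -> exists2 i, i \in s & F m i z.
  have [||s s1 s2] := @compact_subcover U E E (F m) cE; first by move=> p _; exact: open_tube.
    move=> z Ez; exists z => //; rewrite /F/= edistxx.
    have h0 : 0 < 2^-1 ^+ m :> R by rewrite exprn_gt0// invr_gt0.
    by split => //; apply/andP; split; lra.
  by exists s.
have [s sP] := choice Hm.
rewrite (_ : E = \bigcap_m (\bigcup_(p in [set` s m]) F m p)).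
  apply: bigcapT_measurable => m; apply: fin_bigcup_measurable => //.
  by move=> p _; exact: measurable_tube.
apply/seteqP; split=> z.
  by move=> Ez m _; have [_ /(_ z Ez)[p ps Fp]] := sP m; exists p.
move=> h; apply: clE => V /nbhs_tube[e e0 eV].
have [m me] : exists m, 2^-1 ^+ m < e :> R.
  have : 2^-1 ^+ k @[k --> \oo] --> (0 : R).
    by apply: cvg_expr; rewrite ger0_norm ?invr_ge0// invf_lt1// ltr1n.
  by move/cvgr_lt => /(_ e e0)[k _ hk]; exists k; apply: hk => /=.
have [p /= ps [/andP[p1 p2] pz]] := h m I.
exists p; split; first by have [+ _] := sP m; apply.
apply: eV; split; first by apply/andP; split; lra.
by rewrite edistC (lt_trans pz).
Qed.

(** An exhaustion of the half-space by compact sets; the dyadic sizes will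
    make the contribution of the l-th shell decay geometrically in l. *)
Definition box (l : nat) : set U :=
  [set w | 2^-1 ^+ l <= w.1 <= 2 ^+ l /\ edist 0 w.2 <= 2 ^+ l].

Lemma box_gt0 l w : box l w -> 0 < w.1.
Proof. by move=> [/andP[+ _] _]; apply: lt_le_trans; rewrite exprn_gt0// invr_gt0. Qed.

Lemma le_half_exp (l m : nat) : (l <= m)%N -> 2^-1 ^+ m <= 2^-1 ^+ l :> R.
Proof. by move=> lm; apply: ler_wiXn2l => //; rewrite ?invr_ge0// invf_le1// ler1n. Qed.

Lemma box_mono l m : (l <= m)%N -> box l `<=` box m.
Proof.
move=> lm w [/andP[w1 w2] w3]; split.
  rewrite (le_trans (le_half_exp lm))//= (le_trans w2)//.
  by rewrite ler_weXn2l// ler1n.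
by rewrite (le_trans w3)// ler_weXn2l// ler1n.
Qed.

Lemma measurable_box l : measurable (box l).
Proof.
rewrite (_ : box l = `[2^-1 ^+ l, 2 ^+ l]%classic `*` [set y | edist 0 y <= 2 ^+ l]).
  apply: measurableX => //.
  rewrite -[X in measurable X]setTI.
  rewrite (_ : [set y | _] = (edist 0) @^-1` `]-oo, (2 ^+ l)]%classic).
    by apply: measurable_edist.
  by apply/seteqP; split => y; rewrite /= in_itv.
by apply/seteqP; split => -[s y]; rewrite /= in_itv.
Qed.

Lemma compact_box l : compact (box l).
Proof.
apply: (@subclosed_compact _ _ ((`[2^-1 ^+ l, 2 ^+ l]%classic `*`
    [set v : X | forall i, `[- (2 ^+ l), 2 ^+ l]%classic (v ord0 i)]) : set U)).
- rewrite (_ : box l = ((fst : U -> R) @^-1` `[2^-1 ^+ l, 2 ^+ l]%classic) `&`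
    ((edist 0 \o (snd : U -> X)) @^-1` `]-oo, (2 ^+ l)]%classic)); last first.
    by apply/seteqP; split => w; rewrite /= !in_itv.
  apply: closedI; apply: closed_comp; try exact: interval_closed.
    by move=> w _; exact: cvg_fst.
  by move=> w _; apply: continuous_comp; [exact: cvg_snd|exact: continuous_edist].
- apply: compact_setX; first exact: segment_compact.
  have h := @rV_compact R n (fun=> `[- (2 ^+ l), 2 ^+ l]%classic).
  by apply: h => i; exact: segment_compact.
move=> w [w1 w2]; split => /=; first by rewrite in_itv.
move=> i; rewrite in_itv/= -ler_norml.
apply: le_trans w2; have := ler_coord_edist 0 w.2 i.
by rewrite mxE sub0r normrN.
Qed.

Definition open_box (l : nat) : set U :=
  [set w : U | 2^-1 ^+ l < w.1 < 2 ^+ l /\ edist 0 w.2 < 2 ^+ l].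

Lemma open_box_sub l : open_box l `<=` box l.
Proof. by move=> w [/andP[/ltW w1 /ltW w2] /ltW w3]; split => //; rewrite w1. Qed.

Lemma open_box_mono l m : (l <= m)%N -> open_box l `<=` open_box m.
Proof.
move=> lm w [/andP[w1 w2] w3]; split.
  rewrite (le_lt_trans (le_half_exp lm))//= (lt_le_trans w2)//.
  by rewrite ler_weXn2l// ler1n.
by rewrite (lt_le_trans w3)// ler_weXn2l// ler1n.
Qed.

Lemma open_box_exhaust (w : U) : 0 < w.1 -> exists l, open_box l w.
Proof.
move=> w0.
have cv : 2^-1 ^+ k @[k --> \oo] --> (0 : R).
  by apply: cvg_expr; rewrite ger0_norm ?invr_ge0// invf_lt1// ltr1n.
have small (e : R) : 0 < e -> \forall k \near \oo, 2^-1 ^+ k < e by move: cv => /cvgr_lt; apply.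
have large (a : R) : 0 <= a -> \forall k \near \oo, a < 2 ^+ k.
  move=> a0; have a1 : 0 < (a + 1)^-1 by rewrite invr_gt0 ltr_pwDr.
  apply: filterS (small _ a1) => k; rewrite exprVn ltf_pV2 ?posrE ?exprn_gt0 ?ltr_pwDr//.
  by apply: lt_trans; rewrite ltrDl.
have h1 := small _ w0; have h2 := large _ (ltW w0); have h3 := large _ (edist_ge0 0 w.2).
have [l _ /(_ l (leqnn _))[[l1 l2] l3]] := filterI (filterI h1 h2) h3.
by exists l; split => //; rewrite l1.
Qed.

Lemma compact_sub_open_box (E : set U) : compact E -> (forall w, E w -> 0 < w.1) ->
  exists l, E `<=` open_box l.
Proof.
move=> cE E0.
have [||s _ sE] := @compact_subcover nat E setT open_box cE.
- by move=> l _; exact: open_tube.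
- by move=> z /E0/open_box_exhaust[l ?]; exists l.
exists (\max_(l <- s) l) => z /sE[l ls]; apply: open_box_mono.
exact: (@leq_bigmax_seq _ _ xpredT id).
Qed.

Lemma closed_box l : closed (box l).
Proof. by apply: compact_closed; [exact: norm_hausdorff|exact: compact_box]. Qed.

Lemma not_ess_supp (f : U -> R[i]) (V : set U) z : nbhs z V -> (forall w, V w -> f w = 0) ->
  ~ ess_supp f z.
Proof. by move=> zV f0 [_ /(_ V zV)]; apply; exact: aeW. Qed.

(** The box is closed, so points off it have neighbourhoods on which f
    vanishes. *)
Lemma compact_ess_supp (f : U -> R[i]) l : (forall w, ~ box l w -> f w = 0) ->
  compact (ess_supp f).
Proof.
move=> f0.
have sub : ess_supp f `<=` box l.
  move=> z fz; apply: contrapT => nz; apply: (@not_ess_supp f (~` box l) z) fz => //.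
  by apply: open_nbhs_nbhs; split => //; exact/closed_openC/closed_box.
apply: (subclosed_compact _ (@compact_box l)) => //.
move=> z clz; have bz : box l z by apply: closed_box => V /clz[w [/sub ? ?]]; exists w.
split; first exact: box_gt0 bz.
move=> V; rewrite nbhsE => -[G [oG Gz] GV] fV.
have [w [[_ fw] Gw]] := clz G (open_nbhs_nbhs (conj oG Gz)).
by apply: (fw V) fV; rewrite nbhsE; exists G.
Qed.

(** Points off the support have neighbourhoods on which f vanishes almost
    everywhere. Countably many suffice: finitely many for each compact
    difference of a box and a fixed open box that contains the support. *)
Lemma ae_zero_off_box (f : U -> R[i]) : compact (ess_supp f) ->
  exists l, {ae dtdx, forall w, ~ box l w -> f w = 0}.
Proof.
move=> /compact_sub_open_box[|l fl]; first by move=> w [].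
exists l.
have h m : {ae dtdx, forall w, (box m `\` open_box l) w -> f w = 0}.
  have cK : compact (box m `\` open_box l).
    apply: (subclosed_compact _ (@compact_box m)); last by move=> w [].
    apply: closedI; first exact: closed_box.
    by apply: open_closedC; exact: open_tube.
  pose D := [set V : set U | open V /\ {ae dtdx, forall w, V w -> f w = 0}].
  have [||s sD sE] := @compact_subcover _ _ D id cK.
  - by move=> V [].
  - move=> z [bz oz]; have : ~ ess_supp f z by move=> /fl.
    move=> /not_andP[|]; first by have := box_gt0 bz.
    move=> /existsNP[V /not_implyP[zV /contrapT fV]].
    move: zV; rewrite nbhsE => -[G [oG Gz] GV]; exists G => //; split => //.
    by apply: filterS fV => w + /GV.
  have : {ae dtdx, forall w, forall V, V \in s -> V w -> f w = 0}.
    elim: s sD {sE} => [_|V s ih sD]; first by apply: aeW => w V; rewrite in_nil.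
    have [_ hV] : D V by apply: sD; rewrite mem_head.
    have := ih (fun i si => sD i (mem_behead (s:=V :: s) si)).
    apply: filterS2 hV => w hV hs V'; rewrite in_cons => /orP[/eqP ->//|]; exact: hs.
  by apply: filterS => w hw /sE[V Vs]; exact: hw.
have := ae_foralln (fun m => h m).
apply: filterS2 ae_dtdx_gt0 => w w0 hw nb.
have [m bm] := open_box_exhaust w0.
apply: (hw m); split; first exact: open_box_sub.
by move=> /open_box_sub.
Qed.

End half_space_topology.

(** * Whitney regions, weights and local means *)

Section whitney_weights.
Context {R : realType} {n : nat}.
Local Notation X := ('rV[R]_n).
Local Notation U := (R * 'rV[R]_n)%type.
Local Notation nu := (@dt_t R).
Local Notation mu := (@dtdx R n).

(** The Whitney region [t/2,t] x B(x,sqrt t) of z = (t,x). *)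
Definition in_whitney (z w : U) : bool :=
  [&& z.1 / 2 <= w.1, w.1 <= z.1 & edist z.2 w.2 < Num.sqrt z.1].

(** The enlarged region (t/4,t] x B(x,4 sqrt t). A point outside it and not
    later than t is separated from the Whitney region in time or in space;
    times after t are left out, which keeps the estimates causal. *)
Definition in_enlarged (z w : U) : bool :=
  [&& z.1 / 4 < w.1, w.1 <= z.1 & edist z.2 w.2 < 4 * Num.sqrt z.1].

(** Decay in time before t and in space, as it remains of the kernel of S
    after integration; zero at times after t. *)
Definition far_weight (eta b : R) (z w : U) : R :=
  if [&& 0 < w.1 & w.1 <= z.1] then (w.1 / z.1) `^ eta * pweight z.2 z.1 w.2 `^ (- b) else 0.

(** The kernel (s/t)^eta t^(-n/2) (1+|x-y|^2/t)^-b for dy ds/s. Times s up to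
    2t are allowed because the kernel will be applied to functions of the base
    point of a Whitney region, and that point may be later than the points of
    the region. *)
Definition schur_kernel (eta b : R) (z w : U) : R :=
  if [&& 0 < z.1, 0 < w.1 & w.1 <= 2 * z.1] then
    (w.1 / z.1) `^ eta * z.1 `^ (- (n%:R / 2)) * pweight z.2 z.1 w.2 `^ (- b) else 0.

Lemma measurable_bool d (T : measurableType d) (f : T -> bool) :
  measurable_fun setT f -> measurable_fun setT (fun x => (f x)%:R : R).
Proof.
move=> mf; rewrite (_ : (fun x => _) = (fun x => if f x then 1 else 0)).
  by apply: measurable_fun_ifT.
by apply/funext => x; case: (f x).
Qed.

Section measurability.
Context d (T : measurableType d) (f g : T -> U).
Hypotheses (mf : measurable_fun setT f) (mg : measurable_fun setT g).

Lemma measurable_fst_comp (h : T -> U) : measurable_fun setT h -> measurable_fun setT (fun x => (h x).1).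
Proof. by move=> mh; exact: (measurableT_comp (@measurable_fst _ _ R X) mh). Qed.

Lemma measurable_snd_comp (h : T -> U) : measurable_fun setT h -> measurable_fun setT (fun x => (h x).2).
Proof. by move=> mh; exact: (measurableT_comp (@measurable_snd _ _ R X) mh). Qed.

Let mf1 := measurable_fst_comp mf.
Let mg1 := measurable_fst_comp mg.
Let mfg : measurable_fun setT (fun x => edist (f x).2 (g x).2).
Proof. by apply: measurable_edist; exact: measurable_snd_comp. Qed.

Lemma measurable_sqrt_comp (h : T -> R) : measurable_fun setT h ->
  measurable_fun setT (fun x => Num.sqrt (h x)).
Proof.
move=> mh; rewrite (_ : (fun x => _) = (Num.sqrt \o h))//.
apply: measurableT_comp mh; apply: continuous_measurable_fun.
exact: sqrt_continuous.
Qed.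

Lemma measurable_inv_comp (h : T -> R) : measurable_fun setT h ->
  measurable_fun setT (fun x => if 0 < h x then (h x)^-1 else 0).
Proof. by move=> mh; exact: (measurableT_comp (@measurable_inv_pos R) mh). Qed.

Lemma measurable_in_whitney : measurable_fun setT (fun x => (in_whitney (f x) (g x))%:R : R).
Proof.
apply: measurable_bool; apply: measurable_and; first by apply: measurable_fun_ler => //; exact: measurable_funM.
apply: measurable_and; first exact: measurable_fun_ler.
by apply: measurable_fun_ltr => //; exact: measurable_sqrt_comp.
Qed.

Lemma measurable_in_enlarged : measurable_fun setT (fun x => (in_enlarged (f x) (g x))%:R : R).
Proof.
apply: measurable_bool; apply: measurable_and; first by apply: measurable_fun_ltr => //; exact: measurable_funM.
apply: measurable_and; first exact: measurable_fun_ler.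
apply: measurable_fun_ltr => //; apply: measurable_funM => //; exact: measurable_sqrt_comp.
Qed.

Let mpow (a : R) (h : T -> R) : measurable_fun setT h -> measurable_fun setT (fun x => h x `^ a).
Proof. by move=> mh; exact: (measurableT_comp (measurable_powR _) mh). Qed.

Let mpw (b : R) : measurable_fun setT (fun x => (1 + edist (f x).2 (g x).2 ^+ 2 * inv_pos (f x).1) `^ b).
Proof.
apply: mpow; apply: measurable_funD => //; apply: measurable_funM; first exact: measurable_funX.
exact: (measurableT_comp (@measurable_inv_pos R) mf1).
Qed.

Lemma measurable_far_weight eta b : measurable_fun setT (fun x => far_weight eta b (f x) (g x)).
Proof.
rewrite (_ : (fun x => _) = (fun x => if [&& 0 < (g x).1 & (g x).1 <= (f x).1] then
   ((g x).1 * inv_pos (f x).1) `^ eta *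
   (1 + edist (f x).2 (g x).2 ^+ 2 * inv_pos (f x).1) `^ (- b) else 0)); last first.
  apply/funext => x; rewrite /far_weight; case: ifPn => // /andP[g0 gf].
  by rewrite /pweight /inv_pos (lt_le_trans g0 gf).
apply: measurable_fun_ifT => //.
  by apply: measurable_and; [exact: measurable_fun_ltr|exact: measurable_fun_ler].
apply: measurable_funM => //; apply: mpow; apply: measurable_funM => //.
exact: (measurableT_comp (@measurable_inv_pos R) mf1).
Qed.

Lemma measurable_schur_kernel eta b : measurable_fun setT (fun x => schur_kernel eta b (f x) (g x)).
Proof.
rewrite (_ : (fun x => _) = (fun x => if [&& 0 < (f x).1, 0 < (g x).1 & (g x).1 <= 2 * (f x).1] then
   ((g x).1 * inv_pos (f x).1) `^ eta * (f x).1 `^ (- (n%:R / 2)) *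
   (1 + edist (f x).2 (g x).2 ^+ 2 * inv_pos (f x).1) `^ (- b) else 0)); last first.
  apply/funext => x; rewrite /schur_kernel; case: ifPn => // /and3P[f0 g0 gf].
  by rewrite /pweight /inv_pos f0.
apply: measurable_fun_ifT => //.
  apply: measurable_and; first exact: measurable_fun_ltr.
  apply: measurable_and; first exact: measurable_fun_ltr.
  by apply: measurable_fun_ler => //; exact: measurable_funM.
apply: measurable_funM => //; apply: measurable_funM; last exact: mpow.
apply: mpow; apply: measurable_funM => //.
exact: (measurableT_comp (@measurable_inv_pos R) mf1).
Qed.

End measurability.

Lemma far_weight_ge0 eta b z w : 0 <= far_weight eta b z w.
Proof. by rewrite /far_weight; case: ifPn => // _; rewrite mulr_ge0 ?powR_ge0. Qed.

Lemma schur_kernel_ge0 eta b z w : 0 <= schur_kernel eta b z w.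
Proof. by rewrite /schur_kernel; case: ifPn => // _; rewrite !mulr_ge0 ?powR_ge0. Qed.

Local Open Scope ereal_scope.

Lemma measurable_tube_cc (a b c : R) (x : X) : measurable (`[a, b]%classic `*` eball x c : set U).
Proof. by apply: measurableX => //; exact: measurable_eball. Qed.

Lemma dtdx_tube_le (a b c t : R) (x : X) : (0 < a <= b)%R -> (0 < c)%R -> (0 < t)%R ->
  mu (`[a, b]%classic `*` eball x (c * Num.sqrt t)) <=
  ((b - a) / a * ((2 * c) ^+ n * t `^ (n%:R / 2)))%:E.
Proof.
move=> ab c0 t0; rewrite dtdx_setX//; last exact: measurable_eball.
rewrite EFinM; apply: lee_pmul => //.
- exact: dt_t_itv_le.
- exact: leb_eball_sqrt_le.
Qed.

Lemma dtdx_tube_ge (a b c t : R) (x : X) : (0 < n)%N -> (0 < a < b)%R -> (0 < c)%R -> (0 < t)%R ->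
  ((b - a) / b * ((2 / n%:R * c) ^+ n * t `^ (n%:R / 2)))%:E <=
  mu (`[a, b]%classic `*` eball x (c * Num.sqrt t)).
Proof.
move=> n0 /andP[a0 ab] c0 t0; rewrite dtdx_setX//; last exact: measurable_eball.
have b0 : (0 < b)%R by exact: lt_trans ab.
rewrite EFinM; apply: lee_pmul => //.
- by rewrite lee_fin divr_ge0 ?subr_ge0 ?(ltW ab) ?(ltW b0).
- by rewrite lee_fin mulr_ge0 ?powR_ge0 ?exprn_ge0// mulr_ge0 ?divr_ge0// ltW.
- by apply: dt_t_itv_ge; rewrite a0.
- exact: leb_eball_sqrt_ge.
Qed.

(** Space is integrated first and produces t^(n/2), which the factor t^(-n/2)
    cancels; then (s/t)^eta is integrable for ds/s. *)
Lemma schur_right (eta b : R) : (0 < eta)%R -> (n%:R / 2 < b)%R -> exists2 C : R, (0 < C)%R &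
  forall z, (0 < z.1)%R -> \int[mu]_w (schur_kernel eta b z w)%:E <= C%:E.
Proof.
move=> e0 b0; have [C1 C10 h1] := @integral_scale_below R eta e0.
have [C2 C20 h2] := @integral_pweight R n b b0.
exists (2 `^ eta * C1 * C2)%R; first by rewrite !mulr_gt0// powR_gt0.
move=> [t x]/= t0.
have mk : measurable_fun setT (fun w : U => (schur_kernel eta b (t, x) w)%:E).
  by apply/measurable_EFinP; apply: measurable_schur_kernel.
rewrite integral_dtdx//; last by move=> w; rewrite lee_fin schur_kernel_ge0.
pose D := `]0%R, (2 * t)%R]%classic : set R.
have mD : measurable D by exact: measurable_itv.
pose c s : R := (2 `^ eta * (s / (2 * t)) `^ eta * t `^ (- (n%:R / 2)))%R.
have c0 s : (0 <= c s)%R by rewrite !mulr_ge0 ?powR_ge0.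
have mc : measurable_fun setT c.
  apply: measurable_funM => //; apply: measurable_funM => //.
  by apply: (measurableT_comp (measurable_powR _)); exact: measurable_funM.
have ktE s y : (schur_kernel eta b (t, x) (s, y) = c s * \1_D s * pweight x t y `^ (- b))%R.
  rewrite /schur_kernel /= t0/= indicE; have [Ds|nDs] := boolP (s \in D).
    move/set_mem : Ds; rewrite /D/= in_itv/= => /andP[s0 st]; rewrite s0 st/= mulr1 /c.
    congr (_ * _ * _)%R; rewrite -powRM ?divr_ge0 ?mulr_ge0 ?(ltW t0) ?(ltW s0)//.
    by congr (_ `^ _)%R; field; rewrite gt_eqF.
  rewrite mulr0 mul0r; case: ifPn => // /andP[s0 st].
  by move: nDs; rewrite notin_setE /D/= in_itv/= s0 st.
apply: (@le_trans _ _ (\int[nu]_s ((c s * \1_D s)%:E * (C2 * t `^ (n%:R / 2))%:E))).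
  apply: ge0_le_integral => //.
  - by move=> s _; apply: integral_ge0 => y _; rewrite lee_fin schur_kernel_ge0.
  - apply: (@measurable_fun_fubini_tonelli_F _ _ _ _ _ (leb n) (fun w : U => (schur_kernel eta b (t, x) w)%:E)) => //.
    by move=> w; rewrite lee_fin schur_kernel_ge0.
  - apply: emeasurable_funM; last exact: measurable_cst.
    by apply/measurable_EFinP; apply: measurable_funM => //; exact: measurable_indic.
  move=> s _; under eq_integral do rewrite ktE EFinM.
  rewrite ge0_integralZl_EFin//.
  - by apply: lee_wpmul2l; [rewrite lee_fin mulr_ge0|exact: h2].
  - by move=> y _; rewrite lee_fin powR_ge0.
  - apply/measurable_EFinP; apply: (measurableT_comp (measurable_powR _)).
    by apply: measurable_funD => //; apply: measurable_funM => //; apply: measurable_funX; apply: measurable_edist.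
  - by rewrite mulr_ge0.
rewrite (_ : \int[_]_s _ = (2 `^ eta * C2)%:E * \int[nu]_(s in D) ((s / (2 * t)) `^ eta)%:E).
  rewrite (_ : (2 `^ eta * C1 * C2)%:E = (2 `^ eta * C2)%:E * C1%:E); last by rewrite -EFinM mulrAC.
  apply: lee_wpmul2l; first by rewrite lee_fin mulr_ge0 ?powR_ge0// ltW.
  by apply: h1; rewrite mulr_gt0.
rewrite [in RHS]integral_mkcond -ge0_integralZl_EFin//.
- apply: eq_integral => s _; rewrite /patch indicE; case: ifPn => _.
    rewrite -!EFinM; congr (_%:E); rewrite /c mulr1.
    have -> : (t `^ (- (n%:R / 2)) = (t `^ (n%:R / 2))^-1)%R by rewrite powRN.
    by field; rewrite gt_eqF// powR_gt0.
  by rewrite mulr0 mul0e mule0.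
- by move=> s _; rewrite /patch; case: ifP => // _; rewrite lee_fin powR_ge0.
- apply/(measurable_restrictT _ _).1 => //; apply: measurable_funTS; apply/measurable_EFinP.
  by apply: (measurableT_comp (measurable_powR _)); exact: measurable_funM.
- by rewrite mulr_ge0 ?powR_ge0// ltW.
Qed.

Lemma pweightC (x : X) (t : R) (y : X) : pweight x t y = pweight y t x.
Proof. by rewrite /pweight edistC. Qed.

(** The same computation in z: now t ranges over [s/2,oo), where (s/t)^eta is
    integrable for dt/t. *)
Lemma schur_left (eta b : R) : (0 < eta)%R -> (n%:R / 2 < b)%R -> exists2 C : R, (0 < C)%R &
  forall w, (0 < w.1)%R -> \int[mu]_z (schur_kernel eta b z w)%:E <= C%:E.
Proof.
move=> e0 b0; have [C1 C10 h1] := @integral_scale_above R eta e0.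
have [C2 C20 h2] := @integral_pweight R n b b0.
exists (2 `^ eta * C1 * C2)%R; first by rewrite !mulr_gt0// powR_gt0.
move=> [s y]/= s0.
have mk : measurable_fun setT (fun z : U => (schur_kernel eta b z (s, y))%:E).
  by apply/measurable_EFinP; apply: measurable_schur_kernel.
rewrite integral_dtdx//; last by move=> w; rewrite lee_fin schur_kernel_ge0.
pose D := `[(s / 2)%R, +oo[%classic : set R.
have mD : measurable D by exact: measurable_itv.
pose c t : R := (2 `^ eta * (s / 2 * inv_pos t) `^ eta * t `^ (- (n%:R / 2)))%R.
have c0 t : (0 <= c t)%R by rewrite !mulr_ge0 ?powR_ge0.
have mc : measurable_fun setT c.
  apply: measurable_funM => //.
  by apply: measurable_funM => //; apply: (measurableT_comp (measurable_powR _));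
    apply: measurable_funM => //; exact: measurable_inv_pos.
have D0 t : D t -> (0 < t)%R.
  by rewrite /D/= in_itv/= andbT; apply: lt_le_trans; rewrite divr_gt0.
have ktE t x : (schur_kernel eta b (t, x) (s, y) = c t * \1_D t * pweight y t x `^ (- b))%R.
  rewrite /schur_kernel /= s0/= indicE; have [Dt|nDt] := boolP (t \in D).
    move/set_mem : Dt => /[dup] /D0 t0; rewrite /D/= in_itv/= andbT => st.
    rewrite t0/= (_ : (s <= 2 * t)%R); last by rewrite mulrC -ler_pdivrMr.
    rewrite mulr1 /c /inv_pos t0 pweightC.
    congr (_ * _ * _)%R; rewrite -powRM ?mulr_ge0 ?divr_ge0 ?invr_ge0 ?(ltW t0) ?(ltW s0)//.
    by congr (_ `^ _)%R; field; rewrite gt_eqF.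
  rewrite mulr0 mul0r; case: ifPn => // /andP[t0 st].
  by move: nDt; rewrite notin_setE /D/= in_itv/= andbT ler_pdivrMr// mulrC st.
apply: (@le_trans _ _ (\int[nu]_t ((c t * \1_D t)%:E * (C2 * t `^ (n%:R / 2))%:E))).
  apply: ge0_le_integral => //.
  - by move=> t _; apply: integral_ge0 => x _; rewrite lee_fin schur_kernel_ge0.
  - apply: (@measurable_fun_fubini_tonelli_F _ _ _ _ _ (leb n) (fun z : U => (schur_kernel eta b z (s, y))%:E)) => //.
    by move=> w; rewrite lee_fin schur_kernel_ge0.
  - by apply: emeasurable_funM => //; apply/measurable_EFinP; apply: measurable_funM => //; exact: measurable_indic.
  move=> t _; have [t0|t0] := ltP 0%R t; last first.
    rewrite (_ : \int[_]_ _ _ = 0).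
      by rewrite -EFinM lee_fin !mulr_ge0 ?powR_ge0// ltW.
    apply: integral0_eq => x _; rewrite ktE indicE memNset ?mulr0 ?mul0r//.
    by move=> /D0; rewrite ltNge t0.
  under eq_integral do rewrite ktE EFinM.
  rewrite ge0_integralZl_EFin//.
  - by apply: lee_wpmul2l; [rewrite lee_fin mulr_ge0|exact: h2].
  - by move=> x _; rewrite lee_fin powR_ge0.
  - apply/measurable_EFinP; apply: (measurableT_comp (measurable_powR _)).
    by apply: measurable_funD => //; apply: measurable_funM => //; apply: measurable_funX; apply: measurable_edist.
  - by rewrite mulr_ge0.
rewrite (_ : \int[_]_t _ = (2 `^ eta * C2)%:E * \int[nu]_(t in D) ((s / 2 / t) `^ eta)%:E).
  rewrite (_ : (2 `^ eta * C1 * C2)%:E = (2 `^ eta * C2)%:E * C1%:E); last by rewrite -EFinM mulrAC.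
  apply: lee_wpmul2l; first by rewrite lee_fin mulr_ge0 ?powR_ge0// ltW.
  by apply: h1; rewrite divr_gt0.
rewrite (_ : \int[nu]_(t in D) _ = \int[nu]_(t in D) ((s / 2 * inv_pos t) `^ eta)%:E); last first.
  by apply: eq_integral => t /set_mem/D0 t0; rewrite /inv_pos t0.
rewrite [in RHS]integral_mkcond -ge0_integralZl_EFin//.
- apply: eq_integral => t _; rewrite /patch indicE; case: ifPn => [/set_mem/D0 t0|_].
    rewrite -!EFinM; congr (_%:E); rewrite /c mulr1.
    have -> : (t `^ (- (n%:R / 2)) = (t `^ (n%:R / 2))^-1)%R by rewrite powRN.
    by field; rewrite gt_eqF// powR_gt0.
  by rewrite mulr0 mul0e mule0.
- by move=> t _; rewrite /patch; case: ifP => // _; rewrite lee_fin powR_ge0.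
- apply/(measurable_restrictT _ _).1 => //; apply: measurable_funTS; apply/measurable_EFinP.
  apply: (measurableT_comp (measurable_powR _)); apply: measurable_funM => //.
  exact: measurable_inv_pos.
- by rewrite mulr_ge0 ?powR_ge0// ltW.
Qed.

(** The factor z.1^(-n/(2p)) makes this a mean when g z is carried by a region
    of volume comparable to z.1^(n/2). *)
Definition wmean (p : \bar R) (g : U -> U -> R) (v : U -> R) (z : U) : \bar R :=
  (z.1 `^ (- (n%:R / 2 * einv p)))%:E * 'N[mu]_p[(fun w => (g z w * v w)%:E)].

Definition whitney_ind (z w : U) : R := (in_whitney z w)%:R.
Definition enlarged_ind (z w : U) : R := (in_enlarged z w)%:R.

Lemma whitney_ind_ge0 z w : (0 <= whitney_ind z w)%R. Proof. exact: ler0n. Qed.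
Lemma enlarged_ind_ge0 z w : (0 <= enlarged_ind z w)%R. Proof. exact: ler0n. Qed.

Lemma wmean_ge0 p g v z : 0 <= wmean p g v z.
Proof. by rewrite mule_ge0 ?Lnorm_ge0// lee_fin powR_ge0. Qed.

Section measurable_wmean.
Variable g : U -> U -> R.
Hypothesis mg : measurable_fun setT (fun zw : U * U => g zw.1 zw.2).
Variable v : U -> R.
Hypothesis mv : measurable_fun setT v.

Let mgv : measurable_fun setT (fun zw : U * U => (g zw.1 zw.2 * v zw.2)%:E).
Proof.
apply/measurable_EFinP; apply: measurable_funM => //.
by apply: (measurableT_comp mv).
Qed.

Lemma measurable_weight z : measurable_fun setT (fun w => (g z w * v w)%:E).
Proof. exact: (measurable_fun_pair1 z mgv). Qed.

Lemma measurable_wmean p : 0 < p -> measurable_fun setT (wmean p g v).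
Proof.
move=> p0; apply: emeasurable_funM; last exact: (measurable_Lnorm_dtdx p0 mgv).
apply/measurable_EFinP; apply: (measurableT_comp (measurable_powR _)).
exact: measurable_fst_comp.
Qed.

End measurable_wmean.

Lemma measurable_whitney_ind : measurable_fun setT (fun zw : U * U => whitney_ind zw.1 zw.2).
Proof. by apply: measurable_in_whitney. Qed.
Lemma measurable_enlarged_ind : measurable_fun setT (fun zw : U * U => enlarged_ind zw.1 zw.2).
Proof. by apply: measurable_in_enlarged. Qed.
Lemma measurable_far_weight2 eta b : measurable_fun setT (fun zw : U * U => far_weight eta b zw.1 zw.2).
Proof. by apply: measurable_far_weight. Qed.

Lemma in_whitney_setE z : [set w | in_whitney z w] = `[(z.1 / 2)%R, z.1]%classic `*` eball z.2 (1 * Num.sqrt z.1).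
Proof.
apply/seteqP; split => -[s y] /=; rewrite /in_whitney/= in_itv/= /eball/= mul1r.
  by move=> /and3P[-> -> ->].
by move=> [/andP[-> ->] ->].
Qed.

Lemma measurable_whitney z : measurable [set w | in_whitney z w].
Proof. by rewrite in_whitney_setE; apply: measurable_tube_cc. Qed.

Lemma dtdx_whitney_le z : (0 < z.1)%R -> mu [set w | in_whitney z w] <= (2 ^+ n * z.1 `^ (n%:R / 2))%:E.
Proof.
move=> z0; rewrite in_whitney_setE; apply: (le_trans (dtdx_tube_le _ _ _ _)) => //.
  by rewrite divr_gt0//= ler_pdivrMr// ler_peMr ?ler1n// ltW.
rewrite lee_fin mulr1 (_ : (z.1 - z.1 / 2) / (z.1 / 2) = 1)%R ?mul1r//.
by field; rewrite gt_eqF.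
Qed.

(** Jensen's inequality on the Whitney region, whose volume compensates the
    two normalizations. *)
Lemma wmean_le (a : R) (q : \bar R) : (0 < a)%R -> a%:E <= q -> exists2 C : R, (0 < C)%R &
  forall (v : U -> R) z, measurable_fun setT v -> (forall w, 0 <= v w)%R -> (0 < z.1)%R ->
  wmean a%:E whitney_ind v z <= C%:E * wmean q whitney_ind v z.
Proof.
move=> a0 aq.
have q0 : 0 < q by rewrite (lt_le_trans _ aq)// lte_fin.
pose m : R := (2 ^+ n)%R; have m0 : (0 < m)%R by rewrite exprn_gt0.
exists (m `^ (a^-1 - einv q))%R; first exact: powR_gt0.
move=> v z mv v0 z0.
pose t2 := (z.1 `^ (n%:R / 2))%R; have t20 : (0 < t2)%R by exact: powR_gt0.
have mW := measurable_weight measurable_whitney_ind mv z.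
have gv0 w : (0 <= whitney_ind z w * v w)%R by rewrite mulr_ge0 ?whitney_ind_ge0.
have mgW : measurable_fun setT (whitney_ind z).
  by have := measurable_fun_pair1 z measurable_whitney_ind.
have igW : \int[mu]_w (whitney_ind z w)%:E <= (m * t2)%:E.
  rewrite (_ : \int[mu]_w _ = \int[mu]_w (\1_[set w | in_whitney z w] w)%:E).
    by rewrite integral_indic//= ?setIT; [exact: dtdx_whitney_le|exact: measurable_whitney].
  by apply: eq_integral => w _; rewrite indicE /whitney_ind; case: (boolP (in_whitney z w)) => h; [rewrite mem_set|rewrite memNset//; exact/negP].
have key : 'N[mu]_a%:E[(fun w => (whitney_ind z w * v w)%:E)] <=
    ((m * t2) `^ (a^-1 - einv q))%:E * 'N[mu]_q[(fun w => (whitney_ind z w * v w)%:E)].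
  rewrite Lnorm_le_integral//; last by rewrite mule_ge0 ?Lnorm_ge0// lee_fin powR_ge0.
  rewrite poweRM ?Lnorm_ge0 ?lee_fin ?powR_ge0// poweR_EFin -powRrM mulrBl mulVf ?gt_eqF//.
  move: (q0) aq => /gt0_cases[->|[r r0 ->]] aq.
    rewrite /einv/= invr0 mul0r subr0.
    rewrite powRr1; last by rewrite mulr_ge0 ?powR_ge0// ltW.
    set N := 'N[mu]_+oo[_].
    apply: (@le_trans _ _ (\int[mu]_w ((whitney_ind z w)%:E * N `^ a))).
      apply: ae_ge0_le_integral => //.
      - by apply: (@measurable_fun_poweR _ _ _ (fun w => `|(whitney_ind z w * v w)%:E|)); exact: measurableT_comp.
      - by move=> w _; rewrite mule_ge0 ?poweR_ge0// lee_fin whitney_ind_ge0.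
      - by apply: emeasurable_funM => //; exact/measurable_EFinP.
      apply: filterS (Lnormy_ae mu (fun w => (whitney_ind z w * v w)%:E)) => w + _.
      rewrite /= ger0_norm// -/N /whitney_ind; case: (in_whitney z w) => /= h.
        by rewrite mul1e -poweR_EFin; apply: (@le_poweR _ _ N) => //; [exact: ltW|rewrite lee_fin mul1r].
      by rewrite mul0r mul0e powR0// gt_eqF.
    under eq_integral do rewrite muleC.
    rewrite ge0_integralZl ?poweR_ge0//.
    - by rewrite muleC; apply: lee_wpmul2r => //; exact: poweR_ge0.
    - exact/measurable_EFinP.
    - by move=> w _; rewrite lee_fin whitney_ind_ge0.
  rewrite lee_fin in aq; rewrite /einv/=.
  have P1 : (1 <= r / a)%R by rewrite ler_pdivlMr// mul1r.
  have P0 : (0 < r / a)%R by rewrite divr_gt0.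
  have mk0 : (0 < m * t2)%R by rewrite mulr_gt0.
  have mva : measurable_fun setT (fun w => ((v w) `^ a)%:E).
    by apply/measurable_EFinP; exact: (measurableT_comp (measurable_powR _) mv).
  have := @jensen_integral _ _ _ mu (whitney_ind z) (fun w => ((v w) `^ a)%:E) (m * t2) (r / a) P1 mk0 mgW
    (whitney_ind_ge0 z) mva (fun w => powR_ge0 _ _) igW.
  have e1 c w : (0 < c)%R -> (whitney_ind z w)%:E * ((v w) `^ c)%:E = `|(whitney_ind z w * v w)%:E| `^ c.
    move=> c0; rewrite /= ger0_norm// /whitney_ind; case: (in_whitney z w); first by rewrite !mul1r mul1e.
    by rewrite !mul0r mul0e powR0// gt_eqF.
  under eq_integral do rewrite e1//.
  under [X in _ * X]eq_integral => w _.
    rewrite poweR_EFin -powRrM mulrC mulfVK ?gt_eqF// e1//.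
    over.
  move=> h.
  rewrite -(@poweRK _ (\int[mu]_x `|(whitney_ind z x * v x)%:E| `^ a) (r / a)) ?gt_eqF//; last first.
    by apply: integral_ge0 => w _; exact: poweR_ge0.
  apply: (le_trans (le_poweR _ _ h)); first by rewrite invr_ge0 ltW.
    exact: poweR_ge0.
  rewrite poweRM ?lee_fin ?powR_ge0//; last by apply: integral_ge0 => w _; exact: poweR_ge0.
  rewrite poweR_EFin -powRrM invf_div mulrBl mul1r.
  have -> : (r / a * (a / r) - a / r = 1 - r^-1 * a)%R by field; rewrite !gt_eqF.
  by rewrite LnormE -poweRrM [(a / r)%R]mulrC.
apply: (le_trans (lee_wpmul2l _ key)); first by rewrite lee_fin powR_ge0.
rewrite /wmean !muleA -!EFinM; apply: lee_wpmul2r; first exact: Lnorm_ge0.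
rewrite lee_fin powRM ?(ltW m0) ?(ltW t20)// mulrCA ler_wpM2l ?powR_ge0//.
rewrite /t2 -powRrM -powRD; last by rewrite (gt_eqF z0) implybT.
rewrite /einv/= le_eqVlt; apply/orP; left; apply/eqP; congr (_ `^ _)%R; ring.
Qed.

End whitney_weights.

(** * Schur means *)

Section kernel_bounds.
Context {R : realType} {n : nat}.
Hypothesis n0 : (0 < n)%N.
Local Notation X := ('rV[R]_n).
Local Notation U := (R * 'rV[R]_n)%type.
Local Notation mu := (@dtdx R n).
Local Open Scope ereal_scope.

(** A mean of F against the kernel. For p = oo the supremum is taken over the
    whole half-space, which makes its bound in L^oo immediate. *)
Definition schur_mean (eta b : R) (p : \bar R) (F : U -> \bar R) (z : U) : \bar R :=
  match p with
  | a%:E => (\int[mu]_w ((schur_kernel eta b z w)%:E * F w `^ a)) `^ a^-1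
  | _ => 'N[mu]_+oo[F]
  end.

Lemma schur_mean_ge0 eta b p F z : 0 <= schur_mean eta b p F z.
Proof. by case: p => [a||] /=; rewrite ?poweR_ge0 ?Lnorm_ge0. Qed.

Lemma measurable_schur_kernel_at eta b z : measurable_fun setT (fun w : U => (schur_kernel eta b z w)%:E).
Proof. by apply/measurable_EFinP; apply: measurable_schur_kernel. Qed.

Lemma measurable_schur_mean eta b p F : measurable_fun setT F -> (forall w, 0 <= F w) ->
  measurable_fun setT (schur_mean eta b p F).
Proof.
move=> mF F0; case: p => [a||] /=; last 2 first.
- exact: measurable_cst.
- exact: measurable_cst.
apply: measurable_fun_poweR.
apply: (@measurable_integral_dtdx _ _ (fun zw : U * U => (schur_kernel eta b zw.1 zw.2)%:E * F zw.2 `^ a)).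
  apply: emeasurable_funM.
    by apply/measurable_EFinP; apply: measurable_schur_kernel.
  by apply: measurable_fun_poweR; exact: (measurableT_comp mF measurable_snd).
by move=> zw; rewrite mule_ge0 ?poweR_ge0// lee_fin schur_kernel_ge0.
Qed.

(** After the integrals are exchanged, the bound on the integral of the kernel
    in z applies. *)
Lemma Lnorm_schur_mean (eta b : R) p : (0 < eta)%R -> (n%:R / 2 < b)%R -> 0 < p ->
  exists2 C : R, (0 < C)%R & forall F, measurable_fun setT F -> (forall w, 0 <= F w) ->
  'N[mu]_p[schur_mean eta b p F] <= C%:E * 'N[mu]_p[F].
Proof.
move=> e0 b0; have [C C0 hC] := @schur_left R n eta b e0 b0.
move=> /gt0_cases[->|[a a0 ->]].
  exists 1%R => // F mF F0; rewrite mul1e; apply/Lnormy_le; split; first exact: Lnorm_ge0.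
  by apply: nearW => z /=; rewrite gee0_abs ?Lnorm_ge0.
exists (C `^ a^-1)%R; first exact: powR_gt0.
move=> F mF F0.
have mk : measurable_fun setT (fun zw : U * U => (schur_kernel eta b zw.1 zw.2)%:E * F zw.2 `^ a).
  apply: emeasurable_funM.
    by apply/measurable_EFinP; apply: measurable_schur_kernel.
  by apply: measurable_fun_poweR; exact: (measurableT_comp mF measurable_snd).
rewrite Lnorm_le_integral//; last by rewrite mule_ge0 ?Lnorm_ge0// lee_fin powR_ge0.
rewrite poweRM ?Lnorm_ge0 ?lee_fin ?powR_ge0// poweR_EFin -powRrM mulVf ?gt_eqF// powRr1 ?(ltW C0)//.
rewrite poweR_Lnorm ?gt_eqF//.
under eq_integral => z _.
  rewrite gee0_abs ?schur_mean_ge0//= poweRVK ?gt_eqF//; last first.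
    by apply: integral_ge0 => w _; rewrite mule_ge0 ?poweR_ge0// lee_fin schur_kernel_ge0.
  over.
rewrite (@dtdx_swap _ _ (fun zw : U * U => (schur_kernel eta b zw.1 zw.2)%:E * F zw.2 `^ a))//; last first.
  by move=> zw; rewrite mule_ge0 ?poweR_ge0// lee_fin schur_kernel_ge0.
have mFa : measurable_fun setT (fun w => `|F w| `^ a).
  by apply: measurable_fun_poweR; exact: measurableT_comp.
rewrite -ge0_integralZl_EFin ?(ltW C0)//; last by move=> w _; exact: poweR_ge0.
apply: ae_ge0_le_integral => //.
- by move=> w _; apply: integral_ge0 => z _; rewrite mule_ge0 ?poweR_ge0// lee_fin schur_kernel_ge0.
- apply: (@measurable_integral_dtdx _ _ (fun wz : U * U => (schur_kernel eta b wz.2 wz.1)%:E * F wz.1 `^ a)).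
    apply: emeasurable_funM.
      by apply/measurable_EFinP; apply: measurable_schur_kernel.
    by apply: measurable_fun_poweR; exact: (measurableT_comp mF measurable_fst).
  by move=> zw; rewrite mule_ge0 ?poweR_ge0// lee_fin schur_kernel_ge0.
- by move=> w _; rewrite mule_ge0 ?poweR_ge0// lee_fin ltW.
- by apply: emeasurable_funM.
apply: filterS (@ae_dtdx_gt0 R n) => w w0 _ /=.
under eq_integral do rewrite muleC.
rewrite ge0_integralZl ?poweR_ge0//; last 2 first.
- by apply/measurable_EFinP; apply: measurable_schur_kernel.
- by move=> z _; rewrite lee_fin schur_kernel_ge0.
by rewrite muleC gee0_abs//; apply: lee_wpmul2r; [exact: poweR_ge0|exact: hC].
Qed.

(** If F >= A on a set V of kernel mass at least m, then A is at most a
    multiple of the mean of F. This is how a mean over a region around z is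
    compared with the Whitney means based at nearby points. *)
Lemma le_schur_mean (eta b m : R) p F z (V : set U) (A : \bar R) :
  (0 < m)%R -> 0 < p -> measurable V -> measurable_fun setT F -> (forall w, 0 <= F w) -> 0 <= A ->
  (forall w, V w -> A <= F w) -> m%:E <= \int[mu]_w ((schur_kernel eta b z w)%:E * (\1_V w)%:E) ->
  A <= (m `^ (- einv p))%:E * schur_mean eta b p F z.
Proof.
move=> m0 p0 mV mF F0 A0 AF mk.
have mk' := measurable_schur_kernel_at eta b z.
have mI : measurable_fun setT (fun w => (schur_kernel eta b z w)%:E * (\1_V w)%:E).
  by apply: emeasurable_funM => //; exact/measurable_EFinP.
move: p0 => /gt0_cases[->|[a a0 ->]].
  rewrite /einv invr0 oppr0 powRr0 mul1e /=.
  rewrite leNgt; apply/negP => NA.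
  have : 0 < \int[mu]_w ((schur_kernel eta b z w)%:E * (\1_V w)%:E) by apply: lt_le_trans mk; rewrite lte_fin.
  rewrite (@ge0_ae_eq_integral _ _ _ _ _ _ (cst 0)) ?integral0 ?ltxx//.
    by move=> w _; rewrite -EFinM lee_fin mulr_ge0 ?schur_kernel_ge0.
  apply: filterS (Lnormy_ae mu F) => w Fw _ /=.
  rewrite indicE memNset ?mule0// => /AF AFw.
  by move: NA; rewrite ltNge (le_trans AFw)// (le_trans _ Fw)// lee_abs.
rewrite /= /einv/= powRN.
have am : (0 < m `^ a^-1)%R by exact: powR_gt0.
rewrite -[A]mul1e -(mulVf (lt0r_neq0 am)) EFinM -muleA; apply: lee_wpmul2l.
  by rewrite lee_fin invr_ge0 ltW.
rewrite -poweR_EFin -[A](@poweRK _ _ a) ?gt_eqF// -poweRM ?poweR_ge0 ?lee_fin ?(ltW m0)//.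
apply: le_poweR; [by rewrite invr_ge0 ltW|by rewrite mule_ge0 ?poweR_ge0// lee_fin ltW|].
apply: (@le_trans _ _ (\int[mu]_w (A `^ a * ((schur_kernel eta b z w)%:E * (\1_V w)%:E)))).
  rewrite ge0_integralZl ?poweR_ge0//.
    by rewrite muleC; apply: lee_wpmul2l => //; exact: poweR_ge0.
  by move=> w _; rewrite -EFinM lee_fin mulr_ge0 ?schur_kernel_ge0.
apply: ge0_le_integral => //.
- by move=> w _; rewrite mule_ge0 ?poweR_ge0// -EFinM lee_fin mulr_ge0 ?schur_kernel_ge0.
- by apply: emeasurable_funM.
- by apply: emeasurable_funM => //; exact: measurable_fun_poweR.
move=> w _; rewrite indicE; have [Vw|_] := boolP (w \in V); last by rewrite !mule0 mule_ge0 ?poweR_ge0// lee_fin schur_kernel_ge0.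
rewrite mule1 muleC; apply: lee_wpmul2l; first by rewrite lee_fin schur_kernel_ge0.
by apply: le_poweR; [exact: ltW|done|apply: AF; exact/set_mem].
Qed.

(** Jensen's inequality, since the kernel has bounded mass in w. *)
Lemma schur_mean_mono (eta b a : R) p : (0 < eta)%R -> (n%:R / 2 < b)%R -> (0 < a)%R -> a%:E <= p ->
  exists2 C : R, (0 < C)%R & forall F z, measurable_fun setT F -> (forall w, 0 <= F w) -> (0 < z.1)%R ->
  schur_mean eta b a%:E F z <= C%:E * schur_mean eta b p F z.
Proof.
move=> e0 b0 a0 ap; have [C C0 hC] := @schur_right R n eta b e0 b0.
have p0 : 0 < p by rewrite (lt_le_trans _ ap)// lte_fin.
exists (C `^ (a^-1 - einv p))%R; first exact: powR_gt0.
move=> F z mF F0 z0; have mk' := measurable_schur_kernel_at eta b z.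
have kF0 c w : 0 <= (schur_kernel eta b z w)%:E * F w `^ c by rewrite mule_ge0 ?poweR_ge0// lee_fin schur_kernel_ge0.
have mkF c : measurable_fun setT (fun w => (schur_kernel eta b z w)%:E * F w `^ c).
  by apply: emeasurable_funM => //; exact: measurable_fun_poweR.
move: p0 ap => /gt0_cases[->|[r r0 ->]] ap.
  rewrite /einv invr0 subr0 /= poweR_lee_inv//; last 2 first.
  - exact: integral_ge0.
  - by rewrite mule_ge0 ?Lnorm_ge0// lee_fin powR_ge0.
  rewrite poweRM ?Lnorm_ge0 ?lee_fin ?powR_ge0// poweR_EFin -powRrM mulVf ?gt_eqF// powRr1 ?(ltW C0)//.
  set N := 'N[mu]_+oo[F].
  apply: (@le_trans _ _ (\int[mu]_w (N `^ a * (schur_kernel eta b z w)%:E))).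
    apply: ae_ge0_le_integral => //.
    - by move=> w _; rewrite mule_ge0 ?poweR_ge0// lee_fin schur_kernel_ge0.
    - exact: emeasurable_funM.
    apply: filterS (Lnormy_ae mu F) => w; rewrite -/N gee0_abs// => Fw _.
    rewrite muleC; apply: lee_wpmul2r; first by rewrite lee_fin schur_kernel_ge0.
    by apply: le_poweR => //; exact: ltW.
  rewrite ge0_integralZl ?poweR_ge0//; last by move=> w _; rewrite lee_fin schur_kernel_ge0.
  by rewrite muleC; apply: lee_wpmul2r; [exact: poweR_ge0|exact: hC].
rewrite lee_fin in ap; rewrite /einv/=.
have P1 : (1 <= r / a)%R by rewrite ler_pdivlMr// mul1r.
have mFa : measurable_fun setT (fun w => F w `^ a) by exact: measurable_fun_poweR.
have mkr : measurable_fun setT (schur_kernel eta b z) by apply: measurable_schur_kernel.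
have := @jensen_integral _ _ _ mu (schur_kernel eta b z) (fun w => F w `^ a) C (r / a) P1 C0 mkr
  (schur_kernel_ge0 _ _ _) mFa (fun w => poweR_ge0 _ _) (hC _ z0).
under [X in _ * X]eq_integral do rewrite -poweRrM mulrC mulfVK ?gt_eqF//.
move=> h; set I := \int[mu]_w _ in h *; set J := \int[mu]_w _ in h *.
have I0 : 0 <= I by exact: integral_ge0.
have J0 : 0 <= J by exact: integral_ge0.
have -> : I `^ a^-1 = (I `^ (r / a)) `^ r^-1.
  by rewrite -poweRrM; congr (_ `^ _); field; rewrite !gt_eqF.
apply: (le_trans (le_poweR _ _ h)); [by rewrite invr_ge0 ltW|exact: poweR_ge0|].
rewrite poweRM ?lee_fin ?powR_ge0// poweR_EFin -powRrM mulrBl mul1r.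
by have -> : (r / a / r - r^-1 = a^-1 - r^-1)%R by field; rewrite !gt_eqF.
Qed.

Lemma schur_mean_le (eta b : R) p F G (c : R) z : (0 <= c)%R -> 0 < p -> measurable_fun setT F -> measurable_fun setT G ->
  (forall w, 0 <= F w) -> (forall w, 0 <= G w) -> {ae mu, forall w, F w <= c%:E * G w} ->
  schur_mean eta b p F z <= c%:E * schur_mean eta b p G z.
Proof.
move=> c0 p0 mF mG F0 G0 FG; move: p0 => /gt0_cases[->|[a a0 ->]] /=.
  rewrite -LnormZ_ge0//; apply: ae_le_Lnorm => //; first exact: emeasurable_funM.
  by apply: filterS FG => w; rewrite !gee0_abs ?mule_ge0.
have mk' := measurable_schur_kernel_at eta b z.
have kF0 (H : U -> \bar R) w : 0 <= (schur_kernel eta b z w)%:E * H w `^ a by rewrite mule_ge0 ?poweR_ge0// lee_fin schur_kernel_ge0.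
have mkF (H : U -> \bar R) : measurable_fun setT H -> measurable_fun setT (fun w => (schur_kernel eta b z w)%:E * H w `^ a).
  by move=> mH; apply: emeasurable_funM => //; exact: measurable_fun_poweR.
rewrite poweR_lee_inv//; last 2 first.
- exact: integral_ge0.
- by rewrite mule_ge0 ?poweR_ge0.
rewrite poweRM ?poweR_ge0// poweRVK ?gt_eqF//; last exact: integral_ge0.
rewrite poweR_EFin -ge0_integralZl_EFin ?powR_ge0//; last exact: mkF.
apply: ae_ge0_le_integral => //.
- exact: mkF.
- by move=> w _; rewrite mule_ge0// lee_fin powR_ge0.
- by apply: emeasurable_funM => //; exact: mkF.
apply: filterS FG => w h _; rewrite muleCA; apply: lee_wpmul2l; first by rewrite lee_fin schur_kernel_ge0.
by rewrite -poweR_EFin -poweRM//; apply: le_poweR => //; exact: ltW.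
Qed.

End kernel_bounds.

(** * Local and far means against Schur means *)

Section whitney_control.
Context {R : realType} {n : nat}.
Hypothesis n0 : (0 < n)%N.
Local Notation X := ('rV[R]_n).
Local Notation U := (R * 'rV[R]_n)%type.
Local Notation mu := (@dtdx R n).
Local Open Scope ereal_scope.

(** A set of base points whose Whitney regions contain w, of measure
    comparable to that of the region of w. *)
Definition dual_box (w : U) : set U := `[w.1, (2 * w.1)%R]%classic `*` eball w.2 (1 * Num.sqrt w.1).

Lemma measurable_dual_box w : measurable (dual_box w).
Proof. exact: measurable_tube_cc. Qed.

Lemma dual_box_in_whitney w w' : (0 < w.1)%R -> dual_box w w' -> in_whitney w' w.
Proof.
move=> w0 [/=]; rewrite in_itv/= => /andP[w1 w2]; rewrite /eball/= mul1r => w3.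
rewrite /in_whitney w1 ler_pdivrMr// mulrC w2/= edistC (lt_le_trans w3)//.
by rewrite ler_wsqrtr.
Qed.

Lemma dtdx_dual_box_ge w : (0 < w.1)%R ->
  (2^-1 * (2 / n%:R) ^+ n * w.1 `^ (n%:R / 2))%:E <= mu (dual_box w).
Proof.
move=> w0; apply: (le_trans _ (@dtdx_tube_ge R n w.1 (2 * w.1) 1 w.1 w.2 n0 _ _ _)) => //.
  rewrite lee_fin mulr1 mulrA (_ : (2 * w.1 - w.1) / (2 * w.1) = 2^-1)%R//.
  by field; rewrite gt_eqF.
by rewrite w0/= ltr_pMl// ltr1n.
Qed.

Lemma dtdx_dual_box_gt0 w : (0 < w.1)%R -> 0 < mu (dual_box w).
Proof.
move=> w0; apply: (lt_le_trans _ (dtdx_dual_box_ge w0)).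
by rewrite lte_fin !mulr_gt0// ?powR_gt0// exprn_gt0// divr_gt0// ltr0n.
Qed.

Lemma integral_set (F : U -> \bar R) (V : set U) (c : R) : measurable V -> (0 <= c)%R ->
  measurable_fun setT F ->
  (forall w, 0 <= F w) -> (forall w, V w -> c%:E <= F w) -> c%:E * mu V <= \int[mu]_w F w.
Proof.
move=> mV c0 mF F0 cF.
have -> : mu V = \int[mu]_w (\1_V w)%:E by rewrite integral_indic// setIT.
rewrite -ge0_integralZl_EFin//; last exact/measurable_EFinP.
apply: ge0_le_integral => //.
- by move=> w _; rewrite -EFinM lee_fin mulr_ge0.
- by apply/measurable_EFinP; apply: measurable_funM.
move=> w _; rewrite indicE; have [/set_mem Vw|_] := boolP (w \in V).
  by rewrite mule1 cF.
by rewrite mule0.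
Qed.

Lemma pweight_nearby (x y y' : X) (t s : R) : (0 < t)%R -> (s <= t)%R -> (edist y y' < Num.sqrt s)%R ->
  (pweight x t y' <= 3 * pweight x t y)%R.
Proof.
move=> t0 st yy; rewrite /pweight mulrDr mulr1.
have s0 : (0 <= s)%R.
  rewrite leNgt; apply/negP => s0; move: yy; rewrite ltr0_sqrtr//; apply/negP.
  by rewrite -leNgt edist_ge0.
have h : (edist y y' ^+ 2 <= t)%R.
  apply: le_trans st; rewrite -[leRHS]sqr_sqrtr//.
  by rewrite ler_pXn2r ?nnegrE ?edist_ge0 ?sqrtr_ge0// ltW.
have : (edist x y' ^+ 2 <= 2 * edist x y ^+ 2 + 2 * t)%R.
  apply: (@le_trans _ _ ((edist x y + edist y y') ^+ 2)%R).
    by rewrite ler_pXn2r ?nnegrE ?addr_ge0 ?edist_ge0// edist_triangle.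
  apply: (@le_trans _ _ (2 * edist x y ^+ 2 + 2 * edist y y' ^+ 2)%R); last by rewrite lerD2l ler_pM2l.
  have := sqr_ge0 (edist x y - edist y y')%R; nra.
move=> h2; have : (edist x y' ^+ 2 / t <= 2 * (edist x y ^+ 2 / t) + 2)%R.
  rewrite ler_pdivrMr// mulrDl -!mulrA mulVf ?gt_eqF// mulr1//.
have : (0 <= edist x y ^+ 2 / t)%R by rewrite divr_ge0 ?sqr_ge0// ltW.
lra.
Qed.

Lemma powR_antimono (x y c : R) : (0 < x)%R -> (x <= y)%R -> (0 <= c)%R -> (y `^ (- c) <= x `^ (- c))%R.
Proof.
move=> x0 xy c0; have y0 : (0 < y)%R by exact: lt_le_trans xy.
by rewrite !powRN lef_pV2 ?posrE ?powR_gt0// ler_powRl// ltW.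
Qed.

(** Write 1 as an average over base points w' in the dual box of w, and
    exchange the integrals: the weight at w is at most a multiple of the
    average of the kernel over the dual box, because s and y change there only
    by a factor and by at most sqrt s. *)
Lemma far_mean_pointwise (a eta b : R) : (0 < a)%R -> (0 < eta)%R -> (0 < b)%R ->
  exists2 C : R, (0 < C)%R & forall (v : U -> R) z, measurable_fun setT v -> (forall w, 0 <= v w)%R -> (0 < z.1)%R ->
  wmean a%:E (far_weight eta b) v z <= C%:E * schur_mean (eta * a) (b * a) a%:E (wmean a%:E whitney_ind v) z.
Proof.
move=> a0 e0 b0.
pose n2 := (n%:R / 2 : R)%R; have n20 : (0 <= n2)%R by rewrite divr_ge0.
pose c0 := (3 `^ (- (b * a)) * (2 `^ (- n2) * (2^-1 * (2 / n%:R) ^+ n)))%R.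
have c0_gt0 : (0 < c0)%R.
  by rewrite !mulr_gt0// ?powR_gt0// exprn_gt0// divr_gt0// ltr0n.
exists (c0 `^ (- a^-1))%R; first exact: powR_gt0.
move=> v z mv v0 z0.
have mva : measurable_fun setT (fun w => (v w `^ a)%:E).
  by apply/measurable_EFinP; exact: (measurableT_comp (measurable_powR _) mv).
have va0 w : 0 <= (v w `^ a)%:E by rewrite lee_fin powR_ge0.
have mk' := measurable_schur_kernel_at (eta * a) (b * a) z.
(* up to normalization, [J w] is the average of the kernel over the base
   points whose Whitney region contains w *)
pose J w := \int[mu]_w' ((schur_kernel (eta * a) (b * a) z w')%:E * ((w'.1 `^ (- n2))%:E * (whitney_ind w' w)%:E)).
have mJ' : measurable_fun setT (fun ww' : U * U =>
    ((schur_kernel (eta * a) (b * a) z ww'.2)%:E * ((ww'.2.1 `^ (- n2))%:E * (whitney_ind ww'.2 ww'.1)%:E))).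
  apply: emeasurable_funM.
    by apply/measurable_EFinP; apply: measurable_schur_kernel.
  apply: emeasurable_funM; apply/measurable_EFinP.
    apply: (measurableT_comp (measurable_powR _)); exact: measurable_fst_comp.
  by apply: measurable_in_whitney.
have J'0 w w' : 0 <= ((schur_kernel (eta * a) (b * a) z w')%:E * ((w'.1 `^ (- n2))%:E * (whitney_ind w' w)%:E)).
  by rewrite !mule_ge0// lee_fin ?schur_kernel_ge0 ?powR_ge0 ?whitney_ind_ge0.
have mJ : measurable_fun setT J by exact: (measurable_integral_dtdx mJ').
have key w : (0 < w.1)%R -> (c0 * (z.1 `^ (- n2) * far_weight eta b z w `^ a))%:E <= J w.
  move=> w0; have [h|h] := boolP ((0 < w.1)%R && (w.1 <= z.1)%R); last first.
    rewrite /far_weight (negbTE h) powR0 ?gt_eqF// !mulr0; apply: integral_ge0 => w' _; exact: J'0.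
  have wz : (w.1 <= z.1)%R by case/andP: h.
  pose c1 := ((w.1 / z.1) `^ (eta * a) * z.1 `^ (- n2) * (3 * pweight z.2 z.1 w.2) `^ (- (b * a)) * (2 * w.1) `^ (- n2))%R.
  have c10 : (0 <= c1)%R by rewrite !mulr_ge0 ?powR_ge0.
  apply: (@le_trans _ _ (c1%:E * mu (dual_box w))); last first.
    apply: integral_set => //; first exact: measurable_dual_box.
      exact: (measurable_fun_pair1 w mJ').
    move=> w' /[dup] /(dual_box_in_whitney w0) Ww' [/=]; rewrite in_itv/= => /andP[w1 w2].
    rewrite /eball/= mul1r => w3; rewrite /whitney_ind Ww' mule1 -EFinM lee_fin /c1.
    have w'0 : (0 < w'.1)%R by exact: lt_le_trans w1.
    have w'z : (w'.1 <= 2 * z.1)%R by rewrite (le_trans w2)// ler_pM2l.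
    rewrite /schur_kernel z0 w'0 w'z/=; apply: ler_pM; rewrite ?mulr_ge0 ?powR_ge0//; last exact: powR_antimono.
    apply: ler_pM; rewrite ?mulr_ge0 ?powR_ge0//.
      apply: ler_pM; rewrite ?powR_ge0//; apply: ler_powRl; rewrite ?mulr_ge0 ?divr_ge0 ?invr_ge0 ?(ltW w0) ?(ltW z0) ?(ltW a0) ?(ltW e0)//.
      by rewrite ler_pM2r ?invr_gt0.
    apply: powR_antimono; [exact: pweight_gt0|exact: (pweight_nearby _ z0 wz w3)|by rewrite mulr_ge0// ltW].
  apply: (le_trans _ (lee_wpmul2l _ (dtdx_dual_box_ge w0))); last by rewrite lee_fin.
  rewrite -EFinM lee_fin le_eqVlt; apply/orP; left; apply/eqP.
  rewrite /c1 /c0 /far_weight h -/n2.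
  rewrite [((_ `^ eta * _) `^ a)%R]powRM ?powR_ge0// -!powRrM mulNr.
  rewrite [((3 * _) `^ _)%R]powRM ?(ltW (pweight_gt0 _ _ z0))// [((2 * w.1) `^ _)%R]powRM ?(ltW w0)//.
  have -> : (w.1 `^ (- n2) = (w.1 `^ n2)^-1)%R by rewrite powRN.
  by field; rewrite gt_eqF// powR_gt0.
rewrite /wmean /schur_mean /einv/= -/n2.
rewrite -[X in X <= _](@poweRK _ _ a) ?gt_eqF//; last by rewrite mule_ge0 ?Lnorm_ge0// lee_fin powR_ge0.
have -> : (c0 `^ (- a^-1))%:E = ((c0^-1)%:E) `^ a^-1.
  by rewrite poweR_EFin; congr EFin; rewrite -[in RHS]powR_inv1 ?(ltW c0_gt0)// -powRrM mulN1r.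
rewrite -poweRM ?lee_fin ?invr_ge0 ?(ltW c0_gt0)//; last first.
  by apply: integral_ge0 => w _; rewrite mule_ge0 ?poweR_ge0// lee_fin schur_kernel_ge0.
apply: le_poweR; [by rewrite invr_ge0 ltW|by rewrite poweR_ge0|].
have wE (g : U -> U -> R) (y : U) : (forall y w, 0 <= g y w)%R ->
    ((y.1 `^ (- (n2 * a^-1)))%:E * 'N[mu]_a%:E[(fun w => (g y w * v w)%:E)]) `^ a =
    (y.1 `^ (- n2))%:E * \int[mu]_w ((g y w `^ a)%:E * (v w `^ a)%:E).
  move=> g0; rewrite poweRM ?Lnorm_ge0 ?lee_fin ?powR_ge0// poweR_Lnorm ?gt_eqF// poweR_EFin -powRrM.
  rewrite mulNr mulfVK ?gt_eqF//; congr (_ * _); apply: eq_integral => w _.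
  by rewrite /= ger0_norm ?mulr_ge0// powRM.
rewrite wE; last by move=> *; exact: far_weight_ge0.
have E1 : \int[mu]_w' ((schur_kernel (eta * a) (b * a) z w')%:E * ((w'.1 `^ (- (n2 * a^-1)))%:E *
    'N[mu]_a%:E[(fun w => (whitney_ind w' w * v w)%:E)]) `^ a) = \int[mu]_w (J w * (v w `^ a)%:E).
  transitivity (\int[mu]_w' \int[mu]_w (((schur_kernel (eta * a) (b * a) z w')%:E * ((w'.1 `^ (- n2))%:E * (whitney_ind w' w)%:E)) * (v w `^ a)%:E)).
    apply: eq_integral => w' _; rewrite wE; last by move=> *; exact: whitney_ind_ge0.
    rewrite muleA -ge0_integralZl//.
    - apply: eq_integral => w _; rewrite -!muleA; do 3 congr (_ * _).
      by rewrite /whitney_ind; case: (in_whitney w' w); rewrite ?powR1// powR0// gt_eqF.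
    - apply: emeasurable_funM => //; apply/measurable_EFinP; apply: (measurableT_comp (measurable_powR _)).
      by have := measurable_fun_pair1 w' (@measurable_whitney_ind R n).
    - by move=> w _; rewrite mule_ge0// lee_fin powR_ge0.
    - by rewrite mule_ge0// lee_fin ?schur_kernel_ge0 ?powR_ge0.
  rewrite (@dtdx_swap _ _ (fun ww : U * U => ((schur_kernel (eta * a) (b * a) z ww.1)%:E * ((ww.1.1 `^ (- n2))%:E * (whitney_ind ww.1 ww.2)%:E)) * (v ww.2 `^ a)%:E)).
  - apply: eq_integral => w _; rewrite /J; under eq_integral do rewrite muleC.
    rewrite [RHS]muleC -ge0_integralZl//.
    exact: (measurable_fun_pair1 w mJ').
  - apply: emeasurable_funM; last exact: (measurableT_comp mva measurable_snd).
    apply: emeasurable_funM.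
      by apply/measurable_EFinP; apply: measurable_schur_kernel.
    apply: emeasurable_funM; apply/measurable_EFinP; last by apply: measurable_in_whitney.
    by apply: (measurableT_comp (measurable_powR _)); exact: measurable_fst_comp.
  - by move=> ww; rewrite mule_ge0.
under eq_integral do rewrite /wmean /einv/= -/n2.
rewrite E1.
have mom : measurable_fun setT (fun w => (far_weight eta b z w `^ a)%:E).
  apply/measurable_EFinP; apply: (measurableT_comp (measurable_powR _)).
  by have := measurable_fun_pair1 z (@measurable_far_weight2 R n eta b).
have omv0 w : 0 <= (far_weight eta b z w `^ a)%:E * (v w `^ a)%:E by rewrite mule_ge0// lee_fin powR_ge0.
rewrite -ge0_integralZl_EFin ?powR_ge0//; last exact: emeasurable_funM.
have J0 w : 0 <= J w * (v w `^ a)%:E by rewrite mule_ge0//; apply: integral_ge0 => w' _; exact: J'0.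
rewrite -ge0_integralZl_EFin ?invr_ge0 ?(ltW c0_gt0)//; last exact: emeasurable_funM.
apply: ae_ge0_le_integral => //.
- by move=> w _; rewrite mule_ge0// lee_fin powR_ge0.
- by apply: emeasurable_funM => //; exact: emeasurable_funM.
- by move=> w _; rewrite mule_ge0// lee_fin invr_ge0 ltW.
- by apply: emeasurable_funM => //; exact: emeasurable_funM.
apply: filterS (@ae_dtdx_gt0 R n) => w w0 _ /=.
rewrite !muleA; apply: lee_wpmul2r => //.
rewrite -[X in X <= _]mul1e -(mulVf (lt0r_neq0 c0_gt0)) EFinM -muleA; apply: lee_wpmul2l.
  by rewrite lee_fin invr_ge0 ltW.
by apply: le_trans (key _ w0); rewrite -!EFinM.
Qed.

Lemma wmean_infty g v z : wmean (n := n) +oo g v z = 'N[mu]_+oo[(fun w => (g z w * v w)%:E)] :> \bar R.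
Proof. by rewrite /wmean /einv invr0 mulr0 oppr0 powRr0 mul1e. Qed.

(** Almost every w lies in the Whitney region of base points w' filling a set
    of positive measure, so v w exceeds the supremum of the local suprema only
    on a null set. *)
Lemma ae_le_sup_whitney (v : U -> R) : measurable_fun setT v -> (forall w, 0 <= v w)%R ->
  {ae mu, forall w, (v w)%:E <= 'N[mu]_+oo[wmean +oo whitney_ind v]}.
Proof.
move=> mv v0; set N := 'N[mu]_+oo[_].
have N0 : 0 <= N by exact: Lnorm_ge0.
have m1 : measurable [set ww : U * U | (whitney_ind ww.1 ww.2 * v ww.2)%:E <= N].
  apply: measurable_ereal_le; last exact: measurable_cst.
  apply/measurable_EFinP; apply: measurable_funM; first exact: measurable_whitney_ind.
  exact: (measurableT_comp mv measurable_snd).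
have : {ae mu, forall w', {ae mu, forall w, (whitney_ind w' w * v w)%:E <= N}}.
  apply: filterS (Lnormy_ae mu (wmean +oo whitney_ind v)) => w'; rewrite -/N gee0_abs ?wmean_ge0// wmean_infty => h.
  apply: filterS (Lnormy_ae mu (fun w => (whitney_ind w' w * v w)%:E)) => w; rewrite gee0_abs ?lee_fin ?mulr_ge0 ?whitney_ind_ge0//.
  by move=> h'; exact: le_trans h.
move=> /(@ae_prod_swap _ _ _ _ _ [the {sigma_finite_measure set U -> \bar R} of @dtdx_sf R n]
  [the {sigma_finite_measure set U -> \bar R} of @dtdx_sf R n] _ m1).
apply: filterS2 (@ae_dtdx_gt0 R n) => w w0 h.
rewrite leNgt; apply/negP => Nv.
have := dtdx_dual_box_gt0 w0; rewrite ltNge => /negP; apply.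
have [Z [mZ Z0 QZ]] := h; rewrite -Z0 le_measure ?inE//; first exact: measurable_dual_box.
move=> w' /(dual_box_in_whitney w0) Ww'; apply: QZ => /=; rewrite /whitney_ind Ww' mul1r.
by apply/negP; rewrite -ltNge.
Qed.

Lemma far_weight_le1 (eta b : R) z w : (0 <= eta)%R -> (0 <= b)%R -> (far_weight (n := n) eta b z w <= 1)%R.
Proof.
move=> e0 b0; rewrite /far_weight; case: ifPn => // /andP[w0 wz].
have z0 : (0 < z.1)%R by exact: lt_le_trans wz.
rewrite mulr_ile1 ?powR_ge0//.
  rewrite -[leRHS](_ : (1 : R) `^ eta = 1)%R; last by rewrite powR1.
  apply: ler_powRl => //; first by rewrite divr_ge0// ltW.
  by rewrite ler_pdivrMr// mul1r.
rewrite -[leRHS](_ : (1 : R) `^ (- b) = 1)%R; last by rewrite powR1.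
apply: powR_antimono => //.
exact: pweight_ge1.
Qed.

(** For finite p0 the far mean is a Schur mean of Whitney p0-means, and
    Jensen's inequality is used twice: inside Whitney regions from p0 to q,
    and against the kernel from p0 to p. If p0 = oo all the exponents are oo
    and the weight is at most 1. *)
Lemma far_mean_le (p0 q p : \bar R) (eta b : R) : 1 < p0 -> p0 <= q -> p0 <= p ->
  (0 < eta)%R -> (n%:R / 2 * einv p0 < b)%R ->
  exists eta' b' C : R, [/\ 0 < eta', n%:R / 2 < b' & 0 < C]%R /\
  forall (v : U -> R) z, measurable_fun setT v -> (forall w, 0 <= v w)%R -> (0 < z.1)%R ->
  wmean p0 (far_weight eta b) v z <= C%:E * schur_mean eta' b' p (wmean q whitney_ind v) z.
Proof.
move=> p01; have p00 : 0 < p0 by exact: lt_trans p01.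
have b0 : (n%:R / 2 * einv p0 < b)%R -> (0 < b)%R.
  by apply: le_lt_trans; rewrite mulr_ge0 ?divr_ge0 ?einv_ge0.
move: p00 p01 b0 => /gt0_cases[->|[a a0 ->]] p01 b0.
  rewrite !leye_eq => /eqP -> /eqP -> e0 /b0{}b0.
  exists 1%R, (n%:R / 2 + 1)%R, 1%R; split; first by split => //; rewrite ltrDl.
  move=> v z mv v0 z0; rewrite mul1e wmean_infty /=.
  apply/Lnormy_le; split; first exact: Lnorm_ge0.
  apply: filterS (ae_le_sup_whitney mv v0) => w; apply: le_trans.
  rewrite gee0_abs ?lee_fin ?mulr_ge0 ?far_weight_ge0//.
  by rewrite ler_piMl// far_weight_le1// ltW.
move=> aq ap e0 /[dup] nb /b0{}b0; have bn : (n%:R / 2 < b * a)%R.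
  by rewrite -ltr_pdivrMr.
have ea : (0 < eta * a)%R by rewrite mulr_gt0.
have [C1 C10 h1] := @far_mean_pointwise a eta b a0 e0 b0.
have [C2 C20 h2] := @wmean_le R n a q a0 aq.
have [C3 C30 h3] := @schur_mean_mono R n (eta * a) (b * a) a p ea bn a0 ap.
exists (eta * a)%R, (b * a)%R, (C1 * (C2 * C3))%R; split; first by split => //; rewrite !mulr_gt0.
have q0 : 0 < q by rewrite (lt_le_trans _ aq)// lte_fin.
move=> v z mv v0 z0; apply: (le_trans (h1 v z mv v0 z0)).
rewrite EFinM -muleA; apply: lee_wpmul2l; first by rewrite lee_fin ltW.
have mq : measurable_fun setT (wmean q whitney_ind v) by apply: measurable_wmean => //; exact: measurable_whitney_ind.
have ma : measurable_fun setT (wmean a%:E whitney_ind v) by apply: measurable_wmean => //; exact: measurable_whitney_ind.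
apply: (@le_trans _ _ (C2%:E * schur_mean (eta * a) (b * a) a%:E (wmean q whitney_ind v) z)).
  apply: schur_mean_le => //; [exact: ltW|by move=> w; exact: wmean_ge0|by move=> w; exact: wmean_ge0|].
  by apply: filterS (@ae_dtdx_gt0 R n) => w w0; exact: h2.
rewrite EFinM -muleA; apply: lee_wpmul2l; first by rewrite lee_fin ltW.
by apply: h3 => // w; exact: wmean_ge0.
Qed.

(** The enlarged region is covered by finitely many small tubes, each of which
    lies in the Whitney region of all base points of a slightly later tube;
    that tube has kernel mass bounded below, so [le_schur_mean] applies to
    each small tube. *)
Lemma enlarged_mean_le (q p : \bar R) (eta b : R) : 1 <= q -> 0 < p -> (0 < eta)%R -> (0 <= b)%R ->
  exists2 C : R, (0 < C)%R &
  forall (v : U -> R) z, measurable_fun setT v -> (forall w, 0 <= v w)%R -> (0 < z.1)%R ->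
  wmean q enlarged_ind v z <= C%:E * schur_mean eta b p (wmean q whitney_ind v) z.
Proof.
move=> q1 p0 e0 b0; have q0 : 0 < q by exact: lt_le_trans q1.
pose n2 := (n%:R / 2 : R)%R; have n20 : (0 <= n2)%R by rewrite divr_ge0.
(* [ws] rescaled by sqrt t are centres of balls of radius sqrt t / 4 covering
   B(x,4 sqrt t) *)
have [ws [D [D0 wsD wsN]]] := @eball_net R n 4 4^-1 n0 ltac:(by rewrite invr_gt0).
(* Three intervals of ratio 5/8 cover (t/4,t], as (5/8)^3 < 1/4. Such an
   interval (rho T,T] lies in [t'/2,t'] for all t' in [T,5T/4], and at the
   smallest T = 25t/64 two radii sqrt t / 4 add up to less than sqrt T. *)
pose rho : R := (5 / 8)%R.
have rho0 : (0 < rho)%R by rewrite divr_gt0.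
have rho1 : (rho <= 1)%R by rewrite ler_pdivrMr// mul1r ler_nat.
pose kap := ((25 / 64) `^ eta * (1 + (D + 1) ^+ 2) `^ (- b) * (5^-1 * (2 / n%:R * 4^-1) ^+ n))%R.
have D1 : (0 < 1 + (D + 1) ^+ 2)%R by rewrite ltr_pwDl// sqr_ge0.
have kap0 : (0 < kap)%R.
  apply: mulr_gt0; first by apply: mulr_gt0; apply: powR_gt0 => //; rewrite divr_gt0.
  apply: mulr_gt0; first by rewrite invr_gt0.
  by rewrite exprn_gt0// !mulr_gt0// ?invr_gt0// ltr0n.
pose c1 := ((5 / 4) `^ (n2 * einv q) * kap `^ (- einv p))%R.
have c10 : (0 < c1)%R by rewrite mulr_gt0// powR_gt0.
pose N := (size ws * 3)%N.
exists (N%:R * c1 + 1)%R; first by rewrite ltr_pwDr// mulr_ge0// ltW.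
move=> v z mv v0 z0.
set F := wmean q whitney_ind v.
have mF : measurable_fun setT F by apply: measurable_wmean => //; exact: measurable_whitney_ind.
have F0 w : 0 <= F w by exact: wmean_ge0.
pose t := z.1; pose st := Num.sqrt t.
have st0 : (0 < st)%R by rewrite sqrtr_gt0.
pose tk (k : nat) := (rho ^+ k * t)%R.
(* [P i] are the small tubes and [V i] the base points whose Whitney regions
   contain [P i] *)
pose P (i : X * nat) : set U := `](rho * tk i.2)%R, (tk i.2)]%classic `*` eball (z.2 + st *: i.1) (4^-1 * st).
pose V (i : X * nat) : set U := `[tk i.2, (5 / 4 * tk i.2)%R]%classic `*` eball (z.2 + st *: i.1) (4^-1 * st).
have mP i : measurable (P i) by apply: measurableX => //; exact: measurable_eball.
have mV i : measurable (V i) by exact: measurable_tube_cc.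
pose A i : \bar R := (z.1 `^ (- (n2 * einv q)))%:E * 'N[mu]_q[(fun w => (\1_(P i) w * v w)%:E)].
have mPv i : measurable_fun setT (fun w => (\1_(P i) w * v w)%:E).
  by apply/measurable_EFinP; apply: measurable_funM => //; exact: measurable_indic.
have Pv0 i w : 0 <= (\1_(P i) w * v w)%:E by rewrite lee_fin mulr_ge0.
have tk0 k : (0 < tk k)%R by rewrite mulr_gt0// exprn_gt0.
have tk1 k : (tk k <= t)%R by rewrite ler_piMl ?(ltW z0)// exprn_ile1// ltW.
have tk2 k : (k <= 2)%N -> (25 / 64 * t <= tk k)%R.
  move=> k2; rewrite ler_pM2r// (_ : 25 / 64 = rho ^+ 2)%R; last by rewrite /rho; field.
  by rewrite ler_wiXn2l// ltW.
have Ak w k : w \in ws -> (k <= 2)%N -> A (w, k) <= c1%:E * schur_mean eta b p F z.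
  move=> wws k2.
  have -> : c1%:E * schur_mean eta b p F z = ((5 / 4) `^ (n2 * einv q))%:E * ((kap `^ (- einv p))%:E * schur_mean eta b p F z).
    by rewrite muleA -EFinM.
  have c50 : (0 < (5 / 4 : R) `^ (n2 * einv q))%R by exact: powR_gt0.
  suff : (((5 / 4) `^ (n2 * einv q))^-1)%:E * A (w, k) <= (kap `^ (- einv p))%:E * schur_mean eta b p F z.
    move=> /(@lee_wpmul2l _ ((5 / 4) `^ (n2 * einv q))%:E); rewrite muleA -EFinM mulfV ?gt_eqF// mul1e.
    by apply; rewrite lee_fin ltW.
  apply: (@le_schur_mean _ _ eta b kap p F z (V (w, k))) => //.
  - by rewrite mule_ge0 ?lee_fin ?invr_ge0 ?(ltW c50)// mule_ge0 ?Lnorm_ge0// lee_fin powR_ge0.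
  - move=> w' [/=]; rewrite in_itv/= => /andP[w1 w2]; rewrite /eball/= => w3.
    have w'0 : (0 < w'.1)%R by exact: lt_le_trans w1.
    rewrite /A /F /wmean -/n2 muleA -EFinM; apply: lee_pmul.
    + by rewrite lee_fin mulr_ge0 ?powR_ge0// invr_ge0 powR_ge0.
    + exact: Lnorm_ge0.
    + rewrite lee_fin -powRN -powRM ?(ltW z0) ?divr_ge0//; apply: powR_antimono => //.
        by rewrite (le_trans w2)// ler_pM2l ?divr_gt0.
      by rewrite mulr_ge0// einv_ge0.
    + apply: le_Lnorm => //; first by apply: measurable_weight => //; exact: measurable_whitney_ind.
      move=> u; rewrite !gee0_abs ?lee_fin ?mulr_ge0 ?whitney_ind_ge0//; apply: ler_wpM2r => //.
      rewrite indicE; have [/set_mem|_] := boolP (u \in P (w, k)); last by rewrite whitney_ind_ge0.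
      move=> [/=]; rewrite in_itv/= => /andP[u1 u2]; rewrite /eball/= => u3.
      rewrite /whitney_ind (_ : in_whitney w' u)//; apply/and3P; split.
      * rewrite ler_pdivrMr//; apply: (le_trans w2); move: u1; rewrite /rho; lra.
      * exact: le_trans w1.
      * apply: (le_lt_trans (edist_triangle _ (z.2 + st *: w) _)).
        rewrite edistC; apply: (lt_le_trans (ltrD w3 u3)).
        apply: (@le_trans _ _ (Num.sqrt (25 / 64 * t))); last by rewrite ler_wsqrtr// (le_trans (tk2 _ k2)).
        rewrite sqrtrM ?divr_ge0// (_ : 25 / 64 = (5 / 8) ^+ 2)%R; last by field.
        rewrite sqrtr_sqr ger0_norm ?divr_ge0// -/st; lra.
  - have cc : (0 <= (25 / 64) `^ eta * t `^ (- n2) * (1 + (D + 1) ^+ 2) `^ (- b))%R by rewrite !mulr_ge0 ?powR_ge0.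
    apply: (@le_trans _ _ (((25 / 64) `^ eta * t `^ (- n2) * (1 + (D + 1) ^+ 2) `^ (- b))%:E * mu (V (w, k)))).
      apply: le_trans; last first.
        apply: lee_wpmul2l; first by rewrite lee_fin.
        apply: (@dtdx_tube_ge R n (tk k) (5 / 4 * tk k) 4^-1 t _ n0 _ _ _) => //.
        by rewrite tk0/= ltr_pMl// ltr_pdivlMr// mul1r ltr_nat.
      rewrite -EFinM lee_fin le_eqVlt; apply/orP; left; apply/eqP; rewrite /kap -/n2 [(t `^ (- n2))%R]powRN.
      have tn : (0 < t `^ n2)%R by exact: powR_gt0.
      by field; rewrite !gt_eqF ?ltr0n.
    apply: integral_set => //.
    + by apply: emeasurable_funM; [exact: measurable_schur_kernel_at|exact/measurable_EFinP].
    + by move=> u; rewrite -EFinM lee_fin mulr_ge0 ?schur_kernel_ge0.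
    + move=> u /[dup] Vu [/=]; rewrite in_itv/= => /andP[u1 u2]; rewrite /eball/= => u3.
      rewrite indicE mem_set// mule1 lee_fin /schur_kernel z0 (lt_le_trans (tk0 k) u1)/=.
      have u4 : (u.1 <= 2 * z.1)%R by rewrite (le_trans u2)// -/t; have := tk1 k; have := tk0 k; lra.
      rewrite u4; apply: ler_pM; rewrite ?mulr_ge0 ?powR_ge0//.
        apply: ler_pM; rewrite ?powR_ge0//; apply: ler_powRl; rewrite ?divr_ge0 ?(ltW e0)//.
        by rewrite ler_pdivlMr// (le_trans (tk2 _ k2)).
      apply: powR_antimono => //; first exact: pweight_gt0.
      rewrite /pweight lerD2l ler_pdivrMr// -[leRHS](_ : ((D + 1) * st) ^+ 2 = _)%R.
        rewrite ler_pXn2r ?nnegrE ?edist_ge0 ?mulr_ge0 ?addr_ge0 ?(ltW st0)//.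
        apply: (le_trans (edist_triangle _ (z.2 + st *: w) _)); rewrite mulrDl mul1r; apply: lerD.
          by rewrite edistC edist_scale ger0_norm ?(ltW st0)// mulrC ler_wpM2r ?(ltW st0)// wsD.
        by apply: (ltW (lt_le_trans u3 _)); rewrite ler_piMl ?(ltW st0)// invf_le1// ler1n.
      by rewrite exprMn sqr_sqrtr// ltW.
pose I := [seq (w, k) | w <- ws, k <- iota 0 3].
have II i : i \in I -> (i.1 \in ws) /\ (i.2 <= 2)%N.
  by move=> /allpairsP[[w k] [wws]]; rewrite mem_iota => /= k2 ->.
have cover u : (enlarged_ind z u * v u)%:E <= \sum_(i <- I) (\1_(P i) u * v u)%:E.
  rewrite /enlarged_ind; case: (boolP (in_enlarged z u)) => [|_]; last by rewrite mul0r; apply: sume_ge0.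
  move=> /and3P[u1 u2 u3]; rewrite mul1r.
  have [w wws wu] := wsN st z.2 u.2 st0 u3.
  suff [k k2 tku] : exists2 k, (k <= 2)%N & (rho * tk k < u.1 <= tk k)%R.
    have iI : (w, k) \in I.
      by apply/allpairsP; exists (w, k); split => //; rewrite mem_iota.
    rewrite (big_rem _ iI)/= indicE mem_set; last by split => //=; rewrite in_itv.
    by rewrite mul1r leeDl// sume_ge0.
  have [h1|h1] := ltP (rho * tk 0)%R u.1; first by exists 0%N => //; rewrite h1/= /tk expr0 mul1r.
  have [h2|h2] := ltP (rho * tk 1)%R u.1; first by exists 1%N => //; rewrite h2/= (le_trans h1)// /tk expr0 expr1 mul1r.
  exists 2%N => //; apply/andP; split; last by rewrite (le_trans h2)// /tk mulrA -exprS.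
  apply: (le_lt_trans _ u1); rewrite /tk /rho -/t; move: z0; rewrite -/t !exprS expr0; lra.
apply: (@le_trans _ _ (\sum_(i <- I) A i)).
  rewrite /wmean -/n2 /A -ge0_sume_distrr; last by move=> i _; exact: Lnorm_ge0.
  apply: lee_wpmul2l; first by rewrite lee_fin powR_ge0.
  apply: (le_trans _ (@ge0_Lnorm_sum _ _ _ mu _ I xpredT q (fun i w => (\1_(P i) w * v w)%:E) q1 mPv Pv0)).
  apply: le_Lnorm => //.
  - by apply: measurable_weight => //; exact: measurable_enlarged_ind.
  - exact: measurable_fun_esum_seq.
  - by move=> u; rewrite !gee0_abs ?sume_ge0// lee_fin mulr_ge0 ?enlarged_ind_ge0.
have K0 : 0 <= schur_mean eta b p F z by exact: schur_mean_ge0.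
apply: (@le_trans _ _ (\sum_(i <- I) c1%:E * schur_mean eta b p F z)).
  rewrite big_seq [leRHS]big_seq; apply: lee_sum => -[w k] /II[/= ? ?]; exact: Ak.
rewrite -ge0_sume_distrl; last by move=> i _; rewrite lee_fin ltW.
apply: lee_wpmul2r => //.
rewrite sumEFin lee_fin big_const_seq count_predT iter_addr_0 size_allpairs size_iota -/N mulr_natl lerDl//.
Qed.

End whitney_control.

(** * Complex-valued functions *)

Section complex_functions.
Context {R : realType}.
Local Notation cabs := Normc.normc.
Local Open Scope complex_scope.

Lemma normcE (z : R[i]) : cabs z = Num.sqrt (complex.Re z ^+ 2 + complex.Im z ^+ 2).
Proof. by case: z. Qed.

Lemma normc_ge0 (z : R[i]) : 0 <= cabs z.
Proof. by rewrite normcE sqrtr_ge0. Qed.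

Lemma ler_Re_normc (z : R[i]) : `|complex.Re z| <= cabs z.
Proof. by rewrite normcE -sqrtr_sqr ler_wsqrtr// lerDl sqr_ge0. Qed.

Lemma ler_Im_normc (z : R[i]) : `|complex.Im z| <= cabs z.
Proof. by rewrite normcE -sqrtr_sqr ler_wsqrtr// lerDr sqr_ge0. Qed.

Lemma normc_le_sum (z : R[i]) : cabs z <= `|complex.Re z| + `|complex.Im z|.
Proof.
rewrite normcE -[leRHS]ger0_norm ?addr_ge0// -sqrtr_sqr ler_wsqrtr// sqrrD !real_normK ?num_real//.
by rewrite -addrA lerD2l lerDr mulrn_wge0// mulr_ge0.
Qed.

Lemma normcD (x y : R[i]) : cabs (x + y) <= cabs x + cabs y.
Proof. exact: le_normcD. Qed.

Section measurable.
Context d (T : measurableType d).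
Implicit Types f g : T -> R[i].

Lemma measurable_normc f : cmeasurable f -> measurable_fun setT (fun x => cabs (f x)).
Proof.
move=> [mr mi]; under eq_fun do rewrite normcE.
by apply: measurable_sqrt_comp; apply: measurable_funD; exact: measurable_funX.
Qed.

Lemma cmeasurable_cst (c : R[i]) : cmeasurable (fun=> c : R[i]) (T := T).
Proof. by split; exact: measurable_cst. Qed.

Lemma cmeasurableD f g : cmeasurable f -> cmeasurable g -> cmeasurable (fun x => f x + g x).
Proof.
move=> [fr fi] [gr gi]; split.
  by under eq_fun do rewrite raddfD; exact: measurable_funD.
by under eq_fun do rewrite raddfD; exact: measurable_funD.
Qed.

Lemma cmeasurableB f g : cmeasurable f -> cmeasurable g -> cmeasurable (fun x => f x - g x).
Proof.
move=> [fr fi] [gr gi]; split.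
  by under eq_fun do rewrite raddfB; exact: measurable_funB.
by under eq_fun do rewrite raddfB; exact: measurable_funB.
Qed.

Lemma cmeasurableM f g : cmeasurable f -> cmeasurable g -> cmeasurable (fun x => f x * g x).
Proof.
move=> [fr fi] [gr gi]; split.
  rewrite (_ : (fun x => _) = (fun x => complex.Re (f x) * complex.Re (g x) - complex.Im (f x) * complex.Im (g x))).
    by apply: measurable_funB; exact: measurable_funM.
  by apply/funext => x; case: (f x) (g x) => [? ?] [? ?].
rewrite (_ : (fun x => _) = (fun x => complex.Re (f x) * complex.Im (g x) + complex.Im (f x) * complex.Re (g x))).
  by apply: measurable_funD; exact: measurable_funM.
by apply/funext => x; case: (f x) (g x) => [? ?] [? ?].
Qed.

Lemma cmeasurable_zero_off (A : set T) f : measurable A -> cmeasurable f -> cmeasurable (zero_off A f).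
Proof.
move=> mA [fr fi]; split.
  rewrite (_ : (fun x => _) = (fun x => \1_A x * complex.Re (f x))).
    by apply: measurable_funM.
  by apply/funext => x; rewrite /zero_off /patch indicE; case: (x \in A); rewrite ?mul1r ?mul0r.
rewrite (_ : (fun x => _) = (fun x => \1_A x * complex.Im (f x))).
  by apply: measurable_funM.
by apply/funext => x; rewrite /zero_off /patch indicE; case: (x \in A); rewrite ?mul1r ?mul0r.
Qed.

Lemma cmeasurable_comp d' (T' : measurableType d') (h : T' -> T) f :
  measurable_fun setT h -> cmeasurable f -> cmeasurable (fun x => f (h x)).
Proof. by move=> mh [fr fi]; split; [exact: (measurableT_comp fr)|exact: (measurableT_comp fi)]. Qed.

Lemma normc_zero_off (A : set T) f x : cabs (zero_off A f x) = \1_A x * cabs (f x).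
Proof. by rewrite /zero_off /patch indicE; case: (x \in A); rewrite ?mul1r ?mul0r ?Normc.normc0. Qed.

End measurable.

End complex_functions.

(** * The means in the Z-norm *)

Section whitney_means.
Context {R : realType} {n : nat}.
Hypothesis n0 : (0 < n)%N.
Local Notation X := ('rV[R]_n).
Local Notation U := (R * 'rV[R]_n)%type.
Local Notation mu := (@dtdx R n).
Local Notation nu := (@dt_t R).
Local Notation lam := (@lebesgue_measure R).
Local Notation cabs := Normc.normc.
Local Open Scope ereal_scope.

Definition weighted_abs (beta : R) (u : U -> R[i]) (w : U) : R := (w.1 `^ (- beta) * cabs (u w))%R.

Lemma weighted_abs_ge0 beta u w : (0 <= weighted_abs beta u w)%R.
Proof. by rewrite mulr_ge0 ?powR_ge0 ?normc_ge0. Qed.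

Lemma measurable_powR1 (a : R) : measurable_fun setT (fun w : U => (w.1 `^ a)%R).
Proof. by apply: (measurableT_comp (measurable_powR _)); exact: measurable_fst_comp. Qed.

Lemma measurable_weighted_abs beta u : cmeasurable u -> measurable_fun setT (weighted_abs beta u).
Proof. by move=> mu_; apply: measurable_funM; [exact: measurable_powR1|exact: measurable_normc]. Qed.

Lemma dtdx_setT_gt0 : 0 < mu setT.
Proof.
have := @dtdx_dual_box_gt0 R n n0 (1%R, 0%R) ltr01; move=> /lt_le_trans; apply.
by rewrite le_measure ?inE//; exact: measurable_dual_box.
Qed.

(** The normalization of the spatial averages; it is comparable to z.1^(n/2). *)
Definition ball_volume (z : U) : \bar R := leb n (eball z.2 (Num.sqrt z.1)).

Lemma measurable_ball_volume : measurable_fun setT ball_volume.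
Proof.
rewrite (_ : ball_volume = fun z => \int[leb n]_y ((edist z.2 y < Num.sqrt z.1)%R%:R)%:E).
  apply: (@measurable_fun_fubini_tonelli_F _ _ _ _ _ (leb n)
    (fun zy : U * X => ((edist zy.1.2 zy.2 < Num.sqrt zy.1.1)%R%:R)%:E)).
    apply/measurable_EFinP; apply: measurable_bool; apply: measurable_fun_ltr.
      by apply: measurable_edist => //; exact: measurable_snd_comp.
    by apply: measurable_sqrt_comp; exact: measurable_fst_comp.
  by move=> zy; rewrite lee_fin.
apply/funext => z; rewrite /ball_volume.
have mB := measurable_eball z.2 (Num.sqrt z.1).
transitivity (\int[leb n]_y (\1_(eball z.2 (Num.sqrt z.1)) y)%:E); first by rewrite integral_indic// setIT.
apply: eq_integral => y _; rewrite indicE; congr ((nat_of_bool _)%:R%:E).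
by apply/idP/idP => [/set_mem//|h]; rewrite inE.
Qed.

Lemma ball_volume_bounds z : (0 < z.1)%R ->
  ((2 / n%:R) ^+ n * z.1 `^ (n%:R / 2) <= fine (ball_volume z) <= 2 ^+ n * z.1 `^ (n%:R / 2))%R.
Proof.
move=> z0; have := @leb_eball_sqrt_le R n z.2 1 z.1 ltr01 z0.
have := @leb_eball_sqrt_ge R n z.2 1 z.1 n0 ltr01 z0; rewrite !mul1r !mulr1 -/(ball_volume z) => h1 h2.
have fw : ball_volume z \is a fin_num by rewrite ge0_fin_numE ?measure_ge0//; apply: le_lt_trans h2 _; rewrite ltry.
by rewrite -!lee_fin fineK// h1 h2.
Qed.

Lemma whitney_mean_infty beta u z : whitney_mean +oo beta u z = wmean +oo whitney_ind (weighted_abs beta u) z.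
Proof.
rewrite wmean_infty unlock dtdx_setT_gt0 /whitney_mean; congr (ess_sup _ _); apply/funext => -[s y] /=.
rewrite ger0_norm; last by apply: mulr_ge0; [exact: whitney_ind_ge0|exact: weighted_abs_ge0].
rewrite /patch /whitney_ind.
case: (boolP (in_whitney z (s, y))) => h.
  rewrite mem_set ?mul1r//; move: h => /and3P[/= h1 h2 h3]; split => //=.
  by rewrite in_itv/= h1.
rewrite memNset ?mul0r// => -[/=]; rewrite in_itv/= => /andP[h1 h2] h3.
by move: h => /negP; apply; apply/and3P.
Qed.

Lemma in_whitney_gt0 (z w : U) : in_whitney z w -> (0 < z.1)%R /\ (0 < w.1)%R.
Proof.
move=> /and3P[h1 h2 h3]; have z0 : (0 < z.1)%R.
  by rewrite -sqrtr_gt0 (le_lt_trans _ h3)// edist_ge0.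
by split => //; apply: lt_le_trans h1; rewrite divr_gt0.
Qed.

(** Rewrites the iterated integral as one integral for dx dt/t; the factor w.1
    turns ds/s back into ds. *)
Lemma whitney_mean_real (a beta : R) (u : U -> R[i]) z : (0 < a)%R -> cmeasurable u ->
  whitney_mean a%:E beta u z =
  ((2 * inv_pos z.1 * (fine (ball_volume z))^-1)%:E *
     \int[mu]_w (w.1 * whitney_ind z w * weighted_abs beta u w `^ a)%:E) `^ a^-1.
Proof.
move=> a0 cu; rewrite /whitney_mean.
have mv := measurable_weighted_abs beta cu.
have mva : measurable_fun setT (fun w => weighted_abs beta u w `^ a)%R by exact: (measurableT_comp (measurable_powR _) mv).
have mgWz : measurable_fun setT (whitney_ind z).
  by have := measurable_fun_pair1 z (@measurable_whitney_ind R n).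
have [z0|z0] := ltP 0%R z.1; last first.
  rewrite /inv_pos ltNge z0/= mulr0 mul0r mul0e.
  rewrite (_ : \int[_]_(s in _) _ = 0) ?mule0//.
  rewrite integral0_eq// => s /=; rewrite in_itv/= => /andP[s1 s2].
  have z00 : z.1 = 0%R by move: s1 s2 z0; lra.
  rewrite (_ : eball _ _ = set0) ?integral_set0 ?mule0//.
  rewrite z00 sqrtr0; apply/seteqP; split => // y; rewrite /eball/= => h.
  by move: h; rewrite ltNge edist_ge0.
congr (_ `^ _); rewrite /inv_pos z0 -/(ball_volume z); pose c := ((fine (ball_volume z))^-1)%R.
rewrite -/c [(_ * c)%:E]EFinM -muleA; congr (_ * _); pose B := eball z.2 (Num.sqrt z.1).
have c0 : (0 <= c)%R by rewrite invr_ge0 fine_ge0.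
have mB : measurable B by exact: measurable_eball.
pose D := `[(z.1 / 2)%R, z.1]%classic : set R.
have gWE s y : (whitney_ind z (s, y) = \1_D s * \1_B y)%R.
  rewrite /whitney_ind /in_whitney !indicE -natrM mulnb; congr ((nat_of_bool _)%:R); apply/idP/andP.
    by move=> /and3P[h1 h2 h3]; rewrite !inE /D/= in_itv/= h1 h2.
  by rewrite !inE /D /B /eball/= in_itv/= => -[/andP[-> ->] ->].
have mF : measurable_fun setT (fun w : U => (w.1 * whitney_ind z w * weighted_abs beta u w `^ a)%:E).
  by apply/measurable_EFinP; apply: measurable_funM => //; apply: measurable_funM => //; exact: measurable_fst_comp.
pose F (w : U) := (\1_D w.1 * w.1 * \1_B w.2 * weighted_abs beta u w `^ a)%R.
have D0 s : D s -> (0 < s)%R.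
  by rewrite /D/= in_itv/= => /andP[h _]; apply: lt_le_trans h; rewrite divr_gt0.
have FE w : (w.1 * whitney_ind z w * weighted_abs beta u w `^ a)%:E = (F w)%:E.
  by case: w => s y; rewrite gWE /F/=; congr EFin; ring.
have F0 w : 0 <= (F w)%:E.
  rewrite lee_fin /F; apply: mulr_ge0 (powR_ge0 _ _); apply: mulr_ge0 => //.
  rewrite indicE; case: (boolP (w.1 \in D)) => [/set_mem/D0/ltW h|_]; first by rewrite mul1r.
  by rewrite mul0r.
rewrite integral_dtdx//; last by move=> w; rewrite FE.
have mG : measurable_fun setT (fun s : R => \int[leb n]_y (s * whitney_ind z (s, y) * weighted_abs beta u (s, y) `^ a)%:E).
  apply: (@measurable_fun_fubini_tonelli_F _ _ _ _ _ (leb n) (fun w : U => (w.1 * whitney_ind z w * weighted_abs beta u w `^ a)%:E)) => //.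
  by move=> w; rewrite FE.
have mFE : measurable_fun setT (fun w => (F w)%:E) by under eq_fun do rewrite -FE.
rewrite integral_dt_t//; last by move=> s; apply: integral_ge0 => y _; rewrite (FE (s, y)).
rewrite -ge0_integralZl_EFin//; last 2 first.
- by move=> s _; rewrite mule_ge0 ?lee_fin ?inv_pos_ge0//; apply: integral_ge0 => y _; rewrite (FE (s, y)).
- apply: emeasurable_funM => //; apply/measurable_EFinP; exact: measurable_inv_pos.
rewrite [LHS]integral_mkcond.
apply: eq_integral => s _; rewrite /patch.
case: ifPn => [/set_mem Ds|Ds].
  have s0 := D0 _ Ds; congr (_ * _); rewrite /inv_pos s0 -ge0_integralZl_EFin ?invr_ge0 ?(ltW s0)//; last 2 first.
  - by move=> y _; rewrite (FE (s, y)).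
  - exact: (measurable_fun_pair1 s mF).
  rewrite [LHS]integral_mkcond; apply: eq_integral => y _; rewrite /patch gWE !indicE -/B.
  have -> : (s \in D) = true by apply/mem_set.
  case: (y \in B); rewrite ?mul1r ?mulr1 ?mulr0 ?mul0r ?mule0//.
  by rewrite -EFinM mulrA mulVf ?gt_eqF// mul1r.
rewrite [X in _ * (_ * X)]integral0_eq ?mule0// => y _.
by rewrite gWE indicE (negbTE Ds) mul0r mulr0 mul0r.
Qed.

Lemma measurable_whitney_mean (q : \bar R) beta (u : U -> R[i]) : 0 < q -> cmeasurable u ->
  measurable_fun setT (whitney_mean q beta u).
Proof.
move=> q0 cu; have mv := measurable_weighted_abs beta cu.
move: q0 => /gt0_cases[->|[a a0 ->]].
  rewrite (_ : whitney_mean _ _ _ = wmean +oo whitney_ind (weighted_abs beta u)).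
    by apply: measurable_wmean => //; exact: measurable_whitney_ind.
  by apply/funext => z; exact: whitney_mean_infty.
rewrite (_ : whitney_mean _ _ _ = (fun z => ((2 * inv_pos z.1 * (fine (ball_volume z))^-1)%:E *
     \int[mu]_w (w.1 * whitney_ind z w * weighted_abs beta u w `^ a)%:E) `^ a^-1)); last first.
  by apply/funext => z; exact: whitney_mean_real.
apply: measurable_fun_poweR; apply: emeasurable_funM.
  apply/measurable_EFinP; apply: measurable_funM.
    by apply: measurable_funM => //; apply: (measurableT_comp (@measurable_inv_pos R)); exact: measurable_fst_comp.
  have := measurable_inv_comp (measurableT_comp (fine_measurable measurableT) measurable_ball_volume).
  rewrite (_ : (fun x => _) = (fun z => (fine (ball_volume z))^-1)%R)//.
  apply/funext => z /=; case: ifPn => //; rewrite -leNgt => h.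
  have : (0 <= fine (ball_volume z))%R by rewrite fine_ge0.
  by rewrite le_eqVlt ltNge h orbF => /eqP <-; rewrite invr0.
apply: (@measurable_integral_dtdx _ _ (fun zw : U * U => (zw.2.1 * whitney_ind zw.1 zw.2 * weighted_abs beta u zw.2 `^ a)%:E)).
  apply/measurable_EFinP; apply: measurable_funM.
    apply: measurable_funM; last exact: measurable_whitney_ind.
    exact: measurable_fst_comp.
  by apply: (measurableT_comp (measurable_powR _)); exact: (measurableT_comp mv measurable_snd).
move=> zw; rewrite lee_fin mulr_ge0 ?powR_ge0// /whitney_ind; case: (boolP (in_whitney _ _)) => h; last by rewrite mulr0.
by rewrite mulr1 ltW// (in_whitney_gt0 h).2.
Qed.

(** On the Whitney region s is comparable to t, and the volume of the ball to
    t^(n/2). *)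
Lemma whitney_mean_wmean (q : \bar R) : 0 < q -> exists2 C : R, (0 < C)%R &
  forall beta u z, cmeasurable u -> (0 < z.1)%R ->
  whitney_mean q beta u z <= C%:E * wmean q whitney_ind (weighted_abs beta u) z /\
  wmean q whitney_ind (weighted_abs beta u) z <= C%:E * whitney_mean q beta u z.
Proof.
move=> /gt0_cases[->|[a a0 ->]].
  by exists 1%R => // beta u z _ _; rewrite whitney_mean_infty !mul1e.
pose C1 := (2 * (n%:R / 2) ^+ n : R)%R; pose C2 := (2 ^+ n : R)%R.
have C10 : (0 < C1)%R by rewrite mulr_gt0// exprn_gt0// divr_gt0// ltr0n.
have C20 : (0 < C2)%R by rewrite exprn_gt0.
exists ((C1 + C2) `^ a^-1)%R; first by rewrite powR_gt0// addr_gt0.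
move=> beta u z cu z0.
rewrite whitney_mean_real//.
have mv := measurable_weighted_abs beta cu.
have mva : measurable_fun setT (fun w => weighted_abs beta u w `^ a)%R by exact: (measurableT_comp (measurable_powR _) mv).
have mgWz : measurable_fun setT (whitney_ind z).
  by have := measurable_fun_pair1 z (@measurable_whitney_ind R n).
have mf : measurable_fun setT (fun w => (whitney_ind z w * weighted_abs beta u w `^ a)%:E).
  by apply/measurable_EFinP; exact: measurable_funM.
have f0 w : 0 <= (whitney_ind z w * weighted_abs beta u w `^ a)%:E by rewrite lee_fin mulr_ge0 ?whitney_ind_ge0 ?powR_ge0.
have mF : measurable_fun setT (fun w : U => (w.1 * whitney_ind z w * weighted_abs beta u w `^ a)%:E).
  by apply/measurable_EFinP; apply: measurable_funM => //; apply: measurable_funM => //; exact: measurable_fst_comp.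
have F0 w : 0 <= (w.1 * whitney_ind z w * weighted_abs beta u w `^ a)%:E.
  rewrite lee_fin mulr_ge0 ?powR_ge0// /whitney_ind; case: (boolP (in_whitney _ _)) => h; last by rewrite mulr0.
  by rewrite mulr1 ltW// (in_whitney_gt0 h).2.
set I := \int[mu]_w (w.1 * _ * _)%:E.
pose J := \int[mu]_w (whitney_ind z w * weighted_abs beta u w `^ a)%:E.
have I0 : 0 <= I by exact: integral_ge0.
have J0 : 0 <= J by exact: integral_ge0.
have IJ : I <= (z.1)%:E * J.
  rewrite -ge0_integralZl_EFin ?(ltW z0)//; apply: ge0_le_integral => //; first exact: emeasurable_funM.
  move=> w _; rewrite -EFinM lee_fin mulrA ler_wpM2r ?powR_ge0// /whitney_ind; case: (boolP (in_whitney _ _)) => h; last by rewrite !mulr0.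
  by rewrite !mulr1; case/and3P: h.
have JI : (z.1 / 2)%:E * J <= I.
  rewrite -ge0_integralZl_EFin ?divr_ge0 ?(ltW z0)//; apply: ge0_le_integral => //.
  - by move=> w _; rewrite mule_ge0// lee_fin divr_ge0 ?(ltW z0).
  - exact: emeasurable_funM.
  move=> w _; rewrite -EFinM lee_fin mulrA ler_wpM2r ?powR_ge0// /whitney_ind; case: (boolP (in_whitney _ _)) => h; last by rewrite !mulr0.
  by rewrite !mulr1; case/and3P: h.
have wE : wmean a%:E whitney_ind (weighted_abs beta u) z = ((z.1 `^ (- (n%:R / 2)))%:E * J) `^ a^-1.
  rewrite poweRM ?lee_fin ?powR_ge0// poweR_EFin -powRrM mulNr /wmean LnormE; congr (_ * _ `^ _).
  apply: eq_integral => w _; rewrite gee0_abs ?lee_fin ?(mulr_ge0 (whitney_ind_ge0 _ _) (weighted_abs_ge0 _ _ _))//.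
  rewrite poweR_EFin powRM ?whitney_ind_ge0 ?weighted_abs_ge0//.
  by congr (_ * _)%:E; rewrite /whitney_ind; case: (in_whitney z w); rewrite ?powR1// powR0// gt_eqF.
pose tn := (z.1 `^ (n%:R / 2))%R.
have tn0 : (0 < tn)%R by exact: powR_gt0.
have tE : (z.1 `^ (- (n%:R / 2)) = tn^-1)%R by rewrite powRN.
have /andP[w1 w2] := ball_volume_bounds z0; rewrite -/tn in w1 w2.
set B := fine (ball_volume z) in w1 w2 *.
have B0 : (0 < B)%R.
  by apply: lt_le_trans w1; rewrite mulr_gt0// exprn_gt0// divr_gt0// ltr0n.
have ip : inv_pos z.1 = (z.1^-1)%R by rewrite /inv_pos z0.
have Ct : (0 <= C1 + C2)%R by rewrite addr_ge0// ltW.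
have tJ : 0 <= (tn^-1)%:E * J by rewrite mule_ge0// lee_fin invr_ge0 ltW.
have bI : 0 <= (2 / z.1 / B)%:E * I by rewrite mule_ge0// lee_fin !mulr_ge0 ?invr_ge0 ?(ltW B0) ?(ltW z0).
rewrite wE tE ip -!poweR_EFin -!poweRM ?lee_fin//.
split; apply: le_poweR.
- by rewrite invr_ge0 ltW.
- by rewrite mule_ge0// lee_fin !mulr_ge0 ?invr_ge0 ?(ltW B0) ?(ltW z0).
- apply: (le_trans (lee_wpmul2l _ IJ)); first by rewrite lee_fin !mulr_ge0 ?invr_ge0 ?(ltW B0) ?(ltW z0).
  rewrite !muleA -!EFinM; apply: lee_wpmul2r => //; rewrite lee_fin.
  have -> : (2 / z.1 / B * z.1 = 2 / B)%R by field; rewrite !gt_eqF.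
  apply: (@le_trans _ _ (C1 / tn)%R); last by rewrite ler_wpM2r ?invr_ge0 ?(ltW tn0)// lerDl ltW.
  rewrite /C1 -mulrA ler_pM2l// -[leRHS]invrK lef_pV2 ?posrE ?invr_gt0 ?divr_gt0 ?exprn_gt0 ?divr_gt0 ?ltr0n//.
  by rewrite invf_div mulrC -exprVn invf_div (le_trans _ w1)// mulrC.
- by rewrite invr_ge0 ltW.
- by rewrite mule_ge0// lee_fin invr_ge0 ltW.
- apply: (@le_trans _ _ ((C1 + C2)%:E * ((2 / z.1 / B)%:E * ((z.1 / 2)%:E * J)))); last first.
    by apply: lee_wpmul2l; [rewrite lee_fin|apply: lee_wpmul2l => //; rewrite lee_fin !mulr_ge0 ?invr_ge0 ?(ltW B0) ?(ltW z0)].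
  rewrite !muleA -!EFinM; apply: lee_wpmul2r => //; rewrite lee_fin.
  have -> : ((C1 + C2) * (2 / z.1 / B) * (z.1 / 2) = (C1 + C2) / B)%R by field; rewrite !gt_eqF.
  apply: (@le_trans _ _ (C2 / B)%R); last by rewrite ler_wpM2r ?invr_ge0 ?(ltW B0)// lerDr ltW.
  by rewrite ler_pdivlMr// mulrC ler_pdivrMr.
Qed.

End whitney_means.

(** * The kernel away from the diagonal *)

Section annuli.
Context {R : realType} {n : nat}.
Local Notation X := ('rV[R]_n).

Lemma measurable_annulus j (x : X) (t : R) : measurable (annulus j x t).
Proof.
rewrite /annulus; case: ifP => _; first exact: measurable_eball.
by apply: measurableD; exact: measurable_eball.
Qed.

Lemma unit_vector : (0 < n)%N -> exists e : X, edist 0 e = 1.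
Proof.
case: n => // m _; exists (\row_j (j == ord0)%:R); rewrite /edist big_ord_recl big1.
  by rewrite !mxE eqxx addr0 sub0r sqrrN expr1n sqrtr1.
by move=> i _; rewrite !mxE /= subr0 expr0n.
Qed.

(** For j >= 2 the inner radius of the annulus is at least twice the radius of
    the ball. The dimension must be positive for the annulus to be nonempty. *)
Lemma set_dist_annulus j (x : X) (t : R) : (0 < n)%N -> (2 <= j)%N -> 0 < t ->
  2 ^+ j * t / 4 <= set_dist (eball x (Num.sqrt t)) (annulus j x t) ^+ 2.
Proof.
move=> n0 j2 t0; have st0 : 0 < Num.sqrt t by rewrite sqrtr_gt0.
have p0 : 0 <= 2 ^+ j * t by rewrite mulr_ge0 ?exprn_ge0// ltW.
have -> : 2 ^+ j * t / 4 = (Num.sqrt (2 ^+ j * t) / 2) ^+ 2.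
  by rewrite expr_div_n sqr_sqrtr//; congr (_ / _); ring.
set rho := Num.sqrt (2 ^+ j * t).
have rho2 : 2 * Num.sqrt t <= rho.
  rewrite (_ : 2 * Num.sqrt t = Num.sqrt (2 ^+ 2 * t)).
    by rewrite ler_wsqrtr// ler_pM2r// ler_weXn2l// ler1n.
  by rewrite sqrtrM ?exprn_ge0// sqrtr_sqr ger0_norm.
have rho0 : 0 < rho by apply: lt_le_trans rho2; rewrite mulr_gt0.
have j1 : (j == 1%N) = false by case: j j2 {p0 rho rho2 rho0} => [|[]].
have h : rho / 2 <= set_dist (eball x (Num.sqrt t)) (annulus j x t).
  apply: lb_le_inf => [|_ [y xy [y' xy' ->]]].
    have [e e1] := unit_vector n0.
    exists (edist x (x + rho *: e)), x; first by rewrite /eball/= edistxx.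
    exists (x + rho *: e) => //; rewrite /annulus j1 /eball/=; rewrite edistC edist_scale e1 mulr1 gtr0_norm//.
    split; last by apply/negP; rewrite -leNgt.
    by rewrite /= ltr_sqrt ?mulr_gt0 ?exprn_gt0// ltr_pM2r// ltr_eXn2l// ltr1n.
  move: xy xy'; rewrite /annulus j1 /eball/= => xy [_ /negP]; rewrite -leNgt -/rho => xy'.
  have := edist_triangle x y y'; move: xy xy' rho2; lra.
by rewrite ler_pXn2r ?nnegrE ?divr_ge0 ?(ltW rho0)// (le_trans _ h)// divr_ge0// ltW.
Qed.

End annuli.

Section kernel_far.
Context {R : realType} {n : nat}.
Hypothesis n0 : (0 < n)%N.
Local Notation X := ('rV[R]_n).
Local Notation cabs := Normc.normc.
Variables (p0 r : \bar R) (kappa N N' : R).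
Variable K : R -> R -> (X -> R[i]) -> (X -> R[i]).
Hypotheses (p01 : (1 < p0)%E) (r1 : (1 < r)%E) (N'0 : 0 <= N') (NN : N' < N).
Hypothesis hdec : off_diagonal_decay p0 r kappa N K.
Hypothesis hlin : forall s t, 0 < s -> s < t -> linear_operator (leb n) setT (Lx p0) (Lx r) (K t s).
Local Open Scope ereal_scope.

Local Notation a := (kappa - n%:R / 2 * (einv p0 - einv r))%R.

Let p00 : 0 < p0. Proof. exact: lt_trans p01. Qed.
Let r0 : 0 < r. Proof. exact: lt_trans r1. Qed.

Lemma measurable_EFin_normc (f : X -> R[i]) : cmeasurable f ->
  measurable_fun setT (fun y => (cabs (f y))%:E).
Proof. by move=> cf; apply/measurable_EFinP; exact: measurable_normc. Qed.

Lemma Lx_zero_off p (A : set X) (f : X -> R[i]) : 0 < p -> measurable A -> Lx p f -> Lx p (zero_off A f).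
Proof.
move=> p0' mA [cf fy]; split; first exact: cmeasurable_zero_off.
apply: le_lt_trans fy; apply: le_Lnorm => //; [by apply: measurable_EFin_normc; exact: cmeasurable_zero_off|exact: measurable_EFin_normc|].
move=> y; rewrite !gee0_abs ?lee_fin ?normc_ge0// normc_zero_off ler_piMl ?normc_ge0//.
Qed.

(** The L^p0 norm of f at one time, with the decay that survives the summation
    over annuli. *)
Definition far_norm (N' : R) (t : R) (x : X) (f : X -> R[i]) : \bar R :=
  'N[leb n]_p0[(fun y => (pweight x t y `^ (- N') * cabs (f y))%:E)].

Lemma measurable_pweight x t c : measurable_fun setT (fun y : X => (pweight x t y `^ c)%R).
Proof.
apply: (measurableT_comp (measurable_powR _)).
by apply: measurable_funD => //; apply: measurable_funM => //; apply: measurable_funX; apply: measurable_edist.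
Qed.

Let h : R := (2^-1)%R.
Let rate : R := ((h `^ N) * (2 `^ N'))%R.

Let rate01 : (0 <= rate < 1)%R.
Proof.
rewrite /rate mulr_ge0 ?powR_ge0//=.
have -> : (h `^ N = (2 `^ N)^-1)%R.
  by rewrite /h -powR_inv1// -powRrM mulN1r powRN.
rewrite mulrC ltr_pdivrMr ?powR_gt0// mul1r.
have l2 : (0 < ln 2 :> R)%R by rewrite ln_gt0// ltr1n.
by rewrite /powR (negbTE (lt0r_neq0 _))// ltr_expR ltr_pM2r.
Qed.

(** One annulus. The off-diagonal factor is at most a multiple of ((t'-s)/t)^N
    2^(-jN), since the distance to the j-th annulus is of the order of 2^(j/2)
    sqrt t; on the annulus the weight (1+|x-y|^2/t)^N' costs at most 2^(jN').
    The case j = 1, where there is no distance, is either excluded by the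
    vanishing of f or harmless because t'-s is comparable to t. *)
Lemma annulus_term : exists2 C : R, (0 < C)%R & forall (t t' s : R) (x z : X) (f : X -> R[i]) (j : nat),
  (0 < t)%R -> (t' <= t)%R -> (t / 2 <= t')%R -> (0 < s)%R -> (s < t')%R -> Lx p0 f ->
  (edist x z <= 3 / 2 * Num.sqrt t)%R ->
  ((t / 4 < s)%R -> forall y, (edist x y < 4 * Num.sqrt t)%R -> f y = 0%R) -> (1 <= j)%N ->
  Lx_norm r (zero_off (eball z (Num.sqrt t')) (K t' s (zero_off (annulus j z t') f))) <=
  (C * (t `^ (-1 + a) * ((t' - s) / t) `^ (-1 + a + N)) * rate ^+ j)%:E * far_norm N' t x f.
Proof.
have [c hc] := hdec; pose c' := (`|c| + 1)%R.
have c'0 : (0 < c')%R by rewrite ltr_pwDr.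
exists (c' * 8 `^ N * (2 `^ N') ^+ 3)%R; first by rewrite !mulr_gt0 ?exprn_gt0 ?powR_gt0.
move=> t t' s x z f j t0 t't tt' s0 st' Lf xz fz j1.
have t'0 : (0 < t')%R by exact: lt_trans st'.
have st0 : (0 < Num.sqrt t)%R by rewrite sqrtr_gt0.
have sqt : (Num.sqrt t ^+ 2 = t)%R by rewrite sqr_sqrtr// ltW.
have sqt' : (Num.sqrt t' <= Num.sqrt t)%R by rewrite ler_wsqrtr.
pose A := annulus j z t'; have mA : measurable A by exact: measurable_annulus.
have LA := Lx_zero_off p00 mA Lf.
set D := set_dist (eball z (Num.sqrt t')) A.
have := hc s t' f z j s0 st' Lf j1; rewrite /= -/A -/D => h1.
have ts0 : (0 < t' - s)%R by rewrite subr_gt0.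
have W0 : 0 <= far_norm N' t x f by exact: Lnorm_ge0.
have RHS0 : 0 <= (c' * 8 `^ N * (2 `^ N') ^+ 3 * (t `^ (- 1 + a) * ((t' - s) / t) `^ (- 1 + a + N)) * rate ^+ j)%:E * far_norm N' t x f.
  rewrite mule_ge0// lee_fin !mulr_ge0 ?powR_ge0 ?exprn_ge0 ?powR_ge0 ?(ltW c'0)//.
  by case/andP: rate01.
have [/andP[/eqP jE ts]|hj] := boolP ((j == 1%N) && (t / 4 < s)%R).
  (* the innermost annulus lies where f vanishes *)
  have fA0 : zero_off A f = (fun=> 0%R).
    apply/funext => y; rewrite /zero_off /patch; case: ifPn => // /set_mem.
    rewrite /A jE /annulus eqxx /eball/= => zy; apply: fz => //.
    apply: (le_lt_trans (edist_triangle _ z _)).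
    have : (Num.sqrt (4 * t') <= 2 * Num.sqrt t)%R.
      have e4 : (4 = 2 ^+ 2 :> R)%R by rewrite -natrX.
      by rewrite sqrtrM// e4 sqrtr_sqr ger0_norm// ler_pM2l.
    move: xz zy st0; lra.
  apply: (le_trans _ RHS0); apply: (le_trans h1); rewrite fA0.
  rewrite /Lx_norm (_ : (fun x => _) = cst 0); last by apply/funext => y; rewrite Normc.normc0.
  by rewrite Lnorm0 ?mule0// gt_eqF.
(* Y E >= 1 turns the decay of the off-diagonal factor E into powers of
   (t'-s)/t and 2^-j *)
pose Y := (8 * ((t' - s) / t) * h ^+ j)%R.
have h0 : (0 < h)%R by rewrite invr_gt0.
have Y0 : (0 < Y)%R by rewrite !mulr_gt0 ?invr_gt0// exprn_gt0.
pose E := (1 + D ^+ 2 / (t' - s))%R.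
have E1 : (1 <= E)%R by rewrite lerDl divr_ge0 ?sqr_ge0// ltW.
have YE : (1 <= Y * E)%R.
  have [j2|j2] := leqP 2 j.
    have := set_dist_annulus z n0 j2 t'0; rewrite -/A -/D => hD.
    apply: (@le_trans _ _ (Y * (D ^+ 2 / (t' - s)))%R); last by rewrite ler_pM2l// lerDr.
    apply: (@le_trans _ _ (Y * (2 ^+ j * t' / 4 / (t' - s)))%R); last first.
      by rewrite ler_pM2l// ler_pM2r ?invr_gt0.
    have -> : (Y * (2 ^+ j * t' / 4 / (t' - s)) = 2 * t' / t * (h * 2) ^+ j)%R.
      by rewrite exprMn /Y; field; rewrite !gt_eqF.
    by rewrite /h mulVf// expr1n mulr1 ler_pdivlMr// mul1r; move: tt'; lra.
  have jE : j = 1%N by move: j1 j2; case: (j) => [|[]].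
  move: hj; rewrite jE eqxx/= -leNgt => st.
  rewrite -[leLHS]mulr1; apply: ler_pM => //.
  rewrite /Y jE expr1 /h.
  have -> : (8 * ((t' - s) / t) / 2 = 4 * (t' - s) / t)%R by field; rewrite gt_eqF.
  by rewrite ler_pdivlMr// mul1r; move: tt' st; lra.
have N0 : (0 <= N)%R by rewrite (le_trans N'0)// ltW.
have EN : (E `^ (- N) <= Y `^ N)%R.
  have E0 : (0 < E)%R by exact: lt_le_trans E1.
  rewrite powRN -[leLHS]mul1r ler_pdivrMr ?powR_gt0// -powRM ?(ltW Y0) ?(ltW E0)//.
  rewrite -[leLHS](_ : (1 : R) `^ N = 1)%R; last by rewrite powR1.
  exact: ler_powRl.
have YN : (Y `^ N = 8 `^ N * ((t' - s) / t) `^ N * (h `^ N) ^+ j)%R.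
  rewrite /Y powRM ?exprn_ge0 ?(ltW h0)//; last by rewrite !mulr_ge0 ?invr_ge0 ?(ltW ts0) ?(ltW t0).
  rewrite powRM ?divr_ge0 ?(ltW ts0) ?(ltW t0)//.
  by rewrite powR_exprn// ltW.
apply: (le_trans h1).
have N1 : Lx_norm p0 (zero_off A f) <= ((2 `^ N') ^+ (j + 3))%:E * far_norm N' t x f.
  rewrite /far_norm -LnormZ_ge0 ?exprn_ge0 ?powR_ge0//; last first.
    by apply/measurable_EFinP; apply: measurable_funM; [exact: measurable_pweight|exact: measurable_normc Lf.1].
  apply: le_Lnorm => //.
  - exact: measurable_EFin_normc LA.1.
  - apply: emeasurable_funM => //; apply/measurable_EFinP; apply: measurable_funM; [exact: measurable_pweight|exact: measurable_normc Lf.1].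
  move=> y; rewrite !gee0_abs ?lee_fin ?normc_ge0//; last first.
    by rewrite !mulr_ge0 ?exprn_ge0 ?powR_ge0 ?normc_ge0.
  rewrite normc_zero_off mulrA.
  apply: ler_wpM2r; first exact: normc_ge0.
  rewrite indicE; have [/set_mem Ay|_] := boolP (y \in A); last by rewrite mulr_ge0 ?exprn_ge0 ?powR_ge0.
  have zy : (edist z y < Num.sqrt (2 ^+ j.+1 * t'))%R.
    move: Ay; rewrite /A /annulus; case: ifP => [/eqP ->|_ []//].
    by rewrite /eball/= (_ : 2 ^+ 2 = 4)%R// -natrX.
  have pw : (pweight x t y <= 2 ^+ (j + 3))%R.
    have xy := edist_triangle x z y.
    have zy2 : (edist z y ^+ 2 <= 2 ^+ j.+1 * t)%R.
      apply: (@le_trans _ _ (2 ^+ j.+1 * t')%R); last by rewrite ler_pM2l// exprn_gt0.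
      rewrite -[leRHS]sqr_sqrtr ?mulr_ge0 ?exprn_ge0 ?(ltW t'0)//.
      by rewrite ler_pXn2r ?nnegrE ?edist_ge0 ?sqrtr_ge0// ltW.
    have xz2 : (edist x z ^+ 2 <= 9 / 4 * t)%R.
      rewrite (_ : 9 / 4 * t = (3 / 2 * Num.sqrt t) ^+ 2)%R; last by rewrite exprMn sqt; field.
      by rewrite ler_pXn2r ?nnegrE ?edist_ge0 ?mulr_ge0 ?divr_ge0 ?sqrtr_ge0.
    have xy2 : (edist x y ^+ 2 <= 2 * edist x z ^+ 2 + 2 * edist z y ^+ 2)%R.
      apply: (@le_trans _ _ ((edist x z + edist z y) ^+ 2)%R).
        by rewrite ler_pXn2r ?nnegrE ?addr_ge0 ?edist_ge0.
      have := sqr_ge0 (edist x z - edist z y)%R; nra.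
    have j2 : (2 <= 2 ^+ j :> R)%R by rewrite -{1}(expr1 2) ler_weXn2l// ler1n.
    rewrite /pweight -lerBrDl ler_pdivrMr//.
    apply: (le_trans xy2).
    apply: (@le_trans _ _ (9 / 2 * t + 4 * 2 ^+ j * t)%R).
      by move: xz2 zy2; rewrite [(2 ^+ j.+1)%R]exprS; lra.
    rewrite -mulrDl ler_pM2r// exprD; move: j2; lra.
  have pw0 := pweight_gt0 x y t0.
  rewrite powRN ler_pdivlMr ?powR_gt0// mul1r -powR_exprn//.
  by apply: ler_powRl => //; exact: ltW.
apply: (@le_trans _ _ ((c' * (t `^ (- 1 + a) * ((t' - s) / t) `^ (- 1 + a)) * (8 `^ N * ((t' - s) / t) `^ N * (h `^ N) ^+ j))%:E *
   (((2 `^ N') ^+ (j + 3))%:E * far_norm N' t x f))).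
  apply: (@le_trans _ _ ((c' * (t `^ (- 1 + a) * ((t' - s) / t) `^ (- 1 + a)) * (8 `^ N * ((t' - s) / t) `^ N * (h `^ N) ^+ j))%:E *
     Lx_norm p0 (zero_off A f))).
    apply: lee_wpmul2r; first exact: Lnorm_ge0.
    rewrite lee_fin -YN -powRM ?divr_ge0 ?(ltW t0) ?(ltW ts0)//.
    have -> : (t * ((t' - s) / t) = t' - s)%R by field; rewrite gt_eqF.
    rewrite -addrA -/a -mulrA -[leRHS]mulrA; set P := ((t' - s) `^ _)%R.
    have P0 : (0 <= P)%R by exact: powR_ge0.
    apply: (@le_trans _ _ (c' * (P * E `^ (- N)))%R).
      apply: ler_wpM2r; first by rewrite mulr_ge0 ?powR_ge0.
      by rewrite /c' (le_trans (ler_norm c))// lerDl.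
    by rewrite ler_pM2l// ler_wpM2l.
  apply: lee_wpmul2l => //.
  by rewrite lee_fin !mulr_ge0 ?powR_ge0 ?exprn_ge0 ?powR_ge0 ?(ltW c'0).
rewrite muleA -EFinM; apply: lee_wpmul2r => //.
rewrite lee_fin le_eqVlt; apply/orP; left; apply/eqP.
rewrite exprD /rate exprMn.
have -> : (((t' - s) / t) `^ (- 1 + a + N) = ((t' - s) / t) `^ (- 1 + a) * ((t' - s) / t) `^ N)%R.
  have tst : (0 < (t' - s) / t)%R by exact: divr_gt0.
  by rewrite powRD// (gt_eqF tst) implybT.
ring.
Qed.

Lemma ae_eq_Lx_norm p (B : set X) (f g : X -> R[i]) : 0 < p -> measurable B ->
  cmeasurable f -> cmeasurable g -> {ae leb n, forall y, B y -> f y = g y} ->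
  Lx_norm p (zero_off B f) = Lx_norm p (zero_off B g).
Proof.
move=> p0' mB cf cg fg; apply: ae_eq_Lnorm => //.
- by apply: measurable_EFin_normc; exact: cmeasurable_zero_off.
- by apply: measurable_EFin_normc; exact: cmeasurable_zero_off.
apply: filterS fg => y fgy; rewrite /zero_off /patch; case: ifPn => // /set_mem/fgy -> //.
Qed.

Lemma Lx_normD p (f g : X -> R[i]) : 1 <= p -> cmeasurable f -> cmeasurable g ->
  Lx_norm p (fun y => f y + g y)%R <= Lx_norm p f + Lx_norm p g.
Proof.
move=> p1 cf cg; have p0' : 0 < p by exact: lt_le_trans p1.
apply: (le_trans _ (@ge0_LnormD _ _ _ (leb n) p (fun y => (cabs (f y))%:E) (fun y => (cabs (g y))%:E) p1 _ _ _ _)).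
- apply: le_Lnorm => //.
  + by apply: measurable_EFin_normc; exact: cmeasurableD.
  + by apply: emeasurable_funD; exact: measurable_EFin_normc.
  by move=> y; rewrite !gee0_abs ?adde_ge0 ?lee_fin ?normc_ge0// normcD.
- exact: measurable_EFin_normc.
- exact: measurable_EFin_normc.
- by move=> y; rewrite lee_fin normc_ge0.
- by move=> y; rewrite lee_fin normc_ge0.
Qed.

(** As f has bounded support, finitely many annuli exhaust it, so that
    linearity of the kernel suffices to sum the bounds of the terms, which are
    geometric because N' < N. *)
Lemma annular_sum : exists2 C : R, (0 < C)%R & forall (t t' s : R) (x z : X) (f : X -> R[i]) (rho : R),
  (0 < t)%R -> (t' <= t)%R -> (t / 2 <= t')%R -> (0 < s)%R -> (s < t')%R -> Lx p0 f ->
  (edist x z <= 3 / 2 * Num.sqrt t)%R -> (forall y, (rho < edist z y)%R -> f y = 0%R) ->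
  ((t / 4 < s)%R -> forall y, (edist x y < 4 * Num.sqrt t)%R -> f y = 0%R) ->
  Lx_norm r (zero_off (eball z (Num.sqrt t')) (K t' s f)) <=
  (C * (t `^ (-1 + a) * ((t' - s) / t) `^ (-1 + a + N)))%:E * far_norm N' t x f.
Proof.
have [C C0 hC] := annulus_term; have /andP[q0 q1] := rate01.
exists (C / (1 - rate))%R; first by rewrite divr_gt0// subr_gt0.
move=> t t' s x z f rho t0 t't tt' s0 st' Lf xz frho fz.
have t'0 : (0 < t')%R by exact: lt_trans st'.
set Th := (t `^ _ * _)%R.
have Th0 : (0 <= Th)%R by rewrite mulr_ge0 ?powR_ge0.
have W0 : 0 <= far_norm N' t x f by exact: Lnorm_ge0.
pose D J : set X := eball z (Num.sqrt (2 ^+ J.+2 * t')).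
pose B := eball z (Num.sqrt t'); have mB : measurable B by exact: measurable_eball.
have mD J : measurable (D J) by exact: measurable_eball.
have LD J : Lx p0 (zero_off (D J) f) by exact: Lx_zero_off.
have LA j : Lx p0 (zero_off (annulus j z t') f) by apply: Lx_zero_off => //; exact: measurable_annulus.
have linK := hlin s0 st'.
have claim J : Lx_norm r (zero_off B (K t' s (zero_off (D J) f))) <=
    (C * Th * \sum_(j < J.+1) rate ^+ j.+1)%:E * far_norm N' t x f.
  elim: J => [|J ih].
    rewrite big_ord1; have := hC t t' s x z f 1%N t0 t't tt' s0 st' Lf xz fz isT.
    by rewrite /annulus eqxx /D (_ : 2 ^+ 2 = 4)%R// -natrX.
  have splitD : zero_off (D J.+1) f = (fun y => 1 * zero_off (D J) f y + zero_off (annulus J.+2 z t') f y)%R.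
    apply/funext => y; rewrite mul1r /zero_off /patch /annulus /=.
    have DD : D J `<=` D J.+1.
      move=> w; rewrite /D /eball/= => /lt_le_trans; apply; rewrite ler_wsqrtr// ler_pM2r//.
      by rewrite ler_weXn2l// ler1n.
    case: (boolP (y \in D J)) => [yD|yD].
      rewrite (mem_set (DD _ (set_mem yD))) memNset ?addr0// => -[_]; apply; exact: set_mem.
    rewrite add0r; case: (boolP (y \in D J.+1)) => [yD'|yD'].
      by rewrite mem_set//; split; [exact: set_mem|rewrite notin_setE in yD].
    by rewrite memNset// => -[yD'' _]; rewrite notin_setE in yD'.
  rewrite big_ord_recr/= mulrDr EFinD ge0_muleDl ?lee_fin; last 2 first.
  - apply: mulr_ge0; first by rewrite mulr_ge0// ltW.
    by apply: sumr_ge0 => i _; exact: exprn_ge0.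
  - by apply: mulr_ge0; [rewrite mulr_ge0// ltW|exact: exprn_ge0].
  have cK g : Lx p0 g -> cmeasurable (K t' s g) by move=> /(linop_maps linK)[].
  have -> : Lx_norm r (zero_off B (K t' s (zero_off (D J.+1) f))) =
     Lx_norm r (zero_off B (fun y => K t' s (zero_off (D J) f) y + K t' s (zero_off (annulus J.+2 z t') f) y)%R).
    apply: ae_eq_Lx_norm => //.
    - exact: cK.
    - by apply: cmeasurableD; exact: cK.
    rewrite splitD; apply: filterS (linop_linear linK 1%R (LD J) (LA J.+2)) => y h1 _.
    by rewrite (h1 I) mul1r.
  rewrite (_ : zero_off B _ = (fun y => zero_off B (K t' s (zero_off (D J) f)) y +
       zero_off B (K t' s (zero_off (annulus J.+2 z t') f)) y)%R); last first.
    by apply/funext => y; rewrite /zero_off /patch; case: ifP; rewrite ?addr0.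
  apply: (le_trans (Lx_normD (ltW r1) _ _)).
  - by apply: cmeasurable_zero_off => //; exact: cK.
  - by apply: cmeasurable_zero_off => //; exact: cK.
  apply: leeD => //.
  exact: hC t t' s x z f J.+2 t0 t't tt' s0 st' Lf xz fz isT.
have [J hJ] : exists J, (rho < Num.sqrt (2 ^+ J.+2 * t'))%R.
  have [rho0|rho0] := ltP rho 0%R; first by exists 0%N; rewrite (lt_le_trans rho0).
  pose J := (Num.truncn (rho ^+ 2 / t')); exists J.
  apply: (@le_lt_trans _ _ (Num.sqrt (rho ^+ 2))); first by rewrite sqrtr_sqr ler_norm.
  have P0 : (0 < 2 ^+ J.+2 * t')%R by rewrite mulr_gt0// exprn_gt0.
  rewrite (ltr_sqrt _ P0) -ltr_pdivrMr//.
  apply: (lt_le_trans (truncnS_gt _)).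
  rewrite -natrX ler_nat.
  have : (J.+2 < 2 ^ J.+2)%N by exact: ltn_expl.
  by move/ltnW; apply: leq_trans.
have fD : zero_off (D J) f = f.
  apply/funext => y; rewrite /zero_off /patch; case: ifPn => //; rewrite notin_setE /D /eball/= => /negP.
  by rewrite -leNgt => h1; rewrite frho// (lt_le_trans hJ).
have := claim J; rewrite fD => /le_trans; apply; apply: lee_wpmul2r => //.
have -> : (C / (1 - rate) * Th = C * Th * (1 - rate)^-1)%R by ring.
rewrite lee_fin; apply: ler_wpM2l; first by rewrite mulr_ge0// ltW.
have -> : (\sum_(j < J.+1) rate ^+ j.+1 = rate * ((1 - rate ^+ J.+1) / (1 - rate)))%R.
  under eq_bigr do rewrite exprS.
  rewrite -mulr_sumr; congr (_ * _)%R.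
  have q1' : (1 - rate != 0)%R by rewrite subr_eq0 eq_sym lt_eqF.
  apply: (mulfI q1'); rewrite [RHS]mulrC mulfVK//.
  by rewrite -[LHS]opprK -mulNr opprB -subrX1 opprB.
rewrite mulrA ler_piMl// ?invr_ge0 ?subr_ge0 ?(ltW q1)//.
rewrite mulr_ile1 ?(ltW q1)//; first by rewrite subr_ge0 exprn_ile1// ltW.
by rewrite gerBl exprn_ge0.
Qed.

(** The off-diagonal bound is for balls of radius sqrt t' while the Whitney
    region has radius sqrt t; finitely many translated smaller balls cover it. *)
Lemma kernel_far : exists2 C : R, (0 < C)%R & forall (t t' s : R) (x : X) (f : X -> R[i]) (rho : R),
  (0 < t)%R -> (t' <= t)%R -> (t / 2 <= t')%R -> (0 < s)%R -> (s < t')%R -> Lx p0 f ->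
  (forall y, (rho < edist x y)%R -> f y = 0%R) ->
  ((t / 4 < s)%R -> forall y, (edist x y < 4 * Num.sqrt t)%R -> f y = 0%R) ->
  Lx_norm r (zero_off (eball x (Num.sqrt t)) (K t' s f)) <=
  (C * (t `^ (-1 + a) * ((t' - s) / t) `^ (-1 + a + N)))%:E * far_norm N' t x f.
Proof.
have [C C0 hC] := annular_sum.
have [ws0 [D [D0 _ wsN]]] := @eball_net R n 1 2^-1 n0 ltac:(by rewrite invr_gt0).
(* centres farther than 3/2 from the origin are dropped: their balls miss the
   unit ball *)
pose ws := [seq w <- ws0 | (edist 0%R w <= 3 / 2)%R].
exists ((size ws)%:R * C + 1)%R; first by rewrite ltr_pwDr// mulr_ge0// ltW.
move=> t t' s x f rho t0 t't tt' s0 st' Lf frho fz.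
have t'0 : (0 < t')%R by exact: lt_trans st'.
set st := Num.sqrt t; have st0 : (0 < st)%R by rewrite sqrtr_gt0.
have linK := hlin s0 st'.
have cK : cmeasurable (K t' s f) by have [] := linop_maps linK Lf.
pose zs w := (x + st *: w)%R.
have W0 : 0 <= far_norm N' t x f by exact: Lnorm_ge0.
set Th := (t `^ _ * _)%R.
have Th0 : (0 <= Th)%R by rewrite mulr_ge0 ?powR_ge0.
apply: (@le_trans _ _ (\sum_(w <- ws) Lx_norm r (zero_off (eball (zs w) (Num.sqrt t')) (K t' s f)))).
  apply: (le_trans _ (@ge0_Lnorm_sum _ _ _ (leb n) _ ws xpredT r
     (fun w y => (cabs (zero_off (eball (zs w) (Num.sqrt t')) (K t' s f) y))%:E) (ltW r1) _ _)).
  - apply: le_Lnorm => //.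
    + by apply: measurable_EFin_normc; apply: cmeasurable_zero_off => //; exact: measurable_eball.
    + apply: measurable_fun_esum_seq => w.
      by apply: measurable_EFin_normc; apply: cmeasurable_zero_off => //; exact: measurable_eball.
    move=> y; rewrite !gee0_abs ?sume_ge0 ?lee_fin ?normc_ge0//; last by move=> w _; rewrite lee_fin normc_ge0.
    rewrite normc_zero_off indicE; have [/set_mem|_] := boolP (y \in _); last first.
      by rewrite mul0r; apply: sume_ge0 => w _; rewrite lee_fin normc_ge0.
    rewrite /eball/= => xy; rewrite mul1r.
    have xy1 : (edist x y < 1 * st)%R by rewrite mul1r.
    have [w wws wy] := wsN st x y st0 xy1.
    have wws' : w \in ws.
      rewrite mem_filter wws andbT -(ler_pM2l st0).
      have := edist_scale x w st; rewrite (gtr0_norm st0) => <-.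
      apply: (le_trans (edist_triangle _ y _)); rewrite [edist y x]edistC.
      move: wy xy; rewrite -/st; lra.
    rewrite (big_rem _ wws')/= normc_zero_off indicE mem_set ?mul1r ?leeDl//.
      by apply: sume_ge0 => w' _; rewrite lee_fin normc_ge0.
    rewrite /eball/=; apply: (lt_le_trans wy).
    rewrite -[leLHS]ger0_norm ?mulr_ge0 ?invr_ge0 ?(ltW st0)// -sqrtr_sqr ler_wsqrtr//.
    rewrite exprMn sqr_sqrtr ?(ltW t0)//; move: tt' t0; lra.
  - by move=> w; apply: measurable_EFin_normc; apply: cmeasurable_zero_off => //; exact: measurable_eball.
  - by move=> w y; rewrite lee_fin normc_ge0.
apply: (@le_trans _ _ (\sum_(w <- ws) (C * Th)%:E * far_norm N' t x f)).
  rewrite big_seq [leRHS]big_seq; apply: lee_sum => w; rewrite mem_filter => /andP[w32 _].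
  apply: (hC t t' s x (zs w) f (rho + edist x (zs w))%R) => //.
    by rewrite edistC edist_scale gtr0_norm// mulrC ler_wpM2r// ltW.
  move=> y h1; apply: frho; have := edist_triangle (zs w) x y; rewrite [edist (zs w) x]edistC; move: h1; lra.
rewrite -ge0_sume_distrl; last by move=> w _; rewrite lee_fin mulr_ge0// ltW.
apply: lee_wpmul2r => //.
rewrite sumEFin lee_fin big_const_seq count_predT iter_addr_0 -[leLHS]mulr_natl [leLHS]mulrA.
by apply: ler_wpM2r => //; rewrite lerDl.
Qed.

End kernel_far.

(** * Integrals over the time variable *)

Section power_comparison.
Context {R : realType}.

Lemma powR_quarter (x c : R) : 1 / 4 <= x <= 1 -> x `^ c <= 4 `^ `|c|.
Proof.
move=> /andP[x1 x2]; have x0 : 0 < x by apply: lt_le_trans x1; rewrite divr_gt0.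
have l4 : 0 <= ln 4 :> R by rewrite ln_ge0// ler1n.
rewrite /powR (gt_eqF x0) (gt_eqF (_ : 0 < 4))// ler_expR.
apply: (le_trans (ler_norm _)); rewrite normrM ler_wpM2l//.
have lx : ln x <= 0 by rewrite ln_le0// x2.
rewrite ler0_norm// -lnV ?posrE// ler_ln ?posrE ?invr_gt0//.
by rewrite -[leRHS]invrK lef_pV2 ?posrE ?invr_gt0// -(mul1r 4^-1).
Qed.

(** Powers of time are constant up to a factor on a Whitney region and on its
    enlargement. *)
Lemma powR_comparable (s t c : R) : 0 < t -> t / 4 <= s <= t -> s `^ c <= 4 `^ `|c| * t `^ c.
Proof.
move=> t0 /andP[s1 s2]; have s0 : 0 < s by apply: lt_le_trans s1; rewrite divr_gt0.
have -> : s `^ c = (s / t) `^ c * t `^ c.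
  by rewrite -powRM ?divr_ge0 ?(ltW s0) ?(ltW t0)// mulfVK// gt_eqF.
apply: ler_wpM2r; first exact: powR_ge0.
apply: powR_quarter; apply/andP; split; first by rewrite ler_pdivlMr//; move: s1; lra.
by rewrite ler_pdivrMr// mul1r.
Qed.

Local Open Scope ereal_scope.
Local Notation nu := (@dt_t R).

(** Either s <= t/4, where t'-s is comparable to t and the power of s/t is
    integrable for ds/s, or s > t/4, where s is comparable to t and the
    singularity is integrable. *)
Lemma time_kernel_integral (e b P : R) : (0 < e)%R -> (0 < P)%R -> (-1 < b * P)%R -> exists2 C : R, (0 < C)%R &
  forall t t' : R, (0 < t)%R -> (t / 2 <= t')%R -> (t' <= t)%R ->
  \int[nu]_s ((\1_(`]0%R, t'[%classic) s * ((s / t) `^ e * ((t' - s) / t) `^ b)) `^ P)%:E <= C%:E.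
Proof.
move=> e0 P0 bP.
have [C1 C10 h1] := @integral_scale_below R (e * P) (mulr_gt0 e0 P0).
have [C2 C20 h2] := @integral_singularity R (b * P) bP.
pose c4 : R := (4 `^ `|b * P|)%R; have c40 : (0 < c4)%R by exact: powR_gt0.
exists (c4 * C1 + C2)%R; first by rewrite addr_gt0// mulr_gt0.
move=> t t' t0 tt' t't.
pose f1 s := (\1_(`]0%R, t]%classic) s * (s / t) `^ (e * P))%R.
pose f2 s := (\1_(`](t / 4)%R, t'[%classic) s * ((t' - s) / t) `^ (b * P))%R.
have mlin : measurable_fun setT (fun s : R => (s / t)%R) by exact: measurable_funM.
have mlin2 : measurable_fun setT (fun s : R => ((t' - s) / t)%R) by apply: measurable_funM => //; exact: measurable_funB.
have mf1 : measurable_fun setT (fun s => (f1 s)%:E).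
  apply/measurable_EFinP; apply: measurable_funM => //.
  exact: (measurableT_comp (measurable_powR _)).
have mf2 : measurable_fun setT (fun s => (f2 s)%:E).
  apply/measurable_EFinP; apply: measurable_funM => //.
  exact: (measurableT_comp (measurable_powR _)).
have f10' s : (0 <= f1 s)%R by rewrite mulr_ge0 ?powR_ge0.
have f20' s : (0 <= f2 s)%R by rewrite mulr_ge0 ?powR_ge0.
have f10 s : 0 <= (f1 s)%:E by rewrite lee_fin.
have f20 s : 0 <= (f2 s)%:E by rewrite lee_fin.
apply: (@le_trans _ _ (\int[nu]_s (c4%:E * (f1 s)%:E + (f2 s)%:E))).
  apply: ge0_le_integral => //.
  - by move=> s _; rewrite lee_fin powR_ge0.
  - apply/measurable_EFinP; apply: (measurableT_comp (measurable_powR _)); apply: measurable_funM => //.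
    by apply: measurable_funM; exact: (measurableT_comp (measurable_powR _)).
  - by apply: emeasurable_funD => //; exact: emeasurable_funM.
  move=> s _; rewrite -EFinM -EFinD lee_fin [\1__ s]indicE.
  have [/set_mem|_] := boolP (s \in _); last first.
    by rewrite mul0r powR0 ?gt_eqF//; apply: addr_ge0 => //; apply: mulr_ge0 => //; exact: ltW.
  rewrite /= in_itv/= => /andP[s0 st']; rewrite mul1r.
  have st : (s <= t)%R by rewrite (le_trans (ltW st')).
  have ts0 : (0 <= (t' - s) / t)%R by rewrite divr_ge0 ?(ltW t0)// subr_ge0 ltW.
  have st0 : (0 <= s / t)%R by rewrite divr_ge0 ?(ltW t0)// ltW.
  rewrite powRM ?powR_ge0// -!powRrM.
  have [s4|s4] := leP s (t / 4)%R.
    apply: (@le_trans _ _ (c4 * f1 s)%R); last by rewrite lerDl.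
    rewrite /f1 indicE mem_set ?mul1r/=; last by rewrite in_itv/= s0.
    rewrite mulrC ler_wpM2r ?powR_ge0//; apply: powR_quarter.
    by rewrite ler_pdivlMr// ler_pdivrMr//; move: s0 t't tt' s4; lra.
  apply: (@le_trans _ _ (f2 s)); last by rewrite lerDr mulr_ge0// ltW.
  rewrite /f2 indicE mem_set ?mul1r/=; last by rewrite in_itv/= s4.
  rewrite ler_piMl ?powR_ge0//.
  rewrite -[leRHS](_ : (1 : R) `^ (e * P) = 1)%R; last by rewrite powR1.
  apply: ler_powRl => //; first by rewrite mulr_ge0// ltW.
  by rewrite ler_pdivrMr// mul1r.
rewrite ge0_integralD//; last 2 first.
- by move=> s _; rewrite mule_ge0// lee_fin ltW.
- exact: emeasurable_funM.
rewrite ge0_integralZl_EFin ?(ltW c40)// EFinD EFinM; apply: leeD.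
  apply: lee_wpmul2l; first by rewrite lee_fin ltW.
  apply: (le_trans _ (h1 t t0)); rewrite [leRHS]integral_mkcond le_eqVlt; apply/orP; left; apply/eqP.
  apply: eq_integral => s _; rewrite /f1 /patch indicE; case: ifP => _; by rewrite ?mul1r ?mul0r.
apply: (le_trans _ (h2 t t' t0 t't)); rewrite [leRHS]integral_mkcond le_eqVlt; apply/orP; left; apply/eqP.
by apply: eq_integral => s _; rewrite /f2 /patch indicE; case: ifP => _; rewrite ?mul1r ?mul0r.
Qed.

(** The factor 2 comes from estimating the real and the imaginary part
    separately. *)
Lemma normc_cintegral_le (t : R) (f : R -> R[i]) : cmeasurable f -> cintegrable `]0%R, t[ f ->
  (Normc.normc (cintegral `]0%R, t[ f))%:E <=
  \int[nu]_s (2 * (s * \1_(`]0%R, t[%classic) s) * Normc.normc (f s))%:E.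
Proof.
move=> cf [ir ii]; pose D := `]0%R, t[%classic : set R.
have mD : measurable D by exact: measurable_itv.
have D0 s : D s -> (0 < s)%R by rewrite /D/= in_itv/= => /andP[].
have mn := measurable_normc cf.
have part (g : R -> R) : measurable_fun setT g -> (@lebesgue_measure R).-integrable D (EFin \o g) ->
    (forall s, `|g s| <= Normc.normc (f s))%R ->
    `|(\int[lebesgue_measure]_(s in D) g s)%R|%:E <= \int[nu]_s ((s * \1_D s) * Normc.normc (f s))%:E.
  move=> mg ig gf; rewrite /Rintegral.
  have fi := @integrable_fin_num _ (measurableTypeR R) R lebesgue_measure D mD (EFin \o g) ig.
  rewrite -(fineK fi) /= -abse_EFin fineK//.
  apply: (le_trans (@le_abse_integral _ (measurableTypeR R) R lebesgue_measure D (EFin \o g) mD _)); first by have /integrableP[] := ig.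
  have mF : measurable_fun setT (fun s : R => (s * \1_D s * Normc.normc (f s))%:E).
    by apply/measurable_EFinP; apply: measurable_funM => //; exact: measurable_funM.
  have F0 s : 0 <= (s * \1_D s * Normc.normc (f s))%:E.
    rewrite lee_fin mulr_ge0 ?normc_ge0// indicE; have [/set_mem/D0/ltW h|_] := boolP (s \in D); by rewrite ?mulr1 ?mulr0.
  rewrite integral_dt_t// integral_mkcond.
  apply: ge0_le_integral => //.
  - by move=> s _; rewrite /patch; case: ifP.
  - apply/(measurable_restrictT _ _).1 => //; apply: measurable_funTS; apply: measurableT_comp => //.
    exact/measurable_EFinP.
  - by apply: emeasurable_funM => //; apply/measurable_EFinP; exact: measurable_inv_pos.
  move=> s _; rewrite /patch; case: ifPn => [Ds|_]; last by rewrite mule_ge0// lee_fin inv_pos_ge0.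
  have s0 := D0 _ (set_mem Ds).
  by rewrite indicE Ds mulr1 /inv_pos s0 -EFinM mulrA mulVf ?gt_eqF// mul1r lee_fin.
apply: (@le_trans _ _ (\int[nu]_s ((s * \1_D s) * Normc.normc (f s))%:E + \int[nu]_s ((s * \1_D s) * Normc.normc (f s))%:E)).
  apply: (@le_trans _ _ (`|(\int[lebesgue_measure]_(s in D) complex.Re (f s))%R|%:E + `|(\int[lebesgue_measure]_(s in D) complex.Im (f s))%R|%:E)).
    by rewrite -EFinD lee_fin; exact: normc_le_sum.
  apply: leeD; [apply: (part _ cf.1 ir) => s; exact: ler_Re_normc|apply: (part _ cf.2 ii) => s; exact: ler_Im_normc].
have F0 s : 0 <= (s * \1_D s * Normc.normc (f s))%:E.
  rewrite lee_fin mulr_ge0 ?normc_ge0// indicE; have [/set_mem/D0/ltW h|_] := boolP (s \in D); by rewrite ?mulr1 ?mulr0.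
have mF : measurable_fun setT (fun s : R => (s * \1_D s * Normc.normc (f s))%:E).
  by apply/measurable_EFinP; apply: measurable_funM => //; exact: measurable_funM.
rewrite -ge0_integralD// le_eqVlt; apply/orP; left; apply/eqP; apply: eq_integral => s _.
by rewrite -EFinD; congr EFin; rewrite /D; ring.
Qed.

Section finite_exponent.
Context d (T : measurableType d) (mu : {measure set T -> \bar R}).

(** For finite q, f^p <= 1_A + f^q pointwise, since f is 0 off A. *)
Lemma Lnorm_lty_exponent (A : set T) (f : T -> R) (p q : \bar R) : 0 < p -> p <= q ->
  measurable A -> mu A < +oo -> measurable_fun setT f -> (forall x, 0 <= f x)%R ->
  (forall x, ~ A x -> f x = 0%R) ->
  'N[mu]_q[(fun x => (f x)%:E)] < +oo -> 'N[mu]_p[(fun x => (f x)%:E)] < +oo.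
Proof.
move=> /gt0_cases[->|[a a0 ->]] aq mA muA mf f0 fA; first by move: aq; rewrite leye_eq => /eqP ->.
have q0 : 0 < q by rewrite (lt_le_trans _ aq)// lte_fin.
have mfa : measurable_fun setT (fun x => `|(f x)%:E| `^ a).
  by apply: measurable_fun_poweR; apply: measurableT_comp => //; exact/measurable_EFinP.
have fin (c : R) (g : T -> \bar R) : (0 <= c)%R -> measurable_fun setT g -> (forall x, 0 <= g x) ->
    {ae mu, forall x, (f x `^ a)%:E <= (c * \1_A x)%:E + g x} ->
    \int[mu]_x g x < +oo -> 'N[mu]_a%:E[(fun x => (f x)%:E)] < +oo.
  move=> c0 mg g0 fg gy; rewrite LnormE; apply: poweR_lty.
  apply: (@le_lt_trans _ _ (\int[mu]_x ((c * \1_A x)%:E + g x))).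
    apply: ae_ge0_le_integral => //.
    - by move=> x _; exact: poweR_ge0.
    - by move=> x _; rewrite adde_ge0// lee_fin mulr_ge0.
    - by apply: emeasurable_funD => //; apply/measurable_EFinP; exact: measurable_funM.
    by apply: filterS fg => x fgx _; rewrite gee0_abs ?lee_fin// poweR_EFin.
  rewrite ge0_integralD//; last 2 first.
  - by move=> x _; rewrite lee_fin mulr_ge0.
  - by apply/measurable_EFinP; exact: measurable_funM.
  apply: lte_add_pinfty => //.
  under eq_integral do rewrite EFinM.
  rewrite ge0_integralZl_EFin//; last exact/measurable_EFinP.
  by rewrite integral_indic// setIT lte_mul_pinfty.
move: q0 aq => /gt0_cases[->|[r r0 ->]] aq.
  set N := 'N[mu]_+oo[_] => Ny.
  have Nf : N \is a fin_num by rewrite ge0_fin_numE ?Lnorm_ge0.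
  apply: (fin (fine N `^ a)%R (cst 0)) => //; first exact: powR_ge0.
    apply: filterS (Lnormy_ae mu (fun x => (f x)%:E)) => x; rewrite -/N -(fineK Nf) gee0_abs ?lee_fin// => fN.
    rewrite /= addr0 indicE; have [_|/negP xA] := boolP (x \in A).
      by rewrite mulr1 ler_powRl// ltW.
    by rewrite fA ?powR0 ?gt_eqF ?mulr0// => /mem_set.
  by rewrite integral0.
rewrite lee_fin in aq => Ny.
apply: (fin 1%R (fun x => `|(f x)%:E| `^ r)) => //.
- by apply: measurable_fun_poweR; apply: measurableT_comp => //; exact/measurable_EFinP.
- by move=> x; exact: poweR_ge0.
- apply: nearW => x; rewrite mul1r gee0_abs; last by rewrite lee_fin.
  rewrite poweR_EFin -EFinD lee_fin.
  rewrite indicE; have [_|/negP xA] := boolP (x \in A); last first.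
    by rewrite fA ?powR0 ?gt_eqF ?add0r// => /mem_set.
  have [f1|f1] := leP (f x) 1%R.
    apply: (@le_trans _ _ 1%R); last by rewrite lerDl powR_ge0.
    by rewrite -[leRHS](_ : (1 : R) `^ a = 1)%R; [apply: ler_powRl => //; exact: ltW|rewrite powR1].
  apply: (@le_trans _ _ (f x `^ r)%R); last by rewrite lerDr.
  by apply: ler_powR => //; exact: ltW.
by rewrite -poweR_Lnorm ?gt_eqF//; exact: poweR_lty.
Qed.

End finite_exponent.

End power_comparison.

(** * The estimate of S on Whitney regions *)

Section far_estimate.
Context {R : realType} {n : nat}.
Hypothesis n0 : (0 < n)%N.
Local Notation X := ('rV[R]_n).
Local Notation U := (R * 'rV[R]_n)%type.
Local Notation mu := (@dtdx R n).
Local Notation nu := (@dt_t R).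
Local Notation cabs := Normc.normc.
Variables (p0 q r : \bar R) (kappa : R) (M : \bar R) (N N' : R).
Variable S : (U -> R[i]) -> (U -> R[i]).
Variable K : R -> R -> (X -> R[i]) -> (X -> R[i]).
Hypothesis hS : is_SIO p0 q r kappa M S K.
Hypotheses (N'0 : 0 <= N') (NN : N' < N).
Hypothesis hdec : off_diagonal_decay p0 r kappa N K.
Local Notation a := (kappa - n%:R / 2 * (einv p0 - einv r))%R.
(* makes (t'-s)^(a+N-1) integrable in the exponent conjugate to p0 *)
Hypothesis aN : einv p0 < a + N.
Variables (beta eta : R).
Hypothesis eta01 : 0 < eta < beta + 1.
Local Open Scope ereal_scope.

Let p01 : 1 < p0. Proof. by have [] := SIO_exponents hS. Qed.
Let q1 : 1 < q. Proof. by have [] := SIO_exponents hS. Qed.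
Let r1 : 1 < r. Proof. by have [] := SIO_exponents hS. Qed.
Let pq : p0 <= q. Proof. by have [] := SIO_exponents hS. Qed.
Let p00 : 0 < p0. Proof. exact: lt_trans p01. Qed.
Let q0 : 0 < q. Proof. exact: lt_trans q1. Qed.
Let r0 : 0 < r. Proof. exact: lt_trans r1. Qed.

Lemma cmeasurable_section (f : U -> R[i]) s : cmeasurable f -> cmeasurable (fun y : X => f (s, y)).
Proof. by move=> cf; apply: (cmeasurable_comp (pair1_measurable s) cf). Qed.

Lemma L_norm0E (f : U -> R[i]) p : L_norm p 0 f = 'N[mu]_p[(fun w => (cabs (f w))%:E)].
Proof. by rewrite /L_norm oppr0; apply: eq_Lnorm => w; rewrite powRr0 mul1r. Qed.

Lemma measurable_EFin_normcU (f : U -> R[i]) : cmeasurable f ->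
  measurable_fun setT (fun w => (cabs (f w))%:E).
Proof. by move=> cf; apply/measurable_EFinP; exact: measurable_normc. Qed.

Lemma measurable_Lnorm_section (F : U -> \bar R) p : 0 < p -> measurable_fun setT F ->
  measurable_fun setT (fun s => 'N[leb n]_p[(fun y => F (s, y))]).
Proof. by move=> p0' mF; exact: (@measurable_Lnorm _ _ _ _ _ (leb n) F p p0' mF). Qed.

(** Almost every time slice of f belongs to the domain of the kernel: it is in
    L^q and has bounded support, and p0 <= q. *)
Lemma Lx_section (f : U -> R[i]) l : Lspace q 0 f -> (forall w, ~ box l w -> f w = 0%R) ->
  {ae nu, forall s, Lx p0 (fun y => f (s, y))}.
Proof.
move=> [cf]; rewrite L_norm0E => fy f0; have mf := measurable_EFin_normcU cf.
rewrite Lnorm_dtdx// in fy.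
have mN : measurable_fun setT (fun s => 'N[leb n]_q[(fun y => (cabs (f (s, y)))%:E)]).
  exact: (measurable_Lnorm_section q0 mf).
apply: filterS (Lnorm_lty_ae q0 mN fy) => s; rewrite gee0_abs ?Lnorm_ge0// => sy.
have cs := cmeasurable_section s cf.
split => //.
apply: (@Lnorm_lty_exponent _ _ _ (leb n) (eball 0%R (2 ^+ l + 1)%R) (fun y => cabs (f (s, y))) p0 q) => //.
- exact: measurable_eball.
- apply: (le_lt_trans (leb_eball_le _ _)); last by rewrite ltry.
  by rewrite ltr_pwDr// exprn_ge0.
- exact: measurable_normc.
- by move=> y; exact: normc_ge0.
move=> y yB; rewrite f0 ?Normc.normc0// => -[_ /= h]; apply: yB.
by rewrite /eball/= (le_lt_trans h)// ltrDl.
Qed.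

Let P := ((1 - einv p0)^-1)%R.
Let b := (-1 + a + N)%R.

Let P0 : (0 < P)%R. Proof. by rewrite invr_gt0 subr_gt0 einv_lt1. Qed.

(** The part of f off the enlarged region, seen at one time t'. The kernel
    formula and Minkowski's inequality reduce the claim to [kernel_far] for
    almost every s; Hoelder's inequality in s for ds/s with exponent p0 then
    separates the explicit time factor, integrable by [time_kernel_integral],
    from the weighted norms of the slices of f. *)
Lemma far_at_time : exists2 C : R, (0 < C)%R & forall z (f : U -> R[i]) l, (0 < z.1)%R ->
  Lspace q 0 f -> (forall w, ~ box l w -> f w = 0%R) -> (forall w, in_enlarged z w -> f w = 0%R) ->
  (forall t' x', (z.1 / 2 <= t')%R -> (t' < z.1)%R -> (edist z.2 x' < Num.sqrt z.1)%R -> ~ supp_box f (t', x')) ->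
  {ae nu, forall t', (z.1 / 2 <= t')%R -> (t' < z.1)%R ->
    Lx_norm r (zero_off (eball z.2 (Num.sqrt z.1)) (fun y => S f (t', y))) <=
    (C * z.1 `^ (a + beta))%:E * 'N[mu]_p0[(fun w => (far_weight eta N' z w * weighted_abs beta f w)%:E)]}.
Proof.
have [C1 C10 h1] := @kernel_far R n n0 p0 r kappa N N' K p01 r1 N'0 NN hdec (@SIO_kernel_linear _ _ _ _ _ _ _ _ _ hS).
have e0 : (0 < 1 + beta - eta)%R by move: eta01; lra.
have bP : (-1 < b * P)%R.
  rewrite /P ltr_pdivlMr ?subr_gt0 ?einv_lt1// mulN1r opprB ltrBlDr /b; move: aN; lra.
have [C2 C20 h2] := @time_kernel_integral R (1 + beta - eta) b P e0 P0 bP.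
exists (2 * C1 * C2 `^ (1 - einv p0))%R; first by rewrite !mulr_gt0// powR_gt0.
move=> z f l z0 Lf f0 fW fsupp.
pose t := z.1; pose x := z.2; pose B := eball x (Num.sqrt t).
have mB : measurable B by exact: measurable_eball.
have cf := Lf.1.
have LcS : Lspace_c q f by split => //; exact: compact_ess_supp f0.
have cSf : cmeasurable (S f).
  by have [c [linS _]] := SIO_bounded hS; have [] := linop_maps linS Lf.
have ker := ae_lam_dt_t (SIO_kernel hS LcS).
set Far := 'N[mu]_p0[_].
(* the slices of the far mean: its L^p0 norm in s is the far mean itself *)
pose Psi s := 'N[leb n]_p0[(fun y => (far_weight eta N' z (s, y) * weighted_abs beta f (s, y))%:E)].
have mom : measurable_fun setT (fun w => (far_weight eta N' z w * weighted_abs beta f w)%:E).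
  apply: measurable_weight; first exact: measurable_far_weight2.
  exact: measurable_weighted_abs.
have mPsi : measurable_fun setT Psi by exact: (measurable_Lnorm_section p00 mom).
have FarE : Far = 'N[nu]_p0[Psi] by exact: Lnorm_dtdx.
have Psi0 s : 0 <= Psi s by exact: Lnorm_ge0.
have PsiE s : (0 < s)%R -> (s <= t)%R ->
    Psi s = ((s / t) `^ eta * s `^ (- beta))%:E * far_norm p0 N' t x (fun y => f (s, y)).
  move=> s0 st; rewrite /Psi /far_norm -LnormZ_ge0 ?mulr_ge0 ?powR_ge0//; last first.
    apply/measurable_EFinP; apply: measurable_funM; first exact: measurable_pweight.
    by apply: measurable_normc; exact: cmeasurable_section.
  by apply: eq_Lnorm => y; rewrite -EFinM /far_weight /= s0 st/= /weighted_abs/=; congr EFin; rewrite /t /x; ring.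
apply: filterS (ker) => t' + tt' t't.
have t'0 : (0 < t')%R by apply: lt_le_trans tt'; rewrite divr_gt0.
move=> /(_ t'0)[g [cg gK gS]].
pose D := `]0%R, t'[%classic : set R.
have mD : measurable D by exact: measurable_itv.
have D0 s : D s -> (0 < s)%R /\ (s < t')%R.
  by rewrite /D/= in_itv/= => /andP[].
pose G (sy : R * X) := (2 * (sy.1 * \1_D sy.1) * (\1_B sy.2 * cabs (g sy)))%R.
have sD0 s : (0 <= s * \1_D s)%R.
  by rewrite indicE; have [/set_mem/D0[/ltW h _]|_] := boolP (s \in D); rewrite ?mulr1 ?mulr0.
have G0 sy : 0 <= (G sy)%:E by rewrite lee_fin; apply: mulr_ge0; [exact: mulr_ge0|rewrite mulr_ge0 ?normc_ge0].
have mG : measurable_fun setT (fun sy => (G sy)%:E).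
  apply/measurable_EFinP; apply: measurable_funM.
    apply: measurable_funM => //; apply: measurable_funM; first exact: measurable_fst.
    exact: (measurableT_comp (measurable_indic mD) measurable_fst).
  apply: measurable_funM; first exact: (measurableT_comp (measurable_indic mB) measurable_snd).
  exact: measurable_normc.
have step1 : Lx_norm r (zero_off B (fun y => S f (t', y))) <= 'N[leb n]_r[(fun y => \int[nu]_s (G (s, y))%:E)].
  apply: ae_le_Lnorm => //.
  - by apply: measurable_EFin_normc; apply: cmeasurable_zero_off => //; exact: cmeasurable_section.
  - exact: (measurable_fun_fubini_tonelli_G (m1 := nu) (fun sy => (G sy)%:E) mG G0).
  apply: filterS gS => y gy.
  rewrite !gee0_abs ?lee_fin ?normc_ge0//; last exact: integral_ge0.
  rewrite normc_zero_off indicE; have [/set_mem By|yB] := boolP (y \in B); last first.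
    by rewrite mul0r; apply: integral_ge0 => s _; exact: G0.
  have [ig Sg] := gy (fsupp t' y tt' t't By).
  rewrite mul1r Sg; apply: (le_trans (normc_cintegral_le _ ig)).
    exact: (cmeasurable_comp (pair2_measurable y) cg).
  rewrite le_eqVlt; apply/orP; left; apply/eqP; apply: eq_integral => s _; rewrite /G /= [\1_B y]indicE mem_set// mul1r//.
(* the time factor; s^1 comes from writing ds as s ds/s *)
pose th s := (\1_D s * ((s / t) `^ (1 + beta - eta) * ((t' - s) / t) `^ b))%R.
have mth : measurable_fun setT th.
  apply: measurable_funM => //; apply: measurable_funM; apply: (measurableT_comp (measurable_powR _)).
    exact: measurable_funM.
  by apply: measurable_funM => //; exact: measurable_funB.
have th0 s : (0 <= th s)%R by rewrite !mulr_ge0 ?powR_ge0.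
have step3 : {ae nu, forall s, 'N[leb n]_r[(fun y => (G (s, y))%:E)] <=
    (2 * C1 * t `^ (a + beta))%:E * ((th s)%:E * Psi s)}.
  have gK' : {ae nu, forall s : R, (0 < s)%R -> (s < t')%R -> {ae leb n, forall y : X, ~ supp_box f (t', y) ->
      g (s, y) = K t' s (fun y : X => f (s, y)) y}}.
    apply: ae_lam_dt_t; case: gK => Z [mZ Z0 hZ]; exists Z; split => // s h; apply: hZ => h'; apply: h => s0 st.
    by apply: h'; rewrite s0.
  apply: filterS2 gK' (Lx_section Lf f0).
  move=> s gKs Lfs; have [/set_mem Ds|Ds] := boolP (s \in D); last first.
    rewrite (_ : (fun y => _) = cst 0); last first.
      by apply/funext => y; rewrite /G /= indicE (negbTE Ds) !mulr0 mul0r.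
    by rewrite Lnorm0 ?gt_eqF// !mule_ge0 ?lee_fin ?mulr_ge0 ?powR_ge0// ltW.
  have [s0 st'] := D0 _ Ds.
  have cK : cmeasurable (K t' s (fun y => f (s, y))).
    by have [] := linop_maps (SIO_kernel_linear hS s0 st') Lfs.
  have cgs := cmeasurable_section s cg.
  have -> : 'N[leb n]_r[(fun y => (G (s, y))%:E)] = (2 * s)%:E * Lx_norm r (zero_off B (fun y => g (s, y))).
    rewrite /Lx_norm -LnormZ_ge0 ?mulr_ge0 ?(ltW s0)//; last first.
      by apply: measurable_EFin_normc; exact: cmeasurable_zero_off.
    apply: eq_Lnorm => y; rewrite normc_zero_off /G /= indicE mem_set// mulr1 -EFinM//.
  rewrite (@ae_eq_Lx_norm R n r B _ (K t' s (fun y => f (s, y))))//; last first.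
    apply: filterS (gKs s0 st') => y h By; apply: h; exact: fsupp.
  have far_off y : (edist x 0%R + 2 ^+ l < edist x y)%R -> f (s, y) = 0%R.
    by move=> h; apply: f0 => -[_ /= h']; have := edist_triangle x 0%R y; move: h h'; lra.
  have near_off : (t / 4 < s)%R -> forall y, (edist x y < 4 * Num.sqrt t)%R -> f (s, y) = 0%R.
    move=> ts y xy; apply: fW; apply/and3P; split => //=.
    by rewrite (le_trans (ltW st'))// ltW.
  have := h1 t t' s x (fun y => f (s, y)) _ z0 (ltW t't) tt' s0 st' Lfs far_off near_off.
  have s20 : 0 <= (2 * s)%:E by rewrite lee_fin mulr_ge0// ltW.
  move=> /(lee_wpmul2l s20)/le_trans; apply.
  rewrite PsiE//; last by rewrite (le_trans (ltW st'))// ltW.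
  rewrite !muleA -!EFinM; apply: lee_wpmul2r; first exact: Lnorm_ge0.
  rewrite lee_fin le_eqVlt; apply/orP; left; apply/eqP.
  rewrite /th indicE mem_set// mul1r -/b.
  have u0 : (0 < s / t)%R by rewrite divr_gt0.
  have E1 : ((s / t) `^ (1 + beta - eta) * ((s / t) `^ eta * s `^ (- beta)) = s / t * t `^ (- beta))%R.
    have -> : (s `^ (- beta) = (s / t) `^ (- beta) * t `^ (- beta))%R.
      by rewrite -powRM ?(ltW u0) ?(ltW z0)// mulfVK// gt_eqF.
    rewrite !mulrA -!powRD ?(gt_eqF u0) ?implybT//.
    by have -> : (1 + beta - eta + eta - beta = 1)%R; [ring|rewrite powRr1// ltW].
  have E2 : (t `^ (a + beta) * t `^ (- beta) = t * t `^ (-1 + a))%R.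
    rewrite -[X in (X * t `^ (-1 + a))%R](@powRr1 R t) ?(ltW z0)// -!powRD ?(gt_eqF z0) ?implybT//.
    by congr (_ `^ _)%R; ring.
  transitivity (2 * C1 * (t `^ (a + beta) * ((s / t) `^ (1 + beta - eta) * ((s / t) `^ eta * s `^ (- beta)))) * ((t' - s) / t) `^ b)%R; last by ring.
  rewrite E1 [(t `^ (a + beta) * _)%R]mulrCA E2.
  by field; rewrite gt_eqF.
apply: (le_trans step1).
apply: (le_trans (@minkowski_integral _ _ _ _ _ nu (leb n) (fun sy => (G sy)%:E) r (ltW r1) mG G0)).
apply: (@le_trans _ _ (\int[nu]_s ((2 * C1 * t `^ (a + beta))%:E * ((th s)%:E * Psi s)))).
  apply: ae_ge0_le_integral => //.
  - by move=> s _; exact: Lnorm_ge0.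
  - exact: (measurable_Lnorm_section r0 mG).
  - by move=> s _; rewrite !mule_ge0 ?lee_fin ?mulr_ge0 ?powR_ge0// ltW.
  - by apply: emeasurable_funM => //; apply: emeasurable_funM => //; exact/measurable_EFinP.
  by apply: filterS step3 => s h _.
rewrite ge0_integralZl_EFin ?mulr_ge0 ?powR_ge0 ?(ltW C10)//; last 2 first.
- by move=> s _; rewrite mule_ge0 ?lee_fin.
- by apply: emeasurable_funM => //; exact/measurable_EFinP.
have -> : (2 * C1 * C2 `^ (1 - einv p0) * z.1 `^ (a + beta) = (2 * C1 * t `^ (a + beta)) * C2 `^ (1 - einv p0))%R.
  by rewrite /t; ring.
rewrite [(_ * C2 `^ _)%:E]EFinM -[leRHS]muleA; apply: lee_wpmul2l.
  by rewrite lee_fin !mulr_ge0 ?powR_ge0// ltW.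
rewrite FarE; apply: ehoelder => //.
exact: (h2 t t' z0 tt' (ltW t't)).
Qed.

Lemma Lnorm_indic_le1 (A : set R) : measurable A -> nu A <= 1 -> 'N[nu]_r[(fun s => (\1_A s)%:E)] <= 1.
Proof.
move=> mA A1; move: r0 => /gt0_cases[->|[c c0 ->]].
  apply/Lnormy_le; split => //; apply: nearW => s.
  by rewrite gee0_abs ?lee_fin// indicE lern1 leq_b1.
rewrite Lnorm_le_integral// (_ : 1 `^ c = 1); last by rewrite poweR_EFin powR1.
apply: le_trans A1; rewrite (_ : nu A = \int[nu]_s (\1_A s)%:E); last by rewrite integral_indic// setIT.
rewrite le_eqVlt; apply/orP; left; apply/eqP; apply: eq_integral => s _.
rewrite gee0_abs ?lee_fin// poweR_EFin indicE; case: (s \in A); first by rewrite powR1.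
by rewrite powR0// gt_eqF.
Qed.

(** Integrates [far_at_time] over the times of the Whitney region, which have
    measure at most 1 for ds/s. The powers of t match because the exponent of
    t in [far_at_time] is the parabolic scaling exponent. *)
Lemma far_wmean : exists2 C : R, (0 < C)%R & forall z (f : U -> R[i]) l, (0 < z.1)%R ->
  Lspace q 0 f -> (forall w, ~ box l w -> f w = 0%R) -> (forall w, in_enlarged z w -> f w = 0%R) ->
  (forall t' x', (z.1 / 2 <= t')%R -> (t' < z.1)%R -> (edist z.2 x' < Num.sqrt z.1)%R -> ~ supp_box f (t', x')) ->
  wmean r whitney_ind (weighted_abs (beta + kappa) (S f)) z <= C%:E * wmean p0 (far_weight eta N') (weighted_abs beta f) z.
Proof.
have [C1 C10 h1] := far_at_time.
exists (4 `^ `|- (beta + kappa)| * C1)%R; first by rewrite mulr_gt0// powR_gt0.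
move=> z f l z0 Lf f0 fW fsupp; have := h1 z f l z0 Lf f0 fW fsupp.
have cSf : cmeasurable (S f).
  by have [c [linS _]] := SIO_bounded hS; have [] := linop_maps linS Lf.
set t := z.1; rewrite /wmean -/t; set Far := 'N[mu]_p0[_] => h.
have Far0 : 0 <= Far by exact: Lnorm_ge0.
have C40 : (0 < 4 `^ `|- (beta + kappa)| * C1)%R by rewrite mulr_gt0// powR_gt0.
have [Fary|] := ltP Far +oo; last first.
  rewrite leye_eq => /eqP ->.
  have tp : (0 < t `^ (- (n%:R / 2 * einv p0)))%R by exact: powR_gt0.
  by rewrite gt0_muley ?lte_fin// gt0_muley ?lte_fin// leey.
pose F := fine Far; have FE : Far = F%:E by rewrite fineK// ge0_fin_numE.
have F0 : (0 <= F)%R by exact: fine_ge0.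
pose k := (4 `^ `|- (beta + kappa)| * t `^ (- (beta + kappa)) * (C1 * t `^ (a + beta) * F))%R.
have k0 : (0 <= k)%R by rewrite !mulr_ge0 ?powR_ge0// ltW.
pose A := `[(t / 2)%R, t]%classic : set R.
have mA : measurable A by exact: measurable_itv.
have mw : measurable_fun setT (fun w => (whitney_ind z w * weighted_abs (beta + kappa) (S f) w)%:E).
  by apply: measurable_weight; [exact: measurable_whitney_ind|exact: measurable_weighted_abs].
have Nk : 'N[mu]_r[(fun w => (whitney_ind z w * weighted_abs (beta + kappa) (S f) w)%:E)] <= k%:E.
  rewrite Lnorm_dtdx//.
  apply: (@le_trans _ _ 'N[nu]_r[(fun s => k%:E * (\1_A s)%:E)]); last first.
    rewrite LnormZ_ge0//; last exact/measurable_EFinP.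
    rewrite -[leRHS]mule1; apply: lee_wpmul2l; first by rewrite lee_fin.
    apply: Lnorm_indic_le1 => //; apply: (le_trans (@dt_t_itv_le R A (t / 2) t mA _ _)) => //.
      by rewrite divr_gt0//= ler_pdivrMr// ler_peMr ?ler1n// ltW.
    rewrite lee_fin (_ : (t - t / 2) / (t / 2) = 1)%R//.
    by field; rewrite gt_eqF.
  apply: ae_le_Lnorm => //.
  - exact: (measurable_Lnorm_section r0 mw).
  - by apply: emeasurable_funM => //; exact/measurable_EFinP.
  (* [far_at_time] is about times strictly before t *)
  have net : {ae nu, forall s, s <> t}.
    have net' : {ae nu, forall s, (0 < s)%R -> s <> t}.
      apply: ae_lam_dt_t; exists [set t]; split; [exact: measurable_set1|exact: lebesgue_measure_set1|].
      by move=> s /=; apply: contra_notP => h1' _.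
    by apply: filterS2 net' (@ae_dt_t_gt0 R) => s h1' /h1'.
  apply: filterS2 net h => s st hs.
  rewrite !gee0_abs ?Lnorm_ge0//; last by rewrite mule_ge0// lee_fin.
  have [/set_mem As|As] := boolP (s \in A); last first.
    rewrite (_ : (fun y => _) = cst 0); last first.
      apply/funext => y; rewrite /whitney_ind (_ : in_whitney z (s, y) = false) ?mul0r//.
      apply/negP => /and3P[/= s1 s2 _]; move: As; rewrite notin_setE /A/= in_itv/= s1 s2//.
    by rewrite Lnorm0 ?gt_eqF// mule_ge0// lee_fin.
  move: (As); rewrite /A/= in_itv/= => /andP[s1 s2].
  have s0 : (0 < s)%R by apply: lt_le_trans s1; rewrite divr_gt0.
  have st' : (s < t)%R by rewrite lt_neqAle s2 andbT; apply/eqP.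
  rewrite indicE mem_set// mule1.
  pose B := eball z.2 (Num.sqrt t).
  have -> : 'N[leb n]_r[(fun y => (whitney_ind z (s, y) * weighted_abs (beta + kappa) (S f) (s, y))%:E)] =
      (s `^ (- (beta + kappa)))%:E * Lx_norm r (zero_off B (fun y => S f (s, y))).
    rewrite /Lx_norm -LnormZ_ge0 ?powR_ge0//; last first.
      apply: measurable_EFin_normc; apply: cmeasurable_zero_off; first exact: measurable_eball.
      exact: cmeasurable_section.
    apply: eq_Lnorm => y; rewrite normc_zero_off -EFinM /weighted_abs mulrCA /=; congr (_ * (_ * _))%:E.
    rewrite /whitney_ind /in_whitney /= -/t s1 s2/= indicE; congr ((nat_of_bool _)%:R).
    by apply/idP/idP => [h2|/set_mem//]; rewrite inE.
  apply: (@le_trans _ _ ((4 `^ `|- (beta + kappa)| * t `^ (- (beta + kappa)))%:E * Lx_norm r (zero_off B (fun y => S f (s, y))))).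
    apply: lee_wpmul2r; first exact: Lnorm_ge0.
    rewrite lee_fin; apply: powR_comparable => //; rewrite s2 andbT.
    by move: s1 z0; rewrite -/t; lra.
  rewrite /k [leRHS]EFinM; apply: lee_wpmul2l; first by rewrite lee_fin !mulr_ge0 ?powR_ge0.
  by rewrite [leRHS]EFinM -FE; exact: hs.
apply: (le_trans (lee_wpmul2l _ Nk)); first by rewrite lee_fin powR_ge0.
rewrite FE -!EFinM lee_fin /k le_eqVlt; apply/orP; left; apply/eqP.
have tz : (t == 0%R) = false by rewrite gt_eqF.
have E1 : (t `^ (- (n%:R / 2 * einv r)) * t `^ (- (beta + kappa)) * t `^ (a + beta) = t `^ (- (n%:R / 2 * einv p0)))%R.
  rewrite -!powRD ?tz ?implybT//; congr (_ `^ _)%R; ring.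
rewrite -E1; ring.
Qed.

(** The weight in the target space of S is the one for which the bound is
    scale invariant, so that the powers of t cancel. *)
Lemma loc_wmean : exists2 C : R, (0 < C)%R & forall z (f : U -> R[i]), (0 < z.1)%R ->
  Lspace q 0 f -> (forall w, ~~ in_enlarged z w -> f w = 0%R) ->
  wmean r whitney_ind (weighted_abs (beta + kappa) (S f)) z <= C%:E * wmean q enlarged_ind (weighted_abs beta f) z.
Proof.
have [c [linS cS]] := SIO_bounded hS.
pose g := (kappa - n%:R / 2 * (einv q - einv r))%R.
pose e := (g - (beta + kappa))%R.
pose c' := (`|c| + 1)%R; have c'0 : (0 < c')%R by rewrite ltr_pwDr.
pose c4 (x : R) : R := (4 `^ `|x|)%R.
have c40 x : (0 < c4 x)%R by exact: powR_gt0.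
exists (c4 e * c4 beta * c')%R; first by rewrite !mulr_gt0.
move=> z f z0 Lf fW; set t := z.1.
have [cSf _] := linop_maps linS Lf.
have mabs := measurable_weighted_abs beta Lf.1.
have N1 : 'N[mu]_r[(fun w => (whitney_ind z w * weighted_abs (beta + kappa) (S f) w)%:E)] <= (c4 e * t `^ e)%:E * L_norm r g (S f).
  rewrite /L_norm -LnormZ_ge0 ?mulr_ge0 ?powR_ge0//; last first.
    by apply/measurable_EFinP; exact: measurable_weighted_abs.
  apply: le_Lnorm => //.
  - by apply: measurable_weight; [exact: measurable_whitney_ind|exact: measurable_weighted_abs].
  - by apply: emeasurable_funM => //; apply/measurable_EFinP; exact: measurable_weighted_abs.
  move=> w; rewrite !gee0_abs ?lee_fin ?(mulr_ge0 (whitney_ind_ge0 _ _) (weighted_abs_ge0 _ _ _))//; last first.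
    by rewrite !mulr_ge0 ?powR_ge0 ?normc_ge0.
  rewrite /whitney_ind; case: (boolP (in_whitney z w)) => [/and3P[w1 w2 w3]|_]; last first.
    by rewrite mul0r !mulr_ge0 ?powR_ge0 ?normc_ge0.
  rewrite mul1r /weighted_abs !mulrA; apply: ler_wpM2r; first exact: normc_ge0.
  have w0 : (0 < w.1)%R by apply: lt_le_trans w1; rewrite divr_gt0.
  have -> : (w.1 `^ (- (beta + kappa)) = w.1 `^ e * w.1 `^ (- g))%R.
    by rewrite -powRD ?(gt_eqF w0) ?implybT//; congr (_ `^ _)%R; rewrite /e; ring.
  apply: ler_wpM2r; first exact: powR_ge0.
  by apply: powR_comparable => //; rewrite w2 andbT; move: w1 z0; rewrite -/t; lra.
have N2 : L_norm q 0 f <= (c4 beta * t `^ beta)%:E * 'N[mu]_q[(fun w => (enlarged_ind z w * weighted_abs beta f w)%:E)].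
  have mwst : measurable_fun setT (fun w => (enlarged_ind z w * weighted_abs beta f w)%:E).
    by apply: measurable_weight => //; exact: measurable_enlarged_ind.
  rewrite L_norm0E -LnormZ_ge0 ?mulr_ge0 ?powR_ge0//.
  apply: le_Lnorm => //; first exact: measurable_EFin_normcU Lf.1.
    exact: emeasurable_funM.
  move=> w; rewrite !gee0_abs ?lee_fin ?normc_ge0//; last first.
    by rewrite !mulr_ge0 ?powR_ge0 ?normc_ge0 ?enlarged_ind_ge0.
  rewrite /enlarged_ind; case: (boolP (in_enlarged z w)) => [/and3P[w1 w2 w3]|/fW ->]; last first.
    by rewrite Normc.normc0 mul0r mulr0.
  rewrite mul1r /weighted_abs !mulrA ler_peMl ?normc_ge0//.
  have w0 : (0 < w.1)%R by apply: lt_trans w1; rewrite divr_gt0.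
  rewrite powRN ler_pdivlMr ?powR_gt0// mul1r.
  by apply: powR_comparable => //; rewrite w2 ltW.
rewrite /wmean -/t.
have tz : (t == 0%R) = false by rewrite gt_eqF.
apply: (@le_trans _ _ ((t `^ (- (n%:R / 2 * einv r)))%:E * ((c4 e * t `^ e)%:E * (c'%:E * ((c4 beta * t `^ beta)%:E *
    'N[mu]_q[(fun w => (enlarged_ind z w * weighted_abs beta f w)%:E)]))))); last first.
  rewrite !muleA -!EFinM; apply: lee_wpmul2r; first exact: Lnorm_ge0.
  rewrite lee_fin le_eqVlt; apply/orP; left; apply/eqP.
  have <- : (t `^ (- (n%:R / 2 * einv r)) * t `^ e * t `^ beta = t `^ (- (n%:R / 2 * einv q)))%R.
    by rewrite -!powRD ?tz ?implybT//; congr (_ `^ _)%R; rewrite /e /g; ring.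
  ring.
apply: lee_wpmul2l; first by rewrite lee_fin powR_ge0.
apply: (le_trans N1); apply: lee_wpmul2l; first by rewrite lee_fin mulr_ge0 ?powR_ge0.
apply: (le_trans (cS f Lf)).
apply: (@le_trans _ _ (c'%:E * L_norm q 0 f)).
  apply: lee_wpmul2r; first exact: Lnorm_ge0.
  by rewrite lee_fin /c' (le_trans (ler_norm c))// lerDl.
by apply: lee_wpmul2l; rewrite ?lee_fin ?(ltW c'0).
Qed.

Lemma Lspace_zero_off p c (A : set U) (f : U -> R[i]) : 0 < p -> measurable A -> Lspace p c f -> Lspace p c (zero_off A f).
Proof.
move=> p0' mA [cf fy]; have cz := cmeasurable_zero_off mA cf; split => //.
apply: le_lt_trans fy; apply: le_Lnorm => //.
- by apply/measurable_EFinP; exact: measurable_weighted_abs.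
- by apply/measurable_EFinP; exact: measurable_weighted_abs.
move=> w; rewrite !gee0_abs ?lee_fin ?mulr_ge0 ?powR_ge0 ?normc_ge0// ler_wpM2l ?powR_ge0//.
by rewrite normc_zero_off ler_piMl ?normc_ge0.
Qed.

Lemma le_wmean p (g : U -> U -> R) (v v' : U -> R) z : 0 < p ->
  measurable_fun setT (fun zw : U * U => g zw.1 zw.2) -> (forall w, 0 <= g z w)%R ->
  measurable_fun setT v -> measurable_fun setT v' -> (forall w, 0 <= v w <= v' w)%R ->
  wmean p g v z <= wmean p g v' z.
Proof.
move=> p0' mg g0 mv mv' vv'; apply: lee_wpmul2l; first by rewrite lee_fin powR_ge0.
apply: le_Lnorm => //; [exact: measurable_weight|exact: measurable_weight|].
move=> w; have /andP[v0 h] := vv' w.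
by rewrite !gee0_abs ?lee_fin ?mulr_ge0//; [rewrite ler_wpM2l|exact: le_trans h].
Qed.

Lemma weighted_abs_zero_off_le c (A : set U) (f : U -> R[i]) w :
  (0 <= weighted_abs c (zero_off A f) w <= weighted_abs c f w)%R.
Proof.
rewrite weighted_abs_ge0/= ler_wpM2l ?powR_ge0// normc_zero_off ler_piMl ?normc_ge0//.
Qed.

Lemma SIO_additive (f g : U -> R[i]) : Lspace q 0 f -> Lspace q 0 g ->
  {ae mu, forall w, S (fun w => f w + g w)%R w = (S f w + S g w)%R}.
Proof.
move=> Lf Lg; have [c [linS _]] := SIO_bounded hS.
have := linop_linear linS 1%R Lf Lg.
have -> : (fun w => 1 * f w + g w)%R = (fun w => f w + g w)%R by apply/funext => w; rewrite mul1r.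
by apply: filterS => w /(_ I) ->; rewrite mul1r.
Qed.

Lemma cmeasurable_SIO (f : U -> R[i]) : Lspace q 0 f -> cmeasurable (S f).
Proof. by move=> Lf; have [c [linS _]] := SIO_bounded hS; have [] := linop_maps linS Lf. Qed.

Lemma wmean_add c (u u1 u2 : U -> R[i]) z : cmeasurable u -> cmeasurable u1 -> cmeasurable u2 ->
  {ae mu, forall w, u w = (u1 w + u2 w)%R} ->
  wmean r whitney_ind (weighted_abs c u) z <= wmean r whitney_ind (weighted_abs c u1) z + wmean r whitney_ind (weighted_abs c u2) z.
Proof.
move=> cu cu1 cu2 uE; rewrite /wmean -ge0_muleDr ?Lnorm_ge0//.
apply: lee_wpmul2l; first by rewrite lee_fin powR_ge0.
have mg := @measurable_whitney_ind R n.
have mz v : cmeasurable v -> measurable_fun setT (fun w => (whitney_ind z w * weighted_abs c v w)%:E).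
  by move=> cv; apply: measurable_weight => //; exact: measurable_weighted_abs.
have z0 v w : 0 <= (whitney_ind z w * weighted_abs c v w)%:E by rewrite lee_fin (mulr_ge0 (whitney_ind_ge0 _ _) (weighted_abs_ge0 _ _ _)).
have := @ge0_LnormD _ _ _ mu r _ _ (ltW r1) (mz _ cu1) (mz _ cu2) (z0 _) (z0 _).
apply: le_trans.
apply: ae_le_Lnorm => //; [exact: mz|by apply: emeasurable_funD; exact: mz|].
apply: filterS uE => w uw; rewrite !gee0_abs ?adde_ge0//.
rewrite -EFinD lee_fin -mulrDr ler_wpM2l ?whitney_ind_ge0// /weighted_abs uw -mulrDr ler_wpM2l ?powR_ge0//.
exact: normcD.
Qed.

Lemma wmean_split c (A B : set U) (f : U -> R[i]) z : measurable A -> measurable B -> Lspace q 0 f ->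
  wmean r whitney_ind (weighted_abs c (S (zero_off A f))) z <=
  wmean r whitney_ind (weighted_abs c (S (zero_off (A `&` B) f))) z + wmean r whitney_ind (weighted_abs c (S (zero_off (A `\` B) f))) z.
Proof.
move=> mA mB Lf.
have L1 : Lspace q 0 (zero_off (A `&` B) f) by apply: Lspace_zero_off => //; exact: measurableI.
have L2 : Lspace q 0 (zero_off (A `\` B) f) by apply: Lspace_zero_off => //; exact: measurableD.
have L0 : Lspace q 0 (zero_off A f) by apply: Lspace_zero_off.
apply: wmean_add; try exact: cmeasurable_SIO.
have := SIO_additive L1 L2.
have -> // : (fun w => zero_off (A `&` B) f w + zero_off (A `\` B) f w)%R = zero_off A f.
apply/funext => w; rewrite /zero_off /patch in_setD in_setI.
by case: (w \in A) => /=; rewrite ?addr0//; case: (w \in B); rewrite /= ?addr0 ?add0r.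
Qed.

(** The kernel represents S g only off the product of the projections of the
    support of g. So the part of f off the enlarged region is cut once more,
    into times at most t/4, times in (t/4,t], and times after t: the first and
    the last are separated from the Whitney region in time and the second in
    space. *)
Lemma whitney_estimate : exists2 C : R, (0 < C)%R & forall (f : U -> R[i]) l z, (0 < z.1)%R ->
  Lspace q 0 f -> (forall w, ~ box l w -> f w = 0%R) ->
  wmean r whitney_ind (weighted_abs (beta + kappa) (S f)) z <=
  C%:E * (wmean q enlarged_ind (weighted_abs beta f) z + wmean p0 (far_weight eta N') (weighted_abs beta f) z).
Proof.
have [C1 C10 h1] := far_wmean; have [C2 C20 h2] := loc_wmean.
exists (C2 + 3 * C1)%R; first by rewrite addr_gt0// mulr_gt0.
move=> f l z z0 Lf f0.
pose t := z.1; pose x := z.2.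
have mabs := measurable_weighted_abs beta Lf.1.
set L := wmean q enlarged_ind _ z; set F := wmean p0 _ _ z.
have L0 : 0 <= L by exact: wmean_ge0. have F0 : 0 <= F by exact: wmean_ge0.
pose W := [set w | in_enlarged z w].
have mW : measurable W.
  have := measurable_fun_pair1 z (@measurable_enlarged_ind R n).
  move=> /(_ measurableT [set 1%R] (measurable_set1 _)); rewrite setTI.
  rewrite (_ : _ @^-1` _ = W)//; apply/seteqP; split => w; rewrite /W/= /enlarged_ind; last by move=> ->.
  by case: (in_enlarged z w) => // /esym/eqP; rewrite oner_eq0.
have mlt (c : R) : measurable [set w : U | (w.1 <= c)%R].
  rewrite -[X in measurable X]setTI (_ : [set w | _] = (fst : U -> R) @^-1` `]-oo, c]%classic).
    by apply: measurable_fst.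
  by apply/seteqP; split => w; rewrite /= in_itv.
(* [A1], [A3], [A4] are the early, the simultaneous but spatially separated,
   and the late part *)
pose A1 := (~` W) `&` [set w : U | (w.1 <= t / 4)%R].
pose A1' := (~` W) `\` [set w : U | (w.1 <= t / 4)%R].
pose A3 := A1' `&` [set w : U | (w.1 <= t)%R].
pose A4 := A1' `\` [set w : U | (w.1 <= t)%R].
have mcW : measurable (~` W) by exact: measurableC.
have mA1' : measurable A1' by exact: measurableD.
have farA (A : set U) : measurable A -> A `<=` ~` W ->
    (forall t' x', (t / 2 <= t')%R -> (t' < t)%R -> (edist x x' < Num.sqrt t)%R -> ~ supp_box (zero_off A f) (t', x')) ->
    wmean r whitney_ind (weighted_abs (beta + kappa) (S (zero_off A f))) z <= C1%:E * F.
  move=> mA AW sA; have LA : Lspace q 0 (zero_off A f) by exact: Lspace_zero_off.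
  apply: (le_trans (h1 z (zero_off A f) l z0 LA _ _ sA)).
  - by move=> w /f0 fw; rewrite /zero_off /patch fw; case: ifP.
  - by move=> w Ww; rewrite /zero_off /patch memNset// => /AW; apply.
  apply: lee_wpmul2l; first by rewrite lee_fin ltW.
  apply: le_wmean => //; [exact: measurable_far_weight2|by move=> w; exact: far_weight_ge0|exact: measurable_weighted_abs LA.1|].
  by move=> w; exact: weighted_abs_zero_off_le.
have off (A V : set U) w : open V -> V w -> (A `&` V = set0) -> ~ ess_supp (zero_off A f) w.
  move=> oV Vw AV; apply: (@not_ess_supp _ _ _ V); first by apply: open_nbhs_nbhs; split.
  move=> w' Vw'; rewrite /zero_off /patch memNset// => Aw'.
  by have : (A `&` V) w' by []; rewrite AV.
have fE : f = zero_off setT f by apply/funext => w; rewrite /zero_off /patch in_setT.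
have W1 : wmean r whitney_ind (weighted_abs (beta + kappa) (S (zero_off W f))) z <= C2%:E * L.
  have LA : Lspace q 0 (zero_off W f) by exact: Lspace_zero_off.
  apply: (le_trans (h2 z (zero_off W f) z0 LA _)).
    by move=> w /negP Ww; rewrite /zero_off /patch memNset.
  apply: lee_wpmul2l; first by rewrite lee_fin ltW.
  apply: le_wmean => //; [exact: measurable_enlarged_ind|exact: measurable_weighted_abs LA.1|].
  by move=> w; exact: weighted_abs_zero_off_le.
have F1 : wmean r whitney_ind (weighted_abs (beta + kappa) (S (zero_off A1 f))) z <= C1%:E * F.
  apply: farA; [exact: measurableI|by move=> w []|].
  move=> t' x' tt' t't xx' [[w sw wE] _].
  have w1 : (w.1 = t')%R by rewrite wE.
  apply: (off A1 [set w : U | (t / 4 < w.1)%R] w) sw.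
  - rewrite (_ : [set w | _] = (fst : U -> R) @^-1` `](t / 4)%R, +oo[%classic); last first.
      by apply/seteqP; split => v; rewrite /= in_itv/= andbT.
    by apply: open_comp => // v _; exact: cvg_fst.
  - by rewrite /= w1; move: tt' z0; rewrite -/t; lra.
  - by apply/seteqP; split => v //= [[_ /= v1] v2]; move: v2; rewrite ltNge v1.
have F3 : wmean r whitney_ind (weighted_abs (beta + kappa) (S (zero_off A3 f))) z <= C1%:E * F.
  apply: farA; [exact: measurableI|by move=> w [[]]|].
  move=> t' x' tt' t't xx' [_ [w sw wE]].
  have w1 : w.2 = x' by rewrite wE.
  apply: (off A3 [set w : U | (edist x w.2 < 4 * Num.sqrt t)%R] w) sw.
  - rewrite (_ : [set w | _] = ((edist x \o (snd : U -> X)) @^-1` `]-oo, (4 * Num.sqrt t)%R[%classic)); last first.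
      by apply/seteqP; split => v; rewrite /= in_itv.
    apply: open_comp => // v _; apply: (@continuous_comp _ _ _ (snd : U -> X) (edist x)); first exact: cvg_snd.
    exact: continuous_edist.
  - by rewrite /= w1 (lt_le_trans xx')// ler_peMl ?sqrtr_ge0// ler1n.
  - apply/seteqP; split => v //= [[[vW /= v1] v3] v2]; apply: vW; apply/and3P; split => //.
    by rewrite ltNge; apply/negP.
have F4 : wmean r whitney_ind (weighted_abs (beta + kappa) (S (zero_off A4 f))) z <= C1%:E * F.
  apply: farA; [exact: measurableD|by move=> w [[]]|].
  move=> t' x' tt' t't xx' [[w sw wE] _].
  have w1 : (w.1 = t')%R by rewrite wE.
  apply: (off A4 [set w : U | (w.1 < t)%R] w) sw.
  - rewrite (_ : [set w | _] = (fst : U -> R) @^-1` `]-oo, t[%classic); last first.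
      by apply/seteqP; split => v; rewrite /= in_itv.
    by apply: open_comp => // v _; exact: cvg_fst.
  - by rewrite /= w1.
  - by apply/seteqP; split => v //= [[_ /= v1] v2]; apply: v1; exact: ltW.
rewrite {1}fE; apply: (le_trans (wmean_split _ _ measurableT mW Lf)).
rewrite setTI setTD.
have S1 := wmean_split (beta + kappa)%R z mcW (mlt (t / 4)%R) Lf.
have S2 := wmean_split (beta + kappa)%R z mA1' (mlt t) Lf.
apply: (le_trans (leeD W1 (le_trans S1 (leeD F1 (le_trans S2 (leeD F3 F4)))))).
rewrite ge0_muleDr//.
have C10' : 0 <= C1%:E by rewrite lee_fin ltW.
have C20' : 0 <= C2%:E by rewrite lee_fin ltW.
rewrite !EFinD !ge0_muleDl ?lee_fin ?mulr_ge0 ?(ltW C10) ?(ltW C20)//.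
apply: leeD; first by rewrite leeDl// mule_ge0// lee_fin mulr_ge0// ltW.
have -> : (3 * C1 = C1 + (C1 + C1))%R by ring.
rewrite !EFinD !ge0_muleDl ?adde_ge0//.
by rewrite leeDr// mule_ge0.
Qed.

End far_estimate.

(** * Finite covers by Whitney regions *)

Section covers.
Context {R : realType} {n : nat}.
Hypothesis n0 : (0 < n)%N.
Local Notation X := ('rV[R]_n).
Local Notation U := (R * 'rV[R]_n)%type.
Local Notation mu := (@dtdx R n).

(** A property that holds almost everywhere can be required of the base points
    of a finite cover by Whitney regions: each point lies in the interior of
    the regions of a set of base points of positive measure. *)
Lemma good_cover (G : U -> Prop) (E : set U) : {ae mu, forall z, G z} -> compact E ->
  (forall w, E w -> 0 < w.1) ->
  exists2 zs : seq U, (forall z, z \in zs -> 0 < z.1 /\ G z) & forall w, E w -> exists2 z, z \in zs & in_whitney z w.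
Proof.
move=> aeG cE E0.
pose Wo (z : U) := [set w : U | z.1 / 2 < w.1 < z.1 /\ edist z.2 w.2 < Num.sqrt z.1].
have [||zs zsD zsE] := @compact_subcover R n U E [set z | 0 < z.1 /\ G z] Wo cE.
- by move=> z _; exact: open_tube.
- move=> w /E0 w0.
  (* base points of this set of positive measure have w in the interior of
     their Whitney regions *)
  pose Q := `[5 / 4 * w.1, 3 / 2 * w.1]%classic `*` eball w.2 (1 * Num.sqrt w.1).
  have mQ : measurable Q by exact: measurable_tube_cc.
  have Q0 : (0 < mu Q)%E.
    apply: (lt_le_trans _ (@dtdx_tube_ge R n (5 / 4 * w.1) (3 / 2 * w.1) 1 w.1 w.2 n0 _ ltr01 w0)).
      have -> : (3 / 2 * w.1 - 5 / 4 * w.1) / (3 / 2 * w.1) = 6^-1 by field; rewrite gt_eqF.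
      rewrite lte_fin mulr_gt0 ?invr_gt0//; apply: mulr_gt0; last exact: powR_gt0.
      by rewrite exprn_gt0// mulr1 divr_gt0// ltr0n.
    by rewrite mulr_gt0 ?divr_gt0//= ltr_pM2r//; lra.
  have [z [Qz Gz]] : exists z, Q z /\ G z.
    apply: contrapT => hz; move: Q0; rewrite ltNge => /negP; apply.
    have [Z [mZ Z0 hZ]] := aeG; rewrite -Z0 le_measure ?inE// => z Qz; apply: hZ => Gz.
    by apply: hz; exists z.
  move: Qz => [/=]; rewrite in_itv/= => /andP[z1 z2]; rewrite /eball/= mul1r => z3.
  exists z.
    by split => //; apply: lt_le_trans z1; rewrite mulr_gt0// divr_gt0.
  rewrite /Wo /=; split; first by apply/andP; split; move: z1 z2 w0; lra.
  by rewrite edistC (lt_le_trans z3)// ler_wsqrtr//; move: z1 w0; lra.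
exists zs; first by move=> z /zsD.
move=> w /zsE[z zzs [/andP[w1 w2] w3]]; exists z => //.
by apply/and3P; split => //; exact: ltW.
Qed.

Lemma whitney_sub_box (z : U) : 0 < z.1 -> exists m, forall w, in_whitney z w -> box m w.
Proof.
move=> z0.
have [m1 m1E] : exists m, forall k, (m <= k)%N -> 2^-1 ^+ k <= z.1 / 2 /\ z.1 <= 2 ^+ k.
  have [l1 [/andP[h1 _] _]] := open_box_exhaust (w := (z.1 / 2, 0) : U) ltac:(by rewrite /= divr_gt0).
  have [l2 [/andP[_ h2] _]] := open_box_exhaust (w := (z.1, 0) : U) z0.
  exists (maxn l1 l2) => k; rewrite geq_max => /andP[lk1 lk2]; split.
    by apply: le_trans (ltW h1); exact: le_half_exp.
  by apply: (le_trans (ltW h2)); rewrite ler_weXn2l// ler1n.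
have [m2 m2E] : exists m, edist 0 z.2 + Num.sqrt z.1 <= 2 ^+ m :> R.
  exists (Num.truncn (edist 0 z.2 + Num.sqrt z.1)).+1; apply: ltW.
  apply: (lt_le_trans (truncnS_gt _)).
  by rewrite -natrX ler_nat ltnW// ltn_expl.
exists (maxn m1 m2) => w /and3P[w1 w2 w3].
have [h4 h5] := m1E _ (leq_maxl m1 m2).
split; first by rewrite (le_trans h4 w1) (le_trans w2 h5).
apply: (le_trans (edist_triangle _ z.2 _)).
apply: (@le_trans _ _ (2 ^+ m2)); last by rewrite ler_weXn2l ?ler1n// leq_maxr.
by move: w3 m2E; lra.
Qed.

End covers.

(** * Decay off large boxes *)

Section tails.
Context {R : realType} {n : nat}.
Local Notation X := ('rV[R]_n).
Local Notation U := (R * 'rV[R]_n)%type.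

(** A size attached to z for which [off_box_scale] holds uniformly in l and w:
    it collects the cost of comparing early times, late times and distant
    points with z. *)
Definition scale_at (z : U) : R := z.1 + z.1^-1 + edist 0 z.2 + Num.sqrt z.1.

Lemma scale_at_gt0 z : 0 < z.1 -> 0 < scale_at z.
Proof.
move=> z0; have := edist_ge0 0 z.2; have : 0 < z.1^-1 by rewrite invr_gt0.
by have := sqrtr_ge0 z.1; rewrite /scale_at; lra.
Qed.

(** A point w off the l-th box is at an early time, at a late time, or far
    away in space. The three cases are paid for by z.1 / w.1, by z.1 itself,
    and by the spatial weight. *)
Lemma off_box_scale l (z w : U) : ~ box l w -> 0 < w.1 -> w.1 <= z.1 ->
  2 ^+ l <= scale_at z * (z.1 / w.1) * pweight z.2 z.1 w.2.
Proof.
move=> nb w0 wz; have z0 : 0 < z.1 by exact: lt_le_trans wz.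
have pw := pweight_ge1 z.2 w.2 z0; have s0 := ltW (scale_at_gt0 z0).
have zw : 1 <= z.1 / w.1 by rewrite ler_pdivlMr// mul1r.
have st0 : 0 < Num.sqrt z.1 by rewrite sqrtr_gt0.
have e0 : 0 <= edist 0 z.2 by exact: edist_ge0.
have zi : 0 < z.1^-1 by rewrite invr_gt0.
have [w1|w1] := ltP w.1 (2^-1 ^+ l).
  apply: (@le_trans _ _ (z.1^-1 * (z.1 / w.1))).
    rewrite mulrA mulVf ?gt_eqF// mul1r -[leLHS]invrK lef_pV2 ?posrE ?invr_gt0 ?exprn_gt0//.
    by rewrite -exprVn ltW.
  rewrite -[leLHS]mulr1; apply: ler_pM => //; first by rewrite mulr_ge0// ?divr_ge0 ?ltW.
  rewrite ler_pM2r; last by rewrite divr_gt0.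
  by rewrite /scale_at; move: z0 st0 e0; lra.
have [w2|w2] := ltP (2 ^+ l) w.1.
  apply: (@le_trans _ _ (scale_at z)); first by rewrite /scale_at; move: z0 st0 e0 zi wz w2; lra.
  by rewrite -mulrA ler_peMr// mulr_ege1.
have w3 : 2 ^+ l < edist 0 w.2.
  by rewrite ltNge; apply/negP => h; apply: nb; split => //; rewrite w1.
apply: (@le_trans _ _ (scale_at z * pweight z.2 z.1 w.2)); last first.
  rewrite -mulrA ler_wpM2l// ler_peMl// ltW// (lt_le_trans _ pw)//.
apply: (le_trans (ltW w3)); apply: (le_trans (edist_triangle _ z.2 _)).
have h : edist z.2 w.2 <= Num.sqrt z.1 * pweight z.2 z.1 w.2.
  pose u := edist z.2 w.2 / Num.sqrt z.1.
  have -> : pweight z.2 z.1 w.2 = 1 + u ^+ 2 by rewrite /pweight /u expr_div_n (sqr_sqrtr (ltW z0)).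
  have -> : edist z.2 w.2 = Num.sqrt z.1 * u by rewrite /u mulrC mulfVK// gt_eqF.
  by rewrite ler_pM2l//; have := sqr_ge0 (u - 1); have := sqr_ge0 u; rewrite sqrrB expr1n mulr1; lra.
apply: (@le_trans _ _ ((edist 0 z.2 + Num.sqrt z.1) * pweight z.2 z.1 w.2)).
  rewrite mulrDl; apply: lerD => //; by rewrite ler_peMr.
by rewrite ler_wpM2r ?(le_trans _ pw)// /scale_at; move: z0 zi; lra.
Qed.

(** Off the l-th box, raising both exponents of the weight by delta gains
    2^(-l delta). *)
Lemma far_weight_tail (eta nu delta : R) l (z w : U) : 0 < delta -> ~ box l w ->
  far_weight (eta + delta) (nu + delta) z w <= (scale_at z * 2^-1 ^+ l) `^ delta * far_weight eta nu z w.
Proof.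
move=> d0 nb; rewrite /far_weight; case: ifPn => [/andP[w0 wz]|_]; last by rewrite mulr0.
have z0 : 0 < z.1 by exact: lt_le_trans wz.
have pw := pweight_gt0 z.2 w.2 z0; have s0 := scale_at_gt0 z0.
have u0 : 0 < w.1 / z.1 by rewrite divr_gt0.
rewrite opprD !powRD ?(gt_eqF u0) ?(gt_eqF pw) ?implybT//.
rewrite mulrACA [leRHS]mulrC; apply: ler_wpM2l; first by rewrite mulr_ge0 ?powR_ge0.
have -> : pweight z.2 z.1 w.2 `^ (- delta) = (pweight z.2 z.1 w.2)^-1 `^ delta.
  by rewrite -powR_inv1 ?ltW// -powRrM mulN1r.
rewrite -powRM ?invr_ge0 ?(ltW u0) ?(ltW pw)//.
apply: ler_powRl; [exact: ltW|by rewrite mulr_ge0 ?invr_ge0 ?(ltW u0) ?(ltW pw)|].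
have := off_box_scale nb w0 wz.
rewrite ler_pdivrMr// => h.
rewrite -(ler_pM2l (_ : 0 < 2 ^+ l * (z.1 / w.1))); last by rewrite mulr_gt0 ?exprn_gt0 ?divr_gt0.
have -> : 2 ^+ l * (z.1 / w.1) * (w.1 / z.1) = 2 ^+ l by field; rewrite !gt_eqF.
apply: (le_trans h); rewrite exprVn le_eqVlt; apply/orP; left; apply/eqP.
by field; rewrite gt_eqF ?gt_eqF// exprn_gt0.
Qed.

(** In the enlarged region z.1 / w.1 and the spatial weight are at most 4 and
    17, so a point of it off the l-th box satisfies 2^l <= 68 scale_at z, and
    the inserted factor is at least 1. *)
Lemma enlarged_ind_tail (delta : R) l (z w : U) : 0 < delta -> ~ box l w -> 0 < z.1 ->
  enlarged_ind z w <= (68 * scale_at z * 2^-1 ^+ l) `^ delta * enlarged_ind z w.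
Proof.
move=> d0 nb z0; rewrite /enlarged_ind; case: (boolP (in_enlarged z w)) => [/and3P[w1 w2 w3]|_]; last by rewrite mulr0.
rewrite mulr1 -[leLHS](_ : (1 : R) `^ delta = 1); last by rewrite powR1.
have w0 : 0 < w.1 by apply: lt_trans w1; rewrite divr_gt0.
have s0 := scale_at_gt0 z0.
apply: ler_powRl => //; first exact: ltW.
have h := off_box_scale nb w0 w2.
have zw : z.1 / w.1 <= 4 by rewrite ler_pdivrMr//; move: w1; lra.
have pw : pweight z.2 z.1 w.2 <= 17.
  rewrite /pweight; suff : edist z.2 w.2 ^+ 2 / z.1 <= 16 by lra.
  rewrite ler_pdivrMr// (_ : 16 * z.1 = (4 * Num.sqrt z.1) ^+ 2).
    by rewrite ler_pXn2r ?nnegrE ?edist_ge0 ?mulr_ge0 ?sqrtr_ge0// ltW.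
  by rewrite exprMn sqr_sqrtr ?(ltW z0)//; congr (_ * _); ring.
have pw0 := pweight_gt0 z.2 w.2 z0.
rewrite exprVn ler_pdivlMr ?exprn_gt0// mul1r; apply: (le_trans h).
have -> : 68 * scale_at z = scale_at z * 4 * 17 by ring.
apply: ler_pM => //; [|exact: ltW|]; first by rewrite mulr_ge0 ?divr_ge0 ?ltW.
by rewrite ler_pM2l.
Qed.

End tails.

Section local_means.
Context {R : realType} {n : nat}.
Local Notation X := ('rV[R]_n).
Local Notation U := (R * 'rV[R]_n)%type.
Local Notation mu := (@dtdx R n).
Local Notation cabs := Normc.normc.
Local Open Scope ereal_scope.

Lemma wmean_triangle p (g : U -> U -> R) (v v1 v2 : U -> R) z : 1 <= p ->
  measurable_fun setT (fun zw : U * U => g zw.1 zw.2) -> (forall w, 0 <= g z w)%R ->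
  measurable_fun setT v -> measurable_fun setT v1 -> measurable_fun setT v2 ->
  (forall w, 0 <= v w)%R -> (forall w, 0 <= v1 w)%R -> (forall w, 0 <= v2 w)%R ->
  {ae mu, forall w, v w <= v1 w + v2 w}%R ->
  wmean p g v z <= wmean p g v1 z + wmean p g v2 z.
Proof.
move=> p1 mg g0 mv mv1 mv2 v0 v10 v20 vle; have p0 : 0 < p by exact: lt_le_trans p1.
rewrite /wmean -ge0_muleDr ?Lnorm_ge0//; apply: lee_wpmul2l; first by rewrite lee_fin powR_ge0.
have mz v' : measurable_fun setT v' -> measurable_fun setT (fun w => (g z w * v' w)%:E).
  by move=> mv'; apply: measurable_weight.
have e0 v' : (forall w, 0 <= v' w)%R -> forall w, 0 <= (g z w * v' w)%:E.
  by move=> h w; rewrite lee_fin mulr_ge0.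
apply: (le_trans _ (@ge0_LnormD _ _ _ mu p _ _ p1 (mz _ mv1) (mz _ mv2) (e0 _ v10) (e0 _ v20))).
apply: ae_le_Lnorm => //; [exact: mz|by apply: emeasurable_funD; exact: mz|].
apply: filterS vle => w vw; rewrite !gee0_abs ?adde_ge0 ?e0//.
by rewrite -EFinD lee_fin -mulrDr ler_wpM2l.
Qed.

Lemma wmeanZ_le p (g g' : U -> U -> R) (v v' : U -> R) (c : R) z : 0 < p -> (0 <= c)%R ->
  measurable_fun setT (fun zw : U * U => g zw.1 zw.2) ->
  measurable_fun setT (fun zw : U * U => g' zw.1 zw.2) ->
  measurable_fun setT v -> measurable_fun setT v' ->
  (forall w, 0 <= g z w * v w <= c * (g' z w * v' w))%R ->
  wmean p g v z <= c%:E * wmean p g' v' z.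
Proof.
move=> p0 c0 mg mg' mv mv' h; rewrite /wmean muleCA; apply: lee_wpmul2l; first by rewrite lee_fin powR_ge0.
rewrite -LnormZ_ge0//; last exact: measurable_weight.
apply: le_Lnorm => //; first exact: measurable_weight.
  by apply: emeasurable_funM => //; exact: measurable_weight.
move=> w; have /andP[h1 h2] := h w.
by rewrite !gee0_abs ?lee_fin//; exact: le_trans h2.
Qed.

Lemma whitney_ind_le_enlarged (z w : U) : (whitney_ind z w <= enlarged_ind z w)%R.
Proof.
rewrite /whitney_ind /enlarged_ind; case: (boolP (in_whitney z w)) => // /[dup] /in_whitney_gt0[z0 _] /and3P[w1 w2 w3].
rewrite (_ : in_enlarged z w)//; apply/and3P; split => //.
  by move: w1; rewrite ltr_pdivrMr//; move: z0; lra.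
by rewrite (lt_le_trans w3)// ler_peMl ?sqrtr_ge0// ler1n.
Qed.

(** What remains of the powers of time when a norm over a Whitney region is
    expressed by a local mean. *)
Definition local_weight (p : \bar R) (c : R) (z : U) : R :=
  (4 `^ `|c| * z.1 `^ c * z.1 `^ (n%:R / 2 * einv p))%R.

Lemma local_weight_ge0 p c z : (0 <= local_weight p c z)%R.
Proof. by rewrite !mulr_ge0 ?powR_ge0. Qed.

Lemma weighted_absK c (u : U -> R[i]) (w : U) : (0 < w.1)%R -> cabs (u w) = (w.1 `^ c * weighted_abs c u w)%R.
Proof.
move=> w0; rewrite /weighted_abs mulrA -powRD ?(gt_eqF w0) ?implybT//.
by rewrite subrr powRr0 mul1r.
Qed.

(** Finiteness and convergence on compact sets are reduced to local means at
    finitely many points. *)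
Lemma Lnorm_cover p c (u : U -> R[i]) (E : set U) (zs : seq U) : 1 <= p -> cmeasurable u -> measurable E ->
  (forall z, z \in zs -> (0 < z.1)%R) -> (forall w, E w -> exists2 z, z \in zs & in_whitney z w) ->
  'N[mu]_p[(fun w => (\1_E w * cabs (u w))%:E)] <=
  \sum_(z <- zs) (local_weight p c z)%:E * wmean p whitney_ind (weighted_abs c u) z.
Proof.
move=> p1 cu mE zs0 zsE; have p0 : 0 < p by exact: lt_le_trans p1.
have mz z : measurable_fun setT (fun w => (whitney_ind z w * weighted_abs c u w)%:E).
  by apply: measurable_weight; [exact: measurable_whitney_ind|exact: measurable_weighted_abs].
have g0 z w : 0 <= (whitney_ind z w * weighted_abs c u w)%:E by rewrite lee_fin (mulr_ge0 (whitney_ind_ge0 _ _) (weighted_abs_ge0 _ _ _)).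
pose k (z : U) : R := (4 `^ `|c| * z.1 `^ c)%R.
have k0 z : (0 <= k z)%R by rewrite mulr_ge0 ?powR_ge0.
have k0' z w : 0 <= (k z)%:E * (whitney_ind z w * weighted_abs c u w)%:E by rewrite mule_ge0// lee_fin.
apply: (@le_trans _ _ (\sum_(z <- zs) 'N[mu]_p[(fun w => (k z)%:E * (whitney_ind z w * weighted_abs c u w)%:E)])).
  have := @ge0_Lnorm_sum _ _ _ mu _ zs xpredT p (fun z w => (k z)%:E * (whitney_ind z w * weighted_abs c u w)%:E) p1.
  move=> /(_ (fun z => emeasurable_funM (@measurable_cst _ _ _ _ setT (k z)%:E) (mz z)) k0'); apply: le_trans.
  apply: le_Lnorm => //.
  - by apply/measurable_EFinP; apply: measurable_funM => //; exact: measurable_normc.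
  - by apply: measurable_fun_esum_seq => z; exact: emeasurable_funM.
  move=> w; rewrite !gee0_abs ?sume_ge0 ?lee_fin ?mulr_ge0 ?normc_ge0//.
  rewrite indicE; have [/set_mem/zsE[z zzs wz]|_] := boolP (w \in E); last by rewrite mul0r sume_ge0.
  rewrite mul1r (big_rem _ zzs)/=; apply: (@le_trans _ _ ((k z)%:E * (whitney_ind z w * weighted_abs c u w)%:E)).
    rewrite /whitney_ind wz mul1r -EFinM lee_fin.
    have [z0 w0] := in_whitney_gt0 wz; rewrite (weighted_absK c u w0) ler_wpM2r ?weighted_abs_ge0//.
    by apply: powR_comparable => //; case/and3P: wz => w1 -> _; rewrite andbT; move: w1 z0; lra.
  by rewrite leeDl// sume_ge0.
rewrite big_seq [leRHS]big_seq; apply: lee_sum => z /zs0 z0.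
rewrite LnormZ_ge0// /local_weight /wmean -/(k z) muleA -EFinM.
rewrite -[(k z * _ * _)%R]mulrA -powRD ?(gt_eqF z0) ?implybT//.
by rewrite subrr powRr0 mulr1.
Qed.

End local_means.

(** * The extension of S *)

Section extension.
Context {R : realType} {n : nat}.
Hypothesis n0 : (0 < n)%N.
Local Notation X := ('rV[R]_n).
Local Notation U := (R * 'rV[R]_n)%type.
Local Notation mu := (@dtdx R n).
Local Notation musf := [the {sigma_finite_measure set U -> \bar R} of @dtdx_sf R n].
Local Notation cabs := Normc.normc.
Variables (p0 q r : \bar R) (kappa : R) (M : \bar R) (N : R).
Variable S : (U -> R[i]) -> (U -> R[i]).
Variable K : R -> R -> (X -> R[i]) -> (X -> R[i]).
Hypothesis hS : is_SIO p0 q r kappa M S K.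
Hypothesis hdec : off_diagonal_decay p0 r kappa N K.
Hypothesis aN : einv p0 < (kappa - n%:R / 2 * (einv p0 - einv r)) + N.
Variables (beta eta nu delta : R).
Hypotheses (eta0 : 0 < eta) (d0 : 0 < delta) (eb : eta + delta < beta + 1).
Hypotheses (nu0 : n%:R / 2 * einv p0 < nu) (nuN : nu + delta < N).
Local Open Scope ereal_scope.

Let p01 : 1 < p0. Proof. by have [] := SIO_exponents hS. Qed.
Let q1 : 1 < q. Proof. by have [] := SIO_exponents hS. Qed.
Let r1 : 1 < r. Proof. by have [] := SIO_exponents hS. Qed.
Let pq : p0 <= q. Proof. by have [] := SIO_exponents hS. Qed.
Let p00 : 0 < p0. Proof. exact: lt_trans p01. Qed.
Let q0 : 0 < q. Proof. exact: lt_trans q1. Qed.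
Let r0 : 0 < r. Proof. exact: lt_trans r1. Qed.
Let nu_gt0 : (0 < nu)%R.
Proof. by apply: le_lt_trans nu0; rewrite mulr_ge0 ?divr_ge0 ?einv_ge0. Qed.
Let Lzo := @Lspace_zero_off R n.
Let SIO_cm := cmeasurable_SIO hS.

(** The quantity that bounds the Whitney means of S f at z. *)
Definition control (v : U -> R) (z : U) : \bar R := wmean q enlarged_ind v z + wmean p0 (far_weight eta nu) v z.

Lemma control_ge0 v z : 0 <= control v z.
Proof. by rewrite adde_ge0 ?wmean_ge0. Qed.

Lemma measurable_control v : measurable_fun setT v -> measurable_fun setT (control v).
Proof.
move=> mv; apply: emeasurable_funD; apply: measurable_wmean => //; [exact: measurable_enlarged_ind|exact: measurable_far_weight2].
Qed.

Lemma Lnorm_control p : p0 <= p -> exists2 C : R, (0 < C)%R & forall v : U -> R,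
  measurable_fun setT v -> (forall w, 0 <= v w)%R ->
  'N[mu]_p[control v] <= C%:E * 'N[mu]_p[wmean q whitney_ind v].
Proof.
move=> p0p; have p_gt0 : 0 < p by exact: lt_le_trans p0p.
have [e' [b' [C1 [[e'0 b'0 C10] h1]]]] := @far_mean_le R n n0 p0 q p eta nu p01 pq p0p eta0 nu0.
have b'1 : (0 <= b')%R by rewrite ltW// (le_lt_trans _ b'0)// divr_ge0.
have [C2 C20 h2] := @enlarged_mean_le R n n0 q p e' b' (ltW q1) p_gt0 e'0 b'1.
have [C3 C30 h3] := @Lnorm_schur_mean R n e' b' p e'0 b'0 p_gt0.
exists ((C2 + C1) * C3)%R; first by rewrite mulr_gt0// addr_gt0.
move=> v mv v0; have C120 : (0 <= C2 + C1)%R by rewrite addr_ge0// ltW.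
have mW : measurable_fun setT (wmean q whitney_ind v) by apply: measurable_wmean => //; exact: measurable_whitney_ind.
have mk : measurable_fun setT (schur_mean e' b' p (wmean q whitney_ind v)).
  by apply: measurable_schur_mean => // w; exact: wmean_ge0.
apply: (@le_trans _ _ 'N[mu]_p[(fun z => (C2 + C1)%:E * schur_mean e' b' p (wmean q whitney_ind v) z)]).
  apply: ae_le_Lnorm => //; [exact: measurable_control|exact: emeasurable_funM|].
  apply: filterS (@ae_dtdx_gt0 R n) => z z0.
  rewrite !gee0_abs ?control_ge0 ?mule_ge0 ?schur_mean_ge0 ?lee_fin// EFinD ge0_muleDl ?lee_fin ?(ltW C10) ?(ltW C20)//.
  by apply: leeD; [exact: h2|exact: h1].
rewrite LnormZ_ge0// EFinM -muleA; apply: lee_wpmul2l; first by rewrite lee_fin.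
by apply: h3 => // w; exact: wmean_ge0.
Qed.

Lemma le_control (v v' : U -> R) z : measurable_fun setT v -> measurable_fun setT v' ->
  (forall w, 0 <= v w <= v' w)%R -> control v z <= control v' z.
Proof.
move=> mv mv' vv'; apply: leeD; apply: le_wmean => //.
- exact: measurable_enlarged_ind.
- exact: measurable_far_weight2.
- by move=> w; exact: far_weight_ge0.
Qed.

Lemma control_triangle (c : R) (v v1 v2 : U -> R) z : (0 <= c)%R -> measurable_fun setT v -> measurable_fun setT v1 -> measurable_fun setT v2 ->
  (forall w, 0 <= v w)%R -> (forall w, 0 <= v1 w)%R -> (forall w, 0 <= v2 w)%R ->
  (forall w, v w <= c * v1 w + v2 w)%R -> control v z <= c%:E * control v1 z + control v2 z.
Proof.
move=> c0 mv mv1 mv2 v0 v10 v20 vle.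
have mcv : measurable_fun setT (fun w => c * v1 w)%R by exact: measurable_funM.
have cv0 w : (0 <= c * v1 w)%R by rewrite mulr_ge0.
rewrite /control ge0_muleDr ?wmean_ge0// addeACA; apply: leeD.
  apply: (le_trans (@wmean_triangle _ _ _ enlarged_ind _ (fun w => c * v1 w)%R v2 _ (ltW q1) _ _ mv mcv mv2 v0 cv0 v20 _)).
  - exact: measurable_enlarged_ind.
  - by move=> w; exact: enlarged_ind_ge0.
  - exact: nearW.
  apply: leeD => //; apply: wmeanZ_le => //; [exact: measurable_enlarged_ind|exact: measurable_enlarged_ind|].
  by move=> w; rewrite mulrCA lexx andbT mulr_ge0// mulr_ge0 ?enlarged_ind_ge0.
apply: (le_trans (@wmean_triangle _ _ _ (far_weight eta nu) _ (fun w => c * v1 w)%R v2 _ (ltW p01) _ _ mv mcv mv2 v0 cv0 v20 _)).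
- exact: measurable_far_weight2.
- by move=> w; exact: far_weight_ge0.
- exact: nearW.
apply: leeD => //; apply: wmeanZ_le => //; [exact: measurable_far_weight2|exact: measurable_far_weight2|].
by move=> w; rewrite mulrCA lexx andbT mulr_ge0// mulr_ge0 ?far_weight_ge0.
Qed.

Lemma SIO_bound : exists2 C : R, (0 < C)%R & forall (f : U -> R[i]) l z, (0 < z.1)%R ->
  Lspace q 0 f -> (forall w, ~ box l w -> f w = 0%R) ->
  wmean r whitney_ind (weighted_abs (beta + kappa) (S f)) z <= C%:E * control (weighted_abs beta f) z.
Proof.
have nuN' : (nu < N)%R by apply: lt_trans nuN; rewrite ltrDl.
have eb' : (0 < eta < beta + 1)%R by rewrite eta0 (lt_trans _ eb)// ltrDl.
exact: (whitney_estimate n0 hS (ltW nu_gt0) nuN' hdec aN eb').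
Qed.

(** [whitney_estimate] with the exponents eta + delta and nu + delta, followed
    by the tail gains. *)
Lemma SIO_tail_bound : exists2 C : R, (0 < C)%R & forall (F : U -> R[i]) (A : set U) l m z, (0 < z.1)%R ->
  cmeasurable F -> measurable A -> Lspace q 0 (zero_off A F) -> A `<=` box m -> (forall w, A w -> ~ box l w) ->
  wmean r whitney_ind (weighted_abs (beta + kappa) (S (zero_off A F))) z <=
  (C * (68 * scale_at z * 2^-1 ^+ l) `^ delta)%:E * control (weighted_abs beta F) z.
Proof.
have nd0 : (0 <= nu + delta)%R by rewrite addr_ge0// ltW.
have eb' : (0 < eta + delta < beta + 1)%R by rewrite eb addr_gt0.
have [C C0 h] := whitney_estimate n0 hS nd0 nuN hdec aN eb'.
exists C => // F A l m z z0 cF mA LA Am Al.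
have A0 w : ~ box m w -> zero_off A F w = 0%R.
  by move=> nb; rewrite /zero_off /patch memNset// => /Am.
apply: (le_trans (h _ m z z0 LA A0)); rewrite EFinM -muleA; apply: lee_wpmul2l; first by rewrite lee_fin ltW.
rewrite /control ge0_muleDr ?wmean_ge0//.
have mF := measurable_weighted_abs beta cF; have mA' := measurable_weighted_abs beta LA.1.
have s0 := scale_at_gt0 z0.
have h0 : (0 <= scale_at z * 2^-1 ^+ l)%R by rewrite mulr_ge0 ?exprn_ge0 ?invr_ge0 ?ltW.
have main (g g' : U -> U -> R) : (forall w, 0 <= g z w)%R -> (forall w, 0 <= g' z w)%R ->
    (forall w, ~ box l w -> g z w <= (68 * scale_at z * 2^-1 ^+ l) `^ delta * g' z w)%R -> forall w,
    (0 <= g z w * weighted_abs beta (zero_off A F) w <= (68 * scale_at z * 2^-1 ^+ l) `^ delta * (g' z w * weighted_abs beta F w))%R.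
  move=> g0 g'0 gg w; rewrite mulr_ge0 ?g0 ?weighted_abs_ge0//=.
  rewrite {1}/weighted_abs normc_zero_off indicE; have [/set_mem Aw|_] := boolP (w \in A); last first.
    by rewrite mul0r !mulr0 mulr_ge0 ?powR_ge0// mulr_ge0 ?g'0 ?weighted_abs_ge0.
  by rewrite mul1r -/(weighted_abs beta F w) mulrA ler_wpM2r ?weighted_abs_ge0// gg//; exact: Al.
apply: leeD; apply: wmeanZ_le; rewrite ?powR_ge0//.
- exact: measurable_enlarged_ind.
- exact: measurable_enlarged_ind.
- by apply: main => w; [exact: enlarged_ind_ge0|exact: enlarged_ind_ge0|move=> nb; exact: enlarged_ind_tail].
- exact: measurable_far_weight2.
- exact: measurable_far_weight2.
apply: main => w; [exact: far_weight_ge0|exact: far_weight_ge0|move=> nb].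
apply: (le_trans (far_weight_tail eta nu z d0 nb)); rewrite ler_wpM2r ?far_weight_ge0//.
apply: ler_powRl => //; first exact: ltW.
by rewrite ler_wpM2r ?exprn_ge0 ?invr_ge0// ler_peMl ?(ltW s0)// ler1n.
Qed.

(** The domain of the extension. It contains the spaces Z^{p,q}_beta for all p
    in [p0,oo], see [admissible_of_Lnorm], and is stable under linear
    combinations and restriction to sets. *)
Definition admissible (F : U -> R[i]) : Prop :=
  cmeasurable F /\ {ae mu, forall z, control (weighted_abs beta F) z < +oo}.

Lemma admissible_Lspace F (E : set U) : admissible F -> compact E -> (forall w, E w -> (0 < w.1)%R) ->
  Lspace q 0 (zero_off E F).
Proof.
move=> [cF Ry] cE E0; have mE := compact_measurable_half_space cE.
split; first exact: cmeasurable_zero_off.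
have [zs zsG zsE] := good_cover n0 Ry cE E0.
rewrite L_norm0E.
have -> : 'N[mu]_q[(fun w => (cabs (zero_off E F w))%:E)] = 'N[mu]_q[(fun w => (\1_E w * cabs (F w))%:E)].
  by apply: eq_Lnorm => w; rewrite normc_zero_off.
apply: (le_lt_trans (@Lnorm_cover _ _ q beta F E zs (ltW q1) cF mE _ zsE)); first by move=> z /zsG[].
rewrite big_seq; apply: (big_ind (fun x => x < +oo)) => //; first by move=> x y; exact: lte_add_pinfty.
move=> z /zsG[z0 Rzy]; apply: lte_mul_pinfty; rewrite ?lee_fin ?local_weight_ge0//.
apply: (le_lt_trans _ Rzy); apply: (@le_trans _ _ (wmean q enlarged_ind (weighted_abs beta F) z)); last by rewrite leeDl// wmean_ge0.
rewrite -[leRHS]mul1e; apply: wmeanZ_le => //; try exact: measurable_weighted_abs.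
- exact: measurable_whitney_ind.
- exact: measurable_enlarged_ind.
move=> w; rewrite (mulr_ge0 (whitney_ind_ge0 _ _) (weighted_abs_ge0 _ _ _)) mul1r ler_wpM2r ?weighted_abs_ge0//.
exact: whitney_ind_le_enlarged.
Qed.

Definition trunc (l : nat) (F : U -> R[i]) : U -> R[i] := zero_off (box l) F.

Lemma trunc_Lspace l F : admissible F -> Lspace q 0 (trunc l F).
Proof.
by move=> aF; apply: admissible_Lspace => //; [exact: compact_box|move=> w; exact: box_gt0].
Qed.

Lemma trunc_off l F w : ~ box l w -> trunc l F w = 0%R.
Proof. by move=> nb; rewrite /trunc /zero_off /patch memNset. Qed.

(** Cover E by Whitney regions whose base points have a finite control; on
    each of them the l-th increment, the image of the part of F between two
    boxes, is at most a multiple of 2^(-l delta). *)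
Lemma SIO_increments F (E : set U) : admissible F -> compact E -> (forall w, E w -> (0 < w.1)%R) ->
  \sum_(l <oo) 'N[mu]_r[(fun w => (\1_E w * cabs (S (trunc l.+1 F) w - S (trunc l F) w))%:E)] < +oo.
Proof.
move=> aF cE E0; have [cF Ry] := aF; have mE := compact_measurable_half_space cE.
have [C C0 hC] := SIO_tail_bound.
have [zs zsG zsE] := good_cover n0 Ry cE E0.
(* the increments are bounded by [Kf * rho ^+ l] *)
pose k z := (local_weight r (beta + kappa) z * (C * (68 * scale_at z) `^ delta) * fine (control (weighted_abs beta F) z))%R.
pose Kf := (\sum_(z <- zs) k z)%R.
have k0 z : (0 < z.1)%R -> (0 <= k z)%R.
  move=> z0; rewrite /k !mulr_ge0 ?powR_ge0 ?(ltW C0)// fine_ge0//; exact: control_ge0.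
have Kf0 : (0 <= Kf)%R by rewrite /Kf big_seq; apply: sumr_ge0 => z /zsG[z0 _]; exact: k0.
pose rho := ((2^-1 : R) `^ delta)%R.
have rho01 : (0 <= rho < 1)%R by rewrite powR_ge0 powR_lt1// half_itv01.
apply: (le_lt_trans _ (ltry (Kf / (1 - rho))%R)); apply: (le_trans _ (geometric_nneseries Kf0 rho01)).
apply: lee_nneseries => l _ //; rewrite ?Lnorm_ge0//.
pose A : set U := box l.+1 `\` box l.
have mA : measurable A by apply: measurableD; exact: measurable_box.
have L1 := trunc_Lspace l aF.
have LA : Lspace q 0 (zero_off A F).
  have -> : zero_off A F = zero_off A (trunc l.+1 F).
    apply/funext => w; rewrite /trunc /zero_off /patch; case: ifPn => // /set_mem[Bw _].
    by rewrite mem_set.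
  by apply: Lzo => //; exact: trunc_Lspace.
have SE : {ae mu, forall w, S (trunc l.+1 F) w - S (trunc l F) w = S (zero_off A F) w}%R.
  have := SIO_additive hS L1 LA.
  have -> : (fun w => trunc l F w + zero_off A F w)%R = trunc l.+1 F.
    apply/funext => w; rewrite /trunc /zero_off /patch /A in_setD.
    case: (boolP (w \in box l)) => /= wl; rewrite ?andbF ?andbT ?addr0 ?add0r//.
    by rewrite mem_set//; apply: box_mono (set_mem wl).
  by apply: filterS => w ->; rewrite addrAC subrr add0r.
have cSA := SIO_cm LA.
apply: (@le_trans _ _ 'N[mu]_r[(fun w => (\1_E w * cabs (S (zero_off A F) w))%:E)]).
  apply: ae_le_Lnorm => //.
  - apply/measurable_EFinP; apply: measurable_funM => //; apply: measurable_normc.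
    by apply: cmeasurableB; apply: SIO_cm; exact: trunc_Lspace.
  - by apply/measurable_EFinP; apply: measurable_funM => //; exact: measurable_normc.
  by apply: filterS SE => w ->.
apply: (le_trans (@Lnorm_cover _ _ r (beta + kappa) _ E zs (ltW r1) cSA mE _ zsE)); first by move=> z /zsG[].
rewrite /Kf mulr_suml -sumEFin big_seq [leRHS]big_seq; apply: lee_sum => z /zsG[z0 Rzy].
have Rf : control (weighted_abs beta F) z = (fine (control (weighted_abs beta F) z))%:E by rewrite fineK// ge0_fin_numE// control_ge0.
have := hC F A l l.+1 z z0 cF mA LA (fun w h => proj1 h) (fun w h => proj2 h).
have lw0 : 0 <= (local_weight r (beta + kappa) z)%:E by rewrite lee_fin local_weight_ge0.
move=> /(lee_wpmul2l lw0)/le_trans; apply.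
rewrite Rf -!EFinM lee_fin le_eqVlt; apply/orP; left; apply/eqP.
rewrite /k /rho -powR_exprn ?invr_ge0// powRM ?exprn_ge0 ?invr_ge0//; last first.
  by rewrite mulr_ge0// ltW// scale_at_gt0.
ring.
Qed.

(** The upper limit is measurable without any assumption of convergence, and
    [fine] makes it real. *)
Definition limit_of (u : nat -> U -> R) (w : U) : R := fine (limn_esup (fun l => (u l w)%:E)).

Lemma measurable_limit_of u : (forall l, measurable_fun setT (u l)) -> measurable_fun setT (limit_of u).
Proof.
move=> mu_; apply: (measurableT_comp (fine_measurable measurableT)).
by apply: measurable_fun_limn_esup => l; exact/measurable_EFinP.
Qed.

Lemma limit_of_cvg u w (c : R) : u ^~ w @ \oo --> c -> limit_of u w = c.
Proof.
move=> uc; have h : (fun l => (u l w)%:E) @ \oo --> c%:E by apply: cvg_EFin => //; exact: nearW.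
rewrite /limit_of is_cvg_limn_esupE; last by apply/cvg_ex; exists c%:E.
by rewrite (cvg_lim _ h).
Qed.

Definition Sext (F : U -> R[i]) (w : U) : R[i] :=
  Complex (limit_of (fun l w => complex.Re (S (trunc l F) w)) w)
          (limit_of (fun l w => complex.Im (S (trunc l F) w)) w).

Lemma cmeasurable_Sext F : admissible F -> cmeasurable (Sext F).
Proof.
move=> aF; split; apply: measurable_limit_of => l; have [] := SIO_cm (trunc_Lspace l aF) => //.
Qed.

Let part_le (pt : R[i] -> R) (F : U -> R[i]) (E : set U) : admissible F -> compact E -> (forall w, E w -> (0 < w.1)%R) ->
  (forall x y, `|pt x - pt y| <= cabs (x - y))%R ->
  (forall f : U -> R[i], cmeasurable f -> measurable_fun setT (fun w => pt (f w))) ->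
  let u l w := pt (S (trunc l F) w) in
  {ae mu, forall w, E w -> cvgn (u ^~ w)} /\
  forall v : U -> R, measurable_fun setT v ->
    {ae mu, forall w, E w -> u ^~ w @ \oo --> v w} ->
    (fun l => 'N[mu]_r[(fun w => (`|v w - u l w| * \1_E w)%:E)]) @ \oo --> 0.
Proof.
move=> aF cE E0 ptle mpt u; have mE := compact_measurable_half_space cE.
have cS l := SIO_cm (trunc_Lspace l aF).
apply: (@cvg_of_summable_increments _ U R musf r u E (ltW r1) mE) => [l|]; first exact: mpt.
apply: (le_lt_trans _ (SIO_increments aF cE E0)).
apply: lee_nneseries => l _ //; rewrite ?Lnorm_ge0//.
apply: (@le_Lnorm _ _ _ mu) => //.
- apply/measurable_EFinP; apply: measurable_funM => //; apply: measurableT_comp => //.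
  by apply: measurable_funB; exact: mpt.
- by apply/measurable_EFinP; apply: measurable_funM => //; apply: measurable_normc; exact: cmeasurableB.
move=> w; rewrite !gee0_abs ?lee_fin ?mulr_ge0 ?normc_ge0// mulrC; apply: ler_wpM2l => //; exact: ptle.
Qed.

Let Re_le (x y : R[i]) : (`|complex.Re x - complex.Re y| <= cabs (x - y))%R.
Proof. by rewrite -raddfB; exact: ler_Re_normc. Qed.
Let Im_le (x y : R[i]) : (`|complex.Im x - complex.Im y| <= cabs (x - y))%R.
Proof. by rewrite -raddfB; exact: ler_Im_normc. Qed.

Lemma Sext_cvg F : admissible F -> {ae mu, forall w,
  (fun l => complex.Re (S (trunc l F) w)) @ \oo --> complex.Re (Sext F w) /\
  (fun l => complex.Im (S (trunc l F) w)) @ \oo --> complex.Im (Sext F w)}.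
Proof.
move=> aF.
have hR m := (part_le aF (@compact_box R n m) (@box_gt0 R n m) Re_le (fun f (cf : cmeasurable f) => cf.1)).1.
have hI m := (part_le aF (@compact_box R n m) (@box_gt0 R n m) Im_le (fun f (cf : cmeasurable f) => cf.2)).1.
have aR := @ae_foralln _ _ R mu (fun m w => box m w -> cvgn (fun l => complex.Re (S (trunc l F) w))) hR.
have aI := @ae_foralln _ _ R mu (fun m w => box m w -> cvgn (fun l => complex.Im (S (trunc l F) w))) hI.
apply: filterS3 aR aI (@ae_dtdx_gt0 R n) => w hRw hIw w0.
have [m mw] := open_box_exhaust w0; have bw := open_box_sub mw.
split.
  by rewrite /Sext /= (limit_of_cvg (hRw m bw)); exact: hRw m bw.
by rewrite /Sext /= (limit_of_cvg (hIw m bw)); exact: hIw m bw.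
Qed.

(** [cvg_of_summable_increments] is applied to the real and the imaginary
    parts separately. *)
Lemma Sext_Lnorm_cvg F (E : set U) : admissible F -> compact E -> (forall w, E w -> (0 < w.1)%R) ->
  (fun l => 'N[mu]_r[(fun w => (\1_E w * cabs (Sext F w - S (trunc l F) w))%:E)]) @ \oo --> 0.
Proof.
move=> aF cE E0; have mE := compact_measurable_half_space cE.
have cS l := SIO_cm (trunc_Lspace l aF); have cX := cmeasurable_Sext aF.
have aR : {ae mu, forall w, E w -> (fun l => complex.Re (S (trunc l F) w)) @ \oo --> complex.Re (Sext F w)}.
  by apply: filterS (Sext_cvg aF) => w [h _] _.
have aI : {ae mu, forall w, E w -> (fun l => complex.Im (S (trunc l F) w)) @ \oo --> complex.Im (Sext F w)}.
  by apply: filterS (Sext_cvg aF) => w [_ h] _.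
have := (part_le aF cE E0 Re_le (fun f (cf : cmeasurable f) => cf.1)).2 _ cX.1 aR.
have := (part_le aF cE E0 Im_le (fun f (cf : cmeasurable f) => cf.2)).2 _ cX.2 aI.
set NI := fun l => _; set NR := fun l => _ => hI hR.
have hRI : (fun l => NR l + NI l) @ \oo --> 0.
  by rewrite -[0](@adde0 R); apply: cvgeD.
apply: (@squeeze_cvge _ _ _ _ (cst 0) _ (fun l => NR l + NI l)) => //; last exact: cvg_cst.
apply: nearW => l; rewrite Lnorm_ge0/=.
have mpart (v : U -> R) : measurable_fun setT v -> measurable_fun setT (fun w => (`|v w| * \1_E w)%:E).
  by move=> mv; apply/measurable_EFinP; apply: measurable_funM => //; exact: measurableT_comp.
have mR := mpart _ (measurable_funB cX.1 (cS l).1).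
have mI := mpart _ (measurable_funB cX.2 (cS l).2).
apply: (le_trans _ (@ge0_LnormD _ _ _ mu r _ _ (ltW r1) mR mI _ _)).
- apply: le_Lnorm => //.
  + by apply/measurable_EFinP; apply: measurable_funM => //; apply: measurable_normc; exact: cmeasurableB.
  + exact: emeasurable_funD.
  move=> w; rewrite gee0_abs ?lee_fin ?mulr_ge0 ?normc_ge0//.
  rewrite [X in (_ <= X)%R]ger0_norm ?addr_ge0 ?mulr_ge0// -mulrDl mulrC.
  rewrite ler_wpM2r//; apply: (le_trans (normc_le_sum _)); by rewrite !raddfB.
- by move=> w; rewrite lee_fin mulr_ge0.
- by move=> w; rewrite lee_fin mulr_ge0.
Qed.

(** The estimate holds for each truncation with the control of F itself; a
    Whitney region is contained in a box, where the truncations converge in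
    L^r. *)
Lemma Sext_bound : exists2 C : R, (0 < C)%R & forall F z, admissible F -> (0 < z.1)%R ->
  wmean r whitney_ind (weighted_abs (beta + kappa) (Sext F)) z <= C%:E * control (weighted_abs beta F) z.
Proof.
have [C C0 hC] := SIO_bound; exists C => // F z aF z0.
have cX := cmeasurable_Sext aF; have cS l := SIO_cm (trunc_Lspace l aF).
have [m mW] := whitney_sub_box z0; have mB : measurable (box m : set U) by exact: measurable_box.
set c := (beta + kappa)%R.
pose k := (z.1 `^ (- (n%:R / 2 * einv r)) * (4 `^ `|- c| * z.1 `^ (- c)))%R.
have k0 : (0 <= k)%R by rewrite !mulr_ge0 ?powR_ge0.
pose eps l := 'N[mu]_r[(fun w => (\1_(box m) w * cabs (Sext F w - S (trunc l F) w))%:E)].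
have eps_cvg : eps @ \oo --> 0 by apply: Sext_Lnorm_cvg => //; [exact: compact_box|exact: box_gt0].
have step l : wmean r whitney_ind (weighted_abs c (Sext F)) z <= k%:E * eps l + C%:E * control (weighted_abs beta F) z.
  have cD : cmeasurable (fun w => Sext F w - S (trunc l F) w)%R by exact: cmeasurableB.
  apply: (@le_trans _ _ (wmean r whitney_ind (weighted_abs c (fun w => Sext F w - S (trunc l F) w)%R) z + wmean r whitney_ind (weighted_abs c (S (trunc l F))) z)).
    apply: wmean_triangle; rewrite ?(ltW r1)//; try exact: weighted_abs_ge0; try exact: measurable_weighted_abs.
    - exact: measurable_whitney_ind.
    - apply: nearW => w; rewrite /weighted_abs -mulrDr ler_wpM2l ?powR_ge0//.
      by rewrite -{1}(subrK (S (trunc l F) w) (Sext F w)); exact: normcD.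
  apply: leeD.
    rewrite /wmean /k EFinM -muleA; apply: lee_wpmul2l; first by rewrite lee_fin powR_ge0.
    have mb : measurable_fun setT (fun w => (\1_(box m) w * cabs (Sext F w - S (trunc l F) w))%:E).
      by apply/measurable_EFinP; apply: measurable_funM => //; exact: measurable_normc.
    rewrite /eps -LnormZ_ge0 ?mulr_ge0 ?powR_ge0//.
    apply: le_Lnorm => //.
    - by apply: measurable_weight; [exact: measurable_whitney_ind|exact: measurable_weighted_abs].
    - exact: emeasurable_funM.
    move=> w; rewrite !gee0_abs ?lee_fin ?(mulr_ge0 (whitney_ind_ge0 _ _) (weighted_abs_ge0 _ _ _))//; last first.
      by rewrite !mulr_ge0 ?powR_ge0 ?normc_ge0.
    rewrite /whitney_ind; case: (boolP (in_whitney z w)) => [wW|_]; last by rewrite mul0r !mulr_ge0 ?powR_ge0 ?normc_ge0.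
    rewrite indicE mem_set ?mul1r; last exact: mW.
    rewrite /weighted_abs ler_wpM2r ?normc_ge0//; apply: powR_comparable => //.
    by case/and3P: wW => w1 -> _; rewrite andbT; move: w1 z0; lra.
  apply: (le_trans (hC (trunc l F) l z z0 (trunc_Lspace l aF) (@trunc_off l F))).
  apply: lee_wpmul2l; first by rewrite lee_fin ltW.
  apply: le_control; [exact: measurable_weighted_abs (trunc_Lspace l aF).1|exact: measurable_weighted_abs aF.1|].
  by move=> w; exact: weighted_abs_zero_off_le.
have h : (fun l => k%:E * eps l + C%:E * control (weighted_abs beta F) z) @ \oo --> C%:E * control (weighted_abs beta F) z.
  rewrite -[X in _ --> X]add0e; apply: cvgeD => //; last exact: cvg_cst.
  by rewrite -(mule0 k%:E); apply: cvgeZl.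
rewrite -(cvg_lim _ h)//; apply: lime_ge; first by apply/cvg_ex; eexists; exact: h.
exact: nearW.
Qed.

Lemma admissible_linear (a : R[i]) F G : admissible F -> admissible G -> admissible (fun w => a * F w + G w)%R.
Proof.
move=> [cF RF] [cG RG].
have cL : cmeasurable (fun w => a * F w + G w)%R.
  by apply: cmeasurableD => //; apply: cmeasurableM => //; exact: cmeasurable_cst.
split => //; apply: filterS2 RF RG => z RFz RGz.
apply: (@le_lt_trans _ _ ((cabs a)%:E * control (weighted_abs beta F) z + control (weighted_abs beta G) z)).
  apply: control_triangle; rewrite ?normc_ge0//; try exact: measurable_weighted_abs; try exact: weighted_abs_ge0.
  move=> w; rewrite /weighted_abs mulrCA -mulrDr ler_wpM2l ?powR_ge0// -Normc.normcM.
  exact: normcD.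
apply: lte_add_pinfty => //; apply: lte_mul_pinfty => //.
by rewrite lee_fin normc_ge0.
Qed.

Lemma Sext_linear (a : R[i]) F G : admissible F -> admissible G ->
  {ae mu, forall w, Sext (fun w => a * F w + G w)%R w = (a * Sext F w + Sext G w)%R}.
Proof.
move=> aF aG; have aL := admissible_linear a aF aG.
have [c [linS _]] := SIO_bounded hS.
have SL : {ae mu, forall w, forall l, S (trunc l (fun w => a * F w + G w)) w = a * S (trunc l F) w + S (trunc l G) w}%R.
  apply: ae_foralln => l; have := linop_linear linS a (trunc_Lspace l aF) (trunc_Lspace l aG).
  have -> : (fun w => a * trunc l F w + trunc l G w)%R = trunc l (fun w => a * F w + G w)%R.
    by apply/funext => w; rewrite /trunc /zero_off /patch; case: ifP => // _; rewrite mulr0 addr0.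
  by apply: filterS => w /(_ I).
have cvgFG : {ae mu, forall w,
    ((fun l => complex.Re (S (trunc l F) w)) @ \oo --> complex.Re (Sext F w) /\
     (fun l => complex.Im (S (trunc l F) w)) @ \oo --> complex.Im (Sext F w)) /\
    ((fun l => complex.Re (S (trunc l G) w)) @ \oo --> complex.Re (Sext G w) /\
     (fun l => complex.Im (S (trunc l G) w)) @ \oo --> complex.Im (Sext G w))}.
  by apply: filterS2 (Sext_cvg aF) (Sext_cvg aG) => w.
apply: filterS3 SL cvgFG (Sext_cvg aL) => w SLw [[RF IF_] [RG IG]] [RL IL].
have ReE : complex.Re (Sext (fun w => a * F w + G w)%R w) =
    (complex.Re a * complex.Re (Sext F w) - complex.Im a * complex.Im (Sext F w) + complex.Re (Sext G w))%R.
  rewrite -(cvg_lim (@Rhausdorff R) RL); apply: cvg_lim => //.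
  under eq_fun do rewrite SLw.
  rewrite (_ : (fun l => _) = (fun l => complex.Re a * complex.Re (S (trunc l F) w) - complex.Im a * complex.Im (S (trunc l F) w) + complex.Re (S (trunc l G) w)))%R.
    by apply: cvgD => //; apply: cvgB; apply: cvgMl_tmp.
  by apply/funext => l; case: (a) (S (trunc l F) w) (S (trunc l G) w) => [? ?] [? ?] [? ?].
have ImE : complex.Im (Sext (fun w => a * F w + G w)%R w) =
    (complex.Re a * complex.Im (Sext F w) + complex.Im a * complex.Re (Sext F w) + complex.Im (Sext G w))%R.
  rewrite -(cvg_lim (@Rhausdorff R) IL); apply: cvg_lim => //.
  under eq_fun do rewrite SLw.
  rewrite (_ : (fun l => _) = (fun l => complex.Re a * complex.Im (S (trunc l F) w) + complex.Im a * complex.Re (S (trunc l F) w) + complex.Im (S (trunc l G) w)))%R.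
    by apply: cvgD => //; apply: cvgD; apply: cvgMl_tmp.
  by apply/funext => l; case: (a) (S (trunc l F) w) (S (trunc l G) w) => [? ?] [? ?] [? ?].
move: ReE ImE; case: (a) (Sext F w) (Sext G w) (Sext _ w) => [? ?] [? ?] [? ?] [? ?] /= -> ->.
by [].
Qed.

Lemma Sext_ae F G : admissible F -> admissible G -> {ae mu, forall w, F w = G w} ->
  {ae mu, forall w, Sext F w = Sext G w}.
Proof.
move=> aF aG FG; have [c [linS _]] := SIO_bounded hS.
have : {ae mu, forall w, forall l, S (trunc l F) w = S (trunc l G) w}.
  apply: ae_foralln => l.
  have h : {ae mu, forall w, setT w -> trunc l F w = trunc l G w}.
    by apply: filterS FG => w FGw _; rewrite /trunc /zero_off /patch FGw.
  have := linop_ae linS (trunc_Lspace l aF) (trunc_Lspace l aG) h.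
  by apply: filterS => w /(_ I).
by apply: filterS => w h; rewrite /Sext /limit_of; congr Complex; congr (fine (limn_esup _));
  apply/funext => l; rewrite h.
Qed.

(** A function with compact essential support is, up to a null set, its own
    truncation to all large boxes. *)
Lemma Sext_eq F : admissible F -> Lspace_c q F -> {ae mu, forall w, Sext F w = S F w}.
Proof.
move=> aF [LF /ae_zero_off_box[l0 Fl0]]; have [c [linS _]] := SIO_bounded hS.
have : {ae mu, forall w, forall l, S (trunc (l + l0) F) w = S F w}.
  apply: ae_foralln => l.
  have h : {ae mu, forall w, setT w -> trunc (l + l0) F w = F w}.
    apply: filterS Fl0 => w Fw _; rewrite /trunc /zero_off /patch; case: ifPn => //.
    by rewrite notin_setE => nb; rewrite Fw// => bw; apply: nb; apply: box_mono bw; rewrite leq_addl.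
  have := linop_ae linS (trunc_Lspace (l + l0) aF) LF h.
  by apply: filterS => w /(_ I).
apply: filterS => w h.
have ev (pt : R[i] -> R) : limit_of (fun l w => pt (S (trunc l F) w)) w = pt (S F w).
  apply: limit_of_cvg; rewrite -(cvg_shiftn l0).
  rewrite (_ : (fun l => _) = cst (pt (S F w))); first exact: cvg_cst.
  by apply/funext => l; rewrite /= h.
by rewrite /Sext (ev (@complex.Re R)) (ev (@complex.Im R)); case: (S F w).
Qed.

Lemma admissible_of_Lnorm p F : p0 <= p -> cmeasurable F ->
  'N[mu]_p[wmean q whitney_ind (weighted_abs beta F)] < +oo -> admissible F.
Proof.
move=> pp cF Fy; have p_gt0 : 0 < p by exact: lt_le_trans pp.
split => //; have [C C0 hC] := Lnorm_control pp.
have mF := measurable_weighted_abs beta cF.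
have : 'N[mu]_p[control (weighted_abs beta F)] < +oo.
  apply: (le_lt_trans (hC _ mF (weighted_abs_ge0 _ _))); apply: lte_mul_pinfty => //.
  by rewrite lee_fin ltW.
move=> /(Lnorm_lty_ae p_gt0 (measurable_control mF)); apply: filterS => z.
by rewrite gee0_abs// control_ge0.
Qed.

Lemma admissible_zero_off F (A : set U) : measurable A -> admissible F -> admissible (zero_off A F).
Proof.
move=> mA [cF RF]; have cA := cmeasurable_zero_off mA cF; split => //.
apply: filterS RF => z; apply: le_lt_trans; apply: le_control; try exact: measurable_weighted_abs.
by move=> w; exact: weighted_abs_zero_off_le.
Qed.

(** The control at times before tau vanishes, so almost all Whitney means
    there are zero; almost every point at such a time lies in the Whitney
    region of base points that are still before tau. *)
Lemma Sext_causal F (tau : R) : admissible F -> (forall w, (w.1 < tau)%R -> F w = 0%R) ->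
  {ae mu, forall w, (w.1 < tau)%R -> Sext F w = 0%R}.
Proof.
move=> aF F0; have [C C0 hC] := Sext_bound; have cX := cmeasurable_Sext aF.
have mX := measurable_weighted_abs (beta + kappa) cX; have mF := measurable_weighted_abs beta aF.1.
have R0 z : (0 < z.1)%R -> (z.1 < tau)%R -> control (weighted_abs beta F) z = 0.
  move=> z0 zt; have v0 w : (w.1 <= z.1)%R -> weighted_abs beta F w = 0%R.
    by move=> wz; rewrite /weighted_abs F0 ?Normc.normc0 ?mulr0// (le_lt_trans wz).
  rewrite /control /wmean; have -> : (fun w => (enlarged_ind z w * weighted_abs beta F w)%:E) = cst 0.
    apply/funext => w; rewrite /enlarged_ind; case: (boolP (in_enlarged z w)) => [/and3P[_ wz _]|_]; last by rewrite mul0r.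
    by rewrite v0 ?mulr0.
  have -> : (fun w => (far_weight eta nu z w * weighted_abs beta F w)%:E) = cst 0.
    apply/funext => w; rewrite /far_weight; case: ifPn => [/andP[_ wz]|_]; last by rewrite mul0r.
    by rewrite v0 ?mulr0.
  by rewrite !Lnorm0 ?gt_eqF// !mule0 adde0.
have m1 : measurable [set ww : U * U | ((ww.1.1 < tau)%R%:R * (whitney_ind ww.1 ww.2 * weighted_abs (beta + kappa) (Sext F) ww.2))%:E <= 0].
  apply: measurable_ereal_le; last exact: measurable_cst.
  apply/measurable_EFinP; apply: measurable_funM.
    by apply: measurable_bool; apply: measurable_fun_ltr => //; exact: measurable_fst_comp.
  by apply: measurable_funM; [exact: measurable_whitney_ind|exact: (measurableT_comp mX measurable_snd)].
have : {ae mu, forall z, {ae mu, forall w, ((z.1 < tau)%R%:R * (whitney_ind z w * weighted_abs (beta + kappa) (Sext F) w))%:E <= 0}}.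
  apply: filterS (@ae_dtdx_gt0 R n) => z z0.
  case: (boolP (z.1 < tau)%R) => zt; last by apply: nearW => w; rewrite mul0r.
  have := hC F z aF z0; rewrite R0// mule0 => wm0.
  have tp : (0 < z.1 `^ (- (n%:R / 2 * einv r)))%R by exact: powR_gt0.
  have mw : measurable_fun setT (fun w => (whitney_ind z w * weighted_abs (beta + kappa) (Sext F) w)%:E).
    by apply: measurable_weight => //; exact: measurable_whitney_ind.
  have N0 : 'N[mu]_r[(fun w => (whitney_ind z w * weighted_abs (beta + kappa) (Sext F) w)%:E)] = 0.
    apply/eqP; rewrite eq_le Lnorm_ge0 andbT.
    by move: wm0; rewrite /wmean pmule_rle0// lte_fin.
  apply: filterS (Lnorm_eq0_eq0 mw r0 N0) => w /(_ I) h.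
  by rewrite mul1r h.
move=> /(@ae_prod_swap _ _ _ _ _ musf musf _ m1).
apply: filterS2 (@ae_dtdx_gt0 R n) => w w0 h wt.
(* base points with time in [w.1,b] are before tau and have w in their Whitney
   region *)
pose b := ((w.1 + Num.min tau (2 * w.1)) / 2)%R.
have wm : (w.1 < Num.min tau (2 * w.1))%R by rewrite lt_min wt/= ltr_pMl// ltr1n.
have wb : (w.1 < b)%R by rewrite /b; move: wm; lra.
have bt : (b < tau)%R.
  have : (Num.min tau (2 * w.1) <= tau)%R by rewrite ge_min lexx.
  by rewrite /b; move: wt; lra.
have b2 : (b <= 2 * w.1)%R.
  have : (Num.min tau (2 * w.1) <= 2 * w.1)%R by rewrite ge_min lexx orbT.
  by rewrite /b; move: w0; lra.
pose Q : set U := `[w.1, b]%classic `*` eball w.2 (1 * Num.sqrt w.1).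
have mQ : measurable Q by exact: measurable_tube_cc.
have b0 : (0 < b)%R by exact: lt_trans wb.
have wab : (0 < w.1 < b)%R by rewrite w0.
have Q0 : 0 < mu Q.
  apply: (lt_le_trans _ (@dtdx_tube_ge R n w.1 b 1 w.1 w.2 n0 wab ltr01 w0)).
  rewrite lte_fin; apply: mulr_gt0; first by rewrite divr_gt0// subr_gt0.
  apply: mulr_gt0; last exact: powR_gt0.
  by rewrite exprn_gt0// mulr1 divr_gt0// ltr0n.
have [z [Qz hz]] : exists z, Q z /\ ((z.1 < tau)%R%:R * (whitney_ind z w * weighted_abs (beta + kappa) (Sext F) w))%:E <= 0.
  apply: contrapT => hz; move: Q0; rewrite ltNge => /negP; apply.
  have [Z [mZ Z0 hZ]] := h; rewrite -Z0 le_measure ?inE// => z Qz; apply: hZ => Gz.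
  by apply: hz; exists z.
move: Qz => [/=]; rewrite in_itv/= => /andP[z1 z2]; rewrite /eball/= mul1r => z3.
have zW : in_whitney z w.
  rewrite /in_whitney z1 ler_pdivrMr// mulrC (le_trans z2 b2)/= edistC (lt_le_trans z3)//.
  by rewrite ler_wsqrtr.
move: hz; rewrite (le_lt_trans z2 bt) /whitney_ind zW !mul1r lee_fin /weighted_abs pmulr_rle0 ?powR_gt0// => h1.
by apply: Normc.eq0_normc; apply/eqP; rewrite eq_le h1 normc_ge0.
Qed.

(** The Whitney mean at z of F off the l-th box vanishes as soon as the box
    contains the Whitney region of z, and it is dominated by the Whitney mean
    of F, whose p-th power is integrable. *)
Lemma trunc_dense (p : R) F (eps : R) : p0 <= p%:E -> cmeasurable F ->
  'N[mu]_p%:E[wmean q whitney_ind (weighted_abs beta F)] < +oo -> (0 < eps)%R ->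
  exists l, 'N[mu]_p%:E[wmean q whitney_ind (weighted_abs beta (zero_off (~` box l) F))] <= eps%:E.
Proof.
move=> pp cF Fy e0; have p_gt0 : (0 < p)%R by rewrite -lte_fin (lt_le_trans p00).
have mF := measurable_weighted_abs beta cF.
have mB l : measurable (~` box l : set U) by apply: measurableC; exact: measurable_box.
have cB l := cmeasurable_zero_off (mB l) cF.
pose G l z := wmean q whitney_ind (weighted_abs beta (zero_off (~` box l) F)) z.
have mG l : measurable_fun setT (G l).
  by apply: measurable_wmean; [exact: measurable_whitney_ind|exact: measurable_weighted_abs|].
have mW : measurable_fun setT (wmean q whitney_ind (weighted_abs beta F)) by apply: measurable_wmean => //; exact: measurable_whitney_ind.
have G0 l z : 0 <= G l z by exact: wmean_ge0.
have W0 z : 0 <= wmean q whitney_ind (weighted_abs beta F) z by exact: wmean_ge0.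
have GW l z : G l z <= wmean q whitney_ind (weighted_abs beta F) z.
  apply: le_wmean => //; [exact: measurable_whitney_ind|exact: measurable_weighted_abs|].
  by move=> w; exact: weighted_abs_zero_off_le.
have IW : \int[mu]_z (wmean q whitney_ind (weighted_abs beta F) z) `^ p < +oo.
  have -> : \int[mu]_z (wmean q whitney_ind (weighted_abs beta F) z) `^ p = 'N[mu]_p%:E[wmean q whitney_ind (weighted_abs beta F)] `^ p.
    by rewrite poweR_Lnorm ?gt_eqF//; apply: eq_integral => z _; rewrite gee0_abs.
  exact: poweR_lty.
have G_cvg : {ae mu, forall z, setT z -> (fun l => (G l z) `^ p) @ \oo --> (0 : \bar R)}.
  apply: filterS (@ae_dtdx_gt0 R n) => z z0 _.
  have [m mW'] := whitney_sub_box z0; rewrite -(cvg_shiftn m).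
  rewrite (_ : (fun l => _) = cst 0); first exact: cvg_cst.
  apply/funext => l /=; rewrite /G /wmean (_ : (fun w => _) = cst 0); last first.
    apply/funext => w; rewrite /whitney_ind; case: (boolP (in_whitney z w)) => [/mW' bw|_]; last by rewrite mul0r.
    rewrite /weighted_abs normc_zero_off indicE memNset ?mul0r ?mulr0//.
    by move=> nb; apply: nb; apply: box_mono bw; rewrite leq_addl.
  by rewrite Lnorm0 ?gt_eqF// mule0 poweR_EFin powR0// gt_eqF.
have iW : mu.-integrable setT (fun z => (wmean q whitney_ind (weighted_abs beta F) z) `^ p).
  apply/integrableP; split; first exact: measurable_fun_poweR.
  by under eq_integral do rewrite gee0_abs ?poweR_ge0//.
have dom : {ae mu, forall z, forall l, setT z -> `|(G l z) `^ p| <= (wmean q whitney_ind (weighted_abs beta F) z) `^ p}.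
  by apply: nearW => z l _; rewrite gee0_abs ?poweR_ge0//; apply: le_poweR => //; exact: ltW.
have [_ _] := @dominated_convergence _ _ R mu setT measurableT (fun l z => (G l z) `^ p) (cst 0)
  (fun z => (wmean q whitney_ind (weighted_abs beta F) z) `^ p) (fun l => measurable_fun_poweR _ (mG l)) (measurable_cst _) G_cvg iW dom.
rewrite integral0 => h0.
have ep : 0 < (eps `^ p)%:E by rewrite lte_fin powR_gt0.
have : \forall l \near \oo, \int[mu]_z (G l z) `^ p < (eps `^ p)%:E.
  exact: h0 _ (open_ereal_lt' ep).
move=> [l _ /(_ l (leqnn l)) /= hl]; exists l.
rewrite Lnorm_le_integral ?lee_fin ?(ltW e0)// poweR_EFin.
under eq_integral do rewrite gee0_abs ?wmean_ge0//.
exact: ltW.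
Qed.

End extension.

(** * The extension on the Z-spaces *)

Section Z_extension.
Context {R : realType} {n : nat}.
Hypothesis n0 : (0 < n)%N.
Local Notation X := ('rV[R]_n).
Local Notation U := (R * 'rV[R]_n)%type.
Local Notation mu := (@dtdx R n).
Local Notation cabs := Normc.normc.
Variables (p0 q r : \bar R) (kappa : R) (M : \bar R) (N : R).
Variable S : (U -> R[i]) -> (U -> R[i]).
Variable K : R -> R -> (X -> R[i]) -> (X -> R[i]).
Hypothesis hS : is_SIO p0 q r kappa M S K.
Hypothesis hdec : off_diagonal_decay p0 r kappa N K.
Hypothesis aN : einv p0 < (kappa - n%:R / 2 * (einv p0 - einv r)) + N.
Variables (beta eta nu delta : R).
Hypotheses (eta0 : 0 < eta) (d0 : 0 < delta) (eb : eta + delta < beta + 1).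
Hypotheses (nu0 : n%:R / 2 * einv p0 < nu) (nuN : nu + delta < N).
Local Open Scope ereal_scope.

Let p01 : 1 < p0. Proof. by have [] := SIO_exponents hS. Qed.
Let q1 : 1 < q. Proof. by have [] := SIO_exponents hS. Qed.
Let r1 : 1 < r. Proof. by have [] := SIO_exponents hS. Qed.
Let pq : p0 <= q. Proof. by have [] := SIO_exponents hS. Qed.
Let p00 : 0 < p0. Proof. exact: lt_trans p01. Qed.
Let q0 : 0 < q. Proof. exact: lt_trans q1. Qed.
Let r0 : 0 < r. Proof. exact: lt_trans r1. Qed.

Local Notation adm := (admissible p0 q beta eta nu).
Local Notation Sx := (Sext S).

Lemma Z_norm_wmean p (s : \bar R) : 0 < p -> 0 < s -> exists2 C : R, (0 < C)%R &
  forall c (u : U -> R[i]), cmeasurable u ->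
  Z_norm p s c u <= C%:E * 'N[mu]_p[wmean s whitney_ind (weighted_abs c u)] /\
  'N[mu]_p[wmean s whitney_ind (weighted_abs c u)] <= C%:E * Z_norm p s c u.
Proof.
move=> p_gt0 s0; have [C C0 hC] := @whitney_mean_wmean R n n0 s s0.
have C0' : 0 <= C%:E by rewrite lee_fin ltW.
exists C => // c u cu; have mu_ := measurable_weighted_abs c cu.
have mw := measurable_whitney_mean n0 c s0 cu.
have mW : measurable_fun setT (wmean s whitney_ind (weighted_abs c u)) by apply: measurable_wmean => //; exact: measurable_whitney_ind.
have w0 z : 0 <= whitney_mean s c u z.
  move: s0 => /gt0_cases[->|[a a0 ->]]; last by rewrite /whitney_mean poweR_ge0.
  by rewrite whitney_mean_infty// wmean_ge0.
split; rewrite -LnormZ_ge0 ?(ltW C0)//; apply: ae_le_Lnorm => //; try exact: emeasurable_funM.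
  apply: filterS (@ae_dtdx_gt0 R n) => z z0.
  by rewrite (gee0_abs (w0 z)) (gee0_abs (mule_ge0 C0' (wmean_ge0 _ _ _ _))); have [] := hC c u z cu z0.
apply: filterS (@ae_dtdx_gt0 R n) => z z0.
by rewrite (gee0_abs (mule_ge0 C0' (w0 z))) (gee0_abs (wmean_ge0 _ _ _ _)); have [] := hC c u z cu z0.
Qed.

Lemma measurable_strip (T : \bar R) : measurable (strip T : set U).
Proof.
rewrite (_ : strip T = ((fst : U -> R) @^-1` [set s : R | (0 < s)%R /\ s%:E < T])); last first.
  by apply/seteqP; split.
rewrite -[X in measurable X]setTI; apply: (@measurable_fst _ _ R X) => //.
move: T => [T||]; last 2 first.
- rewrite (_ : [set s | _] = `]0%R, +oo[%classic)//; apply/seteqP; split => s /=; rewrite in_itv/= andbT; first by case.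
  by move=> s0; split => //; exact: ltry.
- rewrite (_ : [set s | _] = set0)//; apply/seteqP; split => s //= [_]; by rewrite ltNge leNye.
rewrite (_ : [set s | _] = `]0%R, T[%classic)//; apply/seteqP; split => s /=; rewrite in_itv/= lte_fin; first by case=> -> ->.
by move=> /andP[].
Qed.

Lemma zero_off_linear (A : set U) (a : R[i]) (f g : U -> R[i]) :
  zero_off A (fun w => a * f w + g w)%R = (fun w => a * zero_off A f w + zero_off A g w)%R.
Proof. by apply/funext => w; rewrite /zero_off /patch; case: ifP => // _; rewrite mulr0 addr0. Qed.

Lemma Z_norm_admissible p (F : U -> R[i]) : p0 <= p -> cmeasurable F -> Z_norm p q beta F < +oo -> adm F.
Proof.
move=> pp cF Fy; have p_gt0 : 0 < p by exact: lt_le_trans pp.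
have [C C0 hC] := Z_norm_wmean p_gt0 q0.
apply: (admissible_of_Lnorm n0 hS eta0 nu0 pp cF).
apply: (le_lt_trans (hC beta F cF).2); apply: lte_mul_pinfty => //.
by rewrite lee_fin ltW.
Qed.

Lemma Zspace_admissible p (T : \bar R) (f : U -> R[i]) : p0 <= p -> Zspace p q beta T f -> adm (zero_off (strip T) f).
Proof. by move=> pp [cF Fy]; exact: (Z_norm_admissible pp). Qed.

(** H stands for the restriction of the extension to a strip, or for zero off
    a shorter strip; only the size of H matters. *)
Lemma Sext_Z_bound p : p0 <= p -> exists2 C : R, (0 < C)%R & forall G H : U -> R[i],
  adm G -> cmeasurable H -> {ae mu, forall w, cabs (H w) <= cabs (Sx G w)}%R ->
  Z_norm p r (beta + kappa) H <= C%:E * Z_norm p q beta G.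
Proof.
move=> pp; have p_gt0 : 0 < p by exact: lt_le_trans pp.
have [Cr Cr0 hr] := Z_norm_wmean p_gt0 r0; have [Cq Cq0 hq] := Z_norm_wmean p_gt0 q0.
have [C1 C10 h1] := Sext_bound n0 hS hdec aN eta0 d0 eb nu0 nuN.
have [C2 C20 h2] := Lnorm_control n0 hS eta0 nu0 pp.
exists (Cr * (C1 * (C2 * Cq)))%R; first by rewrite !mulr_gt0.
move=> G H aG cH HG; set c := (beta + kappa)%R.
have cX := cmeasurable_Sext n0 hS aG.
have mG := measurable_weighted_abs beta aG.1.
have mWH : measurable_fun setT (wmean r whitney_ind (weighted_abs c H)).
  by apply: measurable_wmean => //; [exact: measurable_whitney_ind|exact: measurable_weighted_abs].
have mR : measurable_fun setT (control p0 q eta nu (weighted_abs beta G)) by exact: (measurable_control hS).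
apply: (le_trans (hr c H cH).1); rewrite EFinM -muleA; apply: lee_wpmul2l; first by rewrite lee_fin ltW.
apply: (@le_trans _ _ (C1%:E * 'N[mu]_p[control p0 q eta nu (weighted_abs beta G)])).
  rewrite -LnormZ_ge0 ?(ltW C10)//; apply: ae_le_Lnorm => //; first exact: emeasurable_funM.
  apply: filterS (@ae_dtdx_gt0 R n) => z z0.
  have C10' : 0 <= C1%:E by rewrite lee_fin ltW.
  rewrite (gee0_abs (wmean_ge0 _ _ _ _)) (gee0_abs (mule_ge0 C10' (control_ge0 _ _ _ _ _ _))).
  apply: (le_trans _ (h1 G z aG z0)); apply: lee_wpmul2l; first by rewrite lee_fin powR_ge0.
  apply: ae_le_Lnorm => //.
  - by apply: measurable_weight; [exact: measurable_whitney_ind|exact: measurable_weighted_abs].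
  - by apply: measurable_weight; [exact: measurable_whitney_ind|exact: measurable_weighted_abs].
  apply: filterS HG => w hw; rewrite !gee0_abs ?lee_fin ?(mulr_ge0 (whitney_ind_ge0 _ _) (weighted_abs_ge0 _ _ _))//.
  by rewrite ler_wpM2l ?whitney_ind_ge0// /weighted_abs ler_wpM2l ?powR_ge0.
rewrite EFinM -muleA; apply: lee_wpmul2l; first by rewrite lee_fin ltW.
apply: (le_trans (h2 _ mG (weighted_abs_ge0 _ _))); rewrite EFinM -muleA; apply: lee_wpmul2l; first by rewrite lee_fin ltW.
exact: (hq beta G aG.1).2.
Qed.

Lemma zero_off_abs_le (A : set U) (u : U -> R[i]) w : (cabs (zero_off A u w) <= cabs (u w))%R.
Proof. by rewrite normc_zero_off ler_piMl ?normc_ge0. Qed.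

Section fixed_bound.
Variables (p : \bar R) (c : R).
Hypothesis pp : p0 <= p.
Hypothesis c0 : (0 < c)%R.
Hypothesis hc : forall G H : U -> R[i],
  adm G -> cmeasurable H -> {ae mu, forall w, cabs (H w) <= cabs (Sx G w)}%R ->
  Z_norm p r (beta + kappa) H <= c%:E * Z_norm p q beta G.

Lemma bounded_Z T : bounded_operator mu (strip T)
  (Zspace p q beta T) (Z_norm_on p q beta T)
  (Zspace p r (beta + kappa) T) (Z_norm_on p r (beta + kappa) T) c
  (fun f => Sx (zero_off (strip T) f)).
Proof.
have mT := measurable_strip T.
have bnd f : Zspace p q beta T f ->
    Z_norm_on p r (beta + kappa) T (Sx (zero_off (strip T) f)) <= c%:E * Z_norm_on p q beta T f.
  move=> Zf; have aF := Zspace_admissible pp Zf; apply: hc => //.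
    by apply: cmeasurable_zero_off => //; exact: (cmeasurable_Sext n0 hS aF).
  by apply: nearW => w; exact: zero_off_abs_le.
split; last exact: bnd.
split.
- move=> f Zf; have aF := Zspace_admissible pp Zf; split.
    by apply: cmeasurable_zero_off => //; exact: (cmeasurable_Sext n0 hS aF).
  apply: (le_lt_trans (bnd f Zf)); apply: lte_mul_pinfty; rewrite ?lee_fin ?(ltW c0)//.
  by have [] := Zf.
- move=> f g Zf Zg fg; have aF := Zspace_admissible pp Zf; have aG := Zspace_admissible pp Zg.
  have FG : {ae mu, forall w, zero_off (strip T) f w = zero_off (strip T) g w}.
    by apply: filterS fg => w h; rewrite /zero_off /patch; case: ifPn => // /set_mem/h.
  by apply: filterS (Sext_ae n0 hS aF aG FG) => w h _.
- move=> a f g Zf Zg; have aF := Zspace_admissible pp Zf; have aG := Zspace_admissible pp Zg.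
  rewrite zero_off_linear.
  by apply: filterS (Sext_linear n0 hS hdec aN eta0 d0 eb nu0 nuN a aF aG) => w h _.
Qed.

End fixed_bound.

(** Before time tau the image of f is the image of the restriction of f to the
    strip of height tau, by causality. Hence the bound on that strip: the
    smallness on (0,tau) is preserved with eps / c in place of eps. *)
Lemma bounded_vZ (c : R) (T : \bar R) : p0 <= +oo -> (0 < c)%R ->
  (forall G H : U -> R[i],
    adm G -> cmeasurable H -> {ae mu, forall w, cabs (H w) <= cabs (Sx G w)}%R ->
    Z_norm +oo r (beta + kappa) H <= c%:E * Z_norm +oo q beta G) ->
  bounded_operator mu (strip T)
    (vZspace q beta T) (Z_norm_on +oo q beta T)
    (vZspace r (beta + kappa) T) (Z_norm_on +oo r (beta + kappa) T) c
    (fun f => Sx (zero_off (strip T) f)).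
Proof.
move=> pp c0 hc; have [linZ bnd] := bounded_Z pp c0 hc T.
split; last by move=> f [Zf _]; exact: bnd.
split; last 2 first.
- by move=> f g [Zf _] [Zg _]; exact: (linop_ae linZ).
- by move=> a f g [Zf _] [Zg _]; exact: (linop_linear linZ).
move=> f [Zf vf]; split; first exact: (linop_maps linZ).
move=> eps e0; have [|tau [tau0 tauT ftau]] := vf (eps / c)%R; first by rewrite divr_gt0.
exists tau; split => //.
have aF := Zspace_admissible pp Zf; set F := zero_off (strip T) f in aF *.
have mtau := measurable_strip tau%:E.
have sub w : strip tau%:E w -> strip T w.
  by move=> [w0 wt]; split => //; exact: lt_le_trans tauT.
have F1E : zero_off (strip tau%:E) F = zero_off (strip tau%:E) f.
  apply/funext => w; rewrite /F /zero_off /patch; case: ifPn => // /set_mem/sub h.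
  by rewrite mem_set.
set F1 := zero_off (strip tau%:E) f in F1E.
have aF1 : adm F1 by rewrite -F1E; exact: (admissible_zero_off hS).
pose F2 := zero_off (~` strip tau%:E) F.
have aF2 : adm F2 by apply: (admissible_zero_off hS) => //; exact: measurableC.
have F2_0 w : (w.1 < tau)%R -> F2 w = 0%R.
  move=> wt; rewrite /F2 /F /zero_off /patch; case: ifPn => // /set_mem ns.
  by rewrite memNset// => -[w0 _]; apply: ns; split => //; rewrite lte_fin.
have FE : F = (fun w => 1 * F1 w + F2 w)%R.
  apply/funext => w; rewrite mul1r -F1E /F2 /zero_off /patch in_setC.
  by case: (w \in strip tau%:E) => /=; rewrite ?addr0 ?add0r.
have SF : {ae mu, forall w, (w.1 < tau)%R -> Sx F w = Sx F1 w}.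
  rewrite FE.
  apply: filterS2 (Sext_linear n0 hS hdec aN eta0 d0 eb nu0 nuN 1%R aF1 aF2)
    (Sext_causal n0 hS hdec aN eta0 d0 eb nu0 nuN aF2 F2_0) => w -> h2 wt.
  by rewrite h2// addr0 mul1r.
have cX := cmeasurable_Sext n0 hS aF.
apply: (@le_trans _ _ (c%:E * Z_norm +oo q beta F1)).
  apply: hc => //; first exact: cmeasurable_zero_off.
  apply: filterS SF => w h; rewrite normc_zero_off indicE.
  have [/set_mem[_ wt]|_] := boolP (w \in strip tau%:E); last by rewrite mul0r normc_ge0.
  by rewrite mul1r h// -lte_fin.
apply: (@le_trans _ _ (c%:E * (eps / c)%:E)); first by apply: lee_wpmul2l => //; rewrite lee_fin ltW.
by rewrite -EFinM mulrC mulfVK// gt_eqF.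
Qed.

Lemma Sext_on_compact_support (T : \bar R) (f : U -> R[i]) : adm (zero_off (strip T) f) -> Lspace_c_strip q T f ->
  {ae mu, forall z, strip T z -> Sx (zero_off (strip T) f) z = S (zero_off (strip T) f) z}.
Proof. by move=> aF Lf; apply: filterS (Sext_eq n0 hS aF Lf) => z h _. Qed.

(** Truncation to a box is compatible with restriction to the strip, so that
    truncations approximate within the space on the strip. *)
Lemma Z_dense (p : R) (T : \bar R) (f : U -> R[i]) (eps : R) : p0 <= p%:E -> Zspace p%:E q beta T f -> (0 < eps)%R ->
  exists g : U -> R[i], [/\ Zspace p%:E q beta T g, Lspace_c_strip q T g &
    Z_norm_on p%:E q beta T (fun z => f z - g z)%R <= eps%:E].
Proof.
move=> pp Zf e0; have aF := Zspace_admissible pp Zf; have [cF Fy] := Zf.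
have p_gt0 : 0 < p%:E by exact: lt_le_trans pp.
have [C C0 hC] := Z_norm_wmean p_gt0 q0.
set F := zero_off (strip T) f in aF cF Fy.
have wF : 'N[mu]_p%:E[wmean q whitney_ind (weighted_abs beta F)] < +oo.
  apply: (le_lt_trans (hC beta F cF).2); apply: lte_mul_pinfty => //.
  by rewrite lee_fin ltW.
have [|l hl] := trunc_dense hS (eps := (eps / C)%R) pp cF wF; first by rewrite divr_gt0.
pose g := trunc l F.
have mb : measurable (box l : set U) by exact: measurable_box.
have gE : zero_off (strip T) g = g.
  apply/funext => w; rewrite /g /trunc /F /zero_off /patch.
  by case: (w \in strip T) => //; case: (w \in box l).
have cg : cmeasurable g by exact: cmeasurable_zero_off.
exists g; split.
- split; rewrite ?/Z_norm_on gE//.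
  apply: (le_lt_trans (hC beta g cg).1); apply: lte_mul_pinfty; rewrite ?lee_fin ?(ltW C0)//.
  apply: (le_lt_trans _ wF); apply: le_Lnorm => //.
  - by apply: measurable_wmean => //; [exact: measurable_whitney_ind|exact: measurable_weighted_abs].
  - by apply: measurable_wmean => //; [exact: measurable_whitney_ind|exact: measurable_weighted_abs].
  move=> z; rewrite !gee0_abs ?wmean_ge0//; apply: le_wmean => //; try exact: measurable_weighted_abs.
  + exact: measurable_whitney_ind.
  + by move=> w; exact: weighted_abs_zero_off_le.
- rewrite /Lspace_c_strip/= gE; split; first exact: (trunc_Lspace n0 hS l aF).
  by apply: compact_ess_supp; exact: trunc_off.
- have -> : Z_norm_on p%:E q beta T (fun z => f z - g z)%R = Z_norm p%:E q beta (zero_off (~` box l) F).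
    rewrite /Z_norm_on; congr (Z_norm _ _ _ _); apply/funext => w.
    rewrite /g /trunc /F /zero_off /patch in_setC.
    by case: (w \in strip T); case: (w \in box l); rewrite /= ?subrr ?subr0.
  apply: (le_trans (hC beta _ (cmeasurable_zero_off (measurableC mb) cF)).1).
  apply: (@le_trans _ _ (C%:E * (eps / C)%:E)); first by apply: lee_wpmul2l => //; rewrite lee_fin ltW.
  by rewrite -EFinM mulrC mulfVK// gt_eqF.
Qed.

Lemma Lspace_on_compact s g (u : U -> R[i]) (E : set U) : 0 < s -> compact E -> (forall w, E w -> (0 < w.1)%R) ->
  Lspace s g u -> Lspace_on s E u.
Proof.
move=> s0 cE E0 [cu uy]; have mE := compact_measurable_half_space cE.
have [l El] := compact_sub_open_box cE E0.
split; first exact: cmeasurable_zero_off.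
pose k := ((2 ^+ l) `^ `|g| : R)%R.
have k0 : (0 <= k)%R by exact: powR_ge0.
apply: (@le_lt_trans _ _ (k%:E * L_norm s g u)); last by apply: lte_mul_pinfty; rewrite ?lee_fin.
have ma : measurable_fun setT (fun w => (weighted_abs g u w)%:E) by apply/measurable_EFinP; exact: measurable_weighted_abs.
rewrite L_norm0E /L_norm -LnormZ_ge0//; apply: le_Lnorm => //.
- by apply/measurable_EFinP; apply: measurable_normc; exact: cmeasurable_zero_off.
- exact: emeasurable_funM.
move=> w; rewrite !gee0_abs ?lee_fin ?mulr_ge0 ?normc_ge0 ?powR_ge0//.
rewrite normc_zero_off indicE; have [/set_mem Ew|_] := boolP (w \in E); last by rewrite mul0r !mulr_ge0 ?powR_ge0 ?normc_ge0.
have [/andP[w1 w2] _] := El w Ew; have w0 := E0 w Ew.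
apply: (@le_trans _ _ (w.1 `^ g * weighted_abs g u w)%R); first by rewrite mul1r -weighted_absK.
apply: ler_wpM2r; first exact: weighted_abs_ge0.
have l2 : (0 <= ln (2 ^+ l) :> R)%R by rewrite ln_ge0// exprn_ege1// ler1n.
rewrite /k /powR (gt_eqF w0) (gt_eqF (_ : 0 < 2 ^+ l)%R) ?exprn_gt0// ler_expR.
apply: (le_trans (ler_norm _)); rewrite normrM ler_wpM2l// ler_norml; apply/andP; split.
  rewrite -lnV ?posrE ?exprn_gt0// ler_ln ?posrE ?invr_gt0 ?exprn_gt0//.
  by rewrite -exprVn ltW.
by rewrite ler_ln ?posrE ?exprn_gt0// ltW.
Qed.

(** A compact subset of the half-space lies in a box, so the truncations are
    eventually equal to F on it. *)
Lemma Sext_compact_convergence F : adm F -> exists2 f_ : nat -> (U -> R[i]),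
  forall m, Lspace_c q (f_ m) &
  forall E : set U, compact E -> (forall z, E z -> (0 < z.1)%R) ->
    cvg_L_on q E f_ F /\ cvg_L_on r E (fun m => S (f_ m)) (Sx F).
Proof.
move=> aF; exists (fun m => trunc m F).
  move=> m; split; first exact: (trunc_Lspace n0 hS m aF).
  by apply: compact_ess_supp; exact: trunc_off.
move=> E cE E0; have mE := compact_measurable_half_space cE.
have [c [linS _]] := SIO_bounded hS.
have LS m := linop_maps linS (trunc_Lspace n0 hS m aF).
have cX := cmeasurable_Sext n0 hS aF.
have cvgS := Sext_Lnorm_cvg n0 hS hdec aN eta0 d0 eb nu0 nuN aF cE E0.
split; split.
- by move=> m; apply: Lspace_zero_off => //; exact: (trunc_Lspace n0 hS m aF).
- exact: (admissible_Lspace n0 hS aF cE E0).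
- have [l El] := compact_sub_open_box cE E0.
  rewrite -(cvg_shiftn l) (_ : (fun m => _) = cst 0); first exact: cvg_cst.
  apply/funext => m /=; rewrite L_norm0E (_ : (fun w => _) = cst 0) ?Lnorm0 ?gt_eqF//.
  apply/funext => w; rewrite normc_zero_off indicE; have [/set_mem Ew|_] := boolP (w \in E); last by rewrite mul0r.
  rewrite /trunc /zero_off /patch mem_set ?subrr ?Normc.normc0 ?mulr0//.
  by apply: (@box_mono R n l); [rewrite leq_addl|apply/open_box_sub/El].
- by move=> m; exact: Lspace_on_compact (LS m).
- split; first exact: cmeasurable_zero_off.
  have : \forall l \near \oo, 'N[mu]_r[(fun w => (\1_E w * cabs (Sx F w - S (trunc l F) w))%:E)] < 1%:E.
    by apply: cvgS _ (open_ereal_lt' _); rewrite lte_fin.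
  move=> [l _ /(_ l (leqnn l)) /= hl].
  have [_ Sy] := Lspace_on_compact r0 cE E0 (LS l).
  rewrite L_norm0E in Sy; rewrite L_norm0E.
  have cD : cmeasurable (fun w => Sx F w - S (trunc l F) w)%R by apply: cmeasurableB => //; exact: (LS l).1.
  have m1 : measurable_fun setT (fun w => (\1_E w * cabs (Sx F w - S (trunc l F) w))%:E).
    by apply/measurable_EFinP; apply: measurable_funM => //; exact: measurable_normc.
  have m2 : measurable_fun setT (fun w => (cabs (zero_off E (S (trunc l F)) w))%:E).
    by apply/measurable_EFinP; apply: measurable_normc; apply: cmeasurable_zero_off => //; exact: (LS l).1.
  apply: (@le_lt_trans _ _ ('N[mu]_r[(fun w => (\1_E w * cabs (Sx F w - S (trunc l F) w))%:E)] +
      'N[mu]_r[(fun w => (cabs (zero_off E (S (trunc l F)) w))%:E)])); last first.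
    by apply: lte_add_pinfty => //; apply: lt_trans hl _; rewrite ltry.
  apply: (le_trans _ (@ge0_LnormD _ _ _ mu r _ _ (ltW r1) m1 m2 _ _)).
  + apply: le_Lnorm => //.
    * by apply/measurable_EFinP; apply: measurable_normc; exact: cmeasurable_zero_off.
    * exact: emeasurable_funD.
    move=> w; rewrite gee0_abs ?lee_fin ?normc_ge0// [X in (_ <= X)%R]ger0_norm ?addr_ge0 ?mulr_ge0 ?normc_ge0//.
    rewrite !normc_zero_off -mulrDr ler_wpM2l//.
    by rewrite -{1}(subrK (S (trunc l F) w) (Sx F w)); exact: normcD.
  + by move=> w; rewrite lee_fin mulr_ge0 ?normc_ge0.
  + by move=> w; rewrite lee_fin normc_ge0.
- rewrite (_ : (fun m => _) = (fun l => 'N[mu]_r[(fun w => (\1_E w * cabs (Sx F w - S (trunc l F) w))%:E)]))//.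
  apply/funext => m; rewrite L_norm0E; apply: eq_Lnorm => w.
  by rewrite normc_zero_off -normcN opprB.
Qed.

End Z_extension.

Theorem theorem3p4 (R : realType) (n : nat) (hn : (0 < n)%N)
    (p0 q r : \bar R) (kappa : R) (M : \bar R)
    (hp0 : (1 < p0)%E) (hq : (1 < q)%E) (hr : (1 < r)%E)
    (hkappa : 0 <= kappa <= 1) (hM : (0 <= M)%E)
    (hqp0 : (p0 <= q)%E) (hrq : (q <= r)%E)
    (hM1 : ((n%:R / 2 * einv p0)%:E < M)%E)
    (hM2 : ((n%:R / 2 * (einv p0 - einv r) + einv p0 - kappa)%:E < M)%E)
    (S : (R * 'rV[R]_n -> R[i]) -> (R * 'rV[R]_n -> R[i]))
    (K : R -> R -> ('rV[R]_n -> R[i]) -> ('rV[R]_n -> R[i]))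
    (hS : is_SIO p0 q r kappa M S K)
    (beta : R) (hbeta : -1 < beta) :
  (* (i) *)
  (forall p : R, (p0 <= p%:E)%E ->
   exists c : R, forall T : \bar R, (0 < T)%E ->
     (forall f, Zspace p%:E q beta T f -> forall eps : R, 0 < eps ->
        exists g : R * 'rV[R]_n -> R[i],
          [/\ Zspace p%:E q beta T g, Lspace_c_strip q T g &
          (Z_norm_on p%:E q beta T (fun z => f z - g z)%R <= eps%:E)%E]) /\
     exists St : (R * 'rV[R]_n -> R[i]) -> (R * 'rV[R]_n -> R[i]),
       bounded_operator dtdx (strip T)
         (Zspace p%:E q beta T) (Z_norm_on p%:E q beta T)
         (Zspace p%:E r (beta + kappa) T) (Z_norm_on p%:E r (beta + kappa) T) c St /\
       forall f, Zspace p%:E q beta T f -> Lspace_c_strip q T f ->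
         {ae dtdx, forall z, strip T z -> St f z = S (zero_off (strip T) f) z}) /\
  (* (ii) *)
  (exists c : R, forall T : \bar R, (0 < T)%E ->
     exists St : (R * 'rV[R]_n -> R[i]) -> (R * 'rV[R]_n -> R[i]),
       [/\ bounded_operator dtdx (strip T)
             (Zspace +oo%E q beta T) (Z_norm_on +oo%E q beta T)
             (Zspace +oo%E r (beta + kappa) T) (Z_norm_on +oo%E r (beta + kappa) T)
             c St,
           forall f, Zspace +oo%E q beta T f -> Lspace_c_strip q T f ->
             {ae dtdx, forall z, strip T z -> St f z = S (zero_off (strip T) f) z},
           forall f, Zspace +oo%E q beta T f ->
             exists2 f_ : nat -> (R * 'rV[R]_n -> R[i]),
               forall m, Lspace_c q (f_ m) &
               forall E : set (R * 'rV[R]_n), compact E ->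
                 (forall z, E z -> 0 < z.1 /\ (z.1%:E <= T)%E) ->
                 cvg_L_on q E f_ (zero_off (strip T) f) /\
                 exists u, cvg_L_on r E (fun m => S (f_ m)) u /\
                   {ae dtdx, forall z, E z -> u z = St f z} &
           bounded_operator dtdx (strip T)
             (vZspace q beta T) (Z_norm_on +oo%E q beta T)
             (vZspace r (beta + kappa) T) (Z_norm_on +oo%E r (beta + kappa) T)
             c St]).
Proof.
have p00 : (0 < p0)%E by exact: lt_trans hp0.
set e0 := n%:R / 2 * einv p0 in hM1.
set e1 := n%:R / 2 * (einv p0 - einv r) + einv p0 - kappa in hM2.
have e00 : 0 <= e0 by rewrite mulr_ge0 ?divr_ge0 ?einv_ge0.
(* for M = oo, a finite exponent beyond both thresholds *)
have [N [N0 e0N e1N MN]] : exists N : R, [/\ 0 <= N, e0 < N, e1 < N & M = N%:E \/ M = +oo%E].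
  move: M hM hM1 hM2 {hS} => [m||] //=; rewrite ?lte_fin ?lee_fin => h1 h2 h3.
    by exists m; split => //; left.
  exists (`|e0| + `|e1| + 1); split; [by rewrite !addr_ge0| | |by right].
    by have := ler_norm e0; have := normr_ge0 e1; lra.
  by have := ler_norm e1; have := normr_ge0 e0; lra.
have hdec := SIO_offdiag hS N0 MN.
have aN : einv p0 < kappa - n%:R / 2 * (einv p0 - einv r) + N by move: e1N; rewrite /e1; lra.
(* eta and nu are midpoints of their admissible intervals, delta half the room
   that is left *)
pose eta := (beta + 1) / 2; pose nu := (e0 + N) / 2.
pose delta := Num.min ((beta + 1) / 4) ((N - e0) / 4).
have eta0 : 0 < eta by rewrite /eta; lra.
have d0 : 0 < delta by rewrite lt_min; apply/andP; split; lra.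
have eb : eta + delta < beta + 1.
  have : delta <= (beta + 1) / 4 by rewrite ge_min lexx.
  by rewrite /eta; lra.
have nu0 : e0 < nu by rewrite /nu; lra.
have nuN : nu + delta < N.
  have : delta <= (N - e0) / 4 by rewrite ge_min lexx orbT.
  by rewrite /nu; lra.
split.
  move=> p pp.
  have [c c0 hc] := Sext_Z_bound hn hS hdec aN eta0 d0 eb nu0 nuN pp.
  exists c => T T0; split.
    by move=> f Zf eps eps0; exact: (Z_dense hn hS eta0 nu0 pp Zf eps0).
  exists (fun f => Sext S (zero_off (strip T) f)); split.
    exact: (bounded_Z hn hS hdec aN eta0 d0 eb nu0 nuN pp c0 hc).
  move=> f Zf Lf; apply: (Sext_on_compact_support hn hS _ Lf).
  exact: (Zspace_admissible hn hS eta0 nu0 pp Zf).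
have pp : (p0 <= +oo)%E by exact: leey.
have [c c0 hc] := Sext_Z_bound hn hS hdec aN eta0 d0 eb nu0 nuN pp.
exists c => T T0; exists (fun f => Sext S (zero_off (strip T) f)); split.
- exact: (bounded_Z hn hS hdec aN eta0 d0 eb nu0 nuN pp c0 hc).
- move=> f Zf Lf; apply: (Sext_on_compact_support hn hS _ Lf).
  exact: (Zspace_admissible hn hS eta0 nu0 pp Zf).
- move=> f Zf; have aF := Zspace_admissible hn hS eta0 nu0 pp Zf.
  have [f_ Lf_ hf_] := Sext_compact_convergence hn hS hdec aN eta0 d0 eb nu0 nuN aF.
  exists f_ => // E cE ET; have E0 z : E z -> 0 < z.1 by move=> /ET[].
  have [h1 h2] := hf_ E cE E0; split => //.
  by exists (Sext S (zero_off (strip T) f)); split => //; exact: nearW.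
- exact: (bounded_vZ hn hS hdec aN eta0 d0 eb nu0 nuN).
Qed.
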